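(* Let $d\ge1$, $n\in\mathbb{N}^d$, and let $\Lambda\subset\mathbb{R}^{2d}$ be a lattice with adjoint lattice $\Lambda^0$. Then $\Gamma_\Lambda$ is an interpolating sequence for $\mathbf{F}^n(\mathbb{C}^d)$ if and only if $\Gamma_{\Lambda^0}$ is a multiple sampling sequence of multiplicity $K_n$ for the Fock space $\mathcal{F}(\mathbb{C}^d)$.
   Context: Notation: $|m|=\sum m_j$, $m!=\prod m_j!$, $z^m=\prod z_j^{m_j}$, $\bar z^m=\prod\bar z_j^{m_j}$, $|z|^2=\sum|z_j|^2$, $\bar z\cdot\zeta=\sum\bar z_j\zeta_j$; $K_n=\{k\in\mathbb{N}_0^d:0\le k_j\le n_j-1\ \forall j\}$. Fock space $\mathcal{F}(\mathbb{C}^d)$: entire $F$ with $\|F\|^2=\int_{\mathbb{C}^d}|F|^2e^{-\pi|z|^2}dz<\infty$, inner product $\langle F,G\rangle=\int F\bar Ge^{-\pi|z|^2}dz$; $e_k(z)=(\pi^{|k|}/k!)^{1/2}z^k$; $\beta_zF(\zeta)=e^{\pi\bar z\cdot\zeta-\frac{\pi}{2}|z|^2}F(\zeta-z)$. Polyanalytic Fock space $\mathbf{F}^n(\mathbb{C}^d)$: functions $F(z)=\sum_{k\in K_n}\bar z^k\varphi_k(z)$, $\varphi_k$ entire, with $\int|F|^2e^{-\pi|z|^2}dz<\infty$. A lattice is $\Lambda=A\mathbb{Z}^{2d}$, $A$ invertible; with $\pi_{(x,\omega)}=M_\omega T_x$ ($T_xf(t)=f(t-x)$, $M_\omega f(t)=e^{2\pi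 i\omega\cdot t}f(t)$), the adjoint lattice is $\Lambda^0=\{\mu:\pi_\lambda\pi_\mu=\pi_\mu\pi_\lambda\ \forall\lambda\in\Lambda\}$. $\Gamma_\Lambda=\{x+i\omega:(x,\omega)\in\Lambda\}$. $\Gamma$ is an interpolating sequence for $\mathbf{F}^n(\mathbb{C}^d)$ if for every $(\alpha_z)_{z\in\Gamma}\in\ell^2$ there is $F\in\mathbf{F}^n(\mathbb{C}^d)$ with $e^{-\frac{\pi}{2}|z|^2}F(z)=\alpha_z$ for all $z\in\Gamma$. $\Gamma$ is a multiple sampling sequence of multiplicity $K_n$ for $\mathcal{F}(\mathbb{C}^d)$ if there are $A,B>0$ with $A\|F\|^2\le\sum_{z\in\Gamma}\sum_{k\in K_n}|\langle F,\beta_ze_k\rangle|^2\le B\|F\|^2$ for all $F\in\mathcal{F}(\mathbb{C}^d)$. *)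

(* Defs.v *)
From HB Require Import structures.
From mathcomp Require Import all_boot all_order all_algebra.
From mathcomp Require Import all_classical all_reals.
From mathcomp Require Import ereal topology normedtype sequences esum trigo
  measure lebesgue_measure lebesgue_integral.
From mathcomp.real_closed Require Import complex.

Set Implicit Arguments.
Unset Strict Implicit.
Unset Printing Implicit Defensive.

Import Order.TTheory GRing.Theory Num.Theory.
Local Open Scope classical_set_scope.
Local Open Scope ring_scope.
Local Open Scope complex_scope.

Section Defs.
Variable R : realType.
Local Notation C := R[i].

Definition Cd (d : nat) := {ffun 'I_d -> C}.

Definition cabs2 (w : C) : R := complex.Re w ^+ 2 + complex.Im w ^+ 2.
Definition cabs (w : C) : R := Num.sqrt (cabs2 w).
Definition normsq d (z : Cd d) : R := \sum_j cabs2 (z j).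

Definition cexp (w : C) : C :=
  (expR (complex.Re w))%:C * (cos (complex.Im w) +i* sin (complex.Im w)).

Definition upd d (z : Cd d) (j : 'I_d) (w : C) : Cd d :=
  [ffun i => if i == j then w else z i].

Definition cdifferentiable_at (g : C -> C) (w : C) : Prop :=
  exists L : C, forall e : R, 0 < e -> exists del : R, 0 < del /\
    forall h : C, h != 0 -> cabs h < del ->
      cabs ((g (w + h) - g w) / h - L) < e.

Definition ccontinuous d (F : Cd d -> C) : Prop :=
  forall (z : Cd d) (e : R), 0 < e -> exists del : R, 0 < del /\
    forall w : Cd d, (forall j, cabs (w j - z j) < del) ->
      cabs (F w - F z) < e.

(** entire function on C^d: continuous and holomorphic in each variable
    separately (Osgood's definition of holomorphy). *)
Definition entire d (F : Cd d -> C) : Prop :=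
  ccontinuous F /\
  forall (z : Cd d) (j : 'I_d), cdifferentiable_at (fun w => F (upd z j w)) (z j).

(** Integral over C^d = R^{2d} w.r.t. Lebesgue measure, written as the
    iterated integral over complex.Re z_j, complex.Im z_j (j = d-1, ..., 0). *)
Fixpoint iint d (k : nat) (G : Cd d -> \bar R) (z : Cd d) : \bar R :=
  match k with
  | 0 => G z
  | k'.+1 =>
    if insub k' is Some j then
      integral lebesgue_measure setT (fun x : R =>
        integral lebesgue_measure setT (fun y : R =>
          iint k' G (upd z j (x +i* y))))
    else iint k' G z
  end.

Definition cint d (G : Cd d -> \bar R) : \bar R :=
  iint d G [ffun => 0].

Definition gauss d (z : Cd d) : R := expR (- pi * normsq z).

Definition fnorm2 d (F : Cd d -> C) : \bar R :=
  cint (fun z => (cabs2 (F z) * gauss z)%:E).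

Definition finner d (F G : Cd d -> C) : C :=
  let h := fun z => F z * (G z)^* * (gauss z)%:C in
  fine (cint (fun z => (complex.Re (h z))%:E)) +i* fine (cint (fun z => (complex.Im (h z))%:E)).

Definition fock d (F : Cd d -> C) : Prop := entire F /\ (fnorm2 F < +oo)%E.

Definition Kn d (n : 'I_d -> nat) := {dffun forall j : 'I_d, 'I_(n j)}.

Definition mfact d (k : 'I_d -> nat) : nat := \prod_j (k j)`!.
Definition mabs d (k : 'I_d -> nat) : nat := \sum_j k j.

Definition ek d (k : 'I_d -> nat) (z : Cd d) : C :=
  (Num.sqrt (pi ^+ mabs k / (mfact k)%:R))%:C * \prod_j z j ^+ k j.

Definition beta d (z : Cd d) (F : Cd d -> C) (zeta : Cd d) : C :=
  cexp ((pi%:C * \sum_j (z j)^* * zeta j) - (pi / 2 * normsq z)%:C)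
  * F [ffun j => zeta j - z j].

Definition polyfock d (n : 'I_d -> nat) (F : Cd d -> C) : Prop :=
  (exists phi : Kn n -> Cd d -> C,
     (forall k, entire (phi k)) /\
     forall z, F z = \sum_(k : Kn n) (\prod_j ((z j)^* ^+ k j)) * phi k z)
  /\ (fnorm2 F < +oo)%E.

Definition interpolating d (n : 'I_d -> nat) (Gamma : set (Cd d)) : Prop :=
  forall alpha : Cd d -> C,
    (\esum_(z in Gamma) (cabs2 (alpha z))%:E < +oo)%E ->
    exists F, polyfock n F /\
      forall z, Gamma z -> (expR (- (pi / 2) * normsq z))%:C * F z = alpha z.

Definition multiple_sampling d (n : 'I_d -> nat) (Gamma : set (Cd d)) : Prop :=
  exists A B : R, 0 < A /\ 0 < B /\
    forall F, fock F ->
      (A%:E * fnorm2 F <=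
         \esum_(z in Gamma) (\sum_(k : Kn n) cabs2 (finner F (beta z (ek (fun j => k j)))))%:E
       <= B%:E * fnorm2 F)%E.

(** Time-frequency plane R^{2d} as column vectors 'cV_(d+d); for
    lam = (x, omega), x = usubmx lam, omega = dsubmx lam. *)
Definition tf_x d (lam : 'cV[R]_(d + d)) (j : 'I_d) : R := usubmx lam j 0.
Definition tf_w d (lam : 'cV[R]_(d + d)) (j : 'I_d) : R := dsubmx lam j 0.

Definition tfshift d (lam : 'cV[R]_(d + d)) (f : ('I_d -> R) -> C)
  (t : 'I_d -> R) : C :=
  let th := 2 * pi * \sum_j tf_w lam j * t j in
  (cos th +i* sin th) * f (fun j => t j - tf_x lam j).

Definition lattice d (A : 'M[R]_(d + d)) : set 'cV[R]_(d + d) :=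
  [set lam | exists m : 'cV[int]_(d + d), lam = A *m map_mx (fun k : int => k%:~R) m].

Definition adjoint_lattice d (L : set 'cV[R]_(d + d)) : set 'cV[R]_(d + d) :=
  [set mu | forall lam, L lam ->
     forall f t, tfshift lam (tfshift mu f) t = tfshift mu (tfshift lam f) t].

Definition GammaOf d (L : set 'cV[R]_(d + d)) : set (Cd d) :=
  [set z | exists lam, L lam /\ z = [ffun j => tf_x lam j +i* tf_w lam j]].

End Defs.

(* Main.v *)
(** Let [U k m z] be the coefficient of [e_m] in [beta_z e_k], up to conjugation. Weighted by the
  Gaussian, a polyanalytic [F] is [sum a (k, m) U k m] (k in K_n) with [a] in l2 of the same
  norm, so interpolation says that the vectors [(U k m (la s))_(k, m)] solve every moment problem
  in l2; by uniform boundedness and minimal norm interpolants this is a lower Riesz bound.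
  A Fock function with coefficients [b] has [<F, beta_z e_k> = sum_m b m U k m z].
  Poisson summation for Gaussians, read on generating functions, yields
  [sum_mu U k m conj(U k' m') = c sum_la U k k' conj(U m m')] over the adjoint lattice and the
  lattice. Averaging over ever finer translates kills all terms but [la = 0], which turns the
  Riesz bound on the lattice into the sampling bound on its adjoint and back. *)
Require Import Defs.
From HB Require Import structures.
From mathcomp Require Import all_boot all_order all_algebra.
From mathcomp Require Import all_classical all_reals.
From mathcomp Require Import ereal topology normedtype sequences esum trigo exp
  measure lebesgue_measure lebesgue_integral measurable_realfun.
From mathcomp Require Import realfun derive ftc gauss_integral.
From mathcomp.real_closed Require Import complex.
From mathcomp Require Import ring lra zify.

Set Implicit Arguments.
Unset Strict Implicit.
Unset Printing Implicit Defensive.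

Import Order.TTheory GRing.Theory Num.Theory.
Import numFieldTopology.Exports.
Local Open Scope classical_set_scope.
Local Open Scope ring_scope.
Local Open Scope complex_scope.
Local Notation Re := complex.Re.
Local Notation Im := complex.Im.

(** In Gabor terms: a vector-valued system of Hermite windows is a Riesz sequence over a lattice
    exactly when the multi-window system of the same windows is a frame over the adjoint lattice.
    All of this takes place in l2 with the explicit matrix entries [U k m z]; their Gaussian decay
    makes every lattice sum absolutely convergent. What replaces a dual window is the ground state
    [e0]: its translates along a refined lattice form a nearly tight system, so a vector can be
    traded for its samples in the limit. The obstacle on the analytic side is [fnorm2], an iterated
    integral with values in the extended reals: a polyanalytic function of finite norm has no a
    priori reason to have square summable coefficients. Cutoffs that depend on the moduli of the
    coordinates keep terms of different angular weight orthogonal, so truncated series have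
    increasing norms under each cutoff, and a monotone limit gives Bessel's inequality. Complex
    analysis rests on Goursat's argument for rectangles; Fourier series of periodic entire functions
    yield both power series and, through the quasi-periodicity of a theta function, Poisson
    summation. *)

Section ComplexModulus.
Variable R : realType.
Local Notation C := R[i].

Lemma eq_ler (a b : R) : a = b -> a <= b. Proof. by move->. Qed.
(** The copy [Rcomplex R] carries the modulus as a real-valued norm; through it [cabs] inherits the
    triangle inequalities in [R] itself rather than in [R[i]]. *)
Lemma cabsE (w : C) : cabs w = `|w : Rcomplex R|.
Proof. by case: w. Qed.

Lemma cabs_ge0 (w : C) : 0 <= cabs w. Proof. exact: sqrtr_ge0. Qed.
Lemma cabs2_ge0 (w : C) : 0 <= cabs2 w.
Proof. by rewrite /cabs2 addr_ge0 // sqr_ge0. Qed.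
Lemma cabs_sqr (w : C) : cabs w ^+ 2 = cabs2 w.
Proof. by rewrite sqr_sqrtr // cabs2_ge0. Qed.
Lemma cabs0 : cabs (0 : C) = 0. Proof. by rewrite cabsE normr0. Qed.
Lemma cabs_eq0 (w : C) : (cabs w == 0) = (w == 0).
Proof. by rewrite cabsE normr_eq0. Qed.
Lemma cabs1 : cabs (1 : C) = 1.
Proof. by rewrite /cabs /cabs2 /= expr1n expr0n addr0 sqrtr1. Qed.
Lemma cabsN (w : C) : cabs (- w) = cabs w. Proof. by rewrite !cabsE normrN. Qed.
Lemma cabsD (v w : C) : cabs (v + w) <= cabs v + cabs w.
Proof. by rewrite !cabsE ler_normD. Qed.
Lemma cabsB (v w : C) : cabs (v - w) <= cabs v + cabs w.
Proof. by rewrite !cabsE ler_normB. Qed.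
Lemma cabs_distC (v w : C) : cabs (v - w) = cabs (w - v).
Proof. by rewrite !cabsE distrC. Qed.
Lemma cabsM (v w : C) : cabs (v * w) = cabs v * cabs w.
Proof. by case: v w => a b [c d]; exact: (ComplexField.Normc.normcM (a +i* b) (c +i* d)). Qed.
Lemma cabsV (w : C) : cabs w^-1 = (cabs w)^-1. Proof. by case: w => a b; exact: (ComplexField.Normc.normcV (a +i* b)). Qed.
Lemma cabsX (w : C) n : cabs (w ^+ n) = cabs w ^+ n.
Proof. by elim: n => [|n IH]; rewrite ?cabs1 // !exprS cabsM IH. Qed.
Lemma cabsR (x : R) : cabs x%:C = `|x|.
Proof. by rewrite /cabs /cabs2 /= expr0n addr0 sqrtr_sqr. Qed.
Lemma cabs_conj (w : C) : cabs (conjc w) = cabs w.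
Proof. by case: w => a b; rewrite /cabs /cabs2 /= sqrrN. Qed.
Lemma cabs2_conj (w : C) : cabs2 (conjc w) = cabs2 w.
Proof. by rewrite -!cabs_sqr cabs_conj. Qed.
Lemma cabs2M (v w : C) : cabs2 (v * w) = cabs2 v * cabs2 w.
Proof. by rewrite -!cabs_sqr cabsM exprMn. Qed.
Lemma cabs2R (x : R) : cabs2 x%:C = x ^+ 2.
Proof. by rewrite /cabs2 /= expr0n addr0. Qed.
Lemma mul_conj (w : C) : w * (conjc w) = (cabs2 w)%:C.
Proof.
by case: w => a b; apply/eqP; rewrite eq_complex /cabs2 /=; apply/andP; split;
 apply/eqP; ring.
Qed.
Lemma cabs_sum I (r : seq I) (P : pred I) (F : I -> C) :
 cabs (\sum_(i <- r | P i) F i) <= \sum_(i <- r | P i) cabs (F i).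
Proof.
elim/big_ind2: _ => [|a x b y ha hb|//]; first by rewrite cabs0.
by rewrite (le_trans (cabsD _ _)) // lerD.
Qed.
Lemma cabs_prod I (r : seq I) (P : pred I) (F : I -> C) :
 cabs (\prod_(i <- r | P i) F i) = \prod_(i <- r | P i) cabs (F i).
Proof. exact: (big_morph _ cabsM cabs1). Qed.
Lemma cabsRe (w : C) : `|Re w| <= cabs w.
Proof.
rewrite -(@ler_pXn2r _ 2) ?nnegrE ?cabs_ge0 // cabs_sqr /cabs2.
by rewrite real_normK ?num_real // lerDl sqr_ge0.
Qed.
Lemma cabsIm (w : C) : `|Im w| <= cabs w.
Proof.
rewrite -(@ler_pXn2r _ 2) ?nnegrE ?cabs_ge0 // cabs_sqr /cabs2.
by rewrite real_normK ?num_real // lerDr sqr_ge0.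
Qed.
Lemma cabs_ReIm (w : C) : cabs w <= `|Re w| + `|Im w|.
Proof.
case: w => a b; rewrite -(@ler_pXn2r _ 2) ?nnegrE ?cabs_ge0 ?addr_ge0 //.
rewrite cabs_sqr /cabs2 /= sqrrD !real_normK ?num_real //.
by rewrite lerD2r lerDl mulrn_wge0 // mulr_ge0.
Qed.
Lemma ReD (v w : C) : Re (v + w) = Re v + Re w.
Proof. by case: v w => ? ? []. Qed.
Lemma ImD (v w : C) : Im (v + w) = Im v + Im w.
Proof. by case: v w => ? ? []. Qed.
Lemma ReN (v : C) : Re (- v) = - Re v. Proof. by case: v. Qed.
Lemma ImN (v : C) : Im (- v) = - Im v. Proof. by case: v. Qed.
Lemma ReM (v w : C) : Re (v * w) =
 Re v * Re w - Im v * Im w.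
Proof. by case: v w => ? ? []. Qed.
Lemma ImM (v w : C) : Im (v * w) =
 Re v * Im w + Im v * Re w.
Proof. by case: v w => ? ? []. Qed.
Lemma Re_conj (w : C) : Re (conjc w) = Re w. Proof. by case: w. Qed.
Lemma Im_conj (w : C) : Im (conjc w) = - Im w. Proof. by case: w. Qed.
Lemma Re_sum I (r : seq I) (P : pred I) (F : I -> C) :
 Re (\sum_(i <- r | P i) F i) = \sum_(i <- r | P i) Re (F i).
Proof. exact: (big_morph _ ReD). Qed.
Lemma Im_sum I (r : seq I) (P : pred I) (F : I -> C) :
 Im (\sum_(i <- r | P i) F i) = \sum_(i <- r | P i) Im (F i).
Proof. exact: (big_morph _ ImD). Qed.
Lemma real_neq0 (c : R) : 0 < c -> c%:C != 0 :> C.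
Proof. by apply: contraTneq => /(congr1 (@Re R)) /= ->; rewrite ltxx. Qed.

Lemma cE (w : C) : w = Re w +i* Im w. Proof. by case: w. Qed.
Lemma ceq (v w : C) : Re v = Re w -> Im v = Im w ->
 v = w.
Proof. by case: v w => ? ? [? ?] /= -> ->. Qed.
Lemma realCD (x y : R) : (x + y)%:C = x%:C + y%:C. Proof. exact: rmorphD. Qed.
Lemma realCM (x y : R) : (x * y)%:C = x%:C * y%:C. Proof. exact: rmorphM. Qed.
Lemma realCB (x y : R) : (x - y)%:C = x%:C - y%:C. Proof. exact: rmorphB. Qed.
Lemma realCX (x : R) n : (x ^+ n)%:C = x%:C ^+ n. Proof. exact: rmorphXn. Qed.
Lemma realCn n : (n%:R : R)%:C = n%:R. Proof. exact: rmorph_nat. Qed.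
Lemma realCV (x : R) : (x^-1)%:C = x%:C^-1. Proof. exact: fmorphV. Qed.
Lemma conjD (v w : C) : (conjc (v + w)) = (conjc v) + (conjc w). Proof. exact: rmorphD. Qed.
Lemma conjB (v w : C) : (conjc (v - w)) = (conjc v) - (conjc w). Proof. exact: rmorphB. Qed.
Lemma conjM (v w : C) : (conjc (v * w)) = (conjc v) * (conjc w). Proof. exact: rmorphM. Qed.
Lemma conjX (v : C) n : (conjc (v ^+ n)) = (conjc v) ^+ n. Proof. exact: rmorphXn. Qed.
Lemma conj_sum I (r : seq I) (P : pred I) (F : I -> C) :
 (conjc (\sum_(i <- r | P i) F i)) = \sum_(i <- r | P i) (conjc (F i)).
Proof. exact: rmorph_sum. Qed.
Lemma conj_prod I (r : seq I) (P : pred I) (F : I -> C) :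
 (conjc (\prod_(i <- r | P i) F i)) = \prod_(i <- r | P i) (conjc (F i)).
Proof. exact: rmorph_prod. Qed.

Lemma cexpD (v w : C) : cexp (v + w) = cexp v * cexp w.
Proof.
by case: v w => a b [c d]; rewrite /cexp /= expRD cosD sinD; apply: ceq => /=; ring.
Qed.
Lemma cexp0 : cexp (0 : C) = 1.
Proof. by rewrite /cexp /= expR0 cos0 sin0 mul1r. Qed.
Lemma cabs_cexp (w : C) : cabs (cexp w) = expR (Re w).
Proof.
rewrite /cexp cabsM cabsR ger0_norm ?expR_ge0 //.
by rewrite /cabs /cabs2 /= cos2Dsin2 sqrtr1 mulr1.
Qed.
Lemma cexp_neq0 (w : C) : cexp w != 0.
Proof. by rewrite -cabs_eq0 cabs_cexp gt_eqF // expR_gt0. Qed.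
Lemma cexpN (w : C) : cexp (- w) = (cexp w)^-1.
Proof.
apply: (mulfI (cexp_neq0 w)); rewrite -cexpD subrr cexp0 mulfV ?cexp_neq0 //.
Qed.
Lemma cexpB (v w : C) : cexp (v - w) = cexp v / cexp w.
Proof. by rewrite cexpD cexpN. Qed.
Lemma cexp_conj (w : C) : (conjc (cexp w)) = cexp (conjc w).
Proof. by case: w => a b; apply: ceq; rewrite /cexp /= ?cosN ?sinN; ring. Qed.
Lemma cexp_real (x : R) : cexp x%:C = (expR x)%:C.
Proof. by rewrite /cexp /= cos0 sin0 mulr1. Qed.
Lemma cexp_sum I (r : seq I) (P : pred I) (F : I -> C) :
 cexp (\sum_(i <- r | P i) F i) = \prod_(i <- r | P i) cexp (F i).
Proof. exact: (big_morph _ cexpD cexp0). Qed.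
Lemma cexp_natM (w : C) n : cexp (n%:R * w) = cexp w ^+ n.
Proof.
elim: n => [|n IH]; first by rewrite mul0r cexp0.
by rewrite exprS -IH -cexpD; congr cexp; rewrite -natr1; ring.
Qed.
End ComplexModulus.

(** * Unordered sums of real and complex families *)

Section Summation.
Variable R : realType.
Local Notation C := R[i].

Section Real.
Variable I : choiceType.
Implicit Types (g h : I -> R) (A B : seq I).

(** Duplicate-free lists stand for finite subsets, so no enumeration of the index type is involved.
    Only an upper bound is asked: for nonnegative [g] this is unconditional summability, and [rsum]
    is then the sum. *)
Definition rasum g := exists M, forall A, uniq A -> \sum_(i <- A) g i <= M.
Definition rsum g := sup [set \sum_(i <- A) g i | A in [set A | uniq A]].

Lemma ler_sum_sub g A B : (forall i, 0 <= g i) -> uniq A -> {subset A <= B} ->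
 \sum_(i <- A) g i <= \sum_(i <- B) g i.
Proof.
move=> g0 uA; elim: A uA B => [|a A IH] /=.
 by move=> _ B _; rewrite big_nil sumr_ge0.
case/andP=> aA uA B sAB; have aB : a \in B by rewrite sAB ?mem_head.
rewrite big_cons (perm_big _ (perm_to_rem aB)) big_cons lerD2l; apply: IH => // x xA.
have := sAB x; rewrite inE xA orbT => /(_ isT) xB.
have xa : x != a by apply: contraNneq aA => <-.
by have := perm_to_rem aB => /perm_mem/(_ x); rewrite inE (negbTE xa) /= => <-.
Qed.

Lemma rsum_ub g A : rasum g -> uniq A -> \sum_(i <- A) g i <= rsum g.
Proof.
move=> [M hM] uA; apply: ub_le_sup; last by exists A.
by exists M => _ [B uB <-]; exact: hM.
Qed.
Lemma rsum_le g M : (forall A, uniq A -> \sum_(i <- A) g i <= M) -> rsum g <= M.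
Proof.
move=> hM; apply: ge_sup; first by exists 0; exists [::]; rewrite ?big_nil.
by move=> _ [B uB <-]; exact: hM.
Qed.
Lemma rsum_ge0 g : rasum g -> 0 <= rsum g.
Proof. by move=> h; have := @rsum_ub g [::] h isT; rewrite big_nil. Qed.
Lemma rsum_ub1 g i : rasum g -> g i <= rsum g.
Proof. by move=> h; have := @rsum_ub g [:: i] h isT; rewrite big_seq1. Qed.
Lemma rasum_le g h : (forall i, g i <= h i) -> rasum h -> rasum g.
Proof.
move=> gh [M hM]; exists M => A uA; apply: le_trans (hM A uA).
by rewrite ler_sum.
Qed.
Lemma ler_rsum g h : (forall i, g i <= h i) -> rasum h -> rsum g <= rsum h.
Proof.
move=> gh ah; apply: rsum_le => A uA; apply: le_trans (rsum_ub ah uA).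
by rewrite ler_sum.
Qed.
Lemma rasum0 : rasum (fun _ => 0). Proof. by exists 0 => A _; rewrite big1. Qed.
Lemma rasumD g h : rasum g -> rasum h -> rasum (fun i => g i + h i).
Proof.
move=> [M hM] [N hN]; exists (M + N) => A uA; rewrite big_split lerD //.
 exact: hM. exact: hN.
Qed.
Lemma rasumZ c g : 0 <= c -> rasum g -> rasum (fun i => c * g i).
Proof.
move=> c0 [M hM]; exists (c * M) => A uA; rewrite -mulr_sumr ler_wpM2l //; exact: hM.
Qed.
Lemma rasum_fin g (s : seq I) : (forall i, i \notin s -> g i <= 0) -> rasum g.
Proof.
move=> gs; exists (\sum_(i <- undup s) `|g i|) => A uA.
rewrite (bigID (mem s)) /= -[leRHS]addr0 lerD ?sumr_le0 //.
rewrite -big_filter; apply: (@le_trans _ _ (\sum_(i <- [seq i <- A | i \in s]) `|g i|)).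
 by apply: ler_sum => i _; exact: ler_norm.
apply: ler_sum_sub => //; first exact: filter_uniq.
by move=> i; rewrite mem_filter mem_undup => /andP[].
Qed.
(** For a nonnegative family a larger list has a larger sum, so one list close to the supremum
    controls all lists that contain it. *)
Lemma rsum_approx g e : (forall i, 0 <= g i) -> rasum g -> 0 < e ->
 exists2 A, uniq A & forall B, uniq B -> {subset A <= B} ->
  rsum g - e < \sum_(i <- B) g i.
Proof.
move=> g0 ag e0; have : has_sup [set \sum_(i <- A) g i | A in [set A | uniq A]].
 split; first by exists 0; exists [::]; rewrite ?big_nil.
 by case: ag => M hM; exists M => _ [B uB <-]; exact: hM.
move/(sup_adherent e0) => [_ [A uA <-] hA]; exists A => // B uB AB.
by apply: lt_le_trans hA _; exact: ler_sum_sub.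
Qed.
End Real.

Section Complex.
Variable I : choiceType.
Implicit Types (f g : I -> C) (A B : seq I).

Definition casum f := rasum (fun i => cabs (f i)).

Definition has_csum f l := forall e : R, 0 < e -> exists A, forall B, uniq B ->
 {subset A <= B} -> cabs (\sum_(i <- B) f i - l) < e.

(** Splitting into positive and negative parts makes the sum a total function. It is meaningful for
    [casum] families, where [has_csumP] identifies it with the limit of the net of finite partial
    sums. *)
Definition csum f : C :=
 let p (r : C -> R) := rsum (fun i => Num.max (r (f i)) 0) -
            rsum (fun i => Num.max (- r (f i)) 0) in
 p (@Re R) +i* p (@Im R).

Lemma has_csum_uniq f l l' : has_csum f l -> has_csum f l' -> l = l'.
Proof.
move=> hl hl'; apply/eqP; rewrite -subr_eq0 -cabs_eq0 eq_le cabs_ge0 andbT.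
apply/ler_addgt0Pr => e e0; rewrite add0r.
have e20 : 0 < e / 2 by rewrite divr_gt0.
have [A hA] := hl _ e20; have [B hB] := hl' _ e20.
have uU := undup_uniq (A ++ B).
have h1 : {subset A <= undup (A ++ B)}.
 by move=> x xA; rewrite mem_undup mem_cat xA.
have h2 : {subset B <= undup (A ++ B)}.
 by move=> x xA; rewrite mem_undup mem_cat xA orbT.
set s := \sum_(i <- undup (A ++ B)) f i.
have -> : l - l' = (s - l') - (s - l) by ring.
apply: le_trans (cabsB _ _) _; rewrite [leRHS]splitr.
by apply: lerD; apply: ltW; [exact: hB|exact: hA].
Qed.

Lemma has_csumP f : casum f -> has_csum f (csum f).
Proof.
move=> af.
have key (r : C -> R) : (forall w, `|r w| <= cabs w) -> forall e : R, 0 < e ->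
  exists A, forall B, uniq B -> {subset A <= B} ->
  `|\sum_(i <- B) r (f i) - (rsum (fun i => Num.max (r (f i)) 0) -
     rsum (fun i => Num.max (- r (f i)) 0))| < e.
 move=> hr e e0; have e20 : 0 < e / 2 by rewrite divr_gt0.
 have a1 : rasum (fun i => Num.max (r (f i)) 0).
  apply: rasum_le af => i; rewrite ge_max cabs_ge0 andbT.
  exact: le_trans (ler_norm _) (hr _).
 have a2 : rasum (fun i => Num.max (- r (f i)) 0).
  apply: rasum_le af => i; rewrite ge_max cabs_ge0 andbT.
  by apply: le_trans (ler_norm _) _; rewrite normrN.
 have m0 (x : R) : 0 <= Num.max x 0 by rewrite le_max lexx orbT.
 have [A uA hA] := rsum_approx (fun i => m0 _) a1 e20.
 have [A' uA' hA'] := rsum_approx (fun i => m0 _) a2 e20.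
 exists (A ++ A') => B uB sB.
 have s1 : {subset A <= B} by move=> x xA; apply: sB; rewrite mem_cat xA.
 have s2 : {subset A' <= B} by move=> x xA; apply: sB; rewrite mem_cat xA orbT.
 have h1 := hA B uB s1; have h2 := hA' B uB s2.
 have h3 := rsum_ub a1 uB; have h4 := rsum_ub a2 uB.
 have -> : \sum_(i <- B) r (f i) = \sum_(i <- B) Num.max (r (f i)) 0 -
   \sum_(i <- B) Num.max (- r (f i)) 0.
  rewrite -sumrB; apply: eq_bigr => i _.
  by case: (leP (r (f i)) 0); case: (leP (- r (f i)) 0); lra.
 rewrite ltr_norml; apply/andP; split; lra.
move=> e e0; have e20 : 0 < e / 2 by rewrite divr_gt0.
have [A hA] := key _ (@cabsRe R) _ e20; have [A' hA'] := key _ (@cabsIm R) _ e20.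
exists (A ++ A') => B uB sB; apply: le_lt_trans (cabs_ReIm _) _.
rewrite [ltRHS]splitr ReD ReN ImD ImN Re_sum Im_sum ltrD //.
- by apply: hA => // x xA; apply: sB; rewrite mem_cat xA.
- by apply: hA' => // x xA; apply: sB; rewrite mem_cat xA orbT.
Qed.
Lemma csumE f l : casum f -> has_csum f l -> csum f = l.
Proof. by move=> af; exact: has_csum_uniq (has_csumP af). Qed.

(** The list [A] depends only on the majorant [g], not on the family that [g] dominates. This
    uniformity is the source of dominated convergence. *)
Lemma has_csum_casum_tail f (g : I -> R) e : rasum g -> (forall i, 0 <= g i) ->
 0 < e -> exists2 A, uniq A & forall f, (forall i, cabs (f i) <= g i) ->
  forall B, uniq B -> {subset A <= B} ->
  cabs (csum f - \sum_(i <- B) f i) <= e.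
Proof.
move=> ag g0 e0; have e20 : 0 < e / 2 by rewrite divr_gt0.
have [A uA hA] := rsum_approx g0 ag e20; exists A => // {}f fg B uB AB.
have af : casum f by exact: rasum_le ag.
have [D hD] := has_csumP af e20.
set E := undup (D ++ B).
have h1 : {subset D <= E} by move=> x xA; rewrite mem_undup mem_cat xA.
have h2 : {subset B <= E} by move=> x xA; rewrite mem_undup mem_cat xA orbT.
have uE : uniq E by exact: undup_uniq.
have dE : \sum_(i <- E) f i - \sum_(i <- B) f i = \sum_(i <- [seq i <- E | i \notin B]) f i.
 have pE : perm_eq E ([seq i <- E | i \notin B] ++ B).
  rewrite perm_sym perm_catC; apply: uniq_perm => //.
   rewrite cat_uniq uB filter_uniq // andbT; apply/hasPn => x.
   by rewrite mem_filter => /andP[].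
  move=> x; rewrite mem_cat mem_filter; case: (boolP (x \in B)) => //= xB.
  by rewrite h2.
 by rewrite (perm_big _ pE) /= big_cat /= addrK.
have -> : csum f - \sum_(i <- B) f i = (\sum_(i <- E) f i - \sum_(i <- B) f i)
  - (\sum_(i <- E) f i - csum f) by ring.
apply: le_trans (cabsB _ _) _; rewrite [leRHS]splitr lerD //; last first.
 by apply: ltW; apply: hD.
rewrite dE; apply: le_trans (cabs_sum _ _ _) _.
apply: (@le_trans _ _ (\sum_(i <- [seq i <- E | i \notin B]) g i)); first exact: ler_sum.
have uF : uniq (A ++ [seq i <- E | i \notin B]).
 rewrite cat_uniq uA filter_uniq // andbT; apply/hasPn => x.
 by rewrite mem_filter => /andP[xB _]; apply: contra xB => /AB.
have := rsum_ub ag uF; rewrite big_cat /=; have := hA A uA (fun _ => id); lra.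
Qed.

Lemma cabs_csum f : casum f -> cabs (csum f) <= rsum (fun i => cabs (f i)).
Proof.
move=> af; apply/ler_addgt0Pr => e e0.
have [A hA] := has_csumP af e0.
have := hA _ (undup_uniq A) (fun x => ltac:(by rewrite mem_undup)).
set s := \sum_(i <- _) _ => hs.
have -> : csum f = s - (s - csum f) by ring.
apply: le_trans (cabsB _ _) _; apply: lerD (ltW hs).
apply: le_trans (cabs_sum _ _ _) _; apply: rsum_ub => //; exact: undup_uniq.
Qed.

Lemma csumD f g : casum f -> casum g -> csum (fun i => f i + g i) = csum f + csum g.
Proof.
move=> af ag; apply: csumE.
 by apply: rasum_le (rasumD af ag) => i; exact: cabsD.
move=> e e0; have e20 : 0 < e / 2 by rewrite divr_gt0.
have [A hA] := has_csumP af e20; have [A' hA'] := has_csumP ag e20.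
exists (A ++ A') => B uB sB; rewrite big_split /= opprD addrACA.
apply: le_lt_trans (cabsD _ _) _; rewrite [ltRHS]splitr ltrD //.
- by apply: hA => // x xA; apply: sB; rewrite mem_cat xA.
- by apply: hA' => // x xA; apply: sB; rewrite mem_cat xA orbT.
Qed.

Lemma csumZ c f : casum f -> csum (fun i => c * f i) = c * csum f.
Proof.
move=> af; apply: csumE.
 apply: rasum_le (rasumZ (cabs_ge0 c) af) => i; by rewrite cabsM.
move=> e e0; have e20 : 0 < e / (cabs c + 1) by rewrite divr_gt0 // ltr_wpDl ?cabs_ge0.
have [A hA] := has_csumP af e20; exists A => B uB sB.
rewrite -mulr_sumr -mulrBr cabsM.
apply: le_lt_trans (ler_wpM2l (cabs_ge0 c) (ltW (hA B uB sB))) _.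
rewrite mulrA ltr_pdivrMr ?ltr_wpDl ?cabs_ge0 // mulrC ltr_pM2l //.
by rewrite ltrDl.
Qed.
Lemma csumZr c f : casum f -> csum (fun i => f i * c) = csum f * c.
Proof. by move=> af; rewrite mulrC -csumZ //; congr csum; apply/funext => i; rewrite mulrC. Qed.
Lemma csumB f g : casum f -> casum g -> csum (fun i => f i - g i) = csum f - csum g.
Proof.
move=> af ag; rewrite -[X in _ + X]mulN1r -csumZ // -csumD //.
 by congr csum; apply/funext => i; rewrite mulN1r.
by apply: rasum_le ag => i; rewrite mulN1r cabsN.
Qed.
Lemma casumD f g : casum f -> casum g -> casum (fun i => f i + g i).
Proof. by move=> af ag; apply: rasum_le (rasumD af ag) => i; exact: cabsD. Qed.
Lemma casumZ c f : casum f -> casum (fun i => c * f i).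
Proof. by move=> af; apply: rasum_le (rasumZ (cabs_ge0 c) af) => i; rewrite cabsM. Qed.
Lemma casumZr c f : casum f -> casum (fun i => f i * c).
Proof. by move=> /(casumZ c) af; apply: rasum_le af => i; rewrite mulrC. Qed.
Lemma casum_conj f : casum f -> casum (fun i => (conjc (f i))).
Proof. by apply: rasum_le => i; rewrite cabs_conj. Qed.
Lemma casum_fin f (s : seq I) : (forall i, i \notin s -> f i = 0) -> casum f.
Proof. by move=> fs; apply: (@rasum_fin _ _ s) => i /fs ->; rewrite cabs0. Qed.
Lemma casum0 : casum (fun _ => 0).
Proof. by apply: (@casum_fin _ [::]). Qed.
Lemma csum_fin f (s : seq I) : uniq s -> (forall i, i \notin s -> f i = 0) ->
 csum f = \sum_(i <- s) f i.
Proof.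
move=> us fs; apply: csumE; first exact: casum_fin fs.
move=> e e0; exists s => B uB sB.
suff -> : \sum_(i <- B) f i = \sum_(i <- s) f i by rewrite subrr cabs0.
rewrite (bigID (mem s)) /= [X in _ + X]big1 ?addr0; last by move=> i /fs.
rewrite -big_filter; apply: perm_big; apply: uniq_perm => //; first exact: filter_uniq.
by move=> x; rewrite mem_filter; case: (boolP (x \in s)) => //= /sB ->.
Qed.
Lemma csum0 : csum (fun _ => 0) = 0.
Proof. by rewrite (@csum_fin _ [::]) ?big_nil. Qed.
Lemma csum1 f i : (forall j, j != i -> f j = 0) -> csum f = f i.
Proof.
by move=> h; rewrite (@csum_fin _ [:: i]) ?big_seq1 // => j; rewrite inE; exact: h.
Qed.
Lemma casum_sum J (r : seq J) (F : J -> I -> C) :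
 (forall j, casum (F j)) -> casum (fun i => \sum_(j <- r) F j i).
Proof.
move=> h; elim: r => [|j r IH].
 by apply: rasum_le casum0 => i; rewrite big_nil.
by apply: rasum_le (casumD (h j) IH) => i; rewrite big_cons.
Qed.
Lemma csum_sum J (r : seq J) (F : J -> I -> C) :
 (forall j, casum (F j)) ->
 csum (fun i => \sum_(j <- r) F j i) = \sum_(j <- r) csum (F j).
Proof.
move=> h; elim: r => [|j r IH].
 by rewrite big_nil -[RHS]csum0; congr csum; apply/funext => i; rewrite big_nil.
rewrite big_cons -IH -csumD //; last exact: casum_sum.
by congr csum; apply/funext => i; rewrite big_cons.
Qed.
Lemma csum_conj f : casum f -> csum (fun i => (conjc (f i))) = (conjc (csum f)).
Proof.
move=> af; apply: csumE; first exact: casum_conj.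
move=> e /(has_csumP af)[A hA]; exists A => B uB sB.
by rewrite -conj_sum -conjB cabs_conj; exact: hA.
Qed.
Lemma csum_real (g : I -> R) : rasum g -> (forall i, 0 <= g i) ->
 csum (fun i => (g i)%:C) = (rsum g)%:C.
Proof.
move=> ag g0; apply: csumE.
 by apply: rasum_le ag => i; rewrite cabsR ger0_norm.
move=> e e0; have [A uA hA] := rsum_approx g0 ag e0; exists A => B uB sB.
rewrite -(rmorph_sum (real_complex R)) -realCB cabsR ltr_distl hA //=.
by apply: le_lt_trans (rsum_ub ag uB) _; rewrite ltrDl.
Qed.
Lemma casum_real (g : I -> R) : rasum g -> (forall i, 0 <= g i) -> casum (fun i => (g i)%:C).
Proof. by move=> ag g0; apply: rasum_le ag => i; rewrite cabsR ger0_norm. Qed.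
End Complex.

Lemma eq_csum (I : choiceType) (f g : I -> C) : f =1 g -> csum f = csum g.
Proof. by move=> fg; congr csum; exact/funext. Qed.
Lemma eq_rsum (I : choiceType) (f g : I -> R) : f =1 g -> rsum f = rsum g.
Proof. by move=> fg; congr rsum; exact/funext. Qed.

Definition ccvg (u : nat -> C) (l : C) :=
 forall e : R, 0 < e -> exists N, forall n, (N <= n)%N -> cabs (u n - l) < e.

Lemma csum_dct (I : choiceType) (f : nat -> I -> C) (h : I -> C) (g : I -> R) :
 rasum g -> (forall n i, cabs (f n i) <= g i) ->
 (forall i, ccvg (f ^~ i) (h i)) -> ccvg (fun n => csum (f n)) (csum h).
Proof.
move=> ag fg fh.
have g0 i : 0 <= g i by apply: le_trans (fg 0 i); exact: cabs_ge0.
have hg i : cabs (h i) <= g i.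
 apply/ler_addgt0Pr => e /(fh i)[N /(_ N (leqnn N)) hN].
 have -> : h i = f N i - (f N i - h i) by ring.
 by apply: le_trans (cabsB _ _) _; apply: lerD (fg _ _) (ltW hN).
(* Two tails and one finite part, each at most [e / 4], stay strictly below [e]. *)
move=> e e0; have e30 : 0 < e / 4 by rewrite divr_gt0.
have [A uA hA] := has_csum_casum_tail h ag g0 e30.
have : exists N, forall n, (N <= n)%N ->
  cabs (\sum_(i <- A) f n i - \sum_(i <- A) h i) <= e / 4.
 elim: A {uA hA} (e / 4 : R) e30 => [|a A IH] d d0.
  by exists 0%N => n _; rewrite !big_nil subrr cabs0 ltW.
 have d20 : 0 < d / 2 by rewrite divr_gt0.
 have [N1 h1] := IH _ d20; have [N2 h2] := fh a _ d20.
 exists (maxn N1 N2) => n; rewrite geq_max => /andP[n1 n2].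
 rewrite !big_cons opprD addrACA; apply: le_trans (cabsD _ _) _.
 by rewrite [leRHS]splitr lerD ?h1 // ltW // h2.
move=> [N hN]; exists N => n nN.
have t1 := hA _ (fg n) A uA (fun _ => id).
have t2 := hA _ hg A uA (fun _ => id).
have -> : csum (f n) - csum h = (csum (f n) - \sum_(i <- A) f n i) -
  (csum h - \sum_(i <- A) h i) + (\sum_(i <- A) f n i - \sum_(i <- A) h i) by ring.
apply: le_lt_trans (cabsD _ _) _.
have := cabsB (csum (f n) - \sum_(i <- A) f n i) (csum h - \sum_(i <- A) h i).
have := hN n nN; lra.
Qed.

Lemma ler_divS (e : R) n : 0 <= e -> e / n.+1%:R *+ n <= e.
Proof.
move=> e0; rewrite -mulr_natr -mulrA ler_piMr // mulrC ler_pdivrMr ?ltr0n //.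
by rewrite mul1r ler_nat.
Qed.

Section Fubini.
Variables I J : choiceType.

Lemma rasum_pair1 (g : I * J -> R) i : (forall x, 0 <= g x) -> rasum g ->
 rasum (fun j => g (i, j)).
Proof.
move=> g0 [M hM]; exists M => A uA.
rewrite -(big_map (pair i) predT g); apply: hM.
by rewrite map_inj_uniq // => x y [].
Qed.

Lemma sum_allpairs (V : nmodType) (g : I * J -> V) (A : seq I) (B : seq J) :
 \sum_(i <- A) \sum_(j <- B) g (i, j) = \sum_(x <- [seq (i, j) | i <- A, j <- B]) g x.
Proof. by rewrite big_allpairs_dep. Qed.

(** Only finitely many outer indices enter a partial sum, so each inner sum may be approximated up
    to an equal share of [e]. *)
Lemma rasum_pair2 (g : I * J -> R) : (forall x, 0 <= g x) -> rasum g ->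
 rasum (fun i => rsum (fun j => g (i, j))).
Proof.
move=> g0 ag; exists (rsum g) => A uA; apply/ler_addgt0Pr => e e0.
pose d := e / (size A).+1%:R.
have d0 : 0 < d by rewrite divr_gt0.
have hB i : exists2 B, uniq B & forall D, uniq D -> {subset B <= D} ->
  rsum (fun j => g (i, j)) - d < \sum_(j <- D) g (i, j).
 by apply: rsum_approx => //; exact: rasum_pair1.
pose B i := s2val (cid2 (hB i)).
pose D := undup (flatten [seq B i | i <- A]).
have : \sum_(i <- A) (rsum (fun j => g (i, j)) - d) <= rsum g.
 apply: le_trans (_ : \sum_(i <- A) \sum_(j <- D) g (i, j) <= _).
  rewrite big_seq [leRHS]big_seq; apply: ler_sum => i iA.
  apply/ltW; move: (s2valP' (cid2 (hB i))); apply; first exact: undup_uniq.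
  move=> x xb; rewrite mem_undup; apply/flattenP; exists (B i) => //.
  exact: map_f.
 rewrite sum_allpairs; apply: rsum_ub => //.
 by apply: allpairs_uniq => //; [exact: undup_uniq|move=> [? ?] [? ?]].
rewrite sumrB big_const_seq iter_addr_0 count_predT lerBlDr => /le_trans; apply.
rewrite lerD2l; exact: ler_divS (ltW e0).
Qed.

(** Tonelli: every finite set of pairs lies in a product of two finite sets, over which the sum is
    bounded by the iterated one. *)
Lemma rasum_pair (g : I * J -> R) : (forall x, 0 <= g x) ->
 (forall i, rasum (fun j => g (i, j))) ->
 rasum (fun i => rsum (fun j => g (i, j))) -> rasum g.
Proof.
move=> g0 a1 a2; exists (rsum (fun i => rsum (fun j => g (i, j)))) => A uA.
set A1 := undup [seq x.1 | x <- A]; set A2 := undup [seq x.2 | x <- A].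
apply: (@le_trans _ _ (\sum_(i <- A1) \sum_(j <- A2) g (i, j))).
 rewrite sum_allpairs; apply: ler_sum_sub => // -[i j] ijA.
 by apply/allpairsP; exists (i, j); rewrite !mem_undup; split=> //=;
  apply/mapP; exists (i, j).
apply: le_trans (rsum_ub a2 (undup_uniq _)); apply: ler_sum => i _.
by apply: rsum_ub => //; exact: undup_uniq.
Qed.

Lemma csum_pair (f : I * J -> C) : casum f ->
 csum f = csum (fun i => csum (fun j => f (i, j))).
Proof.
move=> af; have f1 i : casum (fun j => f (i, j)).
 by apply: (@rasum_pair1 (fun x => cabs (f x))) => // x; exact: cabs_ge0.
have f2 := rasum_pair2 (fun x => cabs_ge0 (f x)) af.
apply/esym/csumE; first by apply: rasum_le f2 => i; exact: cabs_csum.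
move=> e e0; have e20 : 0 < e / 2 by rewrite divr_gt0.
have [A hA] := has_csumP af e20.
exists [seq x.1 | x <- A] => B uB sB.
pose d := e / 2 / (size B).+1%:R; have d0 : 0 < d by rewrite !divr_gt0.
pose S i := projT1 (cid (has_csumP (f1 i) d0)).
pose D := undup ([seq x.2 | x <- A] ++ flatten [seq S i | i <- B]).
have uD : uniq D by exact: undup_uniq.
have h1 : cabs (\sum_(i <- B) \sum_(j <- D) f (i, j) - csum f) < e / 2.
 rewrite sum_allpairs; apply: hA.
  by apply: allpairs_uniq => // -[? ?] [? ?].
 move=> -[i j] ijA; apply/allpairsP; exists (i, j); split => //=.
  by apply: sB; apply/mapP; exists (i, j).
 by rewrite mem_undup mem_cat; apply/orP; left; apply/mapP; exists (i, j).
have h2 : cabs (\sum_(i <- B) csum (fun j => f (i, j)) -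
  \sum_(i <- B) \sum_(j <- D) f (i, j)) <= e / 2.
 rewrite -sumrB; apply: le_trans (cabs_sum _ _ _) _.
 apply: (@le_trans _ _ (\sum_(i <- B) d)).
  rewrite big_seq [leRHS]big_seq; apply: ler_sum => i iB.
  rewrite cabs_distC; apply: ltW.
  rewrite /D /S; apply: (projT2 (cid (has_csumP (f1 i) d0))) => // x xS.
  rewrite mem_undup mem_cat; apply/orP; right; apply/flattenP.
  by exists (S i) => //; exact: map_f.
 by rewrite big_const_seq iter_addr_0 count_predT; exact: ler_divS (ltW e20).
set s := \sum_(i <- B) \sum_(j <- D) _ in h1 h2.
have -> : \sum_(i <- B) csum (fun j => f (i, j)) - csum f =
 (\sum_(i <- B) csum (fun j => f (i, j)) - s) + (s - csum f) by ring.
by apply: le_lt_trans (cabsD _ _) _; rewrite [ltRHS]splitr ler_ltD.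
Qed.

Lemma rsum_pair (g : I * J -> R) : (forall x, 0 <= g x) -> rasum g ->
 rsum g = rsum (fun i => rsum (fun j => g (i, j))).
Proof.
move=> g0 ag; apply: (@complexI R); rewrite -!csum_real //; last 2 first.
- exact: rasum_pair2.
- by move=> i; apply: rsum_ge0; exact: rasum_pair1.
rewrite csum_pair; last exact: casum_real.
by apply: eq_csum => i; rewrite csum_real //; exact: rasum_pair1.
Qed.

Lemma rasum_inj (h : J -> I) (g : I -> R) : injective h -> rasum g ->
 rasum (fun j => g (h j)).
Proof.
move=> hi [M hM]; exists M => A uA; rewrite -(big_map h predT g); apply: hM.
by rewrite map_inj_uniq.
Qed.

Lemma csum_bij (h : J -> I) (f : I -> C) : bijective h -> casum f ->
 csum (fun j => f (h j)) = csum f.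
Proof.
move=> [k hk kh] af; apply: csumE; first exact: (rasum_inj (can_inj hk) af).
move=> e /(has_csumP af)[A hA]; exists (map k A) => B uB sB.
rewrite -(big_map h predT f); apply: hA; first by rewrite (map_inj_uniq (can_inj hk)).
by move=> x xA; apply/mapP; exists (k x); rewrite ?kh // sB // map_f.
Qed.
End Fubini.

Lemma rsum_bij (I J : choiceType) (h : J -> I) (g : I -> R) : bijective h ->
 rasum g -> (forall i, 0 <= g i) -> rsum (fun j => g (h j)) = rsum g.
Proof.
move=> hb ag g0; apply: (@complexI R); have [k hk _] := hb.
rewrite -!csum_real //; last exact: (rasum_inj (can_inj hk) ag).
exact: (csum_bij (f := fun i => (g i)%:C) hb (casum_real ag g0)).
Qed.

Lemma csum_swap (I J : choiceType) (f : I -> J -> C) :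
 casum (fun x : I * J => f x.1 x.2) ->
 csum (fun i => csum (f i)) = csum (fun j => csum (f^~ j)).
Proof.
move=> af; rewrite -(csum_pair (f := fun x => f x.1 x.2)) //.
have hb : bijective (fun x : J * I => (x.2, x.1)) by exists (fun x => (x.2, x.1)) => -[].
by rewrite -(csum_bij hb af) csum_pair //; apply: rasum_inj af => -[? ?] [? ?] [-> ->].
Qed.

Lemma rasum_prod (I J : choiceType) (g : I -> R) (h : J -> R) :
 (forall i, 0 <= g i) -> (forall j, 0 <= h j) -> rasum g -> rasum h ->
 rasum (fun x : I * J => g x.1 * h x.2).
Proof.
move=> g0 h0 ag ah; apply: rasum_pair => /= [x|i|]; first by rewrite mulr_ge0.
- exact: rasumZ.
- apply: rasum_le (rasumZ (rsum_ge0 ah) ag) => i.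
 apply: rsum_le => A uA; rewrite -mulr_sumr mulrC ler_wpM2r //; exact: rsum_ub.
Qed.
End Summation.

(** * Reindexing, product families and the exponential series *)

Section SumTools.
Variable R : realType.
Local Notation C := R[i].

(** Lists in [I] are pulled back along a partial inverse of [h] obtained by choice; indices outside
    the range carry the value 0 and drop out. *)
Lemma csum_inj (I J : choiceType) (h : J -> I) (f : I -> C) : injective h ->
 casum f -> (forall i, (forall j, h j <> i) -> f i = 0) ->
 csum (fun j => f (h j)) = csum f.
Proof.
move=> hi af f0; apply: csumE; first exact: (rasum_inj hi af).
move=> e /(has_csumP af)[A hA].
have [k hk] : exists k : I -> option J, forall i, if k i is Some j then h j = i else forall j, h j <> i.
 exists (fun i => if pselect (exists j, h j = i) is left e then Some (projT1 (cid e)) else None).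
 move=> i; case: pselect => [e0|h0]; first exact: (projT2 (cid e0)).
 by move=> j hj; apply: h0; exists j.
exists (pmap k A) => B uB sB.
have -> : \sum_(j <- B) f (h j) = \sum_(i <- undup (map h B ++ A)) f i.
 rewrite (bigID (mem (map h B))) /= [X in _ + X]big1_seq ?addr0; last first.
  move=> i /andP[iB]; rewrite mem_undup mem_cat (negbTE iB) /= => iA.
  apply: f0; have := hk i; case ki : (k i) => [j|] //.
  move=> hj; exfalso; move/negP: iB; apply; apply/mapP; exists j => //.
  by apply: sB; rewrite mem_pmap; apply/mapP; exists i.
 rewrite -[RHS]big_filter; transitivity (\sum_(i <- map h B) f i); first by rewrite big_map.
 apply: perm_big; apply: uniq_perm.
 - by rewrite map_inj_uniq.
 - by rewrite filter_uniq // undup_uniq.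
 - move=> x; rewrite mem_filter mem_undup mem_cat /=.
  by case: (x \in map h B).
apply: hA; first exact: undup_uniq.
by move=> x xA; rewrite mem_undup mem_cat xA orbT.
Qed.

(** Extension by zero along an injection. The explicit partial inverse [k] makes the extended family
    a formula; it serves index shifts and the triangle of a Cauchy product. *)
Lemma casum_lift (I J : choiceType) (h : J -> I) (k : I -> option J) (f : J -> C) :
 (forall j, k (h j) = Some j) -> (forall i j, k i = Some j -> h j = i) ->
 casum f -> casum (fun i => oapp f 0 (k i)).
Proof.
move=> hk kh [M hM]; exists M => A uA; pose B := pmap k A.
have uB : uniq B.
 by apply: (pmap_uniq (g := h)) => // i; case ki : (k i) => [j|] //=; rewrite (kh _ _ ki).
apply: le_trans (hM _ uB); rewrite /B {uB uA B}; elim: A => [|a A IH].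
 by rewrite !big_nil.
by rewrite big_cons /=; case: (k a) => [j|] /=; rewrite ?big_cons ?lerD2l ?cabs0 ?add0r.
Qed.
Lemma csum_lift (I J : choiceType) (h : J -> I) (k : I -> option J) (f : J -> C) :
 (forall j, k (h j) = Some j) -> (forall i j, k i = Some j -> h j = i) ->
 casum f -> csum (fun i => oapp f 0 (k i)) = csum f.
Proof.
move=> hk kh af; rewrite -(csum_inj (h := h)).
- by apply: eq_csum => j; rewrite hk.
- by move=> x y /(congr1 k); rewrite !hk => -[].
- exact: casum_lift hk kh af.
- move=> i hi; case ki : (k i) => [j|] //=; by case: (hi j); apply: kh.
Qed.
Definition opred (n : nat) := if n is m.+1 then Some m else None.
Lemma csum_shift (f : nat -> C) : casum f ->
 casum (fun n => oapp f 0 (opred n)) /\ csum (fun n => oapp f 0 (opred n)) = csum f.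
Proof.
move=> af; have h1 j : opred j.+1 = Some j by [].
have h2 i j : opred i = Some j -> j.+1 = i by case: i => //= i [->].
by split; [exact: (casum_lift h1 h2)|exact: (csum_lift h1 h2)].
Qed.

Section ProductFamilies.
Variable T : choiceType.

Definition ffcons d (x : T) (z : {ffun 'I_d -> T}) : {ffun 'I_d.+1 -> T} :=
 [ffun i => oapp z x (unlift ord0 i)].
Lemma ffcons0 d x (z : {ffun 'I_d -> T}) : ffcons x z ord0 = x.
Proof. by rewrite ffunE unlift_none. Qed.
Lemma ffconsS d x (z : {ffun 'I_d -> T}) i : ffcons x z (lift ord0 i) = z i.
Proof. by rewrite ffunE liftK. Qed.
Definition fftail d (z : {ffun 'I_d.+1 -> T}) : {ffun 'I_d -> T} :=
 [ffun i => z (lift ord0 i)].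
Lemma ffconsK d x (z : {ffun 'I_d -> T}) : fftail (ffcons x z) = z.
Proof. by apply/ffunP => i; rewrite ffunE ffconsS. Qed.
Lemma ffcons_eta d (z : {ffun 'I_d.+1 -> T}) : ffcons (z ord0) (fftail z) = z.
Proof.
apply/ffunP => i; case: (unliftP ord0 i) => [j ->|->]; rewrite ?ffcons0 //.
by rewrite ffconsS ffunE.
Qed.
Lemma ffcons_bij d : bijective (fun x : T * {ffun 'I_d -> T} => ffcons x.1 x.2).
Proof.
exists (fun z : {ffun 'I_d.+1 -> T} => (z ord0, fftail z)) => [[x z]|z] /=; last exact: ffcons_eta.
by rewrite ffcons0 ffconsK.
Qed.

(** Fubini for finitely many factors: [ffcons] splits off the first coordinate and the rest is the
    induction hypothesis. It reduces multi-index series of product form to one variable. *)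
Lemma csum_prod d (f : 'I_d -> T -> C) : (forall j, casum (f j)) ->
 casum (fun k : {ffun 'I_d -> T} => \prod_j f j (k j)) /\
 csum (fun k : {ffun 'I_d -> T} => \prod_j f j (k j)) = \prod_j csum (f j).
Proof.
elim: d f => [|d IH] f af.
 have u : forall k : {ffun 'I_0 -> T}, k = ffun0 (card_ord 0).
  by move=> k; apply/ffunP => -[].
 split.
  by apply: (@casum_fin _ _ _ [:: ffun0 (card_ord 0)]) => k; rewrite (u k) mem_head.
 rewrite (@csum1 _ _ _ (ffun0 (card_ord 0))); first by rewrite !big_ord0.
 by move=> k; rewrite (u k) eqxx.
have [IH1 IH2] := IH (fun j => f (lift ord0 j)) (fun j => af _).
have [g gK Kg] := @ffcons_bij d.
pose F (x : T * {ffun 'I_d -> T}) := f ord0 x.1 * \prod_j f (lift ord0 j) (x.2 j).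
have FE x : \prod_j f j (ffcons x.1 x.2 j) = F x.
 rewrite big_ord_recl ffcons0 /F; congr (_ * _).
 by apply: eq_bigr => j _; rewrite ffconsS.
have aF : casum F.
 have := rasum_prod (fun i => cabs_ge0 (f ord0 i))
  (fun k : {ffun 'I_d -> T} => cabs_ge0 (\prod_j f (lift ord0 j) (k j))) (af ord0) IH1.
 by apply: rasum_le => x; rewrite /F cabsM.
have a1 : casum (fun k : {ffun 'I_d.+1 -> T} => \prod_j f j (k j)).
 apply: rasum_le (rasum_inj (can_inj Kg) aF) => k /=.
 by rewrite -FE Kg.
split=> //; rewrite -(csum_bij (@ffcons_bij d) a1).
rewrite (eq_csum FE) csum_pair // big_ord_recl -IH2 -csumZr //.
by apply: eq_csum => x /=; rewrite -csumZ.
Qed.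
End ProductFamilies.

Lemma csum_ccvg (f : nat -> C) : casum f -> ccvg (fun n => \sum_(i < n) f i) (csum f).
Proof.
move=> af e /(has_csumP af)[A hA]; exists (\max_(i <- A) i).+1 => n nA.
rewrite -(big_mkord predT f) /index_iota subn0.
apply: hA => [|x xA]; first exact: iota_uniq.
by rewrite mem_iota add0n; apply: leq_trans nA; rewrite ltnS leq_bigmax_seq.
Qed.

Lemma rasum_exp (x : R) : 0 <= x -> rasum (fun n => x ^+ n / n`!%:R).
Proof.
move=> x0; exists (expR x) => A uA.
apply: (@le_trans _ _ (\sum_(i <- iota 0 (\max_(i <- A) i).+1) x ^+ i / i`!%:R)).
 apply: ler_sum_sub => // [i|i iA]; first by rewrite divr_ge0 ?exprn_ge0.
 by rewrite mem_iota add0n ltnS leq_bigmax_seq.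
rewrite -[X in iota 0 X]subn0 -/(index_iota 0 _) /expR.
apply: (nondecreasing_cvgn_le (u_ := series (exp_coeff x))).
 apply: nondecreasing_series => n _ _; exact: exp_coeff_ge0.
exact: is_cvg_series_exp_coeff.
Qed.
Lemma casum_exp (w : C) : casum (fun n => w ^+ n / n`!%:R).
Proof.
apply: rasum_le (rasum_exp (cabs_ge0 w)) => n.
by rewrite cabsM cabsV -realCn cabsR cabsX normr_nat.
Qed.

Lemma ccvg_uniq (u : nat -> C) l l' : ccvg u l -> ccvg u l' -> l = l'.
Proof.
move=> h1 h2; apply/eqP; rewrite -subr_eq0 -cabs_eq0 eq_le cabs_ge0 andbT.
apply/ler_addgt0Pr => e e0; rewrite add0r; have e20 : 0 < e / 2 by rewrite divr_gt0.
have [N hN] := h1 _ e20; have [M hM] := h2 _ e20.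
have -> : l - l' = (u (maxn N M) - l') - (u (maxn N M) - l) by ring.
apply: le_trans (cabsB _ _) _; rewrite [leRHS]splitr.
by apply: lerD; apply: ltW; [apply: hM; rewrite leq_maxr|apply: hN; rewrite leq_maxl].
Qed.

Lemma ccvg_ReIm (u : nat -> C) (a b : R) :
 (fun n => Re (u n)) @ \oo --> a -> (fun n => Im (u n)) @ \oo --> b ->
 ccvg u (a +i* b).
Proof.
move=> /cvgrPdist_lt ha /cvgrPdist_lt hb e e0.
have e20 : 0 < e / 2 by rewrite divr_gt0.
have [N _ hN] := ha _ e20; have [M _ hM] := hb _ e20.
exists (maxn N M) => n; rewrite geq_max => /andP[nN nM].
apply: le_lt_trans (cabs_ReIm _) _; rewrite [ltRHS]splitr ReD ReN ImD ImN /=.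
by rewrite ltrD // distrC; [exact: hN|exact: hM].
Qed.

Lemma csum_exp_real (x : R) : csum (fun n => x%:C ^+ n / n`!%:R) = (expR x)%:C.
Proof.
apply: ccvg_uniq (csum_ccvg (casum_exp _)) _; apply: ccvg_ReIm => /=.
 rewrite /expR; have := @is_cvg_series_exp_coeff R x.
 apply: cvg_trans; apply: near_eq_cvg; apply: nearW => n /=.
 rewrite Re_sum /series /= big_mkord; apply: eq_bigr => i _.
 rewrite /exp_coeff /=.
 by rewrite -realCX -realCn -realCV -realCM.
rewrite (_ : (fun n => _) = cst 0); first exact: cvg_cst.
apply/funext => n /=; rewrite Im_sum big1 // => i _.
by rewrite -realCX -realCn -realCV -realCM.
Qed.

Lemma imag_expn n (y : R) : (0 +i* y) ^+ n =
 ((~~ odd n)%:R * (-1) ^+ n./2 * y ^+ n) +i* ((odd n)%:R * (-1) ^+ n.-1./2 * y ^+ n) :> C.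
Proof.
elim: n => [|n IH]; first by rewrite /= !mul1r mul0r expr0 mul0r.
rewrite exprS IH; apply: ceq; rewrite ?ReM ?ImM /=; case: (boolP (odd n)) => on /=.
- rewrite uphalfE; case: n on {IH} => //= n on.
 by rewrite uphalf_half (negbTE on) add0n !exprS; ring.
- by rewrite exprS; ring.
- by rewrite exprS; ring.
- by rewrite exprS; ring.
Qed.

Lemma csum_exp_imag (y : R) : csum (fun n => (0 +i* y) ^+ n / n`!%:R) = cexp (0 +i* y).
Proof.
apply: ccvg_uniq (csum_ccvg (casum_exp _)) _.
have -> : cexp (0 +i* y) = cos y +i* sin y by rewrite /cexp /= expR0 mul1r.
have E i : (0 +i* y) ^+ i / i`!%:R = cos_coeff y i +i* sin_coeff y i :> C.
 rewrite -realCn -realCV imag_expn /cos_coeff /sin_coeff /= -exprnP.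
 by apply: ceq; rewrite ?ReM ?ImM /=; ring.
apply: ccvg_ReIm => /=.
 rewrite cos.unlock; have := @is_cvg_series_cos_coeff R y.
 apply: cvg_trans; apply: near_eq_cvg; apply: nearW => n /=.
 by rewrite Re_sum /series /= big_mkord; apply: eq_bigr => i _; rewrite E.
rewrite sin.unlock; have := @is_cvg_series_sin_coeff R y.
apply: cvg_trans; apply: near_eq_cvg; apply: nearW => n /=.
by rewrite Im_sum /series /= big_mkord; apply: eq_bigr => i _; rewrite E.
Qed.

Lemma csum_expD (v w : C) : csum (fun n => (v + w) ^+ n / n`!%:R) =
 csum (fun n => v ^+ n / n`!%:R) * csum (fun n => w ^+ n / n`!%:R).
Proof.
pose F (x : nat * nat) := v ^+ x.1 / x.1`!%:R * (w ^+ x.2 / x.2`!%:R).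
have aF : casum F.
 have := rasum_prod (fun i => cabs_ge0 (v ^+ i / i`!%:R)) (fun i => cabs_ge0 (w ^+ i / i`!%:R))
  (casum_exp v) (casum_exp w).
 by apply: rasum_le => x; rewrite /F cabsM.
(* The pair [(i, j)] is sent to [(i + j, i)]: the double series becomes a sum over the triangle
   [x.2 <= x.1], whose rows are the binomial expansions of [(v + w) ^+ n]. *)
pose k (x : nat * nat) := if (x.2 <= x.1)%N then Some (x.2, x.1 - x.2)%N else None.
have h1 j : k (j.1 + j.2, j.1)%N = Some j by rewrite /k /= leq_addr addKn; case: j.
have h2 i j : k i = Some j -> (j.1 + j.2, j.1)%N = i.
 by rewrite /k; case: i => i1 i2; case: leqP => //= h [<-] /=; rewrite subnKC.
have := csum_lift h1 h2 aF; rewrite (csum_pair aF) csum_pair; last exact: (casum_lift h1 h2 aF).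
have <- : csum (fun i => csum (fun j => F (i, j))) =
  csum (fun n => v ^+ n / n`!%:R) * csum (fun n => w ^+ n / n`!%:R).
 rewrite -csumZr; last exact: casum_exp.
 by apply: eq_csum => i; rewrite -csumZ //; exact: casum_exp.
move=> <-; apply: eq_csum => n.
rewrite (@csum_fin _ _ _ (iota 0 n.+1)) ?iota_uniq //; last first.
 by move=> j; rewrite mem_iota add0n /= ltnS /k /= => /negbTE ->.
rewrite addrC exprDn -[iota 0 _]/(index_iota 0 n.+1) big_mkord mulr_suml; apply: eq_bigr => i _.
have in' : (i <= n)%N by rewrite -ltnS.
rewrite /k /= in' /F /= -(bin_fact in') !natrM -mulr_natr.
field; rewrite !pnatr_eq0 -!lt0n !fact_gt0 bin_gt0 //=.
Qed.

(** [cexp] is built from real functions; the addition formula of the series joins the real axis to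
    the imaginary one, where the series of exp, cos and sin apply. *)
Lemma csum_exp (w : C) : csum (fun n => w ^+ n / n`!%:R) = cexp w.
Proof.
have -> : w = (Re w)%:C + (0 +i* Im w).
 by apply: ceq; rewrite ?ReD ?ImD /= ?addr0 ?add0r.
by rewrite csum_expD cexpD csum_exp_real csum_exp_imag cexp_real.
Qed.
End SumTools.

(** ** The polynomials [pk k m a b], with exponential generating function
  [exp (a x + b y + x y)] *)
Section Polynomials.

Fixpoint pk (K : comNzRingType) (k m : nat) (a b : K) : K :=
 if k is k'.+1 then a * pk k' m a b + m%:R * pk k' m.-1 a b else b ^+ m.

Section Ring.
Variable K : comNzRingType.
Implicit Types a b : K.

(** The generating function [G] satisfies [dG/dx = (a + y) G] and [dG/dy = (b + x) G]. The first
    equation is the definition of [pk], the second is this mirror recursion. *)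
Lemma pk_Sr k m a b : pk k m.+1 a b = b * pk k m a b + k%:R * pk k.-1 m a b.
Proof.
elim: k m => [|k IH] m; first by rewrite /= mul0r addr0 exprS.
rewrite [LHS]/= IH [in RHS]/= -[k.+1%:R]natr1 -[m.+1%:R]natr1.
have E : a * (k%:R * pk k.-1 m a b) + m%:R * pk k m a b =
  b * (m%:R * pk k m.-1 a b) + k%:R * pk k m a b.
 case: k IH => [|k] IH.
  by case: m => [|m]; rewrite /= ?exprS; ring.
 rewrite {2}/pk -/pk /=; case: m => [|m] /=; first by ring.
 have H := IH m; rewrite /= in H; rewrite [X in _ + _ * X = _]H; ring.
have -> : a * (b * pk k m a b + k%:R * pk k.-1 m a b) + (m%:R + 1) * pk k m a b =
 b * (a * pk k m a b) + pk k m a b + (a * (k%:R * pk k.-1 m a b) + m%:R * pk k m a b) by ring.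
rewrite E; ring.
Qed.
Lemma pk_m0 k a b : pk k 0 a b = a ^+ k.
Proof. by elim: k => //= k ->; rewrite mul0r addr0 exprS. Qed.

Lemma pk_sym k m a b : pk k m a b = pk m k b a.
Proof.
elim: k m => [|k IH] m; first by rewrite pk_m0.
by rewrite /= pk_Sr !IH.
Qed.
End Ring.

Variable R : realType.
Local Notation C := R[i].

Lemma cabs_nat n : cabs (n%:R : C) = n%:R.
Proof. by rewrite -realCn cabsR normr_nat. Qed.

(** For fixed [k] the growth in [m] is only exponential, so that division by the factorial of [m]
    gives convergent series. *)
Lemma pk_bound k m (a b : C) :
 cabs (pk k m a b) <= (cabs a + 1) ^+ k * (cabs b + k%:R) ^+ m.
Proof.
have a0 := cabs_ge0 a; have b0 := cabs_ge0 b.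
elim: k m => [|k IH] m /=; first by rewrite addr0 expr0 mul1r cabsX.
apply: le_trans (cabsD _ _) _; rewrite !cabsM cabs_nat.
set s := cabs b + k%:R; have s0 : 0 <= s by rewrite addr_ge0.
have -> : cabs b + k.+1%:R = s + 1 by rewrite /s -natr1 addrA.
have P : 0 <= (cabs a + 1) ^+ k by rewrite exprn_ge0 // addr_ge0.
have h1 : cabs a * cabs (pk k m a b) <= cabs a * ((cabs a + 1) ^+ k * (s + 1) ^+ m).
 apply: ler_wpM2l => //; apply: le_trans (IH m) _; apply: ler_wpM2l => //.
 by rewrite lerXn2r ?nnegrE ?addr_ge0 // lerDl.
have h3 n : n%:R * s ^+ n.-1 <= (s + 1) ^+ n.
 elim: n => [|[|n] IHn] /=; rewrite ?mul0r ?expr0 ?mulr1 //.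
  by rewrite expr1 lerDr.
 have -> : n.+2%:R * s ^+ n.+1 = s * (n.+1%:R * s ^+ n) + s ^+ n.+1.
  by rewrite -natr1 exprS; ring.
 have -> : (s + 1) ^+ n.+2 = s * (s + 1) ^+ n.+1 + (s + 1) ^+ n.+1.
  by rewrite [LHS]exprS mulrDl mul1r.
 rewrite lerD //; first exact: ler_wpM2l.
 by rewrite lerXn2r ?nnegrE ?addr_ge0 // lerDl.
have h2 : m%:R * cabs (pk k m.-1 a b) <= (cabs a + 1) ^+ k * (s + 1) ^+ m.
 apply: le_trans (ler_wpM2l (ler0n _ _) (IH m.-1)) _.
 by rewrite mulrCA ler_wpM2l.
apply: le_trans (lerD h1 h2) _; rewrite exprS; set x := (_ ^+ k); set y := (_ ^+ m).
by apply/eq_ler; ring.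
Qed.

Lemma casum_pk2 k k' (a b a' b' : C) :
 casum (fun m => pk k m a b * pk k' m a' b' / m`!%:R).
Proof.
set s := (cabs b + k%:R) * (cabs b' + k'%:R).
have s0 : 0 <= s by rewrite mulr_ge0 ?addr_ge0 ?cabs_ge0.
have c0 : 0 <= (cabs a + 1) ^+ k * (cabs a' + 1) ^+ k'.
 by rewrite mulr_ge0 // exprn_ge0 // addr_ge0 ?cabs_ge0.
apply: rasum_le (rasumZ c0 (rasum_exp s0)) => m.
rewrite !cabsM cabsV cabs_nat mulrA ler_wpM2r ?invr_ge0 //.
rewrite /s exprMn mulrACA ler_pM ?cabs_ge0 //; exact: pk_bound.
Qed.

(** On generating functions in [k] and [k'] the sum over [m] is
    [exp (a x + a' x' + (b + x) (b' + x'))], which is also the generating function of the right-hand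
    side. The proof follows the two recursions instead. *)
Lemma csum_pk2 k k' (a b a' b' : C) :
 csum (fun m => pk k m a b * pk k' m a' b' / m`!%:R) =
 cexp (b * b') * pk k k' (a + b') (b + a').
Proof.
elim: k k' => [|k IHk].
 elim=> [|k' IH] /=.
  by rewrite mulr1 -csum_exp; apply: eq_csum => m; rewrite exprMn.
 have [s1 s2] := csum_shift (casum_pk2 0 k' a b a' b').
 rewrite exprS; have -> : cexp (b * b') * ((b + a') * (b + a') ^+ k') =
  a' * (cexp (b * b') * (b + a') ^+ k') + b * (cexp (b * b') * (b + a') ^+ k') by ring.
 have a0 := casum_pk2 0 k' a b a' b'.
 rewrite -IH -[X in _ + _ * X]s2 -(csumZ a' a0) -(csumZ b s1) -csumD; last 2 first.
 - exact: casumZ.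
 - exact: casumZ.
 apply: eq_csum => -[|m] /=; first by rewrite mul0r !mulr0 !addr0 /=; ring.
 rewrite exprS factS natrM; field.
 by rewrite nat1r !pnatr_eq0 -!lt0n fact_gt0.
move=> k' /=.
have -> : cexp (b * b') * ((a + b') * pk k k' (a + b') (b + a') +
  k'%:R * pk k k'.-1 (a + b') (b + a')) =
  a * (cexp (b * b') * pk k k' (a + b') (b + a')) +
  (b' * (cexp (b * b') * pk k k' (a + b') (b + a')) +
  k'%:R * (cexp (b * b') * pk k k'.-1 (a + b') (b + a'))) by ring.
rewrite -!IHk -!csumZ; try exact: casum_pk2.
rewrite -csumD; try exact: casumZ (casum_pk2 _ _ _ _ _ _).
have aa : casum (fun m => b' * (pk k m a b * pk k' m a' b' / m`!%:R) +
 k'%:R * (pk k m a b * pk k'.-1 m a' b' / m`!%:R)).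
 by apply: casumD; exact: casumZ (casum_pk2 _ _ _ _ _ _).
(* The factor [m] of the recursion cancels against the factorial and shifts the sum by one; [pk_Sr]
   for [k'] then regroups the shifted terms. *)
have [s1 s2] := csum_shift aa; rewrite -s2 -csumD //.
 apply: eq_csum => -[|m]; first by rewrite /=; ring.
 rewrite /= (pk_Sr k') factS natrM; field.
 by rewrite nat1r !pnatr_eq0 -!lt0n fact_gt0.
exact: casumZ (casum_pk2 _ _ _ _ _ _).
Qed.

Lemma rmorph_pk k m (a b : R) : (pk k m a b)%:C = pk k m a%:C b%:C.
Proof.
elim: k m => [|k IH] m /=; first by rewrite realCX.
by rewrite realCD !realCM !IH realCn.
Qed.
Lemma pk_ge0 k m (a b : R) : 0 <= a -> 0 <= b -> 0 <= pk k m a b.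
Proof.
move=> a0 b0; elim: k m => [|k IH] m /=; first exact: exprn_ge0.
by rewrite addr_ge0 ?mulr_ge0.
Qed.
Lemma cabs_pk k m (a b : C) : cabs (pk k m a b) <= pk k m (cabs a) (cabs b).
Proof.
elim: k m => [|k IH] m /=; first by rewrite cabsX.
apply: le_trans (cabsD _ _) _; rewrite !cabsM cabs_nat.
by rewrite lerD ?ler_wpM2l ?cabs_ge0.
Qed.

(** Absolute convergence is checked on the same series at the moduli of the four arguments, whose
    terms are nonnegative and whose inner sums over [m] are known in closed form. *)
Lemma casum_pk_gen (a b x y : C) :
 casum (fun u : nat * nat => pk u.1 u.2 a b * x ^+ u.1 * y ^+ u.2 / (u.1`!%:R * u.2`!%:R)).
Proof.
pose A := (cabs a)%:C : C; pose B := (cabs b)%:C : C.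
pose X := (cabs x)%:C : C; pose Y := (cabs y)%:C : C.
pose g (u : nat * nat) : R := pk u.1 u.2 (cabs a) (cabs b) * cabs x ^+ u.1 * cabs y ^+ u.2 /
 (u.1`!%:R * u.2`!%:R).
have g0 u : 0 <= g u by rewrite divr_ge0 ?mulr_ge0 ?exprn_ge0 ?cabs_ge0 ?pk_ge0 ?cabs_ge0.
have inner k : casum (fun m => (g (k, m))%:C) /\ csum (fun m => (g (k, m))%:C) =
  cexp (B * Y) * (X ^+ k * (A + Y) ^+ k / k`!%:R).
 have E m : X ^+ k / k`!%:R * (pk k m A B * pk 0 m 0 Y / m`!%:R) = (g (k, m))%:C.
  rewrite -rmorph_pk /= /g /= realCM realCV !realCM !realCX !realCn; field.
  by rewrite !pnatr_eq0 -!lt0n !fact_gt0.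
 split.
  have := casumZ (X ^+ k / k`!%:R) (casum_pk2 k 0 A B 0 Y).
  by apply: rasum_le => m; rewrite -E.
 rewrite -(eq_csum E) (csumZ _ (casum_pk2 k 0 A B 0 Y)) csum_pk2 pk_m0; ring.
have ag : rasum g.
 apply: rasum_pair => //.
  by move=> k; have [h _] := inner k; apply: rasum_le h => m; rewrite cabsR ger0_norm.
 have := casumZ (cexp (B * Y)) (casum_exp (X * (A + Y))).
 apply: rasum_le => k.
 have -> : rsum (fun m => g (k, m)) = cabs (csum (fun m => (g (k, m))%:C)).
  rewrite csum_real // ?cabsR ?ger0_norm //.
   by apply: rsum_ge0; have [h _] := inner k; apply: rasum_le h => m; rewrite cabsR ger0_norm.
  by have [h _] := inner k; apply: rasum_le h => m; rewrite cabsR ger0_norm.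
 by rewrite (inner k).2 exprMn.
apply: rasum_le ag => -[k m] /=; rewrite /g !cabsM cabsV cabsM !cabs_nat !cabsX /=.
by rewrite ler_wpM2r ?invr_ge0 ?mulr_ge0 // !ler_wpM2r ?exprn_ge0 ?cabs_ge0 ?cabs_pk.
Qed.

Lemma csum_pk_gen (a b x y : C) :
 csum (fun u : nat * nat => pk u.1 u.2 a b * x ^+ u.1 * y ^+ u.2 / (u.1`!%:R * u.2`!%:R)) =
 cexp (a * x + b * y + x * y).
Proof.
rewrite csum_pair; last exact: casum_pk_gen.
rewrite (eq_csum (g := fun k => cexp (b * y) * ((x * (a + y)) ^+ k / k`!%:R))); last first.
 move=> k; rewrite (eq_csum (g := fun m => x ^+ k / k`!%:R *
   (pk k m a b * pk 0 m 0 y / m`!%:R))); last first.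
  move=> m /=; field; by rewrite !pnatr_eq0 -!lt0n !fact_gt0.
 by rewrite (csumZ _ (casum_pk2 k 0 a b 0 y)) csum_pk2 pk_m0 exprMn; ring.
rewrite csumZ ?csum_exp -?cexpD; last exact: casum_exp.
congr cexp; ring.
Qed.
End Polynomials.

(** * Square summable families and the Cauchy-Schwarz inequality *)

Section SquareSummable.
Variable R : realType.
Local Notation C := R[i].

Definition l2 (I : choiceType) (f : I -> C) := rasum (fun i => cabs2 (f i)).
Definition n2 (I : choiceType) (f : I -> C) : R := rsum (fun i => cabs2 (f i)).

(** Cauchy-Schwarz from the arithmetic-geometric inequality with a free parameter: [t = x / a] is
    the optimal value, and when [a = 0] the value [t = (b + 1) / x] is already impossible. *)
Lemma sqr_bound (x a b : R) : 0 <= a -> 0 <= b -> 0 <= x ->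
 (forall t, 0 < t -> 2 * x <= t * a + b / t) -> x ^+ 2 <= a * b.
Proof.
move=> a0 b0; rewrite le_eqVlt => /predU1P[<-|x0] h.
 by rewrite expr0n mulr_ge0.
move: a0; rewrite le_eqVlt => /predU1P[a0|a0].
 have := h ((b + 1) / x) (divr_gt0 (ltr_wpDl b0 ltr01) x0).
 rewrite -a0 mulr0 add0r invfM invrK mulrA => h'.
 have : b / (b + 1) * x <= 1 * x.
  by apply: ler_wpM2r; rewrite ?ltW // ltr_pdivrMr ?mul1r ?ltrDl // ltr_wpDl.
 rewrite mul1r mulrAC; move: h'; rewrite mulrAC; lra.
have := h (x / a) (divr_gt0 x0 a0).
rewrite divfK ?gt_eqF // invfM invrK => h'.
have : x <= b * (a / x) by rewrite [a / x]mulrC; lra.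
rewrite mulrA ler_pdivlMr // expr2 [b * a]mulrC; exact.
Qed.

Section Fixed.
Variable I : choiceType.
Implicit Types f g : I -> C.

Lemma n2_ge0 f : l2 f -> 0 <= n2 f. Proof. exact: rsum_ge0. Qed.
Lemma casum_l2 f g : l2 f -> l2 g -> casum (fun i => f i * g i).
Proof.
move=> hf hg; apply: rasum_le (rasumD hf hg) => i.
rewrite cabsM -!cabs_sqr; have := sqr_ge0 (cabs (f i) - cabs (g i)).
have := cabs_ge0 (f i); have := cabs_ge0 (g i); nra.
Qed.
Lemma l2_conj f : l2 f -> l2 (fun i => conjc (f i)).
Proof. by apply: rasum_le => i; rewrite cabs2_conj. Qed.
Lemma n2_conj f : n2 (fun i => conjc (f i)) = n2 f.
Proof. by apply: eq_rsum => i; rewrite cabs2_conj. Qed.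
Lemma cauchy_schwarz f g : l2 f -> l2 g ->
 cabs2 (csum (fun i => f i * g i)) <= n2 f * n2 g.
Proof.
move=> hf hg; rewrite -cabs_sqr; apply: sqr_bound; rewrite ?n2_ge0 ?cabs_ge0 //.
move=> t t0; apply: le_trans (ler_wpM2l (ler0n _ 2) (cabs_csum (casum_l2 hf hg))) _.
rewrite -ler_pdivlMl //; apply: rsum_le => A uA; rewrite ler_pdivlMl //.
apply: (@le_trans _ _ (t * \sum_(i <- A) cabs2 (f i) + (\sum_(i <- A) cabs2 (g i)) / t)).
 rewrite !mulr_sumr mulr_suml -big_split; apply: ler_sum => i _.
 rewrite cabsM -!cabs_sqr -(@ler_pM2l _ t) // mulrDr [t * (_ / t)]mulrC divfK ?gt_eqF //.
 by have := sqr_ge0 (t * cabs (f i) - cabs (g i)); lra.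
apply: lerD; first by apply: ler_wpM2l; [exact: ltW|exact: rsum_ub].
by apply: ler_wpM2r; [rewrite invr_ge0 ltW|exact: rsum_ub].
Qed.
Lemma cabs2D (v w : C) : cabs2 (v + w) <= 2 * cabs2 v + 2 * cabs2 w.
Proof.
rewrite /cabs2 ReD ImD; have := sqr_ge0 (Re v - Re w).
have := sqr_ge0 (Im v - Im w); lra.
Qed.
Lemma l2D f g : l2 f -> l2 g -> l2 (fun i => f i + g i).
Proof.
move=> hf hg; apply: rasum_le (rasumD (rasumZ (ler0n R 2) hf) (rasumZ (ler0n R 2) hg)) => i.
exact: cabs2D.
Qed.
Lemma l2Z c f : l2 f -> l2 (fun i => c * f i).
Proof. by move=> /(rasumZ (cabs2_ge0 c)); apply: rasum_le => i; rewrite cabs2M. Qed.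
Lemma n2Z c f : l2 f -> n2 (fun i => c * f i) = cabs2 c * n2 f.
Proof.
move=> hf; apply: (@complexI R); rewrite realCM /n2 -!csum_real //; last 3 first.
- by move=> i; exact: cabs2_ge0.
- exact: l2Z.
- by move=> i; exact: cabs2_ge0.
by rewrite -csumZ; [apply: eq_csum => i; rewrite cabs2M realCM|apply: casum_real => // i; exact: cabs2_ge0].
Qed.
Lemma n2E f : l2 f -> (n2 f)%:C = csum (fun i => f i * conjc (f i)).
Proof.
move=> hf; rewrite /n2 -csum_real //; last by move=> i; exact: cabs2_ge0.
by apply: eq_csum => i; rewrite mul_conj.
Qed.
Lemma l2_fin f (s : seq I) : (forall i, i \notin s -> f i = 0) -> l2 f.
Proof. by move=> h; apply: (@rasum_fin _ _ _ s) => i /h ->; rewrite /cabs2 /= expr0n addr0. Qed.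
End Fixed.
End SquareSummable.

(** ** Matrix coefficients of the Heisenberg representation *)
Section MatrixCoefficients.
Variable R : realType.
Local Notation C := R[i].

Lemma conjR (x : R) : conjc x%:C = x%:C :> C.
Proof. by rewrite /conjc /= oppr0. Qed.

Lemma conjV (w : C) : conjc w^-1 = (conjc w)^-1.
Proof. exact: fmorphV. Qed.

Lemma pk_conj k m (a b : C) : conjc (pk k m a b) = pk k m (conjc a) (conjc b).
Proof.
elim: k m => [|k IH] m /=; first exact: conjX.
by rewrite conjD !conjM !IH -realCn conjR.
Qed.

Definition sq : R := Num.sqrt pi.
Lemma sq_sqr : sq ^+ 2 = pi. Proof. by rewrite sqr_sqrtr // pi_ge0. Qed.
Lemma sq_gt0 : 0 < sq. Proof. by rewrite sqrtr_gt0 pi_gt0. Qed.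

Definition fs (k m : nat) : R := Num.sqrt (k`!%:R * m`!%:R).
Lemma fs_gt0 k m : 0 < fs k m.
Proof. by rewrite sqrtr_gt0 mulr_gt0 // ltr0n fact_gt0. Qed.
Lemma fs_neq0 k m : (fs k m)%:C != 0 :> C.
Proof. by rewrite -cabs_eq0 cabsR normr_eq0 gt_eqF // fs_gt0. Qed.
Lemma fsM k k' m : fs k m * fs k' m = fs k k' * m`!%:R.
Proof.
rewrite /fs -sqrtrM ?mulr_ge0 //.
have -> : k`!%:R * m`!%:R * (k'`!%:R * m`!%:R) = k`!%:R * k'`!%:R * m`!%:R ^+ 2 :> R by ring.
by rewrite [LHS]sqrtrM ?mulr_ge0 // sqrtr_sqr ger0_norm.
Qed.

(** [u k m z] is the inner product of [e_m] with [beta_z e_k] in one variable. *)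
Definition u (k m : nat) (z : C) : C := (expR (- (pi / 2) * cabs2 z))%:C *
 pk k m (- (sq%:C * conjc z)) (sq%:C * z) / (fs k m)%:C.

Lemma u_neg k m z : u k m (- z) = conjc (u m k z).
Proof.
rewrite /u !conjM pk_conj conjV !conjR.
have -> : cabs2 (- z) = cabs2 z by rewrite -!cabs_sqr cabsN.
rewrite /fs [k`!%:R * _]mulrC pk_sym !rmorphN /= !conjM conjcK !conjR.
by rewrite !mulrN opprK.
Qed.

(** Completing the square: [pi w conj(z) - pi/2 |w|^2 - pi/2 |z|^2] has real part
    [- pi/2 |w - z|^2], and its imaginary part is the cocycle of the projective representation. *)
Lemma gauss_phase (w z : C) :
 (expR (- (pi / 2) * cabs2 w))%:C * (expR (- (pi / 2) * cabs2 z))%:C *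
 cexp (sq%:C * w * (sq%:C * conjc z)) =
 cexp (0 +i* (pi * Im (w * conjc z))) * (expR (- (pi / 2) * cabs2 (w - z)))%:C.
Proof.
rewrite -!cexp_real -!cexpD; congr cexp.
have -> : sq%:C * w * (sq%:C * conjc z) = (pi)%:C * (w * conjc z).
 by rewrite -sq_sqr realCX; ring.
case: w z => a b [c d]; by apply: ceq; rewrite /cabs2 /=; field.
Qed.

(** Composition law of a projective representation, written on matrix entries, since
    [conj (u k' m z)] is [u m k' (- z)]. The sum over [m] is [csum_pk2] and the Gaussians produce
    the phase. *)
Lemma u_add k k' w z :
 casum (fun m => u k m w * conjc (u k' m z)) /\
 csum (fun m => u k m w * conjc (u k' m z)) =
 cexp (0 +i* (pi * Im (w * conjc z))) * u k k' (w - z).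
Proof.
pose c : C := (expR (- (pi / 2) * cabs2 w))%:C * (expR (- (pi / 2) * cabs2 z))%:C / (fs k k')%:C.
have E m : c * (pk k m (- (sq%:C * conjc w)) (sq%:C * w) *
  pk k' m (- (sq%:C * z)) (sq%:C * conjc z) / m`!%:R) = u k m w * conjc (u k' m z).
 rewrite /c /u !conjM pk_conj conjV !conjR rmorphN /= !conjM conjcK conjR.
 have := fsM k k' m => /(congr1 (fun x : R => x%:C)).
 rewrite !realCM realCn => H.
 have -> : (m`!%:R : C)^-1 = (fs k k')%:C / ((fs k m)%:C * (fs k' m)%:C).
  rewrite H; field; rewrite fs_neq0 pnatr_eq0 -lt0n fact_gt0 //.
 field; by rewrite !fs_neq0.
have h := casum_pk2 k k' (- (sq%:C * conjc w)) (sq%:C * w) (- (sq%:C * z)) (sq%:C * conjc z).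
split; first by apply: rasum_le (casumZ c h) => m; rewrite E.
rewrite -(eq_csum E) csumZ // csum_pk2 /u.
have -> : - (sq%:C * conjc w) + sq%:C * conjc z = - (sq%:C * conjc (w - z)).
 by rewrite conjB; ring.
have -> : sq%:C * w + - (sq%:C * z) = sq%:C * (w - z) by ring.
have G := gauss_phase w z; set p := pk _ _ _ _; rewrite /c.
have -> : forall a b f g : C, a * b / f * (g * p) = a * b * g * (p / f) by move=> *; ring.
rewrite G; ring.
Qed.

Lemma u0 k m : u k m 0 = (k == m)%:R.
Proof.
rewrite /u rmorph0 !mulr0 oppr0 /cabs2 /= expr0n addr0 mulr0 expR0 mul1r.
have E : pk k m (0 : C) 0 = (k == m)%:R * m`!%:R.
 elim: k m => [|k IH] [|m] /=; rewrite ?mul0r ?add0r ?mul0r ?expr0 ?mul1r //.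
  by rewrite exprS mul0r.
 by rewrite IH eqSS factS natrM; ring.
rewrite E; case: eqP => [->|_]; last by rewrite !mul0r.
by rewrite /fs -expr2 sqrtr_sqr ger0_norm // realCn mul1r divff.
Qed.

Variable d : nat.
Definition NI := {ffun 'I_d -> nat}.
Definition U (k m : NI) (z : Cd R d) : C := \prod_j u (k j) (m j) (z j).
Definition phase (w z : Cd R d) : C :=
 cexp (0 +i* (pi * \sum_j Im (w j * conjc (z j)))).

Lemma phaseE w z : phase w z = \prod_j cexp (0 +i* (pi * Im (w j * conjc (z j)))).
Proof.
rewrite -cexp_sum; congr cexp; apply: ceq; rewrite ?Re_sum ?Im_sum /= ?mulr_sumr //.
by rewrite big1.
Qed.
Lemma cabs_phase w z : cabs (phase w z) = 1. Proof. by rewrite cabs_cexp expR0. Qed.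
Lemma phase_refl z : phase z z = 1.
Proof.
rewrite /phase big1 ?mulr0 ?cexp0 // => j _; rewrite mul_conj //.
Qed.
Lemma phase_conj w z : conjc (phase w z) = phase z w.
Proof.
rewrite cexp_conj; congr cexp; apply: ceq => //=.
rewrite -mulrN -sumrN; congr (_ * _); apply: eq_bigr => j _.
by rewrite !ImM !Re_conj !Im_conj; ring.
Qed.

Lemma U_add (k k' : NI) w z :
 casum (fun m : NI => U k m w * conjc (U k' m z)) /\
 csum (fun m : NI => U k m w * conjc (U k' m z)) = phase w z * U k k' (w - z).
Proof.
have h j := u_add (k j) (k' j) (w j) (z j).
have [h1 h2] := csum_prod (fun j => (h j).1).
have E (m : NI) : \prod_j (u (k j) (m j) (w j) * conjc (u (k' j) (m j) (z j))) =
  U k m w * conjc (U k' m z).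
 by rewrite big_split conj_prod.
split; first by apply: rasum_le h1 => m; rewrite E.
rewrite -(eq_csum E) h2 phaseE -big_split; apply: eq_bigr => j _.
by rewrite (h j).2 !ffunE.
Qed.
Lemma U_neg (k m : NI) z : U k m (- z) = conjc (U m k z).
Proof. by rewrite conj_prod; apply: eq_bigr => j _; rewrite ffunE u_neg. Qed.
Lemma U0 (k m : NI) : U k m 0 = (k == m)%:R.
Proof.
rewrite /U; case: (eqVneq k m) => [->|km].
 by rewrite big1 // => j _; rewrite ffunE u0 eqxx.
have [j kj] : exists j, k j != m j.
 apply/existsP; rewrite -negb_forall; apply: contraNN km => /forallP h.
 by apply/eqP/ffunP => j; exact/eqP.
by rewrite (bigD1 j) //= ffunE u0 (negbTE kj) mul0r.
Qed.
(** The case [w = z], [k = k'] of [U_add]: the rows of a unitary matrix are unit vectors. *)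
Lemma U_l2 (k : NI) z : l2 (fun m : NI => U k m z) /\ n2 (fun m : NI => U k m z) = 1.
Proof.
have [h1 h2] := U_add k k z z.
have h : l2 (fun m : NI => U k m z).
 by apply: rasum_le h1 => m; rewrite mul_conj cabsR ger0_norm // cabs2_ge0.
split=> //; apply: (@complexI R); rewrite n2E // h2 phase_refl subrr U0 eqxx mul1r //.
Qed.
Lemma U_le1 (k m : NI) z : cabs (U k m z) <= 1.
Proof.
have [h1 h2] := U_l2 k z; rewrite -(@ler_pXn2r _ 2) ?nnegrE ?cabs_ge0 //.
by rewrite cabs_sqr expr1n -h2; apply: (rsum_ub1 (g := fun m => cabs2 (U k m z))).
Qed.
End MatrixCoefficients.

(** ** Complex-valued Lebesgue integrals *)
Section OneVariable.
Variable R : realType.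
Local Notation C := R[i].
Implicit Types u v : nat -> C.

Lemma ccvgE u l : ccvg u l <-> ((fun n => cabs (u n - l)) @ \oo --> (0 : R)).
Proof.
split=> h.
 apply/cvgrPdist_lt => e /h[N hN]; exists N => // n nN /=.
 by rewrite sub0r normrN ger0_norm ?cabs_ge0 //; exact: hN.
move=> e e0; move/cvgrPdist_lt: h => /(_ e e0)[N _ hN]; exists N => n nN.
by have := hN n nN; rewrite /= sub0r normrN ger0_norm ?cabs_ge0.
Qed.
Lemma ccvg_squeeze u l (b : nat -> R) : (forall n, cabs (u n - l) <= b n) ->
 b @ \oo --> (0 : R) -> ccvg u l.
Proof.
move=> ub b0; apply/ccvgE; apply: squeeze_cvgr b0; last exact: cvg_cst.
by apply: nearW => n; rewrite cabs_ge0 ub.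
Qed.
Lemma ccvg_cst (c : C) : ccvg (fun _ => c) c.
Proof. by move=> e e0; exists 0%N => n _; rewrite subrr cabs0. Qed.
Lemma ccvgD u v a b : ccvg u a -> ccvg v b -> ccvg (fun n => u n + v n) (a + b).
Proof.
move=> /ccvgE ha /ccvgE hb; apply: (ccvg_squeeze (b := fun n => cabs (u n - a) + cabs (v n - b))).
 by move=> n; rewrite opprD addrACA cabsD.
by rewrite -[X in _ --> X](addr0 0); exact: cvgD.
Qed.
Lemma ccvgN u a : ccvg u a -> ccvg (fun n => - u n) (- a).
Proof.
move=> h e /h[N hN]; exists N => n /hN; by rewrite -opprD cabsN.
Qed.
Lemma ccvgB u v a b : ccvg u a -> ccvg v b -> ccvg (fun n => u n - v n) (a - b).
Proof. by move=> h1 h2; apply: ccvgD => //; exact: ccvgN. Qed.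
Lemma ccvg_cabs u a : ccvg u a -> (fun n => cabs (u n)) @ \oo --> (cabs a : R).
Proof.
move=> h; apply/cvgrPdist_lt => e /h[N hN]; exists N => // n /hN /= h'.
apply: le_lt_trans h'; rewrite !cabsE [leRHS]distrC.
exact: (@ler_dist_dist R (Rcomplex R)).
Qed.
Lemma ccvgM u v a b : ccvg u a -> ccvg v b -> ccvg (fun n => u n * v n) (a * b).
Proof.
move=> ha hb; have ha' := ccvg_cabs ha; move/ccvgE: ha => ha; move/ccvgE: hb => hb.
apply: (ccvg_squeeze (b := fun n => cabs (u n) * cabs (v n - b) + cabs (u n - a) * cabs b)).
 move=> n; have -> : u n * v n - a * b = u n * (v n - b) + (u n - a) * b by ring.
 by apply: le_trans (cabsD _ _) _; rewrite !cabsM.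
have -> : (0 : R) = cabs a * 0 + 0 * cabs b by rewrite mulr0 mul0r addr0.
by apply: cvgD; apply: cvgM => //; exact: cvg_cst.
Qed.
Lemma ccvgZ c u a : ccvg u a -> ccvg (fun n => c * u n) (c * a).
Proof. by move=> h; apply: ccvgM => //; exact: ccvg_cst. Qed.
Lemma ccvg_conj u a : ccvg u a -> ccvg (fun n => conjc (u n)) (conjc a).
Proof. by move=> h e /h[N hN]; exists N => n /hN; rewrite -conjB cabs_conj. Qed.
Lemma ccvg_sum I (r : seq I) (F : nat -> I -> C) (l : I -> C) :
 (forall i, ccvg (F ^~ i) (l i)) ->
 ccvg (fun n => \sum_(i <- r) F n i) (\sum_(i <- r) l i).
Proof.
move=> h; elim: r => [|i r IH].
 by rewrite big_nil; under eq_fun do rewrite big_nil; exact: ccvg_cst.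
by rewrite big_cons; under eq_fun do rewrite big_cons; exact: ccvgD.
Qed.
Lemma ccvg_prod I (r : seq I) (F : nat -> I -> C) (l : I -> C) :
 (forall i, ccvg (F ^~ i) (l i)) ->
 ccvg (fun n => \prod_(i <- r) F n i) (\prod_(i <- r) l i).
Proof.
move=> h; elim: r => [|i r IH].
 by rewrite big_nil; under eq_fun do rewrite big_nil; exact: ccvg_cst.
by rewrite big_cons; under eq_fun do rewrite big_cons; exact: ccvgM.
Qed.
Lemma ccvgX k u a : ccvg u a -> ccvg (fun n => u n ^+ k) (a ^+ k).
Proof.
move=> h; elim: k => [|k IH]; first exact: ccvg_cst.
by rewrite exprS; under eq_fun do rewrite exprS; exact: ccvgM.
Qed.
Lemma ccvg_Re u a : ccvg u a -> (fun n => Re (u n)) @ \oo --> (Re a : R).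
Proof.
move=> h; apply/cvgrPdist_lt => e /h[N hN]; exists N => // n /hN /=.
by apply: le_lt_trans; rewrite distrC -ReN -ReD cabsRe.
Qed.
Lemma ccvg_Im u a : ccvg u a -> (fun n => Im (u n)) @ \oo --> (Im a : R).
Proof.
move=> h; apply/cvgrPdist_lt => e /h[N hN]; exists N => // n /hN /=.
by apply: le_lt_trans; rewrite distrC -ImN -ImD cabsIm.
Qed.
Lemma ccvg_real (u : nat -> R) (a : R) : u @ \oo --> a -> ccvg (fun n => (u n)%:C) a%:C.
Proof. by move=> h; apply: ccvg_ReIm => //=; exact: cvg_cst. Qed.
Lemma cexp_cont u a : ccvg u a -> ccvg (fun n => cexp (u n)) (cexp a).
Proof.
move=> h; apply: ccvgM.
 by apply: ccvg_real; exact: (cvg_comp _ _ (ccvg_Re h) (@continuous_expR R _)).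
apply: ccvg_ReIm => /=; first exact: (cvg_comp _ _ (ccvg_Im h) (@continuous_cos R _)).
exact: (cvg_comp _ _ (ccvg_Im h) (@continuous_sin R _)).
Qed.
Lemma ccvg_cabs_le u a (M : R) : ccvg u a -> (forall n, cabs (u n) <= M) -> cabs a <= M.
Proof.
move=> h uM; apply/ler_addgt0Pr => e /h[N /(_ N (leqnn N)) hN].
have -> : a = u N - (u N - a) by ring.
by apply: le_trans (cabsB _ _) _; rewrite lerD // ltW.
Qed.

Local Notation leb := (@lebesgue_measure R).

(** Continuity along sequences is the form in which dominated convergence produces it;
    [seq_continuous] converts it where measurability is wanted. *)
Definition rcont (f : R -> C) :=
 forall (v : nat -> R) l, v @ \oo --> l -> ccvg (fun n => f (v n)) (f l).

Lemma seq_continuous (f : R -> R) (x : R) :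
 (forall v : nat -> R, v @ \oo --> x -> (f (v n) @[n --> \oo] --> f x)) ->
 {for x, continuous f}.
Proof.
move=> h; apply/cvgrPdist_lt => e e0; apply: contrapT => hn.
have /choice[v hv] : forall n : nat, exists y, `|x - y| < n.+1%:R^-1 /\ e <= `|f x - f y|.
 move=> n; apply: contrapT => hc; apply: hn; apply/nbhs_ballP; exists n.+1%:R^-1 => //=.
 move=> y hy; rewrite ltNge; apply/negP => ge; apply: hc; exists y; split=> //.
have /h /cvgrPdist_lt/(_ _ e0)[N _ /(_ N (leqnn N)) /=] : v @ \oo --> x.
 apply/cvgrPdist_lt => d d0; have := @cvg_harmonic R => /cvgrPdist_lt/(_ _ d0)[N _ hN].
 exists N => // n /hN /=; rewrite sub0r normrN ger0_norm ?invr_ge0 //.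
 by apply: lt_trans; exact: (hv n).1.
by rewrite ltNge (hv N).2.
Qed.

Lemma rcont_meas (f : R -> C) : rcont f ->
 measurable_fun setT (fun x => Re (f x)) /\
 measurable_fun setT (fun x => Im (f x)).
Proof.
move=> h; split; apply: continuous_measurable_fun => x.
 by apply: seq_continuous => v vx; exact: (ccvg_Re (h _ _ vx)).
by apply: seq_continuous => v vx; exact: (ccvg_Im (h _ _ vx)).
Qed.
Lemma rcont_cst c : rcont (fun _ => c). Proof. by move=> v l _; exact: ccvg_cst. Qed.
Lemma rcontM f g : rcont f -> rcont g -> rcont (fun x => f x * g x).
Proof. by move=> hf hg v l vl; apply: ccvgM; [exact: hf|exact: hg]. Qed.
Lemma rcont_conj f : rcont f -> rcont (fun x => conjc (f x)).
Proof. by move=> hf v l vl; apply: ccvg_conj; exact: hf. Qed.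
Lemma rcont_sum I (r : seq I) (F : I -> R -> C) : (forall i, rcont (F i)) ->
 rcont (fun x => \sum_(i <- r) F i x).
Proof. by move=> h v l vl; apply: ccvg_sum => i; exact: h. Qed.

Section Domain.
Variable D : set R.
Hypothesis mD : measurable D.

Definition lint (f : R -> C) : C := (\int[leb]_(x in D) Re (f x)) +i*
  (\int[leb]_(x in D) Im (f x)).

Definition ign (g : R -> R) := leb.-integrable D (EFin \o g).

Lemma dom_int f (g : R -> R) : rcont f -> ign g -> (forall x, D x -> cabs (f x) <= g x) ->
 ign (fun x => Re (f x)) /\ ign (fun x => Im (f x)).
Proof.
move=> /rcont_meas[m1 m2] ig fg; split; (apply: le_integrable ig => //;
 [by apply: measurableT_comp => //; exact: measurable_funTS|
  move=> x Dx /=; rewrite lee_fin (le_trans _ (le_trans (fg x Dx) (ler_norm _)))//]).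
 exact: cabsRe.
exact: cabsIm.
Qed.

Lemma lintD f h (g1 g2 : R -> R) : rcont f -> rcont h -> ign g1 -> ign g2 ->
 (forall x, D x -> cabs (f x) <= g1 x) -> (forall x, D x -> cabs (h x) <= g2 x) ->
 lint (fun x => f x + h x) = lint f + lint h.
Proof.
move=> cf ch i1 i2 d1 d2; have [a1 a2] := dom_int cf i1 d1.
have [b1 b2] := dom_int ch i2 d2; apply: ceq; rewrite ?ReD ?ImD /=.
 by rewrite -RintegralD //; apply: eq_Rintegral => x _; rewrite ReD.
by rewrite -RintegralD //; apply: eq_Rintegral => x _; rewrite ImD.
Qed.
Lemma ignZ r (q : R -> R) : ign q -> ign (fun x => r * q x).
Proof. by move=> iq; have := @integrableZl _ _ R leb D mD r (EFin \o q) iq. Qed.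

Lemma lintZ c f (g : R -> R) : rcont f -> ign g -> (forall x, D x -> cabs (f x) <= g x) ->
 lint (fun x => c * f x) = c * lint f.
Proof.
move=> cf ig fg; have [a1 a2] := dom_int cf ig fg.
have z r (q : R -> R) : ign q -> ign (fun x => r * q x) by exact: ignZ.
apply: ceq; rewrite ?ReM ?ImM /=; rewrite -!RintegralZl // -?RintegralB -?RintegralD //;
 try exact: z.
 by apply: eq_Rintegral => x _; rewrite ReM.
by apply: eq_Rintegral => x _; rewrite ImM.
Qed.

(** The factor 2 comes from estimating the two components separately; the bound serves finiteness
    and decay only. *)
Lemma lint_bound f (g : R -> R) : rcont f -> ign g -> (forall x, D x -> cabs (f x) <= g x) ->
 cabs (lint f) <= 2 * \int[leb]_(x in D) g x.
Proof.
move=> cf ig fg; have [a1 a2] := dom_int cf ig fg.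
apply: le_trans (cabs_ReIm _) _; rewrite /= mulr_natl mulr2n.
have n q : ign q -> (forall x, D x -> `|q x| <= g x) ->
  `|\int[leb]_(x in D) q x| <= \int[leb]_(x in D) g x.
 move=> iq qg; apply: le_trans (@le_normr_Rintegral _ _ R leb D q mD iq) _; apply: le_Rintegral => //.
 exact: (integrable_norm iq).
by apply: lerD; apply: n => // x Dx; apply: le_trans (fg x Dx); [exact: cabsRe|exact: cabsIm].
Qed.

Lemma lint_dct (f : nat -> R -> C) h (g : R -> R) : (forall n, rcont (f n)) -> rcont h ->
 ign g -> (forall n x, D x -> cabs (f n x) <= g x) ->
 (forall x, D x -> ccvg (f ^~ x) (h x)) -> ccvg (fun n => lint (f n)) (lint h).
Proof.
move=> cf ch ig fg fh.
have hg x : D x -> cabs (h x) <= g x.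
 by move=> Dx; apply: ccvg_cabs_le (fh x Dx) _ => n; exact: fg.
have key (r : C -> R) : (forall w, `|r w| <= cabs w) ->
  (forall u a, ccvg u a -> (fun n => r (u n)) @ \oo --> r a) ->
  (forall q, rcont q -> measurable_fun setT (fun x => r (q x))) ->
  (forall q, rcont q -> (forall x, D x -> cabs (q x) <= g x) -> ign (fun x => r (q x))) ->
  (fun n => \int[leb]_(x in D) r (f n x)) @ \oo --> (\int[leb]_(x in D) r (h x) : R).
 move=> r1 r2 r3 r4.
 have [] := @dominated_convergence _ _ _ leb D mD (fun n x => (r (f n x))%:E)
  (fun x => (r (h x))%:E) (EFin \o g).
 - by move=> n; apply: measurableT_comp => //; apply: measurable_funTS; exact: r3.
 - by apply: measurableT_comp => //; apply: measurable_funTS; exact: r3.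
 - by apply: aeW => x Dx; apply: cvg_EFin; [exact: nearW|exact: r2 (fh x Dx)].
 - exact: ig.
 - by apply: aeW => x n Dx /=; rewrite lee_fin (le_trans (r1 _)) // fg.
 move=> _ _ cv; apply: fine_cvg; rewrite fineK //.
 by apply: integrable_fin_num => //; exact: r4.
apply: ccvg_ReIm; apply: key.
- exact: cabsRe.
- by move=> u a; exact: ccvg_Re.
- by move=> q /rcont_meas[].
- by move=> q cq qg; have [] := dom_int cq ig qg.
- exact: cabsIm.
- by move=> u a; exact: ccvg_Im.
- by move=> q /rcont_meas[].
- by move=> q cq qg; have [] := dom_int cq ig qg.
Qed.
Lemma lint0 : lint (fun _ => 0) = 0.
Proof. by apply: ceq; rewrite /= Rintegral_cst // mul0r. Qed.

Lemma lint_sum I (r : seq I) (F : I -> R -> C) (G : I -> R -> R) :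
 (forall i, rcont (F i)) -> (forall i, ign (G i)) ->
 (forall i x, D x -> cabs (F i x) <= G i x) ->
 lint (fun x => \sum_(i <- r) F i x) = \sum_(i <- r) lint (F i).
Proof.
move=> cF iG FG; elim: r => [|i r IH].
 by rewrite big_nil -[RHS]lint0; congr lint; apply/funext => x; rewrite big_nil.
rewrite big_cons -IH -(lintD (g1 := G i) (g2 := fun x => \sum_(i <- r) G i x)) //.
- by congr lint; apply/funext => x; rewrite big_cons.
- exact: rcont_sum.
- have : leb.-integrable D (fun x => (\sum_(i <- r) (G i x)%:E)%E).
  by apply: integrable_sum => // j _; exact: iG.
 by apply: eq_integrable => // x _; rewrite /= sumEFin.
- exact: FG.
- by move=> x Dx; apply: le_trans (cabs_sum _ _ _) _; apply: ler_sum => j _; exact: FG.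
Qed.

(** The tail is chosen for the majorant [b] alone, hence uniformly in [x] after division by the
    weight [g x]; positivity of [g] enters there. *)
Lemma lint_csum (I : choiceType) (F : I -> R -> C) (b : I -> R) (g : R -> R) :
 (forall i, rcont (F i)) -> ign g -> (forall x, 0 < g x) -> rasum b ->
 (forall i, 0 <= b i) -> (forall i x, D x -> cabs (F i x) <= b i * g x) ->
 rcont (fun x => csum (F ^~ x)) ->
 casum (fun i => lint (F i)) /\ lint (fun x => csum (F ^~ x)) = csum (fun i => lint (F i)).
Proof.
move=> cF ig g0 ab b0 Fb cS.
have z r : ign (fun x => r * g x).
 exact: ignZ.
set K := \int[leb]_(x in D) g x.
have K0 : 0 <= K by apply: Rintegral_ge0 => x _; exact: ltW.
have aL : casum (fun i => lint (F i)).
 apply: rasum_le (rasumZ (mulr_ge0 (ler0n R 2) K0) ab) => i.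
 apply: le_trans (lint_bound (cF i) (z (b i)) (Fb i)) _.
 by rewrite RintegralZl // mulrCA mulrC.
split=> //; apply/esym/csumE => // e e0.
(* With the factor 2 of [lint_bound], a tail below [e' * g] integrates to at most [2 * e' * K < e];
   the added 1 covers [K = 0]. *)
pose e' := e / (2 * (K + 1)).
have K1 : 0 < 2 * (K + 1) by rewrite mulr_gt0 // ltr_wpDl.
have e'0 : 0 < e' by rewrite divr_gt0.
have [A uA hA] := has_csum_casum_tail (fun i => 0) ab b0 e'0.
exists A => B uB AB.
have cT : rcont (fun x => csum (F ^~ x) - \sum_(i <- B) F i x).
 move=> v l vl; apply: ccvgB; first exact: cS.
 by apply: ccvg_sum => i; exact: cF.
have dT x : D x -> cabs (csum (F ^~ x) - \sum_(i <- B) F i x) <= e' * g x.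
 move=> Dx; have gx : (g x)%:C != 0 :> C by rewrite -cabs_eq0 cabsR normr_eq0 gt_eqF.
 have gc i : cabs (F i x / (g x)%:C) <= b i.
  rewrite cabsM cabsV cabsR (gtr0_norm (g0 x)) ler_pdivrMr //; exact: Fb.
 have := hA _ gc B uB AB; rewrite -mulr_suml csumZr; last first.
  by apply: rasum_le (rasumZ (ltW (g0 x)) ab) => i; rewrite mulrC; exact: Fb.
 by rewrite -mulrBl cabsM cabsV cabsR (gtr0_norm (g0 x)) ler_pdivrMr.
have FBd i x : D x -> cabs (F i x) <= b i * g x by exact: Fb.
have E : lint (fun x => csum (F ^~ x)) =
  lint (fun x => csum (F ^~ x) - \sum_(i <- B) F i x) + \sum_(i <- B) lint (F i).
 have zs : ign (fun x => \sum_(i <- B) b i * g x).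
  by under eq_fun do rewrite -mulr_suml; exact: z.
 have ds x : D x -> cabs (\sum_(i <- B) F i x) <= \sum_(i <- B) b i * g x.
  by move=> Dx; apply: le_trans (cabs_sum _ _ _) _; apply: ler_sum => j _; exact: Fb.
 rewrite -(lint_sum B cF (fun i => z (b i)) FBd) -(lintD cT (rcont_sum B cF) (z e') zs dT ds).
 by congr lint; apply/funext => x; rewrite subrK.
rewrite E opprD addrCA subrr addr0 cabsN.
apply: le_lt_trans (lint_bound cT (z e') dT) _.
rewrite RintegralZl // -/K /e' mulrA mulrAC -mulrA.
have -> : 2 * (K * (e / (2 * (K + 1)))) = e * (K / (K + 1)).
 field; rewrite gt_eqF //; exact: ltr_wpDl.
by rewrite gtr_pMr // ltr_pdivrMr ?mul1r ?ltrDl // ltr_wpDl.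
Qed.
End Domain.

(** ** Cauchy's theorem on rectangles *)

Definition ccont (H : C -> C) := forall u l, ccvg u l -> ccvg (fun n => H (u n)) (H l).
Definition cdiff (H : C -> C) := forall w, cdifferentiable_at H w.

Lemma cdiff_seqP (H : C -> C) w : cdifferentiable_at H w <->
 exists L, forall u : nat -> C, (forall n, u n != 0) -> ccvg u 0 ->
  ccvg (fun n => (H (w + u n) - H w) / u n) L.
Proof.
split=> -[L hL]; exists L.
 move=> u u0 cu e /hL[d [d0 hd]]; have [N hN] := cu d d0; exists N => n /hN.
 by rewrite subr0; apply: hd.
move=> e e0; apply: contrapT => hn.
have /choice[v hv] : forall n : nat, exists h : C, [/\ h != 0, cabs h < n.+1%:R^-1 &
  e <= cabs ((H (w + h) - H w) / h - L)].
 move=> n; apply: contrapT => hc; apply: hn; exists n.+1%:R^-1.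
 split=> [|h h0 hl]; first by rewrite invr_gt0.
 by rewrite ltNge; apply/negP => ge; apply: hc; exists h.
have v0 n : v n != 0 by case: (hv n).
have cv : ccvg v 0.
 apply: (ccvg_squeeze (b := fun n => n.+1%:R^-1)); last exact: cvg_harmonic.
 by move=> n; rewrite subr0 ltW //; case: (hv n).
by have [N /(_ N (leqnn N))] := hL v v0 cv e e0; rewrite ltNge; case: (hv N) => _ _ ->.
Qed.

(** A quadratic remainder survives summation of a series, whereas a limit of quotients would call
    for uniformity; holomorphic series are differentiated through this criterion. *)
Lemma cdiff_quad (H : C -> C) w L (K d : R) : 0 < d ->
 (forall h, cabs h < d -> cabs (H (w + h) - H w - L * h) <= K * cabs h ^+ 2) ->
 cdifferentiable_at H w.
Proof.
move=> d0 hK; exists L => e e0; pose K' := `|K| + 1.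
have K'0 : 0 < K' by rewrite ltr_wpDl.
exists (Num.min d (e / K')); split; first by rewrite lt_min d0 divr_gt0.
move=> h h0; rewrite lt_min => /andP[hd he].
have -> : (H (w + h) - H w) / h - L = (H (w + h) - H w - L * h) / h by field.
have ch : 0 < cabs h by rewrite lt_def cabs_ge0 cabs_eq0 h0.
rewrite cabsM cabsV ltr_pdivrMr //; apply: le_lt_trans (hK h hd) _.
rewrite expr2 mulrA ltr_pM2r //; move: he; rewrite ltr_pdivlMr // mulrC.
apply: le_lt_trans; apply: ler_wpM2r; first exact: ltW.
by apply: le_trans (ler_norm _) _; rewrite lerDl.
Qed.

Lemma cdiff_ccvg (H : C -> C) w u : cdifferentiable_at H w -> ccvg u w ->
 ccvg (fun n => H (u n)) (H w).
Proof.
move=> [L hL] cu; have [d [d0 hd]] := hL 1 ltr01.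
apply/ccvgE; have := cu => /ccvgE cu0.
apply/cvgrPdist_lt => e e0; have := cu _ d0 => -[N hN].
have K0 : 0 < cabs L + 1 by rewrite ltr_wpDl ?cabs_ge0.
have [M hM] := cu _ (divr_gt0 e0 K0); exists (maxn N M) => // n /=.
rewrite geq_max => /andP[nN nM]; rewrite sub0r normrN ger0_norm ?cabs_ge0 //.
have [->|ne] := eqVneq (u n) w; first by rewrite subrr cabs0.
pose h := u n - w; have h0 : h != 0 by rewrite subr_eq0.
have := hd h h0 (hN n nN); have -> : w + h = u n by rewrite addrC subrK.
move=> hq; have ch : 0 < cabs h by rewrite lt_def cabs_ge0 cabs_eq0 h0.
have -> : H (u n) - H w = ((H (u n) - H w) / h - L) * h + L * h by field.
apply: le_lt_trans (cabsD _ _) _; rewrite !cabsM -mulrDl.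
have := hM n nM; rewrite ltr_pdivlMr // mulrC; apply: le_lt_trans.
by apply: ler_wpM2r; [exact: ltW|rewrite addrC lerD2l ltW].
Qed.
Lemma cdiff_ccont H : cdiff H -> ccont H.
Proof. by move=> h u l; apply: cdiff_ccvg. Qed.

Lemma cdiffM_at (f g : C -> C) w : cdifferentiable_at f w -> cdifferentiable_at g w ->
 cdifferentiable_at (fun z => f z * g z) w.
Proof.
move=> df dg; have [L hL] := (cdiff_seqP f w).1 df; have [M hM] := (cdiff_seqP g w).1 dg.
apply/cdiff_seqP; exists (L * g w + f w * M) => u u0 cu.
have cw : ccvg (fun n => w + u n) w by rewrite -[X in ccvg _ X]addr0; apply: ccvgD => //; exact: ccvg_cst.
have E n : (f (w + u n) * g (w + u n) - f w * g w) / u n =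
  (f (w + u n) - f w) / u n * g (w + u n) + f w * ((g (w + u n) - g w) / u n).
 by have := u0 n => ?; field.
rewrite (_ : (fun n => _) = (fun n => (f (w + u n) - f w) / u n * g (w + u n) +
 f w * ((g (w + u n) - g w) / u n))); last by apply/funext.
apply: ccvgD; apply: ccvgM; [exact: hL|exact: cdiff_ccvg dg cw|exact: ccvg_cst|exact: hM].
Qed.

Lemma csum_nat_S (f : nat -> C) : casum f -> casum (fun n => f n.+1) /\
 csum f = f 0%N + csum (fun n => f n.+1).
Proof.
move=> af; have aS : casum (fun n => f n.+1) by exact: (rasum_inj succn_inj af).
split=> //; have [s1 s2] := csum_shift aS; rewrite -s2.
pose g n := if n is 0%N then f 0%N else 0.
have <- : csum g = f 0%N by rewrite (@csum1 _ _ _ 0%N) // => -[].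
rewrite -csumD //; first by apply: eq_csum => -[|n] /=; rewrite ?addr0 ?add0r.
by apply: (@casum_fin _ _ _ [:: 0%N]) => -[|n]; rewrite ?mem_head.
Qed.

(** The remainder is [h ^+ 2] times a series whose denominators, factorials of [n + 2], dominate the
    factorials of [n]. *)
Lemma cexp_quad (h : C) : cabs (cexp h - 1 - h) <= cabs h ^+ 2 * expR (cabs h).
Proof.
have [a1 e1] := csum_nat_S (casum_exp h); have [a2 e2] := csum_nat_S a1.
rewrite -csum_exp e1 e2 expr0 expr1 !divr1.
set S := csum _; have -> : 1 + (h + S) - 1 - h = S by ring.
have ch := cabs_ge0 h.
apply: le_trans (cabs_csum a2) _; apply: rsum_le => A uA.
apply: (@le_trans _ _ (\sum_(n <- A) cabs h ^+ 2 * (cabs h ^+ n / n`!%:R))).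
 apply: ler_sum => n _; rewrite cabsM cabsV cabs_nat cabsX -addn2 exprD addn2 mulrAC.
 rewrite mulrC ler_wpM2l ?sqr_ge0 // ler_wpM2l ?exprn_ge0 // lef_pV2 ?posrE ?ltr0n ?fact_gt0 //.
 by rewrite ler_nat !factS; nia.
rewrite -mulr_sumr ler_wpM2l ?sqr_ge0 //.
have := rsum_ub (rasum_exp ch) uA => /le_trans; apply.
rewrite -lecR -csum_real; last by move=> i; rewrite divr_ge0 ?exprn_ge0.
 2: by exact: rasum_exp.
rewrite -csum_exp_real (eq_csum (g := fun n => (cabs h)%:C ^+ n / n`!%:R)) //.
by move=> n; rewrite realCM realCV realCX realCn.
Qed.

Lemma cdiff_cexpM (a : C) : cdiff (fun z => cexp (a * z)).
Proof.
move=> w; apply: (@cdiff_quad _ w (cexp (a * w) * a)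
 (cabs (cexp (a * w)) * cabs a ^+ 2 * expR (cabs a)) 1 ltr01) => h h1.
have -> : cexp (a * (w + h)) - cexp (a * w) - cexp (a * w) * a * h =
  cexp (a * w) * (cexp (a * h) - 1 - a * h) by rewrite mulrDr cexpD; ring.
rewrite cabsM; have -> : cabs (cexp (a * w)) * cabs a ^+ 2 * expR (cabs a) * cabs h ^+ 2 =
 cabs (cexp (a * w)) * (cabs (a * h) ^+ 2 * expR (cabs a)) by rewrite cabsM; ring.
apply: ler_wpM2l; first exact: cabs_ge0.
apply: le_trans (cexp_quad _) _; apply: ler_wpM2l; first exact: sqr_ge0.
by rewrite ler_expR cabsM ler_piMr ?cabs_ge0 // ltW.
Qed.

Definition seg (a b : R) (f : R -> C) : C := lint `[a, b] f.

Lemma leb_itv (a b : R) : leb `[a, b] = (Num.max (b - a) 0)%:E.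
Proof.
have E := @lebesgue_measure_itv R `[a, b]; apply: etrans E _ => /=.
rewrite lte_fin; case: ltP => ab; last by rewrite max_r // subr_le0.
by rewrite -EFinB max_l // subr_ge0 ltW.
Qed.
Lemma ign_cst (a b M : R) : ign `[a, b] (fun _ => M).
Proof.
apply: measurable_bounded_integrable => //.
- by have E := leb_itv a b; rewrite -[X in (X < _)%E]/(leb `[a, b]) E ltry.
- by exists `|M|; split => [|x xM y _ /=]; rewrite ?num_real // ltW.
Qed.
Lemma seg_cst (a b : R) c : a <= b -> seg a b (fun _ => c) = (b - a)%:C * c.
Proof.
move=> ab; have E (r : R) : \int[leb]_(x in `[a, b]) r = (b - a) * r.
 have E := leb_itv a b; rewrite Rintegral_cst // -[X in fine X]/(leb `[a, b]) E.
 by rewrite mulrC max_l // subr_ge0.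
by apply: ceq; rewrite ?ReM ?ImM /= !E ?mul0r ?subr0 ?addr0.
Qed.
Lemma in_seg (a b : R) (P : R -> Prop) : (forall x, a <= x <= b -> P x) ->
 forall x, `[a, b]%classic x -> P x.
Proof. by move=> h x; rewrite /= in_itv /=; exact: h. Qed.
Lemma seg_bound (a b : R) f (M : R) : a <= b -> rcont f ->
 (forall x, a <= x <= b -> cabs (f x) <= M) -> cabs (seg a b f) <= 2 * M * (b - a).
Proof.
move=> ab cf fM; apply: le_trans (lint_bound (measurable_itv _) cf (ign_cst a b M) (in_seg fM)) _.
have := seg_cst M%:C ab => /(congr1 (@Re R)); rewrite /= mul0r subr0 => ->.
by rewrite mulrA mulrAC.
Qed.
Lemma rcont_bounded (a b : R) (f : R -> C) : a <= b -> rcont f ->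
 exists M, forall x, a <= x <= b -> cabs (f x) <= M.
Proof.
move=> ab cf; have [|c _ hc] := @EVT_max R (fun x => cabs (f x)) a b ab.
 apply: continuous_subspaceT => x; apply: seq_continuous => v vx.
 exact: (ccvg_cabs (cf _ _ vx)).
by exists (cabs (f c)) => x xab; apply: hc; rewrite in_itv.
Qed.
Lemma seg_ign (a b : R) (f : R -> C) : a <= b -> rcont f ->
 ign `[a, b] (fun x => Re (f x)) /\ ign `[a, b] (fun x => Im (f x)).
Proof.
move=> ab cf; have [M hM] := rcont_bounded ab cf.
exact: (dom_int (measurable_itv _) cf (ign_cst a b M) (in_seg hM)).
Qed.
Lemma segD (a b : R) (f g : R -> C) : a <= b -> rcont f -> rcont g ->
 seg a b (fun x => f x + g x) = seg a b f + seg a b g.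
Proof.
move=> ab cf cg; have [M hM] := rcont_bounded ab cf; have [N hN] := rcont_bounded ab cg.
exact: (lintD (measurable_itv _) cf cg (ign_cst a b M) (ign_cst a b N) (in_seg hM) (in_seg hN)).
Qed.
Lemma segZ (a b : R) c (f : R -> C) : a <= b -> rcont f -> seg a b (fun x => c * f x) = c * seg a b f.
Proof.
move=> ab cf; have [M hM] := rcont_bounded ab cf.
exact: (lintZ (measurable_itv _) c cf (ign_cst a b M) (in_seg hM)).
Qed.
Lemma seg_sum (a b : R) I (r : seq I) (F : I -> R -> C) : a <= b -> (forall i, rcont (F i)) ->
 seg a b (fun x => \sum_(i <- r) F i x) = \sum_(i <- r) seg a b (F i).
Proof.
move=> ab cF; have /choice[M hM] i := rcont_bounded ab (cF i).
exact: (lint_sum (measurable_itv _) r cF (fun i => ign_cst a b (M i)) (fun i => in_seg (hM i))).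
Qed.
Lemma seg_split (a b c : R) (f : R -> C) : a <= b -> b <= c -> rcont f ->
 seg a c f = seg a b f + seg b c f.
Proof.
move=> ab bc cf; have [i1 i2] := seg_ign (le_trans ab bc) cf.
have [j1 j2] := seg_ign bc cf.
have key (q : R -> R) : ign `[a, c] q -> ign `[b, c] q -> \int[leb]_(x in `[a, c]) q x =
  \int[leb]_(x in `[a, b]) q x + \int[leb]_(x in `[b, c]) q x.
 move=> i j; apply/eqP; rewrite addrC -subr_eq; apply/eqP.
 rewrite (Rintegral_itvB (x := b)) ?bnd_simp // Rintegral_itv_obnd_cbnd //.
 by apply: integrableS j => // x /=; rewrite !in_itv /= => /andP[/ltW -> ->].
by apply: ceq; rewrite ?ReD ?ImD /=; apply: key.
Qed.

Section Rectangle.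
Variable H : C -> C.

(** The integral of [H dz] along the positively oriented boundary of the rectangle with lower left
    corner [a + i s], width [w] and height [h]. *)
Definition rect (a s w h : R) : C :=
 seg a (a + w) (fun x => H (x +i* s) - H (x +i* (s + h))) +
 (0 +i* 1) * seg s (s + h) (fun y => H ((a + w) +i* y) - H (a +i* y)).

Hypothesis cH : cdiff H.

Lemma rcont_hor s : rcont (fun x => H (x +i* s)).
Proof.
by move=> v l vl; apply: (cdiff_ccont cH); apply: ccvg_ReIm => //=; exact: cvg_cst.
Qed.
Lemma rcont_ver s : rcont (fun y => H (s +i* y)).
Proof.
by move=> v l vl; apply: (cdiff_ccont cH); apply: ccvg_ReIm => //=; exact: cvg_cst.
Qed.
Lemma rcontB (f g : R -> C) : rcont f -> rcont g -> rcont (fun x => f x - g x).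
Proof. by move=> hf hg v l vl; apply: ccvgB; [exact: hf|exact: hg]. Qed.
Lemma segB (a b : R) (f g : R -> C) : a <= b -> rcont f -> rcont g ->
 seg a b (fun x => f x - g x) = seg a b f - seg a b g.
Proof.
move=> ab cf cg; rewrite -[X in _ + X]mulN1r -segZ // -segD //.
 by congr seg; apply/funext => x; rewrite mulN1r.
by move=> v l vl; apply: ccvgZ; exact: cg.
Qed.

Lemma rect_split a s w h : 0 <= w -> 0 <= h -> rect a s (w + w) (h + h) =
 rect a s w h + rect (a + w) s w h + (rect a (s + h) w h + rect (a + w) (s + h) w h).
Proof.
move=> w0 h0; rewrite /rect.
have aw : a <= a + w by rewrite lerDl. have sh : s <= s + h by rewrite lerDl.
have aw2 : a + w <= a + w + w by rewrite lerDl. have sh2 : s + h <= s + h + h by rewrite lerDl.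
have sB p q y z (pq : p <= q) := segB pq (rcont_hor y) (rcont_hor z).
have vB p q y z (pq : p <= q) := segB pq (rcont_ver y) (rcont_ver z).
have ss y := seg_split aw aw2 (rcont_hor y).
have vs y := seg_split sh sh2 (rcont_ver y).
rewrite !addrA (sB _ _ _ _ (le_trans aw aw2)) !(sB _ _ _ _ aw) !(sB _ _ _ _ aw2).
rewrite (vB _ _ _ _ (le_trans sh sh2)) !(vB _ _ _ _ sh) !(vB _ _ _ _ sh2) !ss !vs.
ring.
Qed.

(** Goursat's subdivision: if each of the four quarters had an integral below a quarter of the
    total, their sum could not reach it. *)
Lemma rect_sub a s w h : 0 <= w -> 0 <= h -> exists a' s',
 [/\ a <= a' <= a + w, s <= s' <= s + h &
  cabs (rect a s (w + w) (h + h)) <= 4 * cabs (rect a' s' w h)].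
Proof.
move=> w0 h0; apply: contrapT => hn.
have k a' s' : a <= a' <= a + w -> s <= s' <= s + h ->
  4 * cabs (rect a' s' w h) < cabs (rect a s (w + w) (h + h)).
 by move=> h1 h2; rewrite ltNge; apply/negP => h3; apply: hn; exists a', s'.
have := k a s; have := k (a + w) s; have := k a (s + h); have := k (a + w) (s + h).
rewrite !lexx !lerDl w0 h0 !andbT => /(_ isT isT) k1 /(_ isT isT) k2 /(_ isT isT) k3 /(_ isT isT) k4.
have := rect_split a s w0 h0 => E.
have := cabsD (rect a s w h + rect (a + w) s w h) (rect a (s + h) w h + rect (a + w) (s + h) w h).
have := cabsD (rect a s w h) (rect (a + w) s w h).
have := cabsD (rect a (s + h) w h) (rect (a + w) (s + h) w h).
rewrite -E; move: k1 k2 k3 k4; do 4 move: (cabs (rect _ _ w h)) => ?.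
move: (cabs _) => ?; do 2 move: (cabs _) => ?; lra.
Qed.

Lemma nested_limit (a : nat -> R) (w : R) : 0 <= w ->
 (forall n, a n <= a n.+1 <= a n + w / 2 ^+ n.+1) ->
 exists l, forall n, a n <= l <= a n + w / 2 ^+ n.
Proof.
move=> w0 ha; have p2 n : 0 < (2 : R) ^+ n by rewrite exprn_gt0.
have half n : w / 2 ^+ n = w / 2 ^+ n.+1 + w / 2 ^+ n.+1.
 by rewrite exprS; have := p2 n => /lt0r_neq0 ?; field.
have up n m : a (n + m)%N <= a n + w / 2 ^+ n - w / 2 ^+ (n + m).
 elim: m => [|m IH]; first by rewrite addn0; lra.
 have /andP[_ h] := ha (n + m)%N; have := half (n + m)%N; rewrite addnS; lra.
have nd : nondecreasing_seq a.
 by apply/nondecreasing_seqP => n; case/andP: (ha n).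
have ub n m : a m <= a n + w / 2 ^+ n.
 have [nm|mn] := leqP n m.
  have := up n (m - n)%N; rewrite subnKC // => /le_trans; apply.
  by rewrite gerBl // divr_ge0 ?exprn_ge0.
 apply: le_trans (nd _ _ (ltnW mn)) _; by rewrite lerDl divr_ge0 ?exprn_ge0.
exists (sup (range a)) => n; apply/andP; split.
 by apply: ub_le_sup; [exists (a 0%N + w / 2 ^+ 0) => _ [m _ <-]; exact: ub|exists n].
by apply: ge_sup; [exists (a 0%N), 0%N|move=> _ [m _ <-]; exact: ub].
Qed.

(** Goursat's proof: nested rectangles with halved sides shrink to a point where [H] is
    differentiable, and near it the boundary integral is of smaller order than the area. *)
Lemma rect0 a s w h : 0 <= w -> 0 <= h -> rect a s w h = 0.
Proof.
move=> w0 h0; have p2 n : 0 < (2 : R) ^+ n by rewrite exprn_gt0.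
pose W n := w / 2 ^+ n; pose T n := h / 2 ^+ n.
have W0 n : 0 <= W n by rewrite divr_ge0 ?exprn_ge0.
have T0 n : 0 <= T n by rewrite divr_ge0 ?exprn_ge0.
have half x n : x / 2 ^+ n = x / 2 ^+ n.+1 + x / 2 ^+ n.+1 :> R.
 by rewrite exprS; have := p2 n => /lt0r_neq0 ?; field.
have step n (p : R * R) : exists q : R * R, [/\ p.1 <= q.1 <= p.1 + W n.+1,
  p.2 <= q.2 <= p.2 + T n.+1 &
  cabs (rect p.1 p.2 (W n) (T n)) <= 4 * cabs (rect q.1 q.2 (W n.+1) (T n.+1))].
 have [a' [s' [h1 h2 h3]]] := @rect_sub p.1 p.2 _ _ (W0 n.+1) (T0 n.+1).
 by exists (a', s'); split=> //; rewrite /W /T (half w n) (half h n).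
pose nx n p := projT1 (cid (step n p)).
pose P := fix P n := if n is n'.+1 then nx n' (P n') else (a, s).
have hP n := projT2 (cid (step n (P n))).
have big n : cabs (rect a s w h) <= 4 ^+ n * cabs (rect (P n).1 (P n).2 (W n) (T n)).
 elim: n => [|n IH]; first by rewrite mul1r /W /T !divr1.
 apply: le_trans IH _; rewrite exprSr -mulrA ler_wpM2l ?exprn_ge0 //.
 by have [_ _] := hP n.
have [al hal] := @nested_limit (fun n => (P n).1) w w0 (fun n => let: And3 h _ _ := hP n in h).
have [be hbe] := @nested_limit (fun n => (P n).2) h h0 (fun n => let: And3 _ h _ := hP n in h).
have [L hL] := cH (al +i* be).
apply/eqP; rewrite -cabs_eq0 eq_le cabs_ge0 andbT; apply/ler_addgt0Pr => e e0; rewrite add0r.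
(* After [n] halvings the bound is [4 ^+ n * (4 * e' * rho ^+ 2)] with [rho = (w + h) / 2 ^+ n],
   that is [4 * e' * (w + h) ^+ 2]; this [e'] keeps it at most [e]. *)
pose e' := e / (4 * (w + h + 1) ^+ 2).
have wh1 : 0 < w + h + 1 by rewrite ltr_wpDl ?addr_ge0.
have e'0 : 0 < e' by rewrite divr_gt0 // mulr_gt0 // exprn_gt0.
have [d [d0 hd]] := hL e' e'0.
have [n hn] : exists n, W n + T n < d.
 have hd' : 0 < d / (w + h + 1) by rewrite divr_gt0.
 have [n hn] : exists n, (2 ^+ n)^-1 < d / (w + h + 1).
  have := @cvg_expr R (2^-1); rewrite ger0_norm ?invr_ge0 // invf_lt1 ?ltr1n // => /(_ isT).
  move=> /cvgrPdist_lt/(_ _ hd')[N _ /(_ N (leqnn N))] /=.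
  by rewrite sub0r normrN ger0_norm ?exprn_ge0 ?invr_ge0 // exprVn; exists N.
 exists n; rewrite /W /T -mulrDl; apply: le_lt_trans (_ : (w + h + 1) / 2 ^+ n < d).
  by rewrite ler_pM2r ?invr_gt0 // lerDl.
 by rewrite mulrC -ltr_pdivlMr.
set rho := W n + T n in hn; have rho0 : 0 <= rho by rewrite addr_ge0.
pose r z := H z - H (al +i* be) - L * (z - (al +i* be)).
have rE z : cabs (z - (al +i* be)) <= rho -> cabs (r z) <= e' * rho.
 move=> hz; rewrite /r; have [->|zn] := eqVneq z (al +i* be).
  by rewrite !subrr mulr0 subr0 cabs0 mulr_ge0 // ltW.
 pose k := z - (al +i* be); have k0 : k != 0 by rewrite subr_eq0.
 have := hd k k0 (le_lt_trans hz hn); have -> : al +i* be + k = z by rewrite addrC subrK.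
 have -> : H z - H (al +i* be) - L * (z - (al +i* be)) =
  ((H z - H (al +i* be)) / k - L) * k by rewrite /k; field.
 by move=> hq; rewrite cabsM ler_pM ?cabs_ge0 // ltW.
have inr x y : (P n).1 <= x <= (P n).1 + W n -> (P n).2 <= y <= (P n).2 + T n ->
  cabs ((x +i* y) - (al +i* be)) <= rho.
 move=> /andP[x1 x2] /andP[y1 y2]; apply: le_trans (cabs_ReIm _) _ => /=.
 have /andP[a1 a2] := hal n; have /andP[b1 b2] := hbe n.
 by apply: lerD; rewrite ler_norml; apply/andP; split; rewrite -/(W n) -/(T n) in a2 b2 *; lra.
have PW : (P n).1 <= (P n).1 + W n by rewrite lerDl.
have PT : (P n).2 <= (P n).2 + T n by rewrite lerDl.
have cr1 y : rcont (fun x => r (x +i* y)).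
 apply: rcontB; first by apply: rcontB; [exact: rcont_hor|exact: rcont_cst].
 move=> v l vl; apply: ccvgZ; apply: ccvgB; last exact: ccvg_cst.
 by apply: ccvg_ReIm => //=; exact: cvg_cst.
have cr2 x : rcont (fun y => r (x +i* y)).
 apply: rcontB; first by apply: rcontB; [exact: rcont_ver|exact: rcont_cst].
 move=> v l vl; apply: ccvgZ; apply: ccvgB; last exact: ccvg_cst.
 by apply: ccvg_ReIm => //=; exact: cvg_cst.
(* Subtracting the affine approximation costs nothing: it changes the horizontal difference by
   [- L * (0 +i* T n)] and the vertical one by [L * (W n)%:C], and after integration the two
   contributions cancel. *)
have E : rect (P n).1 (P n).2 (W n) (T n) =
  seg (P n).1 ((P n).1 + W n) (fun x => r (x +i* (P n).2) - r (x +i* ((P n).2 + T n))) +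
 (0 +i* 1) * seg (P n).2 ((P n).2 + T n)
   (fun y => r (((P n).1 + W n) +i* y) - r ((P n).1 +i* y)).
 rewrite /rect.
 have -> : (fun x => H (x +i* (P n).2) - H (x +i* ((P n).2 + T n))) =
  (fun x => (r (x +i* (P n).2) - r (x +i* ((P n).2 + T n))) - L * (0 +i* T n)).
  apply/funext => x; rewrite /r.
  have -> : x +i* ((P n).2 + T n) = x +i* (P n).2 + (0 +i* T n).
   by apply: ceq; rewrite ?ReD ?ImD /= ?addr0.
  ring.
 have -> : (fun y => H (((P n).1 + W n) +i* y) - H ((P n).1 +i* y)) =
  (fun y => (r (((P n).1 + W n) +i* y) - r ((P n).1 +i* y)) - - (L * (W n)%:C)).
  apply/funext => x; rewrite /r.
  have -> : ((P n).1 + W n) +i* x = (P n).1 +i* x + (W n)%:C.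
   by apply: ceq; rewrite ?ReD ?ImD /= ?addr0.
  ring.
 rewrite (segB PW (rcontB (cr1 _) (cr1 _)) (rcont_cst _)) (seg_cst _ PW).
 rewrite (segB PT (rcontB (cr2 _) (cr2 _)) (rcont_cst _)) (seg_cst _ PT).
 have -> : (P n).1 + W n - (P n).1 = W n by ring.
 have -> : (P n).2 + T n - (P n).2 = T n by ring.
 have -> : (0 +i* T n) = (0 +i* 1) * (T n)%:C :> C by apply: ceq; rewrite ?ReM ?ImM /=; ring.
 ring.
apply: le_trans (big n) _.
have B : cabs (rect (P n).1 (P n).2 (W n) (T n)) <= 4 * e' * rho ^+ 2.
 rewrite E; apply: le_trans (cabsD _ _) _; rewrite cabsM.
 have -> : cabs (0 +i* 1 : C) = 1 by rewrite /cabs /cabs2 /= expr0n add0r expr1n sqrtr1.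
 rewrite mul1r.
 have B1 : cabs (seg (P n).1 ((P n).1 + W n) (fun x => r (x +i* (P n).2) -
   r (x +i* ((P n).2 + T n)))) <= 2 * (e' * rho + e' * rho) * W n.
  have := @seg_bound (P n).1 ((P n).1 + W n) (fun x => r (x +i* (P n).2) -
   r (x +i* ((P n).2 + T n))) (e' * rho + e' * rho) PW (rcontB (cr1 _) (cr1 _)).
  have -> : (P n).1 + W n - (P n).1 = W n by ring.
  apply=> x hx; apply: le_trans (cabsB _ _) _; apply: lerD; apply: rE; apply: inr => //.
   by rewrite lexx.
  by rewrite lexx andbT.
 have B2 : cabs (seg (P n).2 ((P n).2 + T n) (fun y => r (((P n).1 + W n) +i* y) -
   r ((P n).1 +i* y))) <= 2 * (e' * rho + e' * rho) * T n.
  have := @seg_bound (P n).2 ((P n).2 + T n) (fun y => r (((P n).1 + W n) +i* y) -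
   r ((P n).1 +i* y)) (e' * rho + e' * rho) PT (rcontB (cr2 _) (cr2 _)).
  have -> : (P n).2 + T n - (P n).2 = T n by ring.
  apply=> x hx; apply: le_trans (cabsB _ _) _; apply: lerD; apply: rE; apply: inr => //.
   by rewrite lexx andbT.
  by rewrite lexx.
 apply: le_trans (lerD B1 B2) _; rewrite -mulrDr -/rho.
 by apply/eq_ler; ring.
apply: le_trans (ler_wpM2l _ B) _; first by rewrite exprn_ge0.
have -> : 4 ^+ n * (4 * e' * rho ^+ 2) = 4 * e' * (w + h) ^+ 2.
 rewrite /rho /W /T -mulrDl exprMn exprVn -exprM mulnC exprM.
 have -> : (2 : R) ^+ 2 = 4 by ring.
 have : (4 : R) ^+ n != 0 by rewrite expf_neq0.
 by move=> ?; field.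
have -> : 4 * e' * (w + h) ^+ 2 = e * ((w + h) ^+ 2 / (w + h + 1) ^+ 2).
 by rewrite /e'; field; rewrite gt_eqF.
rewrite ler_piMr ?(ltW e0) // ler_pdivrMr ?exprn_gt0 // mul1r.
by rewrite lerXn2r ?nnegrE ?(addr_ge0 w0 h0) ?(ltW wh1) // lerDl ler01.
Qed.

(** The vertical sides at abscissae 0 and 1 cancel by periodicity, so Cauchy's theorem equates the
    two horizontal ones. *)
Lemma seg_shift_im s t : (forall z, H (z + 1) = H z) ->
 seg 0 1 (fun x => H (x +i* s)) = seg 0 1 (fun x => H (x +i* t)).
Proof.
move=> per; wlog st : s t / s <= t.
 by move=> hw; have [/hw//|/ltW/hw ->] := leP s t.
have := @rect0 0 s 1 (t - s) ler01; rewrite subr_ge0 => /(_ st).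
rewrite /rect !add0r subrKC (_ : (fun y => H (1 +i* y) - _) = fun=> 0); last first.
 apply/funext => y; rewrite -(per (0 +i* y)) (_ : 0 +i* y + 1 = 1 +i* y) ?subrr //.
 by apply: ceq; rewrite ?ReD ?ImD /= ?add0r ?addr0.
rewrite [X in _ * X](_ : _ = 0); last exact: lint0.
rewrite mulr0 addr0 (segB ler01 (rcont_hor _) (rcont_hor _)).
by move/eqP; rewrite subr_eq0 => /eqP.
Qed.
End Rectangle.

(** ** Fourier series of periodic entire functions of one variable *)

Lemma cabs_gt0 (a : C) : a != 0 -> 0 < cabs a.
Proof. by move=> a0; rewrite lt_def cabs_ge0 cabs_eq0 a0. Qed.
Lemma ccvgV (v : nat -> C) a : ccvg v a -> a != 0 -> ccvg (fun n => (v n)^-1) a^-1.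
Proof.
move=> h a0 e e0; have ca := cabs_gt0 a0.
have [N hN] := h _ (divr_gt0 ca (ltr0n R 2)).
have [M hM] := h _ (mulr_gt0 e0 (divr_gt0 (exprn_gt0 2 ca) (ltr0n R 2))).
exists (maxn N M) => n; rewrite geq_max => /andP[/hN h1 /hM h2].
have h3 : cabs a / 2 < cabs (v n).
 have := cabsB (v n) (v n - a); have -> : v n - (v n - a) = a by ring.
 by lra.
have v0 : v n != 0 by rewrite -cabs_eq0 gt_eqF //; lra.
have -> : (v n)^-1 - a^-1 = - (v n - a) / (v n * a) by field; rewrite ?v0 ?a0.
rewrite cabsM cabsV cabsN cabsM ltr_pdivrMr ?mulr_gt0 ?cabs_gt0 //.
apply: lt_trans h2 _; rewrite ltr_pM2l // expr2 mulrAC ltr_pM2r //.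
Qed.
Lemma imD (x y : R) : 0 +i* (x + y) = (0 +i* x) + (0 +i* y) :> C.
Proof. by apply: ceq; rewrite /= ?addr0. Qed.

Definition ez (m : int) (z : C) : C := cexp ((0 +i* (2 * pi * m%:~R)) * z).

Lemma ezDr m z w : ez m (z + w) = ez m z * ez m w.
Proof. by rewrite /ez mulrDr cexpD. Qed.
Lemma ezDl m n z : ez (m + n) z = ez m z * ez n z.
Proof.
by rewrite /ez intrD mulrDr imD mulrDl cexpD.
Qed.
Lemma ez0 z : ez 0 z = 1. Proof. by rewrite /ez mulr0 mul0r cexp0. Qed.
Lemma ez_0 m : ez m 0 = 1. Proof. by rewrite /ez mulr0 cexp0. Qed.
Lemma ezN m z : ez (- m) z = (ez m z)^-1.
Proof.
have e : ez m z != 0 by exact: cexp_neq0.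
by apply: (mulfI e); rewrite -ezDl subrr ez0 mulfV.
Qed.
Lemma ez_1 m : ez m 1 = 1.
Proof.
have h : ez 1 1 = 1.
 have e : 2 * pi * 1%:~R = pi + pi :> R by rewrite mulr1; ring.
 rewrite /ez mulr1 e imD cexpD -expr2.
 have -> : cexp (0 +i* pi) = - 1 :> C.
  by rewrite /cexp /= expR0 mul1r cospi sinpi; apply: ceq => //=; rewrite oppr0.
 by rewrite sqrrN expr1n.
have hn n : ez n%:Z 1 = 1.
 by elim: n => [|n IH]; [exact: ez0|rewrite -addn1 PoszD ezDl IH h mulr1].
by case: m => n; [exact: hn|rewrite NegzE ezN hn invr1].
Qed.
Lemma ez_per m z : ez m (z + 1) = ez m z. Proof. by rewrite ezDr ez_1 mulr1. Qed.
Lemma cabs_ez m z : cabs (ez m z) = expR (- (2 * pi * m%:~R * Im z)).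
Proof. by rewrite cabs_cexp ReM /= mul0r sub0r. Qed.
Lemma cabs_ezR m x : cabs (ez m x%:C) = 1.
Proof. by rewrite cabs_ez /= mulr0 oppr0 expR0. Qed.
Lemma ez_conj m x : conjc (ez m x%:C) = ez (- m) x%:C.
Proof.
by rewrite /ez cexp_conj conjM conjR mulrNz mulrN.
Qed.
Lemma cdiff_ez m : cdiff (ez m). Proof. exact: cdiff_cexpM. Qed.
Lemma per_int (H : C -> C) (k : int) z : (forall z, H (z + 1) = H z) -> H (z + k%:~R) = H z.
Proof.
move=> per; have hn n w : H (w + n%:R) = H w.
 by elim: n w => [|n IH] w; [rewrite addr0|rewrite -natr1 addrA per].
case: k => n; first exact: hn.
have h := hn n.+1 (z - n.+1%:R); rewrite subrK in h.
by rewrite NegzE mulrNz; exact: esym h.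
Qed.
Lemma rcont_line (H : C -> C) y : cdiff H -> rcont (fun x => H (x +i* y)).
Proof. by move=> cH; exact: rcont_hor. Qed.
Lemma rcont_ezR m : rcont (fun x => ez m x%:C).
Proof. exact: (rcont_line 0 (@cdiff_ez m)). Qed.

(** No primitive is used: raising the segment by 1 leaves the integral unchanged and also multiplies
    it by [exp (- 2 pi m)], which differs from 1. *)
Lemma ez_orth m : seg 0 1 (fun x => ez m x%:C) = (m == 0)%:R.
Proof.
have [->|m0] := eqVneq m 0.
 under eq_fun do rewrite ez0; by rewrite (seg_cst _ ler01) subr0 mulr1.
have := seg_shift_im (@cdiff_ez m) 0 1 (ez_per m).
have -> : (fun x => ez m (x +i* 1)) = (fun x => ez m (0 +i* 1) * ez m x%:C).
 apply/funext => x; rewrite -ezDr; congr ez; by apply: ceq; rewrite ?ReD ?ImD /= ?add0r ?addr0.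
rewrite (segZ _ ler01 (rcont_ezR m)); set s := seg _ _ _ => h.
have /eqP : (1 - ez m (0 +i* 1)) * s = 0 by rewrite mulrBl mul1r -h subrr.
rewrite mulf_eq0 => /orP[|/eqP //]; rewrite subr_eq0 => /eqP/(congr1 (@cabs R)).
rewrite cabs1 cabs_ez /= mulr1 -[X in X = _]expR0 => /expR_inj/eqP.
rewrite eq_sym oppr_eq0 mulf_eq0 intr_eq0 (negbTE m0) orbF gt_eqF //.
by rewrite mulr_gt0 // pi_gt0.
Qed.

(** Reduction to the fractional part [f]: [cos (2 pi f) = 1] forces [sin (pi f) = 0], impossible for
    [0 < f < 1]. *)
Lemma ez1_eq1 t : ez 1 t%:C = 1 -> exists k : int, t = k%:~R.
Proof.
move=> h; exists (Num.floor t); apply/eqP; rewrite -subr_eq0.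
set f := t - _; have f01 : 0 <= f < 1.
 rewrite subr_ge0 floor_le_tmp /= ltrBlDl.
 by have := floorD1_gt t; rewrite rmorphD /=.
have hf : ez 1 f%:C = 1.
 rewrite -h; have -> : t%:C = f%:C + (Num.floor t)%:~R :> C.
  by rewrite -[t in LHS](subrK (Num.floor t)%:~R) realCD rmorph_int.
 by rewrite per_int // => z; exact: ez_per.
have {hf} : cexp (0 +i* (2 * pi * f)) = 1 :> C.
 by rewrite -hf /ez; congr cexp; apply: ceq; rewrite ?ReM ?ImM /=; ring.
move/(congr1 (@Re R)); rewrite /cexp /= expR0 mul1r mul0r subr0.
have -> : 2 * pi * f = pi * f + pi * f by ring.
have := cos2Dsin2 (pi * f); rewrite cosD => e1 e2.
have s0 : sin (pi * f) = 0.
 by apply/eqP; rewrite -sqrf_eq0; apply/eqP; lra.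
case/andP: f01; rewrite le_eqVlt eq_sym => /predU1P[->//|f0 f1].
suff : 0 < sin (pi * f) by rewrite s0 ltxx.
by apply: sin_gt0_pi; rewrite mulr_gt0 ?pi_gt0 //= gtr_pMr ?pi_gt0.
Qed.

Lemma rasum_int (g : int -> R) : (forall m, 0 <= g m) -> rasum (fun n => g (Posz n)) ->
 rasum (fun n => g (Negz n)) -> rasum g.
Proof.
move=> g0 [M hM] [N hN]; exists (M + N) => A uA.
rewrite (bigID (fun m : int => if m is Posz _ then true else false)) /=; apply: lerD.
 rewrite -big_filter; apply: le_trans (hM (pmap (fun m : int => if m is Posz n then Some n else None) A) _).
  rewrite big_filter; elim: A {uA} => [|[n|n] A IH]; rewrite ?big_nil //= !big_cons //=.
  by rewrite lerD2l.
 by apply: (pmap_uniq (g := Posz)) => // -[].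
rewrite -big_filter; apply: le_trans (hN (pmap (fun m : int => if m is Negz n then Some n else None) A) _).
 rewrite big_filter; elim: A {uA} => [|[n|n] A IH]; rewrite ?big_nil //= !big_cons //=.
 by rewrite lerD2l.
by apply: (pmap_uniq (g := Negz)) => // -[].
Qed.

Lemma rasum_geom (q : R) : 0 <= q < 1 -> rasum (fun n => q ^+ n).
Proof.
move=> /andP[q0 q1]; exists (1 - q)^-1 => A uA.
apply: (@le_trans _ _ (\sum_(i <- iota 0 (\max_(i <- A) i).+1) q ^+ i)).
 apply: ler_sum_sub => // [i|i iA]; first exact: exprn_ge0.
 by rewrite mem_iota add0n ltnS leq_bigmax_seq.
set N := (_).+1; rewrite -[iota 0 N]/(index_iota 0 N) big_mkord -div1r ler_pdivlMr ?subr_gt0 //.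
have := subrX1 q N => E; have -> : (\sum_(i < N) q ^+ i) * (1 - q) = 1 - q ^+ N.
 by rewrite -[RHS]opprB E; ring.
by rewrite gerBl exprn_ge0.
Qed.

Lemma rasum_int_exp (c : R) : 0 < c -> rasum (fun m : int => expR (- (c * `|m|%:~R))).
Proof.
move=> c0; have q1 : 0 <= expR (- c) < 1.
 by rewrite expR_ge0 /= -expR0 ltr_expR oppr_lt0.
apply: rasum_int => [m||]; first exact: expR_ge0.
 by apply: rasum_le (rasum_geom q1) => n; rewrite -expRM_natl mulrN mulrC.
apply: rasum_le (rasum_geom q1) => n; rewrite -expRM_natl mulrN ler_expR lerN2 mulrC.
by rewrite ler_pM2l // ler_nat.
Qed.

Section Periodic.
Variable H : C -> C.
Hypotheses (cH : cdiff H) (per : forall z, H (z + 1) = H z).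

Definition hc (m : int) : C := seg 0 1 (fun x => H x%:C * ez (- m) x%:C).

Lemma hc_shift m y : hc m = seg 0 1 (fun x => H (x +i* y) * ez (- m) (x +i* y)).
Proof.
apply: (@seg_shift_im (fun z => H z * ez (- m) z) _ 0 y) => [w|z].
 by apply: cdiffM_at; [exact: cH|exact: cdiff_ez].
by rewrite per ez_per.
Qed.
Lemma rcont_hc m y : rcont (fun x => H (x +i* y) * ez m (x +i* y)).
Proof. by apply: rcontM; apply: rcont_line => //; exact: cdiff_ez. Qed.

(** The height [y] is free: taken with sign opposite to [m] and arbitrarily large, it makes the
    coefficients decay faster than any exponential. *)
Lemma hc_bound m y M : (forall x, 0 <= x <= 1 -> cabs (H (x +i* y)) <= M) ->
 cabs (hc m) <= 2 * M * expR (2 * pi * m%:~R * y).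
Proof.
move=> hM; rewrite (hc_shift m y).
have := @seg_bound 0 1 _ (M * expR (2 * pi * m%:~R * y)) ler01 (rcont_hc (- m) y).
rewrite subr0 mulr1 mulrA; apply => x x01.
rewrite cabsM cabs_ez /= rmorphN /= mulrN mulNr opprK.
by apply: ler_wpM2r; [exact: expR_ge0|exact: hM].
Qed.

Lemma hc_casum z : casum (fun m => hc m * ez m z).
Proof.
(* At heights [B] and [- B], one unit beyond [|y|], the bound beats the growth of [ez m z] by a
   factor [exp (- 2 pi |m|)]. *)
pose y := Im z; pose B := `|y| + 1.
have [M1 h1] := rcont_bounded ler01 (rcont_line B cH).
have [M2 h2] := rcont_bounded ler01 (rcont_line (- B) cH).
have K0 : 0 <= 2 * (`|M1| + `|M2|) by rewrite mulr_ge0 // addr_ge0.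
have c0 : 0 < 2 * pi :> R by rewrite mulr_gt0 // pi_gt0.
apply: rasum_le (rasumZ K0 (rasum_int_exp c0)) => m; rewrite cabsM cabs_ez -/y.
have y1 := ler_norm y; have y2 : - `|y| <= y by rewrite lerNl -normrN ler_norm.
have [m0|m0] := leP 0 m.
 apply: le_trans (ler_wpM2r (expR_ge0 _) (hc_bound m (y := - B) h2)) _.
 rewrite -[leLHS]mulrA -expRD; apply: ler_pM; rewrite ?mulr_ge0 ?expR_ge0 //.
 - by have := h2 0; rewrite lexx ler01 => /(_ isT); apply: le_trans; exact: cabs_ge0.
 - by apply: ler_wpM2l => //; apply: le_trans (ler_norm _) _; rewrite lerDr.
 rewrite ler_expR (ger0_norm m0) -mulrBr -[leRHS]mulrN1; apply: ler_wpM2l.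
  by rewrite mulr_ge0 ?ler0z // ltW.
 by rewrite /B; lra.
apply: le_trans (ler_wpM2r (expR_ge0 _) (hc_bound m (y := B) h1)) _.
rewrite -[leLHS]mulrA -expRD; apply: ler_pM; rewrite ?mulr_ge0 ?expR_ge0 //.
- by have := h1 0; rewrite lexx ler01 => /(_ isT); apply: le_trans; exact: cabs_ge0.
- by apply: ler_wpM2l => //; apply: le_trans (ler_norm _) _; rewrite lerDl.
rewrite ler_expR (ltr0_norm m0) mulrNz mulrN opprK -mulrBr -[leRHS]mulr1 ler_nM2l.
 by rewrite /B; lra.
by rewrite pmulr_rlt0 // ltrz0.
Qed.

(* Chernoff's trick: for [q] with [H(x + iy) - H z = (ez 1 (x - Re z) - 1) q(x)],
  the partial sums of the Fourier series at [z] telescope. *)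
Lemma chernoff_quotient z : exists2 q : R -> C, rcont q &
 forall x, H (x +i* Im z) - H z = (ez 1 (x - Re z)%:C - 1) * q x.
Proof.
case: z => a y /=.
have [L hL] := (cdiff_seqP H (a +i* y)).1 (cH _).
have [E hE] := (cdiff_seqP (ez 1) 0).1 (@cdiff_ez 1 0).
(* [E] is known only as a limit of difference quotients; uniqueness of limits identifies it with
   [2 pi i]. *)
have E0 : E != 0.
 have [E' hE'] : exists E', E' != 0 /\ forall u : nat -> C, (forall n, u n != 0) -> ccvg u 0 ->
   ccvg (fun n => (ez 1 (0 + u n) - ez 1 0) / u n) E'.
  exists (0 +i* (2 * pi)); split.
   by rewrite eq_complex /= eqxx /= mulf_neq0 // ?pnatr_eq0 // gt_eqF // pi_gt0.
  move=> u u0 cu; pose a0 : C := 0 +i* (2 * pi * 1%:~R).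
  have A n : (ez 1 (0 + u n) - ez 1 0) / u n = a0 + (cexp (a0 * u n) - 1 - a0 * u n) / u n.
   by rewrite add0r ez_0 /ez -/a0; have := u0 n => ?; field.
  have -> : (0 +i* (2 * pi)) = a0 by rewrite /a0 mulr1.
  apply: (ccvg_squeeze (b := fun n => cabs a0 ^+ 2 * cabs (u n) * expR (cabs a0 * cabs (u n)))).
   move=> n; rewrite A addrAC subrr add0r cabsM cabsV.
   have un : 0 < cabs (u n) by rewrite lt_def cabs_ge0 cabs_eq0 u0.
   rewrite ler_pdivrMr //; apply: le_trans (cexp_quad _) _; rewrite cabsM.
   by apply/eq_ler; ring.
  have := ccvg_cabs cu; rewrite cabs0 => c0.
  have -> : (0 : R) = cabs a0 ^+ 2 * 0 * expR (cabs a0 * 0) by rewrite mulr0 mul0r.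
  apply: cvgM; first by apply: cvgM => //; exact: cvg_cst.
  have : (fun n => cabs a0 * cabs (u n)) @ \oo --> cabs a0 * 0 by apply: cvgM => //; exact: cvg_cst.
  by move=> h; exact: (cvg_comp _ _ h (@continuous_expR R _)).
 pose u n : C := (n.+1%:R^-1 : R)%:C.
 have u0 n : u n != 0 by rewrite -cabs_eq0 cabsR normr_eq0 invr_eq0 pnatr_eq0.
 have cu : ccvg u 0 by apply: ccvg_real; exact: cvg_harmonic.
 by rewrite (ccvg_uniq (hE u u0 cu) (hE'.2 u u0 cu)); exact: hE'.1.
pose S x := `[< exists k : int, x = a + k%:~R >].
(* At the points [a + k], where numerator and denominator both vanish, the quotient is given its
   limit [L / E]. *)
pose q x := if S x then L / E else (H (x +i* y) - H (a +i* y)) / (ez 1 (x - a)%:C - 1).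
have Hk k : H ((a + k%:~R) +i* y) = H (a +i* y).
 rewrite -(per_int k (a +i* y) per); congr H.
 have -> : (k%:~R : C) = ((k%:~R : R))%:C by rewrite rmorph_int.
 by apply: ceq; rewrite ?ReD ?ImD /= ?addr0.
have ek k t : ez 1 (t + (k%:~R : R))%:C = ez 1 t%:C.
 rewrite realCD rmorph_int per_int // => w; exact: ez_per.
exists q => [v l vl|x]; last first.
 rewrite /q /S; case: asboolP => [[k ->]|nk].
  rewrite Hk subrr; have -> : a + k%:~R - a = 0 + k%:~R by ring.
  by rewrite ek ez_0 subrr mul0r.
 rewrite mulrC divfK // subr_eq0; apply/negP => /eqP/ez1_eq1[k hk]; apply: nk.
 by exists k; rewrite -hk addrC subrK.
have cn (x : C) : rcont (fun t => H (t +i* y) - x).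
 by move=> v' l' v'l; apply: ccvgB; [exact: (rcont_line y cH)|exact: ccvg_cst].
have ce (x : R) : rcont (fun t => ez 1 (t - x)%:C - 1).
 move=> v' l' v'l; apply: ccvgB; last exact: ccvg_cst.
 apply: (rcont_ezR 1); apply: cvgB => //; exact: cvg_cst.
rewrite /q /S; case: (asboolP (exists k : int, l = a + k%:~R)) => [[k lk]|nl].
 (* near a lattice point both difference quotients converge *)
 pose u n : C := (v n - l)%:C.
 have cu : ccvg u 0.
  have : ccvg u ((l : R) - l)%:C.
   by apply: ccvg_real; apply: cvgB => //; exact: cvg_cst.
  by rewrite subrr.
 (* The sequence may meet the lattice point itself; there the increment [1 / (n + 1)] is
    substituted, so that both difference quotients make sense. *)
 pose u' n : C := if u n == 0 then (n.+1%:R^-1 : R)%:C else u n.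
 have u'0 n : u' n != 0.
  by rewrite /u'; case: ifP => [_|/negbT //]; rewrite -cabs_eq0 cabsR normr_eq0 invr_eq0 pnatr_eq0.
 have cu' : ccvg u' 0.
  apply: (ccvg_squeeze (b := fun n => cabs (u n) + n.+1%:R^-1)).
   move=> n; rewrite subr0 /u'; case: ifP => [/eqP ->|_]; last by rewrite lerDl invr_ge0.
   by rewrite cabs0 add0r cabsR ger0_norm // invr_ge0.
  rewrite -[X in _ --> X](addr0 0); apply: cvgD; last exact: cvg_harmonic.
  by have := ccvg_cabs cu; rewrite cabs0.
 have cq : ccvg (fun n => ((H (a +i* y + u' n) - H (a +i* y)) / u' n) /
   ((ez 1 (0 + u' n) - ez 1 0) / u' n)) (L / E).
  by apply: ccvgM; [exact: hL|apply: ccvgV => //; exact: hE].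
 move=> e /cq[N hN]; exists N => n /hN; case: asboolP => [_|nS] h.
  by rewrite subrr cabs0; apply: le_lt_trans h; exact: cabs_ge0.
 have un : u n != 0.
  rewrite -cabs_eq0 cabsR normr_eq0; apply/eqP => /subr0_eq vn.
  by apply: nS; exists k; rewrite vn.
 move: h; rewrite /u' (negbTE un) /u ez_0 add0r.
 have -> : a +i* y + (v n - l)%:C = (v n +i* y) + (- k)%:~R.
  have -> : ((- k)%:~R : C) = ((- k)%:~R : R)%:C by rewrite rmorph_int.
  by apply: ceq; rewrite ?ReD ?ImD /= ?addr0 // lk rmorphN /=; ring.
 rewrite per_int //; have -> : ez 1 (v n - l)%:C = ez 1 (v n - a)%:C.
  by rewrite -[RHS](ek (- k)) lk rmorphN /=; congr (ez 1 _%:C); ring.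
 set X := _ / _; suff -> : X = (H (v n +i* y) - H (a +i* y)) / (ez 1 (v n - a)%:C - 1) by [].
 rewrite /X; move: un; rewrite /u; move: ((v n - l)%:C) => w w0; field.
 rewrite w0 andbT subr_eq0; apply/negP => /eqP/ez1_eq1[k' hk']; apply: nS.
 by exists k'; rewrite -hk' addrC subrK.
have D0 : ez 1 (l - a)%:C - 1 != 0.
 rewrite subr_eq0; apply/negP => /eqP/ez1_eq1[k' hk']; apply: nl.
 by exists k'; rewrite -hk' addrC subrK.
have cq : ccvg (fun n => (H (v n +i* y) - H (a +i* y)) / (ez 1 (v n - a)%:C - 1))
  ((H (l +i* y) - H (a +i* y)) / (ez 1 (l - a)%:C - 1)).
 by apply: ccvgM; [exact: cn|apply: ccvgV => //; exact: ce].
move=> e /cq[N hN]; have [M hM] := ce a v l vl _ (cabs_gt0 D0).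
exists (maxn N M) => n; rewrite geq_max => /andP[/hN h /hM hn].
case: asboolP => [[k vk]|_] //; move: hn; rewrite vk.
have -> : a + k%:~R - a = 0 + k%:~R by ring.
by rewrite ek ez_0 subrr sub0r cabsN ltxx.
Qed.

(** Bessel's inequality from the positivity of the integral of [|q - P|^2], where [P] is a partial
    Fourier sum and [q - P] is orthogonal to every exponential in it. *)
Lemma bessel_seg (q : R -> C) a : rcont q -> exists K, forall A : seq int, uniq A ->
 \sum_(m <- A) cabs2 (seg 0 1 (fun x => q x * ez (- m) (x - a)%:C)) <= K.
Proof.
move=> cq; pose t m := seg 0 1 (fun x => q x * ez (- m) (x - a)%:C).
have cf m : rcont (fun x => ez m (x - a)%:C).
 move=> v l vl; apply: (rcont_ezR m); apply: cvgB => //; exact: cvg_cst.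
have orth m n : seg 0 1 (fun x => ez m (x - a)%:C * ez (- n) (x - a)%:C) = (m == n)%:R.
 have -> : (fun x => ez m (x - a)%:C * ez (- n) (x - a)%:C) =
   (fun x => ez (m - n) (- a)%:C * ez (m - n) x%:C).
  by apply/funext => x; rewrite -ezDl realCD ezDr mulrC.
 rewrite (segZ _ ler01 (rcont_ezR _)) ez_orth subr_eq0.
 by case: eqVneq => [->|_]; rewrite ?subrr ?ez0 ?mul1r ?mulr0.
exists (Re (seg 0 1 (fun x => q x * conjc (q x)))) => A uA.
pose P x := \sum_(m <- A) t m * ez m (x - a)%:C.
have cP : rcont P by apply: rcont_sum => m; apply: rcontM => //; exact: rcont_cst.
have cqP := rcontB cq cP.
have res n : n \in A -> seg 0 1 (fun x => (q x - P x) * ez (- n) (x - a)%:C) = 0.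
 move=> nA; have -> : (fun x => (q x - P x) * ez (- n) (x - a)%:C) = (fun x =>
  q x * ez (- n) (x - a)%:C - \sum_(m <- A) t m * (ez m (x - a)%:C * ez (- n) (x - a)%:C)).
  apply/funext => x; rewrite mulrBl /P mulr_suml; congr (_ - _).
  by apply: eq_bigr => m _; rewrite mulrA.
 have cc m : rcont (fun x => t m * (ez m (x - a)%:C * ez (- n) (x - a)%:C)).
  by apply: rcontM; [exact: rcont_cst|exact: rcontM].
 rewrite (segB ler01 (rcontM cq (cf _)) (rcont_sum A cc)) (seg_sum A ler01 cc).
 under eq_bigr do rewrite (segZ _ ler01 (rcontM (cf _) (cf _))) orth.
 rewrite (bigD1_seq n) //= eqxx mulr1 big1 ?addr0 ?subrr // => m /negbTE ->.
 by rewrite mulr0.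
have cj m x : conjc (ez m (x - a)%:C) = ez (- m) (x - a)%:C by exact: ez_conj.
have E : seg 0 1 (fun x => (q x - P x) * conjc (q x - P x)) =
  seg 0 1 (fun x => q x * conjc (q x)) - \sum_(m <- A) (cabs2 (t m))%:C.
 have -> : (fun x => (q x - P x) * conjc (q x - P x)) = (fun x =>
   (q x * conjc (q x) - \sum_(m <- A) t m * conjc (q x * ez (- m) (x - a)%:C)) -
   \sum_(m <- A) conjc (t m) * ((q x - P x) * ez (- m) (x - a)%:C)).
  apply/funext => x; rewrite conjB mulrBr [in LHS]mulrBl; congr (_ - _ - _).
   rewrite /P mulr_suml; apply: eq_bigr => m _.
   by rewrite conjM -cj conjcK; ring.
  rewrite {2}/P conj_sum mulr_sumr; apply: eq_bigr => m _.
  by rewrite conjM cj mulrCA.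
 have c1 m : rcont (fun x => t m * conjc (q x * ez (- m) (x - a)%:C)).
  by apply: rcontM; [exact: rcont_cst|apply: rcont_conj; exact: rcontM].
 have c2 m : rcont (fun x => conjc (t m) * ((q x - P x) * ez (- m) (x - a)%:C)).
  by apply: rcontM; [exact: rcont_cst|exact: rcontM].
 have c3 := rcontM cq (rcont_conj cq).
 rewrite (segB ler01 (rcontB c3 (rcont_sum A c1)) (rcont_sum A c2)).
 rewrite (segB ler01 c3 (rcont_sum A c1)) !(seg_sum A ler01) //.
 rewrite [X in _ - _ - X]big_seq [X in _ - _ - X]big1 ?subr0; last first.
  by move=> m mA; rewrite (segZ _ ler01 (rcontM cqP (cf _))) res // mulr0.
 congr (_ - _); apply: eq_bigr => m _; rewrite -mul_conj.
 rewrite (segZ _ ler01 (rcont_conj (rcontM cq (cf _)))); congr (_ * _).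
 apply: ceq; rewrite /= ?Re_conj ?Im_conj.
  by apply: eq_Rintegral => x _; rewrite Re_conj.
 have [_ iI] := seg_ign ler01 (rcontM cq (cf (- m))).
 rewrite -mulN1r -RintegralZl //; apply: eq_Rintegral => x _.
 by rewrite Im_conj mulN1r.
have : 0 <= Re (seg 0 1 (fun x => (q x - P x) * conjc (q x - P x))).
 by apply: Rintegral_ge0 => x _; rewrite mul_conj cabs2_ge0.
by rewrite E ReD ReN Re_sum subr_ge0.
Qed.

Lemma hc_sum z : H z = csum (fun m => hc m * ez m z).
Proof.
set a := Re z; set y := Im z.
have [q cq hq] := chernoff_quotient z; have [K hK] := bessel_seg a cq.
pose t m := seg 0 1 (fun x => q x * ez (- m) (x - a)%:C).
have cf m : rcont (fun x => ez m (x - a)%:C).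
 move=> v l vl; apply: (rcont_ezR m); apply: cvgB => //; exact: cvg_cst.
have zE : z = a +i* y by exact: cE.
(* Multiplying [q] by [ez 1 - 1] takes differences of neighbouring coefficients, and the product is
   [H - H z] on the line through [z]. *)
have tele m : hc m * ez m z - (m == 0)%:R * H z = t (m - 1) - t m.
 have e1 : seg 0 1 (fun x => ez (- m) (x - a)%:C) = (m == 0)%:R.
  have -> : (fun x => ez (- m) (x - a)%:C) = (fun x => ez (- m) (- a)%:C * ez (- m) x%:C).
   by apply/funext => x; rewrite realCD ezDr mulrC.
  rewrite (segZ _ ler01 (rcont_ezR _)) ez_orth oppr_eq0.
  by case: eqVneq => [->|_]; rewrite ?oppr0 ?ez0 ?mul1r ?mulr0.
 have c1 := rcont_hc (- m) y.
 rewrite (hc_shift m y) -e1 mulrC [X in _ - X]mulrC -(segZ _ ler01 c1).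
 rewrite -(segZ _ ler01 (cf _)) -segB ?ler01 //; last 2 first.
 - by apply: rcontM; [exact: rcont_cst|exact: c1].
 - by apply: rcontM; [exact: rcont_cst|exact: cf].
 rewrite -(segB ler01 (rcontM cq (cf _)) (rcontM cq (cf _))); congr seg.
 apply/funext => x.
 have -> : ez m z * (H (x +i* y) * ez (- m) (x +i* y)) = H (x +i* y) * ez (- m) (x - a)%:C.
  rewrite mulrCA; congr (_ * _); have -> : x +i* y = z + (x - a)%:C.
   by rewrite zE; apply: ceq; rewrite ?ReD ?ImD /= ?addr0 // addrC subrK.
  by rewrite ezDr mulrA -ezDl subrr ez0 mul1r.
 rewrite -mulrBl hq -/a opprB ezDl; ring.
have sums N : \sum_(i < N) (hc (Posz i) * ez (Posz i) z + hc (Negz i) * ez (Negz i) z) =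
  (if N is 0%N then 0 else H z) + (t (- (N%:Z) - 1) - t (N%:Z - 1)).
 elim: N => [|N IH]; first by rewrite big_ord0 oppr0 subrr addr0.
 rewrite big_ord_recr /= IH.
 have h1 : hc N * ez N z = t (N%:Z - 1) - t N + (N == 0%N)%:R * H z.
  by rewrite -tele subrK.
 have h2 : hc (Negz N) * ez (Negz N) z = t (Negz N - 1) - t (Negz N).
  by rewrite -tele mul0r subr0.
 rewrite h1 h2 NegzE; have -> : - N.+1%:Z = - N%:Z - 1 :> int by rewrite -addn1 PoszD opprD.
 have -> : N.+1%:Z - 1 = N :> int by rewrite -addn1 PoszD addrK.
 by case: N {IH h1 h2} => [|N] /=; rewrite ?mul1r ?mul0r; ring.
pose S := csum (fun m => hc m * ez m z).
have cS : ccvg (fun N => \sum_(i < N) (hc (Posz i) * ez (Posz i) z + hc (Negz i) * ez (Negz i) z)) S.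
 have aS := hc_casum z; have a1 := @rasum_inj R int nat Posz _ ltac:(by move=> ? ? []) aS.
 have a2 := @rasum_inj R int nat Negz _ ltac:(by move=> ? ? []) aS.
 have -> : S = csum (fun n : nat => hc (Posz n) * ez (Posz n) z + hc (Negz n) * ez (Negz n) z).
  rewrite csumD //; pose fp m := if m is Posz _ then hc m * ez m z else 0.
  pose fn m := if m is Negz _ then hc m * ez m z else 0.
  have ap : casum fp by apply: rasum_le aS => -[n|n] //=; rewrite cabs0 cabs_ge0.
  have an : casum fn by apply: rasum_le aS => -[n|n] //=; rewrite cabs0 cabs_ge0.
  have -> : S = csum fp + csum fn.
   by rewrite -csumD //; apply: eq_csum => -[n|n] /=; rewrite ?addr0 ?add0r.
  congr (_ + _); [rewrite -(csum_inj (h := Posz)) //|rewrite -(csum_inj (h := Negz)) //].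
  - by move=> ? ? [].
  - by case=> // n /(_ n).
  - by move=> ? ? [].
  - by case=> // n /(_ n).
 exact: csum_ccvg (casumD a1 a2).
apply/esym/eqP; rewrite -subr_eq0 -cabs_eq0; apply: contraT => Sn0.
have s0 : 0 < cabs (S - H z) by rewrite lt_def Sn0 cabs_ge0.
set s := cabs (S - H z) in s0 *.
have s20 : 0 < s / 2 by rewrite divr_gt0.
have [N hN] := cS _ s20.
(* Were the series off by [s], the two boundary terms of every late partial sum would satisfy
   [s / 2 <= |A| + |B|], hence [s ^+ 2 / 8 <= |A|^2 + |B|^2] infinitely often, against Bessel's
   inequality for [q]. *)
have low n : (N <= n)%N -> s ^+ 2 / 8 <= cabs2 (t (- (n.+1%:Z) - 1)) + cabs2 (t n%:Z).
 move=> nN; have := hN n.+1 (leqW nN); rewrite sums.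
 have -> : n.+1%:Z - 1 = n :> int by rewrite -addn1 PoszD addrK.
 set A := t _; set B := t _.
 have e : S - H z = (A - B) - (H z + (A - B) - S) by ring.
 move=> h; have : s / 2 <= cabs A + cabs B.
  have := cabsB (A - B) (H z + (A - B) - S); rewrite -e -/s.
  have := cabsB A B; lra.
 rewrite -!cabs_sqr => h2; have := sqr_ge0 (cabs A - cabs B).
 have : (s / 2) ^+ 2 <= (cabs A + cabs B) ^+ 2.
  by rewrite lerXn2r // nnegrE ?addr_ge0 ?cabs_ge0 // ltW.
 lra.
have big M : (M%:R : R) * (s ^+ 2 / 8) <= K + K.
 pose u1 := [seq (- ((N + i).+1%:Z) - 1 : int) | i <- iota 0 M].
 pose u2 := [seq ((N + i)%:Z : int) | i <- iota 0 M].
 apply: le_trans (lerD (hK u1 _) (hK u2 _)); last 2 first.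
 - rewrite map_inj_uniq ?iota_uniq // => i j /addIr/oppr_inj[]; lia.
 - rewrite map_inj_uniq ?iota_uniq // => i j []; lia.
 rewrite !big_map -big_split /= mulr_natl -[M in leLHS](size_iota 0).
 apply: (@le_trans _ _ (\sum_(i <- iota 0 M) s ^+ 2 / 8)).
  by rewrite big_const_seq iter_addr_0 count_predT.
 by apply: ler_sum => i _; apply: low; exact: leq_addr.
have s8 : 0 < s ^+ 2 / 8 by rewrite divr_gt0 // exprn_gt0.
have := big (Num.truncn ((K + K) / (s ^+ 2 / 8))).+1.
rewrite -ler_pdivlMr // leNgt.
by have := truncnS_gt ((K + K) / (s ^+ 2 / 8)) => ->.
Qed.
End Periodic.
End OneVariable.

(** ** Fourier and power series of entire functions of several variables *)
Section SeveralVariables.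
Variable R : realType.
Local Notation C := R[i].
Local Notation Cd := (Cd R).

Definition dcvg d (z : nat -> Cd d) (l : Cd d) := forall j, ccvg (fun n => z n j) (l j).
Definition dcont d (F : Cd d -> C) := forall z l, dcvg z l -> ccvg (fun n => F (z n)) (F l).
(** Sequential form of Osgood's definition, shown equivalent to [entire] in [entire_sephol]. *)
Definition sephol d (G : Cd d -> C) := dcont G /\ forall z j, cdiff (fun w => G (upd z j w)).
Definition perd d (G : Cd d -> C) := forall z j, G (upd z j (z j + 1)) = G z.

Lemma updE d (z : Cd d) j w i : upd z j w i = if i == j then w else z i.
Proof. by rewrite ffunE. Qed.
Lemma upd_upd d (z : Cd d) j v w : upd (upd z j v) j w = upd z j w.
Proof. by apply/ffunP => i; rewrite !updE; case: eqP. Qed.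
Lemma dcvg_cst d (z : Cd d) : dcvg (fun _ => z) z. Proof. by move=> j; exact: ccvg_cst. Qed.
Lemma dcvg_upd d (z : nat -> Cd d) l j w v : dcvg z l -> ccvg w v ->
 dcvg (fun n => upd (z n) j (w n)) (upd l j v).
Proof.
move=> zl wv i; rewrite updE; under eq_fun do rewrite updE; case: eqP => _ //; exact: zl.
Qed.
Lemma dcvg_cons d (z : nat -> Cd d) l w v : dcvg z l -> ccvg w v ->
 dcvg (fun n => ffcons (w n) (z n) : Cd d.+1) (ffcons v l).
Proof.
move=> zl wv i; case: (unliftP ord0 i) => [j|] ->.
 by rewrite ffconsS; under eq_fun do rewrite ffconsS; exact: zl.
by rewrite ffcons0; under eq_fun do rewrite ffcons0.
Qed.
Lemma ffcons_upd0 d (z : Cd d) (v w : C) : upd (ffcons v z : Cd d.+1) ord0 w = ffcons w z.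
Proof.
apply/ffunP => i; rewrite updE; case: (unliftP ord0 i) => [j|] ->; last by rewrite eqxx ffcons0.
by rewrite eq_sym (negbTE (neq_lift _ _)) !ffconsS.
Qed.
Lemma ffcons_updS d (z : Cd d) (v w : C) j :
 upd (ffcons v z : Cd d.+1) (lift ord0 j) w = ffcons v (upd z j w).
Proof.
apply/ffunP => i; rewrite updE; case: (unliftP ord0 i) => [k|] ->.
 by rewrite (inj_eq lift_inj) !ffconsS updE.
by rewrite (negbTE (neq_lift _ _)) !ffcons0.
Qed.

Lemma ccvg_bounded (u : nat -> C) a : ccvg u a -> exists M, forall n, cabs (u n) <= M.
Proof.
move=> /(_ 1 ltr01)[N hN]; exists (\sum_(i < N) cabs (u i) + (cabs a + 1)) => n.
have S0 : 0 <= \sum_(i < N) cabs (u i) by apply: sumr_ge0 => i _; exact: cabs_ge0.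
have [nN|Nn] := ltnP n N.
 rewrite (bigD1 (Ordinal nN)) //= -addrA lerDl addr_ge0 ?addr_ge0 ?cabs_ge0 //.
 by apply: sumr_ge0 => i _; exact: cabs_ge0.
have := hN n Nn; have := cabsD (u n - a) a; rewrite subrK; lra.
Qed.
Lemma dcvg_bounded d (z : nat -> Cd d) l : dcvg z l -> exists M, forall n j, cabs (z n j) <= M.
Proof.
move=> zl; have /choice[M hM] j := ccvg_bounded (zl j).
exists (\sum_j `|M j|) => n j; apply: le_trans (hM j n) _; apply: le_trans (ler_norm _) _.
by rewrite (bigD1 j) //= lerDl sumr_ge0.
Qed.

Lemma incr_comp (f g : nat -> nat) : increasing_seq f -> increasing_seq g ->
 increasing_seq (f \o g).
Proof. by move=> hf hg m n; rewrite /= hf; exact: hg. Qed.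
Lemma incr_ge (f : nat -> nat) : increasing_seq f -> forall n, (n <= f n)%N.
Proof.
move=> hf; elim=> // n IH; apply: leq_ltn_trans IH _.
by have := hf n.+1 n; rewrite !leEnat ltnn => /negbT; rewrite -ltnNge.
Qed.
Lemma cvg_subseq_incr (u : nat -> R) (l : R) (f : nat -> nat) : increasing_seq f ->
 u @ \oo --> l -> (u \o f) @ \oo --> l.
Proof.
move=> hf ul; apply: cvg_comp ul; move=> A [N _ hN]; exists N => // n /= Nn.
by apply: hN => /=; apply: leq_trans Nn _; exact: incr_ge.
Qed.
Lemma joint_subseq n (c : 'I_n -> nat -> R) (M : R) : (forall i k, `|c i k| <= M) ->
 exists2 f, increasing_seq f & forall i, exists l : R, (c i \o f) @ \oo --> l.
Proof.
elim: n c => [|n IH] c hc; first by exists id => // -[].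
have [f fi fc] := IH (fun i => c (lift ord0 i)) (fun i => hc _).
have [g gi gc] : exists2 g, increasing_seq g & cvgn ((c ord0 \o f) \o g).
 apply: bolzano_weierstrass; exists M; split; rewrite ?num_real // => x Mx k _ /=.
 by apply: le_trans (hc _ _) _; exact: ltW.
exists (f \o g); first exact: incr_comp.
move=> i; case: (unliftP ord0 i) => [j|] ->; last first.
 by exists (lim (((c ord0 \o f) \o g) @ \oo)); exact: gc.
by have [l hl] := fc j; exists l; exact: (cvg_subseq_incr gi hl).
Qed.

(** Points of a polydisc with unbounded values would have a subsequence along which all [2 d] real
    coordinates converge, against continuity. *)
Lemma dcont_locbounded d (F : Cd d -> C) (r : R) : dcont F ->
 exists M, forall z : Cd d, (forall j, cabs (z j) <= r) -> cabs (F z) <= M.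
Proof.
move=> cF; apply: contrapT => hn.
have /choice[z hz] : forall n : nat, exists z : Cd d, (forall j, cabs (z j) <= r) /\ n%:R < cabs (F z).
 move=> n; apply: contrapT => hc; apply: hn; exists n%:R => z hz.
 by rewrite leNgt; apply/negP => ?; apply: hc; exists z.
have [f fi hf] := @joint_subseq d (fun j n => Re (z n j)) r
 (fun j n => le_trans (cabsRe _) ((hz n).1 j)).
have [g gi hg] := @joint_subseq d (fun j n => Im (z (f n) j)) r
 (fun j n => le_trans (cabsIm _) ((hz (f n)).1 j)).
have /choice[a ha] := hf; have /choice[b hb] := hg.
have cv : dcvg (fun n => z (f (g n))) [ffun j => a j +i* b j].
 move=> j; rewrite ffunE; apply: ccvg_ReIm; last exact: hb.
 exact: (cvg_subseq_incr gi (ha j)).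
have [M hM] := ccvg_bounded (cF _ _ cv).
have [_ h] := hz (f (g (Num.truncn M).+1)).
have := lt_le_trans h (hM _); rewrite ltNge; apply/negP; rewrite negbK.
apply: ltW; apply: lt_le_trans (truncnS_gt M) _.
by rewrite ler_nat; apply: leq_trans (incr_ge gi _) (incr_ge fi _).
Qed.

(** Termwise quadratic remainders with summable constants add up to a single quadratic remainder. *)
Lemma cdiff_csum (I : choiceType) (g : I -> C -> C) w (L : I -> C) (B : I -> R) :
 rasum B -> casum L -> (forall z, casum (g ^~ z)) ->
 (forall i h, cabs h < 1 -> cabs (g i (w + h) - g i w - L i * h) <= B i * cabs h ^+ 2) ->
 cdifferentiable_at (fun z => csum (g ^~ z)) w.
Proof.
move=> rB aL ag gB; apply: (@cdiff_quad _ _ w (csum L) (rsum B) 1 ltr01) => h h1.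
have a1 : casum (fun i => g i (w + h) - g i w).
 by apply: rasum_le (rasumD (ag (w + h)) (ag w)) => i; exact: cabsB.
rewrite -csumB // -csumZr // -csumB //; last exact: casumZr.
apply: le_trans (cabs_csum _) _.
 by apply: rasum_le (rasumD a1 (casumZr h aL)) => i; exact: cabsB.
apply: rsum_le => A uA; apply: (@le_trans _ _ (\sum_(i <- A) B i * cabs h ^+ 2)).
 by apply: ler_sum => i _; exact: gB.
by rewrite -mulr_suml ler_wpM2r ?sqr_ge0 // rsum_ub.
Qed.

Lemma ez_le m (z : C) : cabs (ez m z) <= expR (2 * pi * `|Im z| * `|m|%:~R).
Proof.
rewrite cabs_ez ler_expR; apply: le_trans (ler_norm _) _.
by rewrite normrN !normrM (ger0_norm (pi_ge0 R)) ger0_norm // -intr_norm mulrAC.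
Qed.

Lemma cdiff_ezsum (b : int -> C) : (forall c, exists M, forall m,
  cabs (b m) <= M * expR (- (c * `|m|%:~R))) ->
 (forall z, casum (fun m => b m * ez m z)) /\ cdiff (fun z => csum (fun m => b m * ez m z)).
Proof.
move=> hb; have M0 c : exists2 M, 0 <= M & forall m, cabs (b m) <= M * expR (- (c * `|m|%:~R)).
 have [M hM] := hb c; exists `|M| => // m; apply: le_trans (hM m) _.
 by rewrite ler_wpM2r ?expR_ge0 // ler_norm.
have one : (0 : R) < 1 by [].
have aS z : casum (fun m => b m * ez m z).
 have [M M_ge0 hM] := M0 (2 * pi * `|Im z| + 1).
 apply: rasum_le (rasumZ M_ge0 (rasum_int_exp one)) => m.
 rewrite cabsM mul1r; apply: le_trans (ler_pM (cabs_ge0 _) (cabs_ge0 _) (hM m) (ez_le m z)) _.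
 rewrite -[leLHS]mulrA -expRD ler_wpM2l // ler_expR; lra.
split=> // w; pose al m : C := 0 +i* (2 * pi * m%:~R).
have cal m : cabs (al m) = 2 * pi * `|m|%:~R.
 rewrite /al /cabs /cabs2 /= expr0n add0r sqrtr_sqr !normrM (ger0_norm (pi_ge0 R)) ger0_norm //.
 by rewrite intr_norm.
have xe (x : R) : 0 <= x -> x <= expR x.
 by move=> x0; apply: le_trans (expR_ge1Dx x); rewrite lerDr.
have al0 (m : int) : 0 <= 2 * pi * `|m|%:~R :> R by rewrite mulr_ge0 ?ler0z // mulr_ge0 // pi_ge0.
(* The second-order term contributes two factors [2 pi |m|] and the increment [|h| < 1] an
   exponential; each costs one [exp (2 pi |m|)], hence the 3. The last 1 leaves a summable
   [exp (- |m|)]. *)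
have [M M_ge0 hM] := M0 (2 * pi * `|Im w| + 3 * (2 * pi) + 1).
apply: (@cdiff_csum _ (fun m z => b m * ez m z) w (fun m => b m * (al m * ez m w))
 (fun m => M * expR (- (1 * `|m|%:~R)))) => //.
- exact: rasumZ (rasum_int_exp one).
- apply: rasum_le (rasumZ M_ge0 (rasum_int_exp one)) => m.
 rewrite (cabsM (b m)) (cabsM (al m)) cal mul1r.
 apply: le_trans (ler_pM (cabs_ge0 _) _ (hM m) (ler_pM (al0 m) (cabs_ge0 _) (xe _ (al0 m)) (ez_le m w))) _.
  by rewrite mulr_ge0 ?cabs_ge0.
 rewrite -!expRD -[leLHS]mulrA -expRD ler_wpM2l // ler_expR; have := al0 m; lra.
move=> m h h1; have -> : b m * ez m (w + h) - b m * ez m w - b m * (al m * ez m w) * h =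
  b m * ez m w * (cexp (al m * h) - 1 - al m * h) by rewrite /ez mulrDr cexpD -/(al m); ring.
rewrite (cabsM (b m * ez m w)) (cabsM (b m)); apply: le_trans (ler_wpM2l _ (cexp_quad _)) _; first by rewrite mulr_ge0 ?cabs_ge0.
rewrite (cabsM (al m)) cal exprMn mulrCA mulrA [X in _ <= X]mulrC -[leRHS]mulrC mul1r.
set a := 2 * pi * `|m|%:~R; have a0 : 0 <= a by exact: al0.
have e1 : a ^+ 2 <= expR a * expR a by rewrite expr2 ler_pM ?xe.
have e2 : expR (a * cabs h) <= expR a by rewrite ler_expR ler_piMr // ltW.
have e3 := ler_pM (cabs_ge0 _) (cabs_ge0 _) (hM m) (ez_le m w).
have h2 := sqr_ge0 (cabs h).
have -> : a ^+ 2 * cabs h ^+ 2 * (cabs (b m) * cabs (ez m w)) * expR (a * cabs h) =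
 (cabs (b m) * cabs (ez m w)) * (a ^+ 2 * expR (a * cabs h)) * cabs h ^+ 2 by ring.
apply: ler_wpM2r => //.
apply: le_trans (ler_pM _ _ e3 (ler_pM (sqr_ge0 _) (expR_ge0 _) e1 e2)) _.
- by rewrite mulr_ge0 ?cabs_ge0.
- by rewrite mulr_ge0 ?sqr_ge0 ?expR_ge0.
rewrite -!expRD -!mulrA -!expRD ler_wpM2l // ler_expR /a; lra.
Qed.

Section Slice.
Variable d : nat.
Variable G : Cd d.+1 -> C.
Hypotheses (hG : sephol G) (pG : perd G).

Definition Tz (m : int) (z : Cd d) : C :=
 seg 0 1 (fun x => G (ffcons x%:C z) * ez (- m) x%:C).

Lemma rcont_slice (z : Cd d) : rcont (fun x => G (ffcons x%:C z)).
Proof.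
move=> v l vl; apply: hG.1; apply: dcvg_cons; [exact: dcvg_cst|exact: ccvg_real].
Qed.
Lemma slice_cdiff (z : Cd d) : cdiff (fun w => G (ffcons w z)).
Proof.
have := hG.2 (ffcons 0 z) ord0; congr cdiff; apply/funext => w; by rewrite ffcons_upd0.
Qed.
Lemma slice_per (z : Cd d) w : G (ffcons (w + 1) z) = G (ffcons w z).
Proof. by have := pG (ffcons w z) ord0; rewrite ffcons_upd0 ffcons0. Qed.
Lemma Tz_sum z w : casum (fun m => Tz m z * ez m w) /\
 G (ffcons w z) = csum (fun m => Tz m z * ez m w).
Proof.
by split; [exact: (hc_casum (slice_cdiff z) (slice_per z))|
 exact: (hc_sum (slice_cdiff z) (slice_per z))].
Qed.
Lemma Tz_bound m z y M : (forall x, 0 <= x <= 1 -> cabs (G (ffcons (x +i* y) z)) <= M) ->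
 cabs (Tz m z) <= 2 * M * expR (2 * pi * m%:~R * y).
Proof. exact: (hc_bound (slice_cdiff z) (slice_per z)). Qed.

Lemma cabs_le1_ri (x y : R) : 0 <= x <= 1 -> cabs (x +i* y) <= 1 + `|y|.
Proof.
move=> /andP[x0 x1]; apply: le_trans (cabs_ReIm _) _; rewrite /= lerD2r ger0_norm //.
Qed.
Lemma cabs_ffcons r w (z : Cd d) : cabs w <= r -> (forall j, cabs (z j) <= r) ->
 forall j, cabs ((ffcons w z : Cd d.+1) j) <= r.
Proof. by move=> h1 h2 j; case: (unliftP ord0 j) => [k|] ->; rewrite ?ffconsS ?ffcons0. Qed.

Lemma dcont_Tz m : dcont (Tz m).
Proof.
move=> z l zl; have [M hM] := dcvg_bounded zl.
have [K hK] := dcont_locbounded (Num.max M 1) hG.1.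
apply: (lint_dct (measurable_itv _) (g := fun=> K)).
- by move=> n; apply: rcontM; [exact: rcont_slice|exact: rcont_ezR].
- by apply: rcontM; [exact: rcont_slice|exact: rcont_ezR].
- exact: ign_cst.
- move=> n; apply: in_seg => x /andP[x0 x1]; rewrite cabsM cabs_ezR mulr1; apply: hK.
 apply: cabs_ffcons => [|j]; rewrite le_max ?hM // cabsR ger0_norm // x1 orbT //.
- move=> x _; apply: ccvgM; last exact: ccvg_cst.
 by apply: hG.1; apply: dcvg_cons => //; exact: ccvg_cst.
Qed.

(** Differentiation under the integral is avoided: in the variable [j] the integrand is itself a
    Fourier series with rapidly decreasing coefficients, and integrating it termwise gives another
    such series, holomorphic by [cdiff_ezsum]. *)
Lemma sephol_Tz m : sephol (Tz m).
Proof.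
split=> [|z j]; first exact: dcont_Tz.
have cg x : cdiff (fun w => G (ffcons x%:C (upd z j w))).
 have := hG.2 (ffcons x%:C z) (lift ord0 j); congr cdiff.
 by apply/funext => w; rewrite ffcons_updS.
have pg (x : R) w : G (ffcons x%:C (upd z j (w + 1))) = G (ffcons x%:C (upd z j w)).
 have := pG (ffcons x%:C (upd z j w)) (lift ord0 j).
 by rewrite ffcons_updS ffconsS updE eqxx upd_upd.
pose b n (x : R) := hc (fun w => G (ffcons x%:C (upd z j w))) n.
have [Z hZ] : exists Z, forall i, cabs (z i) <= Z.
 exists (\sum_i cabs (z i)) => i; rewrite (bigD1 i) //= lerDl sumr_ge0 // => k _.
 exact: cabs_ge0.
have cb n : rcont (b n).
 move=> v l vl; have [V hV] := ccvg_bounded (ccvg_real vl).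
 have [K hK] := dcont_locbounded (Num.max (Num.max V 1) Z) hG.1.
 apply: (lint_dct (measurable_itv _) (g := fun=> K)).
 - by move=> k; apply: rcontM; [exact: (rcont_line 0 (cg _))|exact: rcont_ezR].
 - by apply: rcontM; [exact: (rcont_line 0 (cg _))|exact: rcont_ezR].
 - exact: ign_cst.
 - move=> k; apply: in_seg => x /andP[x0 x1]; rewrite cabsM cabs_ezR mulr1; apply: hK.
  apply: cabs_ffcons => [|i]; first by rewrite !le_max hV.
  rewrite updE; case: eqP => _; last by rewrite le_max hZ orbT.
  by rewrite cabsR ger0_norm // !le_max x1 orbT.
 - move=> x _; apply: ccvgM; last exact: ccvg_cst.
  by apply: hG.1; apply: dcvg_cons; [exact: dcvg_cst|exact: ccvg_real].
have bB c : exists M, forall n x, 0 <= x <= 1 -> cabs (b n x) <= M * expR (- (c * `|n|%:~R)).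
 (* The heights [y] and [- y] with [2 pi y = c] give the decay [exp (- c |n|)], one for each sign of
    [n]. *)
 pose y := c / (2 * pi).
 have yE : 2 * pi * y = c by rewrite /y mulrC divfK // gt_eqF // mulr_gt0 // pi_gt0.
 have [K hK] := dcont_locbounded (Num.max (1 + `|y|) Z) hG.1.
 have B s : `|s| = `|y| -> forall x, 0 <= x <= 1 -> forall t, 0 <= t <= 1 ->
   cabs (G (ffcons x%:C (upd z j (t +i* s)))) <= K.
  move=> sy x x01 t t01; apply: hK; apply: cabs_ffcons => [|i].
   rewrite le_max (_ : x%:C = x +i* 0) // (le_trans (cabs_le1_ri _ x01)) //.
   by rewrite normr0 lerD2l.
  rewrite updE; case: eqP => _; last by rewrite le_max hZ orbT.
  by rewrite le_max -sy cabs_le1_ri.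
 exists (2 * K) => n x x01; have [n0|n0] := leP 0 n.
  have := hc_bound (cg x) (pg x) n (B (- y) (normrN _) x x01).
  rewrite (ger0_norm n0); have -> // : 2 * pi * n%:~R * - y = - (c * n%:~R).
  by rewrite -yE; ring.
 have := hc_bound (cg x) (pg x) n (B y erefl x x01).
 rewrite (ltr0_norm n0) mulrNz mulrN opprK; have -> // : 2 * pi * n%:~R * y = c * n%:~R.
 by rewrite -yE; ring.
pose be n := seg 0 1 (fun x => b n x * ez (- m) x%:C).
have hbe c : exists M, forall n, cabs (be n) <= M * expR (- (c * `|n|%:~R)).
 have [M hM] := bB c; exists (2 * M) => n.
 have := @seg_bound _ 0 1 _ (M * expR (- (c * `|n|%:~R))) ler01 (rcontM (cb n) (rcont_ezR (- m))).
 by rewrite subr0 mulr1 mulrA; apply => x x01; rewrite cabsM cabs_ezR mulr1; exact: hM.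
have [aS cS] := cdiff_ezsum hbe.
rewrite (_ : (fun w => _) = (fun w => csum (fun n => be n * ez n w))) //.
apply/funext => w; rewrite /Tz.
have [M hM] := bB (2 * pi * `|Im w| + 1).
have e1 x : G (ffcons x%:C (upd z j w)) = csum (fun n => b n x * ez n w) :=
 hc_sum (cg x) (pg x) w.
have cF n : rcont (fun x => ez n w * (b n x * ez (- m) x%:C)).
 by apply: rcontM; [exact: rcont_cst|apply: rcontM => //; exact: rcont_ezR].
have E x : G (ffcons x%:C (upd z j w)) * ez (- m) x%:C =
  csum (fun n => ez n w * (b n x * ez (- m) x%:C)).
 rewrite e1 -csumZr; last exact: (hc_casum (cg x) (pg x) w).
 by apply: eq_csum => n; ring.
under eq_fun do rewrite E.
have r1 : rasum (fun n : int => `|M| * expR (- (1 * `|n|%:~R))).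
 by apply: rasumZ => //; exact: rasum_int_exp.
have r2 (n : int) : 0 <= `|M| * expR (- (1 * `|n|%:~R)) by rewrite mulr_ge0 ?expR_ge0.
have r3 n x : `[0, 1]%classic x -> cabs (ez n w * (b n x * ez (- m) x%:C)) <=
  `|M| * expR (- (1 * `|n|%:~R)) * 1.
 move: x; apply: in_seg => x x01.
 have -> : cabs (ez n w * (b n x * ez (- m) x%:C)) = cabs (ez n w) * cabs (b n x).
  move: (b n x) => y.
  rewrite [LHS](cabsM (ez n w)).
  congr (_ * _).
  rewrite [LHS](cabsM y).
  rewrite (cabs_ezR (- m) x).
  exact: mulr1.
 rewrite [leRHS]mulr1 [1 * _]mul1r.
 apply: le_trans (ler_pM (cabs_ge0 _) (cabs_ge0 _) (ez_le n w) (hM n x x01)) _.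
 rewrite mulrCA -expRD; apply: le_trans (ler_wpM2r (expR_ge0 _) (ler_norm M)) _.
 by apply: ler_wpM2l => //; rewrite ler_expR; lra.
have r4 : rcont (fun x => csum (fun n => ez n w * (b n x * ez (- m) x%:C))).
 by under eq_fun do rewrite -E; apply: rcontM; [exact: rcont_slice|exact: rcont_ezR].
have L := lint_csum (measurable_itv `[0, 1]) cF (ign_cst 0 1 1) (fun=> ltr01) r1 r2 r3 r4.
rewrite [LHS]L.2; apply: eq_csum => n; rewrite -/(seg 0 1 _).
by rewrite (segZ _ ler01 (rcontM (cb n) (rcont_ezR _))) mulrC.
Qed.

Lemma perd_Tz m : perd (Tz m).
Proof.
move=> z j; rewrite /Tz; congr seg; apply/funext => x; congr (_ * _).
by have := pG (ffcons x%:C z) (lift ord0 j); rewrite ffcons_updS ffconsS.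
Qed.
End Slice.

Fixpoint fc d : (Cd d -> C) -> {ffun 'I_d -> int} -> C :=
 if d is d'.+1 then fun G m => fc (Tz G (m ord0)) (fftail m)
 else fun G _ => G [ffun => 0].

Definition ezd d (m : {ffun 'I_d -> int}) (z : Cd d) : C := \prod_j ez (m j) (z j).

Lemma fc_bound d (G : Cd d -> C) (m : {ffun 'I_d -> int}) (eta : 'I_d -> R) (M : R) : sephol G -> perd G ->
 (forall z : Cd d, (forall j, 0 <= Re (z j) <= 1 /\ Im (z j) = eta j) ->
   cabs (G z) <= M) ->
 cabs (fc G m) <= 2 ^+ d * M * expR (2 * pi * \sum_j (m j)%:~R * eta j).
Proof.
elim: d G m eta M => [|d IH] G m eta M hG pG GM /=.
 by rewrite big_ord0 mulr0 expR0 mulr1 mul1r; apply: GM => -[].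
have := IH _ (fftail m) (fun j => eta (lift ord0 j)) (2 * M * expR (2 * pi * (m ord0)%:~R * eta ord0))
 (sephol_Tz hG pG (m ord0)) (perd_Tz pG (m ord0)).
have -> : \sum_j (fftail m j)%:~R * eta (lift ord0 j) =
  \sum_(i < d) (m (lift ord0 i))%:~R * eta (lift ord0 i).
 by apply: eq_bigr => i _; rewrite ffunE.
have -> : 2 * pi * (\sum_(j < d.+1) (m j)%:~R * eta j) = 2 * pi * ((m ord0)%:~R * eta ord0) +
  2 * pi * \sum_(i < d) (m (lift ord0 i))%:~R * eta (lift ord0 i).
 by rewrite big_ord_recl mulrDr.
rewrite expRD.
set S := expR (2 * pi * \sum_(i < d) _) => h.
rewrite [2 * pi * (_ * eta ord0)]mulrA.
have -> : 2 ^+ d.+1 * M * (expR (2 * pi * (m ord0)%:~R * eta ord0) * S) =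
 2 ^+ d * (2 * M * expR (2 * pi * (m ord0)%:~R * eta ord0)) * S.
 by rewrite exprS; ring.
apply: h => z hz; apply: Tz_bound => // x x01; apply: GM => j.
by case: (unliftP ord0 j) => [k|] ->; rewrite ?ffconsS ?ffcons0 //; exact: hz.
Qed.

(** [fc_bound] holds for every choice of heights, so each coordinate gets the height whose sign
    makes its factor small. *)
Lemma fc_decay d (G : Cd d -> C) c : sephol G -> perd G ->
 exists M, forall m, cabs (fc G m) <= M * \prod_j expR (- (c * `|m j|%:~R)).
Proof.
move=> hG pG; pose y := `|c| / (2 * pi).
have p0 : 0 < 2 * pi :> R by rewrite mulr_gt0 // pi_gt0.
have yE : 2 * pi * y = `|c| by rewrite /y mulrC divfK // gt_eqF.
have y0 : 0 <= y by rewrite divr_ge0 // ltW.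
have [K hK] := dcont_locbounded (1 + y) hG.1.
exists (2 ^+ d * `|K|) => m.
pose eta j := if 0 <= m j then - y else y.
have := @fc_bound d G m eta K hG pG.
have -> : 2 * pi * (\sum_j (m j)%:~R * eta j) = \sum_j - (`|c| * `|m j|%:~R).
 rewrite mulr_sumr; apply: eq_bigr => j _; rewrite /eta -yE.
 case: (leP 0 (m j)) => m0; first by rewrite (ger0_norm m0); ring.
 by rewrite (ltr0_norm m0) mulrNz; ring.
move=> h; apply: le_trans (h _) _.
 move=> z hz; apply: hK => j; rewrite [z j]cE; have [h1 ->] := hz j.
 apply: le_trans (cabs_le1_ri _ h1) _; rewrite lerD2l /eta.
 by case: ifP; rewrite ?normrN ger0_norm.
rewrite expR_sum; apply: ler_pM.
- rewrite mulr_ge0 ?exprn_ge0 //; apply: le_trans (cabs_ge0 (G [ffun => 0])) _; apply: hK => j.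
 by rewrite ffunE cabs0 addr_ge0.
- by apply: prodr_ge0 => j _; exact: expR_ge0.
- by apply: ler_wpM2l; rewrite ?exprn_ge0 ?ler_norm.
apply: ler_prod => j _; rewrite expR_ge0 ler_expR lerN2 /=.
by apply: ler_wpM2r; rewrite ?ler0z ?ler_norm.
Qed.

Lemma fc_sum d (G : Cd d -> C) z : sephol G -> perd G ->
 casum (fun m => fc G m * ezd m z) /\ G z = csum (fun m => fc G m * ezd m z).
Proof.
move=> hG pG.
have aS : casum (fun m => fc G m * ezd m z).
 have p0 : 0 <= 2 * pi :> R by rewrite mulr_ge0 // pi_ge0.
 have [M hM] := fc_decay (\sum_j 2 * pi * `|Im (z j)| + 1) hG pG.
 have e1 (j : 'I_d) : casum (fun m : int => (expR (- (1 * `|m|%:~R)) : R)%:C).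
  by apply: casum_real; [exact: rasum_int_exp|move=> m; exact: expR_ge0].
 have [a1 _] := csum_prod e1.
 apply: rasum_le (rasumZ (normr_ge0 M) a1) => m.
 rewrite cabsM cabs_prod; under [in leRHS]eq_bigr do rewrite mul1r.
 rewrite cabs_prod; under [in leRHS]eq_bigr do rewrite cabsR ger0_norm ?expR_ge0 //.
 apply: le_trans (ler_wpM2r _ (hM m)) _; first by apply: prodr_ge0 => j _; exact: cabs_ge0.
 rewrite -mulrA -big_split /=; apply: le_trans (ler_wpM2r _ (ler_norm M)) _.
  by apply: prodr_ge0 => j _; rewrite mulr_ge0 ?expR_ge0 ?cabs_ge0.
 apply: ler_wpM2l => //; apply: ler_prod => j _; rewrite mulr_ge0 ?expR_ge0 ?cabs_ge0 //=.
 apply: le_trans (ler_wpM2l (expR_ge0 _) (ez_le _ _)) _; rewrite -expRD ler_expR.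
 rewrite (bigD1 j) //=; set S := \sum_(i | _) _.
 have S0 : 0 <= S by apply: sumr_ge0 => i _; rewrite mulr_ge0.
 have m0 : 0 <= `|m j|%:~R :> R by rewrite ler0z.
 have := mulr_ge0 S0 m0; lra.
split=> //; elim: d G z hG pG aS => [|d IH] G z hG pG aS.
 rewrite (@csum1 _ _ _ (ffun0 (card_ord 0))); last first.
  by move=> m /eqP []; apply/ffunP => -[].
 rewrite /ezd big_ord0 mulr1 /=; congr G; by apply/ffunP => -[].
have hT m := IH _ (fftail z) (sephol_Tz hG pG m) (perd_Tz pG m).
have [t1 t2] := Tz_sum hG pG (fftail z) (z ord0).
have E (x : int * {ffun 'I_d -> int}) : fc G (ffcons x.1 x.2) * ezd (ffcons x.1 x.2) z =
  ez x.1 (z ord0) * (fc (Tz G x.1) x.2 * ezd x.2 (fftail z)).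
 rewrite /= ffcons0 ffconsK /ezd big_ord_recl ffcons0 mulrCA; congr (_ * (_ * _)).
 by apply: eq_bigr => j _; rewrite ffconsS ffunE.
have [k k1 k2] := @ffcons_bij int d.
have aE : casum (fun x : int * {ffun 'I_d -> int} =>
  ez x.1 (z ord0) * (fc (Tz G x.1) x.2 * ezd x.2 (fftail z))).
 by apply: rasum_le (rasum_inj (can_inj k1) aS) => x; rewrite -E.
have aT m : casum (fun m' => fc (Tz G m) m' * ezd m' (fftail z)).
 have := casumZ (ez m (z ord0))^-1 (rasum_pair1 m (fun x => cabs_ge0 _) aE).
 by apply: rasum_le => m'; rewrite mulrA mulVf ?cexp_neq0 // mul1r.
rewrite -(csum_bij (@ffcons_bij int d) aS) (eq_csum E) (csum_pair aE).
rewrite -{1}[z]ffcons_eta t2; apply: eq_csum => m /=.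
by rewrite (hT m (aT m)) csumZ // mulrC.
Qed.

Lemma fcZ d (G : Cd d -> C) c m : sephol G -> perd G -> fc (fun z => c * G z) m = c * fc G m.
Proof.
elim: d G m => [|d IH] G m hG pG //=.
rewrite -IH; [|exact: sephol_Tz|exact: perd_Tz]; congr fc; apply/funext => z; rewrite /Tz.
rewrite -(segZ _ ler01 (rcontM (rcont_slice hG _) (rcont_ezR _))); congr seg.
by apply/funext => x; rewrite mulrA.
Qed.

(** Moving the contour in each variable: an imaginary translation multiplies a coefficient by a
    value of its exponential. Together with [fc_mul] it turns the quasi-periodicity of theta into a
    recursion for its coefficients. *)
Lemma fc_shift d (G : Cd d -> C) (eta : 'I_d -> R) m : sephol G -> perd G ->
 fc (fun z => G [ffun j => z j + (0 +i* eta j)]) m =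
 (\prod_j ez (m j) (0 +i* eta j)) * fc G m.
Proof.
elim: d G eta m => [|d IH] G eta m hG pG /=.
 by rewrite big_ord0 mul1r; congr G; apply/ffunP => -[].
rewrite big_ord_recl -mulrA.
have -> : \prod_(i < d) ez (m (lift ord0 i)) (0 +i* eta (lift ord0 i)) =
  \prod_i ez (fftail m i) (0 +i* eta (lift ord0 i)).
 by apply: eq_bigr => i _; rewrite ffunE.
rewrite -(IH _ (fun i => eta (lift ord0 i))); [|exact: sephol_Tz|exact: perd_Tz].
rewrite -fcZ; last 2 first.
- split=> [z l zl|z j].
  apply: (dcont_Tz hG) => i; rewrite !ffunE; under eq_fun do rewrite !ffunE.
  by apply: ccvgD; [exact: zl|exact: ccvg_cst].
 have cT := (sephol_Tz hG pG (m ord0)).2 [ffun i => z i + (0 +i* eta (lift ord0 i))] j.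
 move=> w; have := cT (w + (0 +i* eta (lift ord0 j))) => -[L hL]; exists L => e /hL[del [d0 hd]].
 have E v : [ffun i => upd z j v i + (0 +i* eta (lift ord0 i))] =
   upd [ffun i => z i + (0 +i* eta (lift ord0 i))] j (v + (0 +i* eta (lift ord0 j))).
  by apply/ffunP => i; rewrite !ffunE; case: eqP => [->|].
 by exists del; split=> // h h0 hh; rewrite !E (addrAC w h); exact: hd.
- move=> z j; rewrite -[RHS](perd_Tz pG _ _ j); congr Tz.
 by apply/ffunP => i; rewrite !ffunE; case: eqP => [->|] //; ring.
congr fc; apply/funext => z; rewrite /Tz.
set z' := [ffun j => z j + (0 +i* eta (lift ord0 j))].
have := hc_shift (slice_cdiff hG z') (slice_per pG z') (m ord0) (eta ord0).
rewrite /hc => ->; rewrite -segZ ?ler01 //; last first.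
 exact: (rcont_hc (slice_cdiff hG z')).
congr seg; apply/funext => x.
have e : ez (m ord0) (0 +i* eta ord0) * ez (- m ord0) (x +i* eta ord0) = ez (- m ord0) x%:C.
 have -> : x +i* eta ord0 = x%:C + (0 +i* eta ord0).
  by apply: ceq; rewrite ?ReD ?ImD /= ?addr0 ?add0r.
 by rewrite ezDr [LHS]mulrCA -ezDl subrr ez0 mulr1.
rewrite -e; set A := ez _ _; set B := ez _ _; rewrite [RHS]mulrCA; congr (_ * _).
congr G; apply/ffunP => i; rewrite ffunE; case: (unliftP ord0 i) => [j|] ->.
 by rewrite !ffconsS ffunE.
by rewrite !ffcons0; apply: ceq; rewrite ?ReD ?ImD /= ?addr0 ?add0r.
Qed.

Lemma fc_mul d (G : Cd d -> C) j m : sephol G -> perd G ->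
 fc (fun z => ez (- 1) (z j) * G z) m = fc G [ffun i => m i + (i == j)%:Z].
Proof.
elim: d G j m => [|d IH] G j m hG pG; first by case: j.
case: (unliftP ord0 j) => [k|] -> /=.
 have -> : fftail [ffun i => m i + (i == lift ord0 k)%:Z] = [ffun i => fftail m i + (i == k)%:Z].
  by apply/ffunP => i; rewrite !ffunE (inj_eq lift_inj).
 rewrite ffunE (negbTE (neq_lift _ _)) addr0 -IH; [|exact: sephol_Tz|exact: perd_Tz].
 congr fc; apply/funext => z; rewrite /Tz.
 rewrite -(segZ _ ler01 (rcontM (rcont_slice hG _) (rcont_ezR _))); congr seg.
 by apply/funext => x; rewrite ffconsS mulrA.
rewrite ffunE eqxx; congr (fc _ _).
 apply/funext => z; rewrite /Tz; congr seg; apply/funext => x; rewrite ffcons0 mulrAC mulrC.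
 by rewrite -ezDl opprD addrC.
by apply/ffunP => i; rewrite !ffunE eq_sym (negbTE (neq_lift _ _)) addr0.
Qed.

(** Polar form: the angle is an [acos], up to the sign dictated by the sine, and the modulus enters
    through [ln]. *)
Lemma ez_surj (w : C) : w != 0 -> exists z, w = ez 1 z.
Proof.
move=> w0; have c0 := cabs_gt0 w0; pose r := cabs w; pose a := Re w / r.
have h1 : a ^+ 2 + (Im w / r) ^+ 2 = 1.
 rewrite /a !exprMn -mulrDl exprVn -/(cabs2 w) -cabs_sqr divff //.
 by rewrite expf_neq0 // gt_eqF.
have a1 : -1 <= a <= 1.
 rewrite -ler_norml -(@ler_pXn2r _ 2) ?nnegrE // expr1n real_normK ?num_real //.
 by rewrite -h1 lerDl sqr_ge0.
have [t [ct st]] : exists t, cos t = a /\ sin t = Im w / r.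
 have ca : cos (acos a) = a by rewrite acosK // in_itv.
 have sa : sin (acos a) ^+ 2 = (Im w / r) ^+ 2.
  have := cos2Dsin2 (acos a); rewrite ca => h; apply: (addrI (a ^+ 2)); by rewrite h h1.
 have /eqP := sa; rewrite eqf_sqr => /orP[/eqP s|/eqP s].
  by exists (acos a).
 by exists (- acos a); rewrite cosN sinN s opprK.
exists ((t / (2 * pi)) +i* (- (ln r / (2 * pi)))).
have p0 : 2 * pi != 0 :> R by rewrite mulf_neq0 // ?pnatr_eq0 // gt_eqF // pi_gt0.
rewrite /ez mulr1.
have -> : (0 +i* (2 * pi)) * ((t / (2 * pi)) +i* (- (ln r / (2 * pi)))) = (ln r +i* t) :> C.
 apply: ceq; rewrite ?ReM ?ImM /= !mul0r ?sub0r ?add0r ?mulrN ?opprK.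
  by rewrite mulrC divfK.
 by rewrite mulrC divfK.
rewrite /cexp /= lnK ?posrE // ct st; apply: ceq; rewrite ?ReM ?ImM /= mul0r ?subr0 ?addr0.
 by rewrite mulrC divfK // gt_eqF.
by rewrite mulrC divfK // gt_eqF.
Qed.

Lemma cdiff_comp_at (H g : C -> C) w : cdifferentiable_at H (g w) -> cdifferentiable_at g w ->
 cdifferentiable_at (H \o g) w.
Proof.
move=> cH ce; have [L hL] := (cdiff_seqP H (g w)).1 cH; have [M hM] := (cdiff_seqP _ _).1 ce.
apply/cdiff_seqP; exists (L * M) => v v0 cv.
pose k n := g (w + v n) - g w.
(* The increments of g may vanish; there 1/(n+1) replaces them. *)
pose k' n : C := if k n == 0 then (n.+1%:R^-1 : R)%:C else k n.
have ck : ccvg k 0.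
 rewrite -(subrr (g w)); apply: ccvgB; last exact: ccvg_cst.
 by apply: cdiff_ccvg ce _; rewrite -[X in ccvg _ X]addr0; apply: ccvgD => //; exact: ccvg_cst.
have k'0 n : k' n != 0.
 by rewrite /k'; case: ifP => [_|/negbT //]; rewrite -cabs_eq0 cabsR normr_eq0 invr_eq0 pnatr_eq0.
have ck' : ccvg k' 0.
 apply: (ccvg_squeeze (b := fun n => cabs (k n) + n.+1%:R^-1)).
  move=> n; rewrite subr0 /k'; case: ifP => [/eqP ->|_]; last by rewrite lerDl invr_ge0.
  by rewrite cabs0 add0r cabsR ger0_norm // invr_ge0.
 rewrite -[X in _ --> X](addr0 0); apply: cvgD; last exact: cvg_harmonic.
 by have := ccvg_cabs ck; rewrite cabs0.
rewrite (_ : (fun n => _) = (fun n => (H (g w + k' n) - H (g w)) / k' n *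
  ((g (w + v n) - g w) / v n))).
 by apply: ccvgM; [exact: hL|exact: hM].
apply/funext => n /=; rewrite -/(k n); have [k0|k0] := eqVneq (k n) 0.
 rewrite k0 mul0r mulr0; have -> : g (w + v n) = g w by apply/eqP; rewrite -subr_eq0 -/(k n) k0.
 by rewrite subrr mul0r.
rewrite /k' (negbTE k0); have -> : g (w + v n) = g w + k n by rewrite /k [RHS]addrC -addrA addNr addr0.
by rewrite mulrA divfK.
Qed.

Definition mon d (m : {ffun 'I_d -> nat}) (z : Cd d) : C := \prod_j z j ^+ m j.
Definition rpow d (m : {ffun 'I_d -> nat}) (r : R) : R := \prod_(j < d) r ^+ m j.
Definition summ d (b : {ffun 'I_d -> nat} -> C) :=
 forall r, 0 <= r -> rasum (fun m => cabs (b m) * rpow m r).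
Definition powsum d (b : {ffun 'I_d -> nat} -> C) (z : Cd d) := csum (fun m => b m * mon m z).

Lemma cabs_mon d (m : {ffun 'I_d -> nat}) (z : Cd d) r : (forall j, cabs (z j) <= r) ->
 cabs (mon m z) <= rpow m r.
Proof.
move=> zr; rewrite /mon cabs_prod; apply: ler_prod => j _; rewrite cabs_ge0 cabsX /=.
have r0 : 0 <= r by apply: le_trans (zr j); exact: cabs_ge0.
by rewrite lerXn2r ?nnegrE ?cabs_ge0.
Qed.
Lemma Cd_bound d (z : Cd d) : exists2 r, 0 <= r & forall j, cabs (z j) <= r.
Proof.
exists (\sum_j cabs (z j)) => [|j]; first by apply: sumr_ge0 => j _; exact: cabs_ge0.
by rewrite (bigD1 j) //= lerDl sumr_ge0 // => k _; exact: cabs_ge0.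
Qed.
Lemma powsum_casum d (b : {ffun 'I_d -> nat} -> C) z : summ b -> casum (fun m => b m * mon m z).
Proof.
move=> hb; have [r r0 hr] := Cd_bound z; apply: rasum_le (hb r r0) => m.
by rewrite cabsM ler_wpM2l ?cabs_ge0 // cabs_mon.
Qed.
Lemma dcont_powsum d (b : {ffun 'I_d -> nat} -> C) : summ b -> dcont (powsum b).
Proof.
move=> hb z l zl; have [M hM] := dcvg_bounded zl.
apply: (csum_dct (g := fun m => cabs (b m) * rpow m `|M|)); first exact: hb.
 move=> n m; rewrite cabsM ler_wpM2l ?cabs_ge0 // cabs_mon // => j.
 exact: le_trans (hM n j) (ler_norm _).
move=> m; apply: ccvgM; first exact: ccvg_cst.
by apply: ccvg_prod => j; apply: ccvgX; exact: zl.
Qed.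

(** For radius [r] the decay rate [c = ln (2 max(r, 1))] beats [r] by a factor [1/2] per degree,
    leaving a product of geometric series. *)
Lemma geom_prod d (b : {ffun 'I_d -> nat} -> C) :
 (forall c : R, exists M, forall m, cabs (b m) <= M * \prod_j expR (- (c * (m j)%:R))) -> summ b.
Proof.
move=> hb r r0; pose r' := Num.max r 1; have r'0 : 0 < 2 * r' by rewrite mulr_gt0 // lt_max ltr01 orbT.
have [M hM] := hb (ln (2 * r')).
have e1 (j : 'I_d) : casum (fun n : nat => ((2^-1 : R) ^+ n)%:C : C).
 apply: casum_real => [|n]; last by rewrite exprn_ge0 // invr_ge0.
 by apply: rasum_geom; rewrite invr_ge0 ler0n /= invf_lt1 // ltr1n.
have [a1 _] := csum_prod e1; apply: rasum_le (rasumZ (normr_ge0 M) a1) => m.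
rewrite cabs_prod; apply: le_trans (ler_wpM2r _ (hM m)) _.
 by apply: prodr_ge0 => j _; exact: exprn_ge0.
rewrite -mulrA -big_split /=; apply: le_trans (ler_wpM2r _ (ler_norm M)) _.
 by apply: prodr_ge0 => j _; rewrite mulr_ge0 ?expR_ge0 ?exprn_ge0.
apply: ler_wpM2l => //; apply: ler_prod => j _.
rewrite mulr_ge0 ?expR_ge0 ?exprn_ge0 //= cabsR ger0_norm ?exprn_ge0 ?invr_ge0 //.
have -> : ln (2 * r') * (m j)%:R = (m j)%:R * ln (2 * r') by rewrite mulrC.
rewrite -mulrN expRM_natl expRN lnK ?posrE // -exprMn lerXn2r ?nnegrE ?invr_ge0 //.
 by rewrite mulr_ge0 // invr_ge0 ltW.
rewrite invfM -mulrA ler_piMr ?invr_ge0 //.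
by rewrite mulrC ler_pdivrMr ?lt_max ?ltr01 ?orbT // mul1r le_max lexx.
Qed.

Section Expansion.
Variables (d : nat) (F : Cd d -> C).
Hypothesis hF : sephol F.

Let Ge (z : Cd d) := F [ffun j => ez 1 (z j)].

Lemma sephol_Ge : sephol Ge /\ perd Ge.
Proof.
have E z j w : [ffun i => ez 1 (upd z j w i)] = upd [ffun i => ez 1 (z i)] j (ez 1 w).
 by apply/ffunP => i; rewrite !ffunE; case: eqP.
split; [split|].
- move=> z l zl; apply: hF.1 => j; rewrite ffunE; under eq_fun do rewrite ffunE.
 exact: (cdiff_ccont (@cdiff_ez R 1) (zl j)).
- move=> z j w; rewrite /Ge.
 have := hF.2 [ffun i => ez 1 (z i)] j (ez 1 w); set H := fun w => F _ => cH.
 have := @cdiff_ez R 1 w; rewrite (_ : (fun v => F [ffun i => ez 1 (upd z j v i)]) = H \o ez 1); last first.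
  by apply/funext => v; rewrite E.
 by move=> ce; exact: (@cdiff_comp_at H (ez 1) w cH ce).
move=> z j; rewrite /Ge E ez_per; congr F; apply/ffunP => i; rewrite !ffunE.
by case: eqP => [->|].
Qed.

(** Composition with [exp (2 pi i z)] in each variable gives a periodic entire function whose
    Fourier series is the Laurent series of [F] off the coordinate hyperplanes; boundedness of [F]
    near 0 removes the negative exponents. *)
Theorem power_series : exists b, summ b /\ forall z, F z = powsum b z.
Proof.
have [hG pG] := sephol_Ge.
pose zz (m : {ffun 'I_d -> nat}) : {ffun 'I_d -> int} := [ffun j => Posz (m j)].
pose b m := fc Ge (zz m).
have sb : summ b.
 apply: geom_prod => c; have [M hM] := fc_decay c hG pG; exists M => m.
 by have := hM (zz m); under eq_bigr do rewrite ffunE; apply.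
have neg (m : {ffun 'I_d -> int}) : (forall n, zz n <> m) -> fc Ge m = 0.
 move=> hm; have [j mj] : exists j, m j < 0.
  apply: contrapT => hn; apply: (hm [ffun j => absz (m j)]).
  apply/ffunP => j; rewrite !ffunE gez0_abs // leNgt; apply/negP => mj; by apply: hn; exists j.
 have [K hK] := dcont_locbounded 1 hF.1.
 have p0 : 0 < 2 * pi :> R by rewrite mulr_gt0 // pi_gt0.
 (* Height [t / (2 pi)] in the variable with negative index and 0 elsewhere: the points stay in the
    closed unit polydisc, where [F] is bounded, while the exponential factor decays with [t]. *)
 have bd t : 0 <= t -> cabs (fc Ge m) <= 2 ^+ d * K * expR (- t).
  move=> t0; pose eta i := if i == j then t / (2 * pi) else 0 : R.
  have := @fc_bound _ Ge m eta K hG pG.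
  have -> : \sum_i (m i)%:~R * eta i = (m j)%:~R * (t / (2 * pi)).
   rewrite (bigD1 j) //= /eta eqxx big1 ?addr0 // => i /negbTE ->; by rewrite mulr0.
  move=> h; apply: le_trans (h _) _.
   move=> z hz; apply: hK => i; rewrite ffunE cabs_ez -[leRHS]expR0 ler_expR oppr_le0.
   rewrite (hz i).2 /eta mulr1; apply: mulr_ge0; first exact: ltW.
   by case: (i == j) => //; apply: divr_ge0 => //; exact: ltW.
  apply: ler_wpM2l.
   rewrite mulr_ge0 ?exprn_ge0 //; apply: le_trans (cabs_ge0 (F [ffun => 0])) _; apply: hK => i.
   by rewrite ffunE cabs0.
  rewrite ler_expR; have -> : 2 * pi * ((m j)%:~R * (t / (2 * pi))) = (m j)%:~R * t.
   by rewrite mulrCA; congr (_ * _); rewrite mulrC divfK // gt_eqF.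
  rewrite -mulN1r; apply: ler_wpM2r => //; rewrite (_ : -1 = (-1)%:~R :> R) ?ler_int; last by rewrite rmorphN1.
  by move: (m j) mj => k; lia.
 apply/eqP; rewrite -cabs_eq0; apply: contraT => n0.
 have c0 : 0 < cabs (fc Ge m) by rewrite lt_def n0 cabs_ge0.
 pose K' := `|2 ^+ d * K| + 1; have K'0 : 0 < K' by rewrite ltr_wpDl.
 have := bd `|ln (2 * K' / cabs (fc Ge m))| (normr_ge0 _).
 have h1 : expR (- `|ln (2 * K' / cabs (fc Ge m))|) <= cabs (fc Ge m) / (2 * K').
  rewrite -[leRHS]lnK ?posrE ?divr_gt0 ?mulr_gt0 // ler_expR -invf_div lnV ?posrE ?divr_gt0 ?mulr_gt0 //.
  by rewrite normrN lerNl -normrN ler_norm.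
 move=> h2; have := le_trans h2 (ler_wpM2r (expR_ge0 _) (ler_norm (2 ^+ d * K))).
 move=> h3; have := le_trans h3 (ler_wpM2l (normr_ge0 _) h1).
 have : `|2 ^+ d * K| * (cabs (fc Ge m) / (2 * K')) <= cabs (fc Ge m) / 2.
  have K0 : K' != 0 by rewrite gt_eqF.
  have e : cabs (fc Ge m) / 2 = K' * (cabs (fc Ge m) / (2 * K')).
   by move: (cabs _) (K') K0 => x y y0; field.
  rewrite e; apply: ler_wpM2r; last by rewrite /K' lerDl.
  by rewrite divr_ge0 ?cabs_ge0 // mulr_ge0 // ltW.
 by lra.
exists b; split=> // z.
have nz (w : Cd d) : (forall j, w j != 0) -> F w = powsum b w.
 move=> w0; have /choice[v hv] j := ez_surj (w0 j).
 have wE : w = [ffun j => ez 1 (([ffun j => v j] : Cd d) j)].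
  by apply/ffunP => j; rewrite !ffunE.
 have [a1 e1] := fc_sum ([ffun j => v j] : Cd d) hG pG.
 rewrite {1}wE -/(Ge _) e1 -(csum_inj (h := zz)) //.
 - apply: eq_csum => m; congr (_ * _); apply: eq_bigr => j _; rewrite !ffunE hv.
  by elim: (m j) => [|n IH]; [rewrite ez0|rewrite exprS -IH -ezDl].
 - by move=> m m' /ffunP e; apply/ffunP => j; have := e j; rewrite !ffunE => -[].
 - by move=> m hm; rewrite neg ?mul0r // => n /hm.
(* Vanishing coordinates have no logarithm; they are approached by [1 / (n + 1)], both sides being
   continuous. *)
pose w n : Cd d := [ffun j => if z j == 0 then (n.+1%:R^-1 : R)%:C else z j].
have cw : dcvg w z.
 move=> j; rewrite /w; under eq_fun do rewrite ffunE.
 by case: eqP => [->|_]; [apply: ccvg_real; exact: cvg_harmonic|exact: ccvg_cst].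
apply: ccvg_uniq (hF.1 _ _ cw) _.
rewrite (_ : (fun n => _) = (fun n => powsum b (w n))); first exact: dcont_powsum.
apply/funext => n; apply: nz => j; rewrite ffunE; case: ifP => [_|/negbT //].
by rewrite -cabs_eq0 cabsR normr_eq0 invr_eq0 pnatr_eq0.
Qed.
End Expansion.

(** The base [|w| + 2] absorbs both the increment [|h| < 1] and the factor [n] of the derivative. *)
Lemma pow_quad (w h : C) n : cabs h < 1 ->
 cabs ((w + h) ^+ n - w ^+ n - n%:R * w ^+ n.-1 * h) <= (cabs w + 2) ^+ n * cabs h ^+ 2 /\
 cabs (n%:R * w ^+ n.-1) <= (cabs w + 2) ^+ n.
Proof.
move=> h1; have w0 := cabs_ge0 w; have h0 := cabs_ge0 h.
have P k : 0 <= (cabs w + 2) ^+ k by rewrite exprn_ge0 // addr_ge0.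
elim: n => [|n [IH1 IH2]].
 by rewrite !expr0 !mul0r subrr subr0 cabs0 mul1r sqr_ge0 ler01.
split; last first.
 rewrite -natr1 mulrDl mul1r; apply: le_trans (cabsD _ _) _.
 have e1 : cabs (w ^+ n) <= (cabs w + 2) ^+ n by rewrite cabsX lerXn2r ?nnegrE ?addr_ge0 // lerDl.
 have e2 : cabs (n%:R * w ^+ n) <= cabs w * (cabs w + 2) ^+ n.
  case: n IH1 IH2 e1 => [|n] _ IH2 _; first by rewrite mul0r cabs0 mulr_ge0.
  by rewrite exprS mulrCA cabsM ler_wpM2l.
 rewrite [leRHS]exprS /=; have := P n; nra.
have -> : (w + h) ^+ n.+1 - w ^+ n.+1 - n.+1%:R * w ^+ n.+1.-1 * h =
  (w + h) * ((w + h) ^+ n - w ^+ n - n%:R * w ^+ n.-1 * h) + n%:R * w ^+ n.-1 * h ^+ 2.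
 case: n {IH1 IH2} => [|n] /=; first by rewrite !expr1 !expr0; ring.
 by rewrite !exprS -!natr1; ring.
apply: le_trans (cabsD _ _) _; rewrite (cabsM (w + h)) (cabsM (_ * _)) cabsX.
have wh : cabs (w + h) <= cabs w + 1 by apply: le_trans (cabsD _ _) _; rewrite lerD2l ltW.
have := ler_pM (cabs_ge0 _) (cabs_ge0 _) wh IH1.
have := ler_wpM2r (sqr_ge0 (cabs h)) IH2.
rewrite [(cabs w + 2) ^+ n.+1]exprS; set X := (cabs w + 2) ^+ n; set Y := cabs h ^+ 2; lra.
Qed.

Lemma sephol_powsum d (b : {ffun 'I_d -> nat} -> C) : summ b -> sephol (powsum b).
Proof.
move=> hb; split=> [|z j w]; first exact: dcont_powsum.
have [r r0 hr] := Cd_bound z; pose s := r + cabs w + 2.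
have s0 : 0 <= s by rewrite !addr_ge0 ?cabs_ge0.
pose q (m : {ffun 'I_d -> nat}) := b m * \prod_(i | i != j) z i ^+ m i.
have E m v : b m * mon m (upd z j v) = q m * v ^+ m j.
 rewrite /mon (bigD1 j) //= updE eqxx /q mulrCA mulrC; congr (_ * _ * _).
 by apply: eq_bigr => i /negbTE ij; rewrite updE ij.
have qb (m : {ffun 'I_d -> nat}) (t : R) : 0 <= t -> t <= (cabs w + 2) ^+ m j -> cabs (q m) * t <= cabs (b m) * rpow m s.
 move=> t0 ht; rewrite /q cabsM -mulrA; apply: ler_wpM2l; first exact: cabs_ge0.
 rewrite mulrC /rpow [leRHS](bigD1 j) //=.
 apply: ler_pM => //; first exact: cabs_ge0.
  apply: le_trans ht _; rewrite lerXn2r ?nnegrE ?addr_ge0 ?cabs_ge0 //.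
  by rewrite /s -addrA lerDr.
 rewrite cabs_prod; apply: ler_prod => i _; rewrite cabs_ge0 cabsX lerXn2r ?nnegrE ?cabs_ge0 //=.
 by apply: le_trans (hr i) _; rewrite /s -addrA lerDl addr_ge0 ?cabs_ge0.
rewrite (_ : (fun v => _) = (fun v => csum (fun m => q m * v ^+ m j))); last first.
 by apply/funext => v; apply: eq_csum => m; rewrite E.
apply: (@cdiff_csum _ (fun m v => q m * v ^+ m j) w (fun m => q m * ((m j)%:R * w ^+ (m j).-1))
 (fun m => cabs (b m) * rpow m s)) => [||v|m h h1]; first exact: hb.
- have h0 : cabs (0 : C) < 1 by rewrite cabs0.
 apply: rasum_le (hb s s0) => m; rewrite cabsM; apply: qb; first exact: cabs_ge0.
 exact: (pow_quad w (m j) h0).2.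
- by apply: rasum_le (powsum_casum (upd z j v) hb) => m; rewrite E.
rewrite -mulrBr -mulrA -mulrBr cabsM; have [h2 _] := pow_quad w (m j) h1.
apply: le_trans (ler_wpM2l (cabs_ge0 _) h2) _; rewrite mulrA ler_wpM2r ?sqr_ge0 //.
by apply: qb => //; rewrite exprn_ge0 // addr_ge0 ?cabs_ge0.
Qed.

Lemma entire_sephol d (F : Cd d -> C) : entire F <-> sephol F.
Proof.
split=> -[h1 h2]; split.
- move=> z l zl e e0; have [del [d0 hd]] := h1 l e e0.
 have /choice[N hN] : forall j, exists N, forall n, (N <= n)%N -> cabs (z n j - l j) < del.
  by move=> j; exact: zl.
 exists (\max_j N j) => n nN; apply: hd => j; apply: hN.
 exact: leq_trans (leq_bigmax j) nN.
- move=> z j w; have := h2 (upd z j w) j; rewrite updE eqxx.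
 by under eq_fun do rewrite upd_upd.
- move=> z e e0; apply: contrapT => hn.
 have /choice[w hw] : forall n : nat, exists w : Cd d, (forall j, cabs (w j - z j) < n.+1%:R^-1) /\
   e <= cabs (F w - F z).
  move=> n; apply: contrapT => hc; apply: hn; exists n.+1%:R^-1; split; first by rewrite invr_gt0.
  by move=> w hw; rewrite ltNge; apply/negP => ge; apply: hc; exists w.
 have cw : dcvg w z.
  move=> j; apply: (ccvg_squeeze (b := fun n => n.+1%:R^-1)); last exact: cvg_harmonic.
  by move=> n; apply: ltW; exact: (hw n).1.
 by have [N /(_ N (leqnn N))] := h1 _ _ cw e e0; rewrite ltNge (hw N).2.
- move=> z j; exact: h2.
Qed.
End SeveralVariables.

(** * Theta functions of a lattice and Poisson summation *)

Section Theta.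
Variable R : realType.
Local Notation C := R[i].
Local Notation Cd := (Cd R).

Lemma cdiff_sqr_poly (a b c : C) : cdiff (fun v => a * v ^+ 2 + b * v + c).
Proof.
move=> w; apply: (@cdiff_quad _ _ w (2 * a * w + b) (cabs a) 1) => // h _.
by rewrite -cabsX -cabsM; apply/eq_ler; congr cabs; ring.
Qed.

Lemma cdiff_cexp_at (w : C) : cdifferentiable_at (@cexp R) w.
Proof.
by have := cdiff_cexpM (1 : C) w; under eq_fun do rewrite mul1r.
Qed.

Lemma quad_le (c : R) x y : 0 < c -> x * y <= c / 2 * y ^+ 2 + x ^+ 2 / (2 * c).
Proof.
move=> c0; rewrite -subr_ge0.
have -> : c / 2 * y ^+ 2 + x ^+ 2 / (2 * c) - x * y = (c * y - x) ^+ 2 / (2 * c).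
 by field; rewrite gt_eqF.
by rewrite divr_ge0 ?sqr_ge0 // mulr_ge0 // ltW.
Qed.

Variable p : nat.
Local Notation Z := {ffun 'I_p -> int}.

Definition lat (A : 'M[R]_p) (n : Z) (i : 'I_p) : R := \sum_j A i j * (n j)%:~R.

Lemma latD A (m n : Z) i : lat A (m + n) i = lat A m i + lat A n i.
Proof.
by rewrite /lat -big_split; apply: eq_bigr => j _; rewrite ffunE rmorphD mulrDr.
Qed.
Lemma lat0 A i : lat A 0 i = 0.
Proof. by rewrite /lat big1 // => j _; rewrite ffunE mulr0. Qed.

Lemma lat_inv (A B : 'M[R]_p) (n : Z) j : B *m A = 1%:M -> (n j)%:~R = \sum_i B j i * lat A n i.
Proof.
move=> BA; have /matrixP e := BA.
under eq_bigr do rewrite /lat mulr_sumr; rewrite exchange_big /=.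
rewrite (bigD1 j) //= [X in _ + X]big1 ?addr0.
 under eq_bigr do rewrite mulrA.
 by rewrite -mulr_suml; have := e j j; rewrite !mxE eqxx => ->; rewrite mul1r.
move=> k kj; under eq_bigr do rewrite mulrA; rewrite -mulr_suml.
by have := e j k; rewrite !mxE eq_sym (negbTE kj) => ->; rewrite mul0r.
Qed.

Section Gauss.
Variables A B : 'M[R]_p.
Hypothesis BA : B *m A = 1%:M.

Definition latS (n : Z) : R := \sum_i lat A n i ^+ 2.
Definition latT (n : Z) : R := \sum_i `|lat A n i|.

Lemma latS_ge0 n : 0 <= latS n. Proof. by apply: sumr_ge0 => i _; exact: sqr_ge0. Qed.

(** For integers [|n_j| <= n_j^2], and the inverse matrix bounds [n_j] by the length of [A n]; so a
    Gaussian of [A n] decays at least exponentially in the coordinates of [n]. *)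
Lemma lat_coercive : exists2 K : R, 0 < K & forall n : Z, \sum_j (`|n j|%:~R : R) <= K * latS n.
Proof.
pose K := 1 + \sum_j \sum_i `|B j i|.
have b0 : 0 <= \sum_j \sum_i `|B j i| by apply: sumr_ge0 => j _; apply: sumr_ge0.
have K0 : 0 < K by rewrite ltr_wpDr.
exists (p.+1%:R * K ^+ 2) => [|n]; first by rewrite mulr_gt0 // exprn_gt0.
have h j : `|n j|%:~R <= K ^+ 2 * latS n.
 have h1 : (`|n j|%:~R : R) <= (n j)%:~R ^+ 2.
  rewrite -[X in _ <= X]rmorphXn /= ler_int; move: (n j) => z.
  have [->|z0] := eqVneq z 0; first by rewrite normr0.
  rewrite -real_normK ?num_real // expr2 ler_peMl //.
  by rewrite -gtz0_ge1 normr_gt0.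
 apply: le_trans h1 _; rewrite -real_normK ?num_real // -[latS n]sqr_sqrtr ?latS_ge0 // -exprMn.
 rewrite ler_pXn2r ?nnegrE ?mulr_ge0 ?sqrtr_ge0 ?(ltW K0) //.
 rewrite (lat_inv n j BA); apply: le_trans (ler_norm_sum _ _ _) _.
 have hu i : `|lat A n i| <= Num.sqrt (latS n).
  rewrite -sqrtr_sqr ler_sqrt ?latS_ge0 // /latS (bigD1 i) //= lerDl.
  by apply: sumr_ge0 => k _; exact: sqr_ge0.
 apply: (@le_trans _ _ (\sum_i `|B j i| * Num.sqrt (latS n))).
  by apply: ler_sum => i _; rewrite normrM ler_wpM2l.
 rewrite -mulr_suml ler_wpM2r ?sqrtr_ge0 // /K.
 have := @sumr_ge0 R 'I_p (index_enum 'I_p) (fun k => k != j) (fun k => \sum_i `|B k i|) (fun k _ => sumr_ge0 _ (fun i _ => normr_ge0 _)).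
 by rewrite [X in _ -> _ <= 1 + X](bigD1 j) //=; move: (\sum_(i | _) _) (\sum_(i < p) _) => x y; lra.
apply: (@le_trans _ _ (\sum_(j < p) K ^+ 2 * latS n)); first by apply: ler_sum => j _.
have -> : \sum_(j < p) K ^+ 2 * latS n = p%:R * K ^+ 2 * latS n.
 by rewrite sumr_const card_ord -[p%:R * _ * _]mulrA [RHS]mulr_natl.
apply: ler_wpM2r; first exact: latS_ge0.
by apply: ler_wpM2r; rewrite ?sqr_ge0 // ler_nat.
Qed.

(** Half of the Gaussian absorbs the linear term by [quad_le]; the other half is compared with a
    product of exponentials in the single coordinates. *)
Lemma lat_gauss (c x : R) : 0 < c -> rasum (fun n : Z => expR (- c * latS n + x * latT n)).
Proof.
move=> c0; have [K K0 hK] := lat_coercive.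
pose k := c / 2 / K; have k0 : 0 < k by rewrite !divr_gt0.
pose M := expR (p%:R * (x ^+ 2 / (2 * c))).
have e1 (j : 'I_p) : casum (fun m : int => (expR (- (k * `|m|%:~R)))%:C : C).
 by apply: casum_real => [|m]; [exact: rasum_int_exp|exact: expR_ge0].
have [a1 _] := csum_prod e1; apply: rasum_le (rasumZ (expR_ge0 (p%:R * (x ^+ 2 / (2 * c)))) a1) => n.
rewrite cabs_prod; under eq_bigr do rewrite cabsR ger0_norm ?expR_ge0 //.
rewrite -expR_sum -expRD ler_expR.
have h1 : x * latT n <= c / 2 * latS n + p%:R * (x ^+ 2 / (2 * c)).
 have -> : p%:R * (x ^+ 2 / (2 * c)) = \sum_(i < p) x ^+ 2 / (2 * c) by rewrite sumr_const card_ord mulr_natl.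
 rewrite /latT /latS !mulr_sumr -big_split /=.
 apply: ler_sum => i _; apply: le_trans (quad_le x _ c0) _.
 by rewrite real_normK ?num_real.
have h2 : \sum_j - (k * `|n j|%:~R) >= - (c / 2 * latS n).
 rewrite sumrN lerN2 -mulr_sumr; apply: le_trans (ler_wpM2l (ltW k0) (hK n)) _.
 by rewrite mulrA /k divfK // gt_eqF.
by move: h1 h2; move: (latS n) (x * latT n) => S T; lra.
Qed.

Definition latw (z : Cd p) (i : 'I_p) : C := \sum_j (A i j)%:C * z j.
Definition latl (n : Z) (j : 'I_p) : R := - (2 * pi * \sum_i lat A n i * A i j).

(** [theta] is the sum over [n] of [exp (- pi |A (n + z)|^2)], the square being the bilinear one.
    Its part quadratic in [z] is split off as [thE], so that the terms here are exponentials of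
    linear forms. *)
Definition thH (z : Cd p) : C := csum (fun n => (expR (- pi * latS n))%:C *
 cexp (\sum_j (latl n j)%:C * z j)).
Definition thE (z : Cd p) : C := cexp (- (pi%:C * \sum_i latw z i ^+ 2)).
Definition theta (z : Cd p) : C := thE z * thH z.

Lemma latl_le : exists2 K, 0 <= K & forall n, \sum_j `|latl n j| <= K * latT n.
Proof.
exists (2 * pi * \sum_j \sum_i `|A i j|).
 rewrite mulr_ge0 ?mulr_ge0 ?pi_ge0 //; apply: sumr_ge0 => j _; exact: sumr_ge0.
move=> n; rewrite -[leRHS]mulrA mulr_suml mulr_sumr; apply: ler_sum => j _.
rewrite /latl normrN normrM ger0_norm ?mulr_ge0 ?pi_ge0 // ler_wpM2l ?mulr_ge0 ?pi_ge0 //.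
apply: le_trans (ler_norm_sum _ _ _) _; rewrite mulr_suml; apply: ler_sum => i _.
rewrite normrM mulrC ler_wpM2l // /latT (bigD1 i) //= lerDl; exact: sumr_ge0.
Qed.

Lemma thH_le (r : R) : 0 <= r -> exists2 g : Z -> R, rasum g & forall n (z : Cd p),
 (forall j, cabs (z j) <= r) -> expR (- pi * latS n) * expR (\sum_j `|latl n j| * r) <= g n /\
 cabs ((expR (- pi * latS n))%:C * cexp (\sum_j (latl n j)%:C * z j)) <= g n.
Proof.
move=> r0; have [K K0 hK] := latl_le; exists (fun n => expR (- pi * latS n + (K * r) * latT n)).
 exact: lat_gauss (pi_gt0 R).
move=> n z zr.
have h : expR (- pi * latS n) * expR (\sum_j `|latl n j| * r) <= expR (- pi * latS n + (K * r) * latT n).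
 rewrite -expRD ler_expR lerD2l -mulr_suml mulrAC ler_wpM2r //.
split=> //; apply: le_trans h.
rewrite cabsM cabsR ger0_norm ?expR_ge0 // ler_wpM2l ?expR_ge0 // cabs_cexp ler_expR.
apply: le_trans (ler_norm _) _; apply: le_trans (cabsRe _) _; apply: le_trans (cabs_sum _ _ _) _.
by apply: ler_sum => j _; rewrite cabsM cabsR ler_wpM2l.
Qed.

Lemma thH_casum (z : Cd p) : casum (fun n => (expR (- pi * latS n))%:C * cexp (\sum_j (latl n j)%:C * z j)).
Proof.
have [r r0 hr] := Cd_bound z; have [g hg h] := thH_le r0.
by apply: rasum_le hg => n; exact: (h n z hr).2.
Qed.

Lemma sephol_thH : sephol thH.
Proof.
split=> [z l zl|z j w].
 have [M hM] := dcvg_bounded zl; have [g hg h] := thH_le (normr_ge0 M).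
 apply: (csum_dct hg) => [n m|m].
  by apply: (h m (z n) _).2 => j; apply: le_trans (hM n j) (ler_norm _).
 apply: ccvgM; first exact: ccvg_cst.
 by apply: cexp_cont; apply: ccvg_sum => j; apply: ccvgZ; exact: zl.
(* As for Fourier series, a second-order remainder costs three factors [exp |latl n j|], hence the
   margin 3 in the radius. *)
have [r0 r0_ge hr0] := Cd_bound z; pose r := r0 + cabs w + 3.
have rge : 0 <= r by rewrite !addr_ge0 ?cabs_ge0.
have [g hg hG] := thH_le rge.
pose q n := (expR (- pi * latS n))%:C * cexp (\sum_(i | i != j) (latl n i)%:C * z i) : C.
have E n v : (expR (- pi * latS n))%:C * cexp (\sum_i (latl n i)%:C * upd z j v i) =
  q n * cexp ((latl n j)%:C * v).
 rewrite (bigD1 j) //= updE eqxx cexpD /q mulrCA mulrC; congr (_ * cexp _ * _).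
 by apply: eq_bigr => i /negbTE ij; rewrite updE ij.
have qle n (t : R) : t <= expR (`|latl n j| * r) -> cabs (q n) * t <= g n.
 move=> ht; apply: le_trans (hG n z _).1; last first.
  by move=> i; apply: le_trans (hr0 i) _; rewrite /r -addrA lerDl addr_ge0 ?cabs_ge0.
 rewrite /q cabsM cabsR ger0_norm ?expR_ge0 // -mulrA ler_wpM2l ?expR_ge0 //.
 rewrite mulrC [X in _ <= expR X](bigD1 j) //= expRD cabs_cexp.
 apply: le_trans (ler_wpM2r (expR_ge0 _) ht) _; rewrite ler_wpM2l ?expR_ge0 // ler_expR.
 apply: le_trans (ler_norm _) _; apply: le_trans (cabsRe _) _; apply: le_trans (cabs_sum _ _ _) _.
 apply: ler_sum => i _; rewrite cabsM cabsR ler_wpM2l //.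
 by apply: le_trans (hr0 i) _; rewrite /r -addrA lerDl addr_ge0 ?cabs_ge0.
have xe (x : R) : x <= expR x by apply: le_trans (expR_ge1Dx x); rewrite lerDr.
have ce n v : cabs (cexp ((latl n j)%:C * v)) <= expR (`|latl n j| * cabs v).
 rewrite cabs_cexp ler_expR; apply: le_trans (ler_norm _) _; apply: le_trans (cabsRe _) _.
 by rewrite cabsM cabsR.
rewrite (_ : (fun v => _) = (fun v => csum (fun n => q n * cexp ((latl n j)%:C * v)))); last first.
 by apply/funext => v; apply: eq_csum => n; rewrite E.
apply: (@cdiff_csum _ _ (fun n v => q n * cexp ((latl n j)%:C * v)) w
 (fun n => q n * ((latl n j)%:C * cexp ((latl n j)%:C * w))) g) => [||v|n h h1]; first exact: hg.
- apply: rasum_le hg => n; rewrite cabsM; apply: qle; rewrite cabsM cabsR.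
 apply: le_trans (ler_pM (normr_ge0 _) (cabs_ge0 _) (xe _) (ce n w)) _.
 rewrite -expRD ler_expR -[X in X + _]mulr1 -mulrDr ler_wpM2l // /r.
 by move: (cabs w) => b; move: (r0_ge); lra.
- by apply: rasum_le (thH_casum (upd z j v)) => n; rewrite E.
have -> : q n * cexp ((latl n j)%:C * (w + h)) - q n * cexp ((latl n j)%:C * w) -
  q n * ((latl n j)%:C * cexp ((latl n j)%:C * w)) * h =
  q n * (cexp ((latl n j)%:C * w) * (cexp ((latl n j)%:C * h) - 1 - (latl n j)%:C * h)).
 by rewrite mulrDr cexpD; ring.
rewrite cabsM (cabsM (cexp _)).
have h2 := cexp_quad ((latl n j)%:C * h); rewrite cabsM cabsR in h2.
have h3 : cabs (cexp ((latl n j)%:C * h) - 1 - (latl n j)%:C * h) <=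
  expR (`|latl n j| * 3) * cabs h ^+ 2.
 apply: le_trans h2 _; rewrite exprMn mulrAC ler_wpM2r ?sqr_ge0 //.
 have -> : `|latl n j| * 3 = `|latl n j| + `|latl n j| + `|latl n j| by ring.
 rewrite !expRD expr2; apply: ler_pM; rewrite ?mulr_ge0 ?expR_ge0 //.
  by apply: ler_pM => //.
 by rewrite ler_expR ler_piMr // ltW.
apply: le_trans (ler_wpM2l (cabs_ge0 _) (ler_pM (cabs_ge0 _) (cabs_ge0 _) (ce n w) h3)) _.
rewrite [X in cabs (q n) * X]mulrA [leLHS]mulrA; apply: ler_wpM2r; first exact: sqr_ge0.
apply: qle; rewrite -expRD ler_expR -mulrDr ler_wpM2l // /r -addrA lerDr //.
Qed.

Lemma sephol_theta : sephol theta.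
Proof.
split=> [z l zl|z j w].
 apply: ccvgM; last exact: sephol_thH.1.
 apply: cexp_cont; apply: ccvgN; apply: ccvgZ; apply: ccvg_sum => i; apply: ccvgX.
 by apply: ccvg_sum => k; apply: ccvgZ; exact: zl.
apply: cdiffM_at; last exact: sephol_thH.2.
pose al i := \sum_(k | k != j) (A i k)%:C * z k.
have E v i : latw (upd z j v) i = (A i j)%:C * v + al i.
 rewrite /latw (bigD1 j) //= updE eqxx; congr (_ + _).
 by apply: eq_bigr => k /negbTE kj; rewrite updE kj.
rewrite (_ : (fun v => _) = (@cexp R) \o (fun v => (- (pi%:C * \sum_i (A i j)%:C ^+ 2)) * v ^+ 2 +
  (- (pi%:C * \sum_i 2 * (A i j)%:C * al i)) * v + (- (pi%:C * \sum_i al i ^+ 2)))).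
 by apply: cdiff_comp_at; [exact: cdiff_cexp_at|exact: cdiff_sqr_poly].
apply/funext => v; rewrite /thE /=; congr cexp; under eq_bigr do rewrite E.
rewrite !mulNr -!opprD -!mulrA -!mulrDr; congr (- (_ * _)).
rewrite !mulr_suml -!big_split /=; apply: eq_bigr => i _; ring.
Qed.

Lemma theta_sum z : casum (fun n => cexp (- (pi%:C * \sum_i ((lat A n i)%:C + latw z i) ^+ 2))) /\
 theta z = csum (fun n => cexp (- (pi%:C * \sum_i ((lat A n i)%:C + latw z i) ^+ 2))).
Proof.
have E n : cexp (- (pi%:C * \sum_i ((lat A n i)%:C + latw z i) ^+ 2)) =
  thE z * ((expR (- pi * latS n))%:C * cexp (\sum_j (latl n j)%:C * z j)).
 rewrite -cexp_real /thE -!cexpD; congr cexp.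
 have -> : \sum_j (latl n j)%:C * z j = - (2 * pi%:C * \sum_i (lat A n i)%:C * latw z i).
  rewrite /latl /latw -mulrN -sumrN mulr_sumr.
  under [RHS]eq_bigr do rewrite -mulrN -sumrN mulr_sumr mulr_sumr.
  rewrite exchange_big; apply: eq_bigr => j _ /=.
  rewrite -mulrN -sumrN mulr_sumr raddf_sum mulr_suml; apply: eq_bigr => i _ /=.
  by rewrite !(rmorphM, rmorphN) /= -mulrA (rmorph_nat (real_complex R)); ring.
 rewrite !(rmorphM, rmorphN) /= /latS raddf_sum /= !mulr_sumr -!sumrN -!big_split /=.
 by apply: eq_bigr => i _; rewrite rmorphXn /=; ring.
split; first by rewrite (funext E); exact: casumZ (thH_casum z).
by rewrite (funext E) csumZ //; exact: thH_casum.
Qed.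

Lemma theta_perd : perd theta.
Proof.
move=> z j; rewrite (theta_sum _).2 (theta_sum z).2.
pose e : Z := [ffun i => (i == j)%:Z].
have E i : latw (upd z j (z j + 1)) i = latw z i + (lat A e i)%:C.
 rewrite /latw /lat raddf_sum -big_split; apply: eq_bigr => k _ /=; rewrite updE ffunE.
 case: eqP => [->|_]; first by rewrite mulr1 mulrDr mulr1.
 by rewrite mulr0 addr0.
rewrite -[RHS](csum_bij (h := fun n => n + e)); last 2 first.
- by exists (fun n => n - e) => n; rewrite ?addrK ?subrK.
- exact: (theta_sum z).1.
apply: eq_csum => n; congr (cexp (- (_ * _))); apply: eq_bigr => i _.
by rewrite E latD rmorphD /=; ring.
Qed.

Definition unitv (j : 'I_p) : Z := [ffun i => (i == j)%:Z].

Lemma lat_unitv (M : 'M[R]_p) j i : lat M (unitv j) i = M i j.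
Proof.
rewrite /lat (bigD1 j) //= ffunE eqxx mulr1 big1 ?addr0 // => k /negbTE kj.
by rewrite ffunE kj mulr0.
Qed.

Lemma shift_invariant (T : Type) (f : Z -> T) :
 (forall m j, f (m + unitv j) = f m) -> forall m, f m = f 0.
Proof.
move=> hf.
have h1 j (k : int) m : f (m + unitv j *~ k) = f m.
 case: k => k.
  by elim: k => [|k IH]; rewrite ?mulr0z ?addr0 // -addn1 PoszD mulrzDr addrA hf.
 rewrite NegzE mulrNz; elim: k.+1 => [|l IH]; first by rewrite mulr0z subr0.
 by rewrite -[RHS]IH -[LHS](hf _ j) -addn1 PoszD mulrzDr mulr1z opprD addrA subrK.
move=> m; have -> : m = 0 + \sum_j unitv j *~ m j.
 rewrite add0r; apply/ffunP => i; rewrite sum_ffunE (bigD1 i) //= big1 ?addr0.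
  by rewrite ffunMzE ffunE eqxx intz.
 by move=> j ji; rewrite ffunMzE ffunE eq_sym (negbTE ji) mul0rz.
elim/big_rec: _ => [|j v _ IH]; first by rewrite addr0.
by rewrite [_ + v]addrC addrA h1.
Qed.
End Gauss.

Lemma csum_gauss_gt0 (M N : 'M[R]_p) : N *m M = 1%:M ->
 exists2 c : R, 0 < c & csum (fun n : Z => (expR (- pi * \sum_i lat M n i ^+ 2))%:C : C) = c%:C.
Proof.
move=> NM; have hr : rasum (fun n : Z => expR (- pi * \sum_i lat M n i ^+ 2)).
 by have := lat_gauss NM 0 (pi_gt0 R); apply: rasum_le => n; rewrite mul0r addr0.
exists (rsum (fun n : Z => expR (- pi * \sum_i lat M n i ^+ 2))); last first.
 by rewrite csum_real // => n; exact: expR_ge0.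
by apply: lt_le_trans (rsum_ub1 0 hr); exact: expR_gt0.
Qed.
Lemma mx_cancel (M N : 'M[R]_p) (x : 'I_p -> C) i : M *m N = 1%:M ->
 \sum_k (M i k)%:C * \sum_l (N k l)%:C * x l = x i.
Proof.
move=> /matrixP MN; under eq_bigr do rewrite mulr_sumr; rewrite exchange_big /=.
have e l : \sum_k (M i k)%:C * ((N k l)%:C * x l) = ((i == l)%:R : R)%:C * x l.
 under eq_bigr do rewrite mulrA -realCM.
 by rewrite -mulr_suml -raddf_sum /=; have := MN i l; rewrite !mxE => ->.
under eq_bigr do rewrite e.
rewrite (bigD1 i) //= eqxx mul1r big1 ?addr0 // => l li.
by rewrite eq_sym (negbTE li) mul0r.
Qed.

(* D = A^{-T} generates the dual lattice. The coefficients of theta satisfy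
  c (m + e_j) = exp (-pi (q (m + e_j) - q m)) c m with q m = |D m|^2, because theta is
  quasi-periodic in the direction i A^{-1} D e_j. *)
Theorem theta_identity (A B : 'M[R]_p) (D := B^T) : B *m A = 1%:M -> exists2 c : R, 0 < c &
 forall w : 'I_p -> C,
 csum (fun n : Z => cexp (- (pi%:C * \sum_i ((lat A n i)%:C + w i) ^+ 2))) =
 c%:C * csum (fun m : Z => (expR (- pi * \sum_i lat D m i ^+ 2))%:C *
   cexp ((0 +i* (2 * pi)) * \sum_i (lat D m i)%:C * w i)).
Proof.
move=> BA; have AB := mulmx1C BA.
have sT := sephol_theta BA; have pT := theta_perd BA.
pose q (m : Z) := \sum_i lat D m i ^+ 2.
(* [eta j] is [A^-1 D e_j], so that the imaginary translation by it moves [A z] by [i D e_j]. *)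
pose eta j k : R := \sum_i B k i * D i j.
have Dn j n : \sum_i lat A n i * D i j = (n j)%:~R.
 by rewrite (lat_inv n j BA); apply: eq_bigr => i _; rewrite mxE mulrC.
have quasi j (z : Cd p) : theta A [ffun k => z k + (0 +i* eta j k)] =
  (expR (pi * \sum_i D i j ^+ 2))%:C * (ez (- 1) (z j) * theta A z).
 have E i : latw A [ffun k => z k + (0 +i* eta j k)] i = latw A z i + (0 +i* 1) * (D i j)%:C.
  rewrite /latw; under eq_bigr do rewrite ffunE mulrDr.
  rewrite big_split /=; congr (_ + _).
  rewrite -[RHS](mx_cancel (fun i => (0 +i* 1) * (D i j)%:C) i AB); apply: eq_bigr => k _.
  congr (_ * _); rewrite /eta; apply: ceq; rewrite /= ?Re_sum ?Im_sum.
   by rewrite big1 // => l _; rewrite /=; ring.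
  by apply: eq_bigr => l _ /=; ring.
 have Z j' : z j' = \sum_i (D i j')%:C * latw A z i.
  by rewrite -[LHS](mx_cancel z j' BA); apply: eq_bigr => i _; rewrite [D i j']mxE.
 rewrite (theta_sum BA _).2 (theta_sum BA z).2 mulrA -csumZ; last exact: (theta_sum BA z).1.
 apply: eq_csum => n; rewrite -cexp_real /ez -!cexpD.
 (* The cross term of the expanded square contains [2 i (A n) . (D e_j) = 2 i n_j] and contributes
    [exp (- 2 pi i n_j)], which this factor 1 cancels. *)
 have e1 : cexp ((0 +i* (2 * pi)) * ((n j)%:~R)%:C) = 1 :> C.
  have := per_int (n j) 0 (@ez_per R 1); rewrite add0r ez_0 /ez => h.
  rewrite -[RHS]h; congr cexp; rewrite -[(n j)%:~R in RHS](rmorph_int (real_complex R)) /=.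
  by apply: ceq; rewrite /=; ring.
 rewrite -[LHS]mulr1 -e1 -cexpD; congr cexp.
 under eq_bigr do rewrite E.
 rewrite -Dn [z j]Z raddf_sum.
 rewrite [(pi * _)%:C]realCM raddf_sum.
 have -> : (0 +i* (2 * pi * (-1)%:~R)) = - (2 * pi%:C * (0 +i* 1)) :> C.
  by apply: ceq; rewrite /= ?mulrN1 ?mulr1; ring.
 have -> : (0 +i* (2 * pi)) = 2 * pi%:C * (0 +i* 1) :> C by apply: ceq; rewrite /=; ring.
 rewrite !mulr_sumr -!sumrN -!big_split /=; apply: eq_bigr => i _.
 have ii : (0 +i* 1) * (0 +i* 1) = -1 :> C by apply: ceq; rewrite /=; ring.
 rewrite !rmorphXn !rmorphM /=; move: (0 +i* 1) ii => I ii.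
 have -> : ((lat A n i)%:C + (latw A z i + I * (D i j)%:C)) ^+ 2 = ((lat A n i)%:C + latw A z i) ^+ 2 +
  2 * I * (D i j)%:C * ((lat A n i)%:C + latw A z i) + (I * I) * (D i j)%:C ^+ 2 by ring.
 by rewrite ii; ring.
have step m j : fc (theta A) (m + unitv j) * (expR (pi * q (m + unitv j)))%:C =
  fc (theta A) m * (expR (pi * q m))%:C.
 have := fc_shift (eta j) m sT pT; rewrite (funext (quasi j)).
 have sE : sephol (fun z => ez (- 1) (z j) * theta A z).
  split=> [z l zl|z k w].
   by apply: ccvgM (sT.1 _ _ zl); exact: (cdiff_ccont (@cdiff_ez R (-1)) (zl j)).
  apply: cdiffM_at; last exact: sT.2.
  under eq_fun do rewrite updE; case: eqP => _; first exact: cdiff_ez.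
  by apply: (@cdiff_quad _ _ w 0 0 1) => // h _; rewrite subrr mul0r subr0 cabs0 mul0r.
 have pE : perd (fun z => ez (- 1) (z j) * theta A z).
  by move=> z k; rewrite pT updE; case: eqP => // ->; rewrite ez_per.
 rewrite fcZ // fc_mul // => h.
 have -> : m + unitv j = [ffun i => m i + (i == j)%:Z] by apply/ffunP => i; rewrite !ffunE.
 have qE : q [ffun i => m i + (i == j)%:Z] = q m + 2 * (\sum_k (m k)%:~R * eta j k) + \sum_i D i j ^+ 2.
  have -> : [ffun i => m i + (i == j)%:Z] = m + unitv j by apply/ffunP => i; rewrite !ffunE.
  have -> : \sum_k (m k)%:~R * eta j k = \sum_i lat D m i * D i j.
   under eq_bigr do rewrite /eta mulr_sumr; rewrite exchange_big; apply: eq_bigr => i _ /=.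
   rewrite /lat mulr_suml; apply: eq_bigr => k _; rewrite [D i k]mxE; ring.
  rewrite /q mulr_sumr -!big_split; apply: eq_bigr => i _ /=; rewrite latD lat_unitv; ring.
 rewrite qE 2!mulrDr 2!expRD 2!realCM [LHS]mulrCA [X in _ * X]mulrC h.
 have -> : \prod_i ez (m i) (0 +i* eta j i) = (expR (- (2 * pi * \sum_k (m k)%:~R * eta j k)))%:C.
  rewrite -cexp_real /ez -cexp_sum; congr cexp.
  by rewrite mulr_sumr -sumrN raddf_sum; apply: eq_bigr => k _ /=; apply: ceq; rewrite /=; ring.
 have -> : pi * (2 * \sum_k (m k)%:~R * eta j k) = 2 * pi * \sum_k (m k)%:~R * eta j k by ring.
 rewrite expRN realCV; set E := (expR (2 * pi * _))%:C.
 have E0 : E != 0 by rewrite /E -cexp_real cexp_neq0.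
 by move: (fc _ m) ((expR (pi * q m))%:C) => x y; field.
have coef m : fc (theta A) m = fc (theta A) 0 * (expR (- pi * q m))%:C.
 have := shift_invariant (fun m j => step m j) m.
 have -> : q 0 = 0 by rewrite /q big1 // => i _; rewrite lat0 expr0n.
 rewrite mulr0 expR0 mulr1 => <-.
 by rewrite -mulrA -realCM -expRD mulNr subrr expR0 mulr1.
have BT : A^T *m D = 1%:M by rewrite -trmx_mul BA trmx1.
have [c1 c10 e1] := csum_gauss_gt0 BA; have [c2 c20 e2] := csum_gauss_gt0 BT.
have z0 i : latw A 0 i = 0 by rewrite /latw big1 // => j _; rewrite ffunE mulr0.
(* Evaluation at [z = 0] gives the constant as a quotient of two positive Gaussian sums, so its
   positivity is seen without computing a determinant. *)
have c00 : fc (theta A) 0 = (c1 / c2)%:C.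
 have := (fc_sum 0 sT pT).2; rewrite (theta_sum BA 0).2.
 under eq_csum do under eq_bigr do rewrite z0 addr0 -rmorphXn.
 have -> : (fun n : Z => cexp (- (pi%:C * \sum_i ((lat A n i ^+ 2)%:C)))) =
   (fun n : Z => (expR (- pi * \sum_i lat A n i ^+ 2))%:C : C).
  apply/funext => n; rewrite -cexp_real; congr cexp.
  by rewrite -raddf_sum /= -realCM -rmorphN /= mulNr.
 rewrite e1 => h.
 have : c1%:C = fc (theta A) 0 * c2%:C :> C.
  rewrite h -e2 -csumZ; last first.
   apply: casum_real => [|n]; last exact: expR_ge0.
   by apply: rasum_le (lat_gauss BT 0 (pi_gt0 R)) => n; rewrite mul0r addr0.
  apply: eq_csum => m; rewrite coef /ezd big1 ?mulr1 // => j _; by rewrite ffunE ez_0.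
 by move=> E1; rewrite realCM E1 -mulrA -realCM divff ?gt_eqF // mulr1.
exists (c1 / c2) => [|w]; first exact: divr_gt0.
pose z : Cd p := [ffun j => \sum_i (B j i)%:C * w i].
have zw i : latw A z i = w i.
 by rewrite -[RHS](mx_cancel w i AB); apply: eq_bigr => k _; rewrite ffunE.
have := (theta_sum BA z).2; under eq_csum do under eq_bigr do rewrite zw.
move=> <-; rewrite (fc_sum z sT pT).2.
have cE m : fc (theta A) m * ezd m z = (c1 / c2)%:C * ((expR (- pi * q m))%:C *
  cexp ((0 +i* (2 * pi)) * \sum_i (lat D m i)%:C * w i)).
 rewrite coef c00 -mulrA; congr (_ * (_ * _)); rewrite /ezd /ez -cexp_sum; congr cexp.
 rewrite mulr_sumr; under [RHS]eq_bigr do rewrite /lat raddf_sum mulr_suml mulr_sumr.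
 rewrite exchange_big; apply: eq_bigr => j _ /=; rewrite ffunE mulr_sumr.
 apply: eq_bigr => i _; rewrite [D i j]mxE !realCM.
 have -> : (0 +i* (2 * pi * (m j)%:~R)) = (0 +i* (2 * pi)) * ((m j)%:~R : R)%:C :> C.
  by apply: ceq; rewrite /=; ring.
 by move: ((m j)%:~R) (0 +i* (2 * pi)) => a b; ring.
have hc := (fc_sum z sT pT).1; rewrite (funext cE) in hc *; rewrite csumZ //.
have := casumZ (c1 / c2)%:C^-1 hc; rewrite (funext (fun m => mulKf _ _)) //.
by rewrite -cabs_eq0 cabsR normr_eq0 gt_eqF // divr_gt0.
Qed.
End Theta.

(** * Generating functions and the exchange of indices between the two lattices *)

Section IntertwiningIdentity.
Variable R : realType.
Local Notation C := R[i].
Local Notation Cd := (Cd R).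

Lemma csum_swap_bound (I J : choiceType) (f : I -> J -> C) (g : I -> R) :
 rasum g -> (forall i, casum (f i)) -> (forall i, rsum (fun j => cabs (f i j)) <= g i) ->
 [/\ forall j, casum (f^~ j), casum (fun j => csum (f^~ j)) &
   csum (fun i => csum (f i)) = csum (fun j => csum (f^~ j))].
Proof.
move=> hg hf hle.
have h1 : rasum (fun x : I * J => cabs (f x.1 x.2)).
 by apply: rasum_pair => [x||]; [exact: cabs_ge0|exact: hf|exact: rasum_le hle hg].
have h2 : rasum (fun x : J * I => cabs (f x.2 x.1)).
 by apply: (rasum_inj (h := fun x : J * I => (x.2, x.1)) _ h1) => -[a b] [a' b'] [-> ->].
have h3 j : casum (f^~ j) by exact: (rasum_pair1 j (fun _ => cabs_ge0 _) h2).
split=> //; last exact: csum_swap.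
by apply: rasum_le (rasum_pair2 (fun _ => cabs_ge0 _) h2) => j; exact: cabs_csum.
Qed.

Section Uniqueness.

(** The constant term is the value at 0; the series divided by [t] then vanishes for [t != 0], and
    at 0 by continuity, so the induction applies to it. *)
Lemma power_series_uniq1 (b : nat -> C) : (forall r : R, 0 <= r -> rasum (fun n => cabs (b n) * r ^+ n)) ->
 (forall t, csum (fun n => b n * t ^+ n) = 0) -> forall n, b n = 0.
Proof.
move=> hb h0 n; elim: n b hb h0 => [|n IH] b hb h0.
 have := h0 0; rewrite (@csum1 _ _ _ 0%N) ?expr0 ?mulr1 // => j j0.
 by rewrite expr0n (negbTE j0) mulr0.
have a t : casum (fun n => b n * t ^+ n).
 by apply: rasum_le (hb _ (cabs_ge0 t)) => k; rewrite cabsM cabsX.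
have b0 : b 0%N = 0.
 have := h0 0; rewrite (@csum1 _ _ _ 0%N) ?expr0 ?mulr1 // => j j0.
 by rewrite expr0n (negbTE j0) mulr0.
have hb' (r : R) : 0 <= r -> rasum (fun n => cabs (b n.+1) * r ^+ n).
 move=> r0; apply: rasum_le (rasum_inj (h := S) succn_inj (hb (r + 1) (addr_ge0 r0 ler01))) => k.
 rewrite ler_wpM2l ?cabs_ge0 //; apply: (@le_trans _ _ ((r + 1) ^+ k)).
  by rewrite lerXn2r ?nnegrE ?addr_ge0 // lerDl.
 by rewrite exprS ler_peMl ?exprn_ge0 ?addr_ge0 // lerDr.
apply: (IH (fun n => b n.+1)) => // t.
have nz v : v != 0 -> csum (fun n => b n.+1 * v ^+ n) = 0.
 move=> v0; have := h0 v; have [_ ->] := csum_nat_S (a v); rewrite b0 mul0r add0r.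
 under eq_csum do rewrite exprS mulrCA.
 rewrite csumZ; first by move/eqP; rewrite mulf_eq0 (negbTE v0) => /eqP.
 by apply: rasum_le (hb' _ (cabs_ge0 v)) => k; rewrite cabsM cabsX.
have [->|] := eqVneq t 0; last exact: nz.
pose w n : C := (n.+1%:R^-1 : R)%:C.
have cw : ccvg w 0 by apply: ccvg_real; exact: cvg_harmonic.
apply: (ccvg_uniq (u := fun n => csum (fun k => b k.+1 * w n ^+ k))); last first.
 rewrite (_ : (fun n => _) = (fun=> 0)); first exact: ccvg_cst.
 by apply/funext => k; rewrite nz // /w -cabs_eq0 cabsR normr_eq0 invr_eq0 pnatr_eq0.
apply: (csum_dct (hb' 1 ler01)) => [k j|j]; last by apply: ccvgZ; exact: ccvgX.
rewrite cabsM ler_wpM2l ?cabs_ge0 // cabsX lerXn2r ?nnegrE ?cabs_ge0 //.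
by rewrite /w cabsR ger0_norm ?invr_ge0 // invf_le1 ?ltr0n // ler1n.
Qed.

Lemma mon_ffcons d (t : C) (z : Cd d) (m : {ffun 'I_d.+1 -> nat}) :
 mon m (ffcons t z) = t ^+ m ord0 * mon (fftail m) z.
Proof.
rewrite /mon big_ord_recl ffcons0; congr (_ * _).
by apply: eq_bigr => j _; rewrite ffconsS ffunE.
Qed.

Lemma power_series_uniq d (b : {ffun 'I_d -> nat} -> C) : summ b -> (forall z, powsum b z = 0) ->
 forall m, b m = 0.
Proof.
elim: d b => [|d IH] b hb h0 m.
 have := h0 [ffun=> 0]; rewrite /powsum (@csum1 _ _ _ m) => [|j]; first by rewrite /mon big_ord0 mulr1.
 by have -> : j = m by [apply/ffunP => -[]]; rewrite eqxx.
pose c n (m' : {ffun 'I_d -> nat}) := b (ffcons n m').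
have inj : injective (fun x : nat * {ffun 'I_d -> nat} => ffcons x.1 x.2) := bij_inj (ffcons_bij _ _).
have pr z t : casum (fun x : nat * {ffun 'I_d -> nat} => b (ffcons x.1 x.2) * mon (ffcons x.1 x.2) (ffcons t z : Cd d.+1)).
 exact: (rasum_inj inj (powsum_casum _ hb)).
have sl n : summ (c n).
 have pos (r : R) : 0 <= r -> forall x : nat * {ffun 'I_d -> nat},
   0 <= cabs (b (ffcons x.1 x.2)) * rpow (ffcons x.1 x.2) r.
  by move=> r0 x; rewrite mulr_ge0 ?cabs_ge0 // prodr_ge0 // => j _; exact: exprn_ge0.
 move=> r r0; have h1 := rasum_pair1 n (pos r r0) (rasum_inj inj (hb r r0)).
 have {}h1 : rasum (fun m' => r ^+ n * (cabs (c n m') * rpow m' r)).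
  apply: rasum_le h1 => m'; rewrite mulrCA ler_wpM2l ?cabs_ge0 //.
  by rewrite /rpow big_ord_recl ffcons0 ler_wpM2l ?exprn_ge0 //; under [leRHS]eq_bigr do rewrite ffconsS.
 have [->|r1] := eqVneq r 0; last first.
  have rv0 : 0 <= r^-1 by rewrite invr_ge0.
  have := rasumZ (exprn_ge0 n rv0) h1.
  by apply: rasum_le => m'; rewrite mulrA -exprMn mulVf // expr1n mul1r.
 have := rasum_pair1 n (pos 1 ler01) (rasum_inj inj (hb 1 ler01)).
 apply: rasum_le => m' /=; rewrite ler_wpM2l ?cabs_ge0 //.
 rewrite /rpow [leRHS]big1 => [|j _]; last exact: expr1n.
 rewrite [leRHS](_ : 1 = \prod_(j < d) 1 :> R); last by rewrite big1.
 by apply: ler_prod => j _; rewrite exprn_ge0 //= exprn_ile1.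
have E z t : csum (fun n => powsum (c n) z * t ^+ n) = 0.
 rewrite -(h0 (ffcons t z)) /powsum -[RHS](csum_bij (@ffcons_bij _ d)) ?csum_pair //; last exact: powsum_casum.
 apply: eq_csum => n; rewrite -csumZr; last exact: powsum_casum.
 by apply: eq_csum => m' /=; rewrite mon_ffcons ffcons0 ffconsK mulrAC -mulrA.
rewrite -(ffcons_eta m); apply: (IH (c (m ord0))) => // z.
apply: (power_series_uniq1 _ (E z)) => r r0.
have := rasum_pair2 (fun _ => cabs_ge0 _) (pr z r%:C); apply: rasum_le => n /=.
rewrite -[r in leLHS]ger0_norm // -cabsR -cabsX -cabsM -csumZr; last exact: powsum_casum.
apply: le_trans (cabs_csum (casumZr _ (powsum_casum _ (sl n)))) _.
apply/eq_ler; apply: eq_rsum => m'.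
by rewrite mon_ffcons ffcons0 ffconsK mulrAC -mulrA.
Qed.

(* One slot at a time: the coefficients in the first variable of a power series vanish. *)
Lemma power_series_slot d (J : choiceType) (a : {ffun 'I_d -> nat} * J -> C) (v : J -> C) :
 (forall x, casum (fun i => a i * (mon i.1 x * v i.2))) ->
 (forall x, csum (fun i => a i * (mon i.1 x * v i.2)) = 0) ->
 forall k, casum (fun j => a (k, j) * v j) /\ csum (fun j => a (k, j) * v j) = 0.
Proof.
move=> ha h0.
have m1 k : mon k [ffun=> 1] = 1 :> C by apply: big1 => j _; rewrite ffunE expr1n.
have hk k : casum (fun j => a (k, j) * v j).
 have := rasum_pair1 k (fun _ => cabs_ge0 _) (ha [ffun=> 1]).
 by apply: rasum_le => j /=; rewrite m1 mul1r.
move=> k; split=> //.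
apply: (power_series_uniq (b := fun k => csum (fun j => a (k, j) * v j))) => [r r0|z].
 have := rasum_pair2 (fun _ => cabs_ge0 _) (ha [ffun=> r%:C]); apply: rasum_le => n /=.
 have mr : (rpow n r)%:C = mon n ([ffun=> r%:C] : Cd d).
  by rewrite /rpow /mon rmorph_prod; apply: eq_bigr => j _; rewrite ffunE rmorphXn.
 have -> : rpow n r = cabs (rpow n r)%:C.
  by rewrite cabsR ger0_norm // prodr_ge0 // => j _; exact: exprn_ge0.
 rewrite -cabsM -csumZr // mr.
 apply: le_trans (cabs_csum (casumZr _ (hk n))) _.
 by apply/eq_ler; apply: eq_rsum => j; rewrite mulrAC -mulrA.
rewrite -(h0 z) csum_pair // /powsum; apply: eq_csum => n /=; rewrite -csumZr //.
by apply: eq_csum => j; rewrite mulrAC -mulrA.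
Qed.
End Uniqueness.

(** The Gaussian factor of [u] merges with the generating function of [pk] into one exponential. The
    bound on the absolute sum is the same identity at the moduli; it is what later justifies the
    exchange with lattice sums. *)
Lemma u_gen (z x y : C) (f := fun t : nat * nat => u t.1 t.2 z * (x ^+ t.1 * y ^+ t.2 / (fs R t.1 t.2)%:C)) :
 [/\ casum f,
 csum f = cexp ((- (pi / 2) * cabs2 z)%:C - (sq R)%:C * conjc z * x + (sq R)%:C * z * y + x * y) &
 rsum (fun t => cabs (f t)) <= expR (- (pi / 2) * cabs2 z + sq R * cabs z * (cabs x + cabs y) + cabs x * cabs y)].
Proof.
have fE t : f t = (expR (- (pi / 2) * cabs2 z))%:C * (pk t.1 t.2 (- ((sq R)%:C * conjc z)) ((sq R)%:C * z)
  * x ^+ t.1 * y ^+ t.2 / (t.1`!%:R * t.2`!%:R)).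
 rewrite /f /u; have e : (fs R t.1 t.2)%:C * (fs R t.1 t.2)%:C = t.1`!%:R * t.2`!%:R :> C.
  by rewrite -realCM /fs -expr2 sqr_sqrtr ?mulr_ge0 // realCM !realCn.
 rewrite -e; have := fs_neq0 R t.1 t.2; move: ((fs R _ _)%:C) (pk _ _ _ _) ((expR _)%:C) (x ^+ _) (y ^+ _) => F P E X Y F0.
 by field.
have cf : casum f by rewrite (funext fE); apply: casumZ; exact: casum_pk_gen.
split=> //.
 rewrite (funext fE) csumZ; last exact: casum_pk_gen.
 rewrite csum_pk_gen -cexp_real -cexpD; congr cexp; ring.
have s0 := ltW (sq_gt0 R).
pose g t := expR (- (pi / 2) * cabs2 z) * (pk t.1 t.2 (sq R * cabs z) (sq R * cabs z)
  * cabs x ^+ t.1 * cabs y ^+ t.2 / (t.1`!%:R * t.2`!%:R)).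
have g0 t : 0 <= g t.
 by rewrite /g mulr_ge0 ?expR_ge0 // divr_ge0 ?mulr_ge0 ?exprn_ge0 ?cabs_ge0 // pk_ge0 // mulr_ge0 ?cabs_ge0.
have gE t : (g t)%:C = (expR (- (pi / 2) * cabs2 z))%:C * (pk t.1 t.2 (sq R * cabs z)%:C (sq R * cabs z)%:C
  * (cabs x)%:C ^+ t.1 * (cabs y)%:C ^+ t.2 / (t.1`!%:R * t.2`!%:R)).
 by rewrite /g !realCM realCV !realCM rmorph_pk !realCX !realCn !realCM.
have hg : rasum g.
 have h : casum (fun t => (g t)%:C) by rewrite (funext gE); apply: casumZ; exact: casum_pk_gen.
 by apply: rasum_le h => t; rewrite cabsR ger0_norm.
have rg : rsum g = expR (- (pi / 2) * cabs2 z + sq R * cabs z * (cabs x + cabs y) + cabs x * cabs y).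
 have : (rsum g)%:C = (expR (- (pi / 2) * cabs2 z + sq R * cabs z * (cabs x + cabs y) + cabs x * cabs y))%:C :> C.
  rewrite -csum_real // (funext gE) csumZ; last exact: casum_pk_gen.
  rewrite csum_pk_gen -!realCM -!realCD cexp_real -realCM -expRD; congr (expR _)%:C; ring.
 by move=> [].
rewrite -rg; apply: ler_rsum hg => t; rewrite fE /g cabsM cabsR ger0_norm ?expR_ge0 // ler_wpM2l ?expR_ge0 //.
rewrite !cabsM cabsV cabsM !cabs_nat !cabsX; apply: ler_wpM2r; first by rewrite invr_ge0 mulr_ge0.
do 2 (apply: ler_wpM2r; first by rewrite exprn_ge0 ?cabs_ge0).
apply: le_trans (cabs_pk _ _ _ _) _.
by rewrite cabsN !cabsM cabs_conj cabsR ger0_norm.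
Qed.

Variable d : nat.
Local Notation NI := (NI d).

Definition fsd (k m : NI) : R := \prod_j fs R (k j) (m j).
Lemma fsd_neq0 k m : (fsd k m)%:C != 0 :> C.
Proof.
by rewrite /fsd rmorph_prod; apply/prodf_neq0 => j _; exact: fs_neq0.
Qed.
Lemma rsum_prod (T : choiceType) (f : 'I_d -> T -> R) : (forall j t, 0 <= f j t) -> (forall j, rasum (f j)) ->
 rsum (fun k : {ffun 'I_d -> T} => \prod_j f j (k j)) = \prod_j rsum (f j).
Proof.
move=> f0 hf; have hc j : casum (fun t => (f j t)%:C : C) by exact: casum_real.
have [a e] := csum_prod hc.
have p0 (k : {ffun 'I_d -> T}) : 0 <= \prod_j f j (k j) by apply: prodr_ge0.
have E (k : {ffun 'I_d -> T}) : \prod_j (f j (k j))%:C = (\prod_j f j (k j))%:C :> C by rewrite rmorph_prod.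
have : (rsum (fun k : {ffun 'I_d -> T} => \prod_j f j (k j)))%:C = (\prod_j rsum (f j))%:C :> C.
 rewrite -csum_real //; last by apply: rasum_le a => k; rewrite E cabsR ger0_norm.
 by rewrite rmorph_prod -(funext E) e; apply: eq_bigr => j _; rewrite csum_real.
by move=> [].
Qed.

(** A pair of multi-indices read as one multi-index of pairs, so that [csum_prod] factors a double
    series over the coordinates. *)
Definition zip2 (t : NI * NI) : {ffun 'I_d -> nat * nat} := [ffun j => (t.1 j, t.2 j)].
Lemma zip2_bij : bijective zip2.
Proof.
exists (fun k : {ffun 'I_d -> nat * nat} => ([ffun j => (k j).1] : NI, [ffun j => (k j).2] : NI)) => [[k m]|k].
 by congr pair; apply/ffunP => j; rewrite !ffunE.
by apply/ffunP => j; rewrite !ffunE -surjective_pairing.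
Qed.

Definition nrm2 (z : Cd d) : R := \sum_j cabs2 (z j).
Definition nrm1 (z : Cd d) : R := \sum_j cabs (z j).

Lemma U_gen (z x y : Cd d) (f := fun t : NI * NI => U t.1 t.2 z * (mon t.1 x * mon t.2 y / (fsd t.1 t.2)%:C)) :
 [/\ casum f,
 csum f = cexp ((- (pi / 2) * nrm2 z)%:C + \sum_j ((sq R)%:C * (z j * y j - conjc (z j) * x j) + x j * y j)) &
 forall r, (forall j, cabs (x j) <= r /\ cabs (y j) <= r) ->
 rsum (fun t => cabs (f t)) <= expR (- (pi / 2) * nrm2 z + sq R * 2 * r * nrm1 z + d%:R * r ^+ 2)].
Proof.
pose g j (t : nat * nat) := u t.1 t.2 (z j) * (x j ^+ t.1 * y j ^+ t.2 / (fs R t.1 t.2)%:C).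
have fE t : f t = \prod_j g j (zip2 t j).
 rewrite /f /U /mon /fsd rmorph_prod -prodfV -!big_split; apply: eq_bigr => j _ /=.
 by rewrite ffunE.
have hg j : casum (g j) by have [] := u_gen (z j) (x j) (y j).
have [a e] := csum_prod hg; have inj := bij_inj zip2_bij.
split.
- by rewrite (funext fE); exact: (rasum_inj inj a).
- rewrite (funext fE) (csum_bij zip2_bij a) e.
 have -> : (- (pi / 2) * nrm2 z)%:C = \sum_j (- (pi / 2) * cabs2 (z j))%:C :> C.
  by rewrite /nrm2 mulr_sumr raddf_sum.
 rewrite -big_split cexp_sum; apply: eq_bigr => j _; have [_ -> _] := u_gen (z j) (x j) (y j).
 by congr cexp => /=; ring.
move=> r hr; have r0 (j : 'I_d) : 0 <= r by apply: le_trans (cabs_ge0 (x j)) (hr j).1.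
have -> : rsum (fun t => cabs (f t)) = rsum (fun t => \prod_j cabs (g j (zip2 t j))).
 by apply: eq_rsum => t; rewrite fE cabs_prod.
have a' : rasum (fun k : {ffun 'I_d -> nat * nat} => \prod_j cabs (g j (k j))).
 by apply: rasum_le a => k; rewrite cabs_prod.
rewrite (rsum_bij zip2_bij a') => [|k]; last by apply: prodr_ge0 => j _; exact: cabs_ge0.
rewrite (rsum_prod (f := fun j t => cabs (g j t))) //; last by move=> j t; exact: cabs_ge0.
have -> : - (pi / 2) * nrm2 z + sq R * 2 * r * nrm1 z + d%:R * r ^+ 2 =
  \sum_j (- (pi / 2) * cabs2 (z j) + sq R * cabs (z j) * (r + r) + r * r).
 rewrite !big_split /= sumr_const card_ord /nrm2 /nrm1 !mulr_sumr -[r * r *+ d]mulr_natl -expr2.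
 by congr (_ + _ + _); apply: eq_bigr => j _; ring.
rewrite expR_sum; apply: ler_prod => j _; have [_ _ h] := u_gen (z j) (x j) (y j).
rewrite (rsum_ge0 (hg j)) /=; apply: le_trans h _; rewrite ler_expR -!addrA lerD2l.
have [hx hy] := hr j; apply: lerD; last by apply: ler_pM => //; exact: cabs_ge0.
by rewrite ler_wpM2l ?lerD // mulr_ge0 ?cabs_ge0 // ltW // sq_gt0.
Qed.

Section PointFamily.
Variables (J : choiceType) (pt : J -> Cd d).

Definition gsum := forall r, rasum (fun n => expR (- pi * nrm2 (pt n) + r * nrm1 (pt n))).
Hypothesis hpt : gsum.

Definition S4 (k m k' m' : NI) : C := csum (fun n => U k m (pt n) * conjc (U k' m' (pt n))).
(** What remains of the generating function of [S4] once the factors free of the points are taken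
    out: a Gaussian sum with a linear exponent, ready for Poisson summation. *)
Definition T4 (w w' : Cd d) : C := csum (fun n => cexp ((- pi * nrm2 (pt n))%:C +
 (sq R)%:C * \sum_j (pt n j * w j + conjc (pt n j) * w' j))).

Lemma T4_casum (w w' : Cd d) : casum (fun n => cexp ((- pi * nrm2 (pt n))%:C + (sq R)%:C * \sum_j (pt n j * w j + conjc (pt n j) * w' j))).
Proof.
have [a a0 ha] := Cd_bound w; have [b b0 hb] := Cd_bound w'.
apply: rasum_le (hpt (sq R * (a + b))) => n.
rewrite cabs_cexp ler_expR ReD lerD2l /=; apply: le_trans (ler_norm _) _.
apply: le_trans (cabsRe _) _; rewrite cabsM cabsR (ger0_norm (ltW (sq_gt0 R))) -mulrA.
rewrite ler_wpM2l ?(ltW (sq_gt0 R)) //; apply: le_trans (cabs_sum _ _ _) _.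
rewrite /nrm1 mulr_sumr; apply: ler_sum => j _; apply: le_trans (cabsD _ _) _.
by rewrite !cabsM cabs_conj -mulrDr mulrC ler_wpM2r ?cabs_ge0 // lerD ?ha ?hb.
Qed.

(** Product of two instances of [U_gen], the second conjugated at conjugated variables: the points
    couple to [z (y - x') + conj(z) (y' - x)] only. *)
Lemma S4_gen (x y x' y' : Cd d)
 (c := fun t : (NI * NI) * (NI * NI) => mon t.1.1 x * mon t.1.2 y / (fsd t.1.1 t.1.2)%:C *
  (mon t.2.1 x' * mon t.2.2 y' / (fsd t.2.1 t.2.2)%:C)) :
 [/\ forall t, casum (fun n => U t.1.1 t.1.2 (pt n) * conjc (U t.2.1 t.2.2 (pt n)) * c t),
 casum (fun t => S4 t.1.1 t.1.2 t.2.1 t.2.2 * c t) &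
 csum (fun t => S4 t.1.1 t.1.2 t.2.1 t.2.2 * c t) =
  cexp (\sum_j (x j * y j + x' j * y' j)) * T4 (y - x') (y' - x)].
Proof.
have [r r0 hr] : exists2 r, 0 <= r & forall z, z \in [:: x; y; x'; y'] -> forall j, cabs (z j) <= r.
 have [a a0 ha] := Cd_bound x; have [b b0 hb] := Cd_bound y.
 have [a' a'0 ha'] := Cd_bound x'; have [b' b'0 hb'] := Cd_bound y'.
 exists (a + b + a' + b') => [|z]; first by rewrite !addr_ge0.
 rewrite !inE => /or4P[] /eqP -> j.
 - by apply: le_trans (ha j) _; rewrite -!addrA lerDl !addr_ge0.
 - by apply: le_trans (hb j) _; rewrite [a + b]addrC -!addrA lerDl !addr_ge0.
 - by apply: le_trans (ha' j) _; rewrite [_ + a']addrC -!addrA lerDl !addr_ge0.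
 - by apply: le_trans (hb' j) _; rewrite lerDr !addr_ge0.
pose cj (z : Cd d) : Cd d := [ffun j => conjc (z j)].
have cjm k z : conjc (mon k (cj z)) = mon k z.
 rewrite /mon conj_prod; apply: eq_bigr => j _; by rewrite ffunE conjX conjcK.
pose f n (t : (NI * NI) * (NI * NI)) := U t.1.1 t.1.2 (pt n) * conjc (U t.2.1 t.2.2 (pt n)) * c t.
pose g1 n (t : NI * NI) := U t.1 t.2 (pt n) * (mon t.1 x * mon t.2 y / (fsd t.1 t.2)%:C).
pose g2 n (t : NI * NI) := U t.1 t.2 (pt n) * (mon t.1 (cj x') * mon t.2 (cj y') / (fsd t.1 t.2)%:C).
have fE n t : f n t = g1 n t.1 * conjc (g2 n t.2).
 rewrite /f /c /g1 /g2 !conjM !cjm conjV conjR.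
 move: (U _ _ _) (conjc _) (mon _ x) (mon _ y) (mon _ x') (mon _ y') (_^-1) (_^-1) => *; ring.
have a1 n : casum (g1 n) by have [] := U_gen (pt n) x y.
have a2 n : casum (fun t => conjc (g2 n t)) by apply: casum_conj; have [] := U_gen (pt n) (cj x') (cj y').
have hf n : casum (f n).
 have := rasum_prod (fun _ => cabs_ge0 _) (fun _ => cabs_ge0 _) (a1 n) (a2 n).
 by apply: rasum_le => t; rewrite fE cabsM.
have eqle (a b : R) : a = b -> a <= b by move=> ->.
have hb n : rsum (fun t => cabs (f n t)) <=
  expR (2 * (d%:R * r ^+ 2)) * expR (- pi * nrm2 (pt n) + (4 * sq R * r) * nrm1 (pt n)).
 rewrite (rsum_pair (fun _ => cabs_ge0 _) (hf n)).
 have h2 : rsum (fun t => cabs (conjc (g2 n t))) <=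
   expR (- (pi / 2) * nrm2 (pt n) + sq R * 2 * r * nrm1 (pt n) + d%:R * r ^+ 2).
  under eq_rsum do rewrite cabs_conj.
  have [_ _] := U_gen (pt n) (cj x') (cj y'); apply => j; rewrite !ffunE !cabs_conj.
  by split; apply: hr; rewrite !inE eqxx ?orbT.
 have h1 : rsum (fun t => cabs (g1 n t)) <=
   expR (- (pi / 2) * nrm2 (pt n) + sq R * 2 * r * nrm1 (pt n) + d%:R * r ^+ 2).
  have [_ _] := U_gen (pt n) x y; apply => j.
  by split; apply: hr; rewrite !inE eqxx ?orbT.
 apply: (@le_trans _ _ (rsum (fun t => rsum (fun t' => cabs (conjc (g2 n t'))) * cabs (g1 n t)))).
  apply: ler_rsum => [t|]; last by apply: rasumZ (a1 n); exact: rsum_ge0 (a2 n).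
  apply: rsum_le => A uA; under eq_bigr do rewrite fE cabsM /=.
  rewrite -mulr_sumr mulrC ler_wpM2r ?cabs_ge0 //; exact: (rsum_ub (a2 n) uA).
 apply: (@le_trans _ _ (rsum (fun t' => cabs (conjc (g2 n t'))) * rsum (fun t => cabs (g1 n t)))).
  apply: rsum_le => A uA; rewrite -mulr_sumr ler_wpM2l ?(rsum_ge0 (a2 n)) //.
  exact: (rsum_ub (a1 n) uA).
 apply: le_trans (ler_pM (rsum_ge0 (a2 n)) (rsum_ge0 (a1 n)) h2 h1) _.
 by rewrite -!expRD ler_expR; apply: eqle; field.
have [h1 h2 h3] := csum_swap_bound (rasumZ (expR_ge0 _) (hpt (4 * sq R * r))) hf hb.
have SE t : csum (f^~ t) = S4 t.1.1 t.1.2 t.2.1 t.2.2 * c t.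
 rewrite /S4; have [c0|c0] := eqVneq (c t) 0.
  by rewrite c0 mulr0 (eq_csum (g := fun=> 0)) ?csum0 // => n; rewrite /f c0 mulr0.
 rewrite -csumZr //; have := casumZr (c t)^-1 (h1 t).
 by apply: rasum_le => n; rewrite /f mulfK.
split=> //; first by rewrite (funext SE) in h2.
rewrite -(funext SE) -h3 /T4 -csumZ; last exact: T4_casum.
apply: eq_csum => n; under eq_csum do rewrite fE.
rewrite csum_pair; last by rewrite -(funext (fE n)).
under eq_csum do rewrite /= csumZ //.
rewrite csumZr // csum_conj; last by have [] := U_gen (pt n) (cj x') (cj y').
have [_ -> _] := U_gen (pt n) x y; have [_ -> _] := U_gen (pt n) (cj x') (cj y').
rewrite cexp_conj -!cexpD; congr cexp; rewrite conjD conjR conj_sum.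
have -> : (- pi * nrm2 (pt n))%:C = (- (pi / 2) * nrm2 (pt n))%:C + (- (pi / 2) * nrm2 (pt n))%:C :> C.
 by rewrite -realCD; congr (_%:C); field.
rewrite mulr_sumr addrACA [RHS]addrCA [in RHS]addrA -[RHS]addrA; congr (_ + _).
rewrite -!big_split; apply: eq_bigr => j _ /=; rewrite !ffunE.
by rewrite conjD !conjM conjB !conjM !conjcK conjR; ring.
Qed.
End PointFamily.

Lemma power_series_uniq_casum (b : NI -> C) : (forall x, casum (fun k => b k * mon k x)) ->
 (forall x, csum (fun k => b k * mon k x) = 0) -> forall k, b k = 0.
Proof.
move=> hb h0; apply: (power_series_uniq _ h0) => r r0.
apply: rasum_le (hb [ffun=> r%:C]) => k; rewrite cabsM ler_wpM2l ?cabs_ge0 //.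
rewrite /mon cabs_prod /rpow; apply: ler_prod => j _; rewrite exprn_ge0 //=.
by rewrite ffunE cabsX cabsR ger0_norm.
Qed.

(** The index is regrouped as nested pairs, and [power_series_slot] removes the groups of variables
    one at a time. *)
Lemma uniq4 (a : (NI * NI) * (NI * NI) -> C)
 (v := fun (x y x' y' : Cd d) (t : (NI * NI) * (NI * NI)) =>
   mon t.1.1 x * mon t.1.2 y * (mon t.2.1 x' * mon t.2.2 y')) :
 (forall x y x' y', casum (fun t => a t * v x y x' y' t)) ->
 (forall x y x' y', csum (fun t => a t * v x y x' y' t) = 0) -> forall t, a t = 0.
Proof.
move=> ha h0.
pose h (s : NI * (NI * (NI * NI))) : (NI * NI) * (NI * NI) := ((s.1, s.2.1), s.2.2).
have bh : bijective h by exists (fun t => (t.1.1, (t.1.2, t.2))) => [[k [m s]]|[[k m] s]].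
pose v3 (x' y' : Cd d) (s : NI * NI) := mon s.1 x' * mon s.2 y'.
pose v2 (y x' y' : Cd d) (s : NI * (NI * NI)) := mon s.1 y * v3 x' y' s.2.
have E x y x' y' s : a (h s) * v x y x' y' (h s) = a (h s) * (mon s.1 x * v2 y x' y' s.2).
 by rewrite /v /v2 /v3 /= !mulrA.
have s1 y x' y' := @power_series_slot d _ (a \o h) (v2 y x' y').
have {}s1 y x' y' k : casum (fun j => a (h (k, j)) * v2 y x' y' j) /\ csum (fun j => a (h (k, j)) * v2 y x' y' j) = 0.
 apply: s1 => x.
  by have := rasum_inj (bij_inj bh) (ha x y x' y'); apply: rasum_le => s; rewrite E.
 by rewrite -(h0 x y x' y') -[RHS](csum_bij bh) //; apply: eq_csum => s; rewrite E.
have s2 x' y' k m : casum (fun j => a (h (k, (m, j))) * v3 x' y' j) /\ csum (fun j => a (h (k, (m, j))) * v3 x' y' j) = 0.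
 have := @power_series_slot d _ (fun j => a (h (k, j))) (v3 x' y') (fun y => (s1 y x' y' k).1).
 by apply => y; exact: (s1 y x' y' k).2.
have s3 y' k m k' : casum (fun j => a (h (k, (m, (k', j)))) * mon j y') /\ csum (fun j => a (h (k, (m, (k', j)))) * mon j y') = 0.
 have := @power_series_slot d _ (fun j => a (h (k, (m, j)))) (fun j => mon j y') (fun x => (s2 x y' k m).1).
 by apply => x'; exact: (s2 x' y' k m).2.
move=> [[k m] [k' m']].
have := @power_series_uniq_casum (fun j => a (h (k, (m, (k', j))))) (fun x => (s3 x k m k').1).
by apply => x; exact: (s3 x k m k').2.
Qed.

Lemma fsdM k m k' m' : fsd k m * fsd k' m' = fsd k k' * fsd m m'.
Proof.
rewrite /fsd -!big_split; apply: eq_bigr => j _ /=.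
by rewrite /fs !sqrtrM // mulrACA.
Qed.

(** Exchanging [m] and [k'] exchanges [y] and [x'] in the generating function, that is, it changes
    the sign of the first argument of [T4]. The factor [exp (w . w')] turns [x y + x' y'] into
    [x x' + y y'], and the normalisations agree by [fsdM]. *)
Theorem intertwining (J1 J2 : choiceType) (p1 : J1 -> Cd d) (p2 : J2 -> Cd d) (c : C) :
 gsum p1 -> gsum p2 ->
 (forall w w', T4 p1 w w' = c * cexp (\sum_j w j * w' j) * T4 p2 (- w) w') ->
 forall k m k' m', S4 p1 k m k' m' = c * S4 p2 k k' m m'.
Proof.
move=> h1 h2 hT k m k' m'.
pose sw (t : (NI * NI) * (NI * NI)) := ((t.1.1, t.2.1), (t.1.2, t.2.2)).
have bsw : bijective sw by exists sw => -[[? ?] [? ?]].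
pose F t := ((fsd t.1.1 t.1.2 * fsd t.2.1 t.2.2)%:C)^-1 : C.
have F0 t : F t != 0 by rewrite invr_eq0 realCM mulf_neq0 ?fsd_neq0.
pose a t := F t * (S4 p1 t.1.1 t.1.2 t.2.1 t.2.2 - c * S4 p2 t.1.1 t.2.1 t.1.2 t.2.2).
suff /eqP : a ((k, m), (k', m')) = 0.
 by rewrite mulf_eq0 (negbTE (F0 _)) subr_eq0 => /eqP.
have key (x y x' y' : Cd d) : casum (fun t => a t * (mon t.1.1 x * mon t.1.2 y * (mon t.2.1 x' * mon t.2.2 y'))) /\
  csum (fun t => a t * (mon t.1.1 x * mon t.1.2 y * (mon t.2.1 x' * mon t.2.2 y'))) = 0.
 have [_] := S4_gen h1 x y x' y'; set f1 := fun t => _ => a1 e1.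
 have [_] := S4_gen h2 x x' y y'; set f2 := fun t => _ => a2 e2.
 have E t : a t * (mon t.1.1 x * mon t.1.2 y * (mon t.2.1 x' * mon t.2.2 y')) = f1 t - c * f2 (sw t).
  rewrite /a /f1 /f2 /F /= [in LHS]realCM invfM.
  have -> : (mon t.1.1 x * mon t.2.1 x' / (fsd t.1.1 t.2.1)%:C * (mon t.1.2 y * mon t.2.2 y' / (fsd t.1.2 t.2.2)%:C)) =
    mon t.1.1 x * mon t.1.2 y / (fsd t.1.1 t.1.2)%:C * (mon t.2.1 x' * mon t.2.2 y' / (fsd t.2.1 t.2.2)%:C) :> C.
   transitivity (mon t.1.1 x * mon t.2.1 x' * (mon t.1.2 y * mon t.2.2 y') / ((fsd t.1.1 t.2.1)%:C * (fsd t.1.2 t.2.2)%:C)).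
    by rewrite invfM; move: (_^-1) (_^-1) => *; ring.
   by rewrite -realCM -fsdM realCM invfM; move: (_^-1) (_^-1) => *; ring.
  by move: (_^-1) (_^-1) (S4 _ _ _ _ _) (S4 _ _ _ _ _) => *; ring.
 have a2' : casum (fun t => f2 (sw t)) by exact: (rasum_inj (bij_inj bsw) a2).
 rewrite (funext E); split; first by apply: rasum_le (rasumD a1 (casumZ c a2')) => t; exact: cabsB.
 rewrite csumB ?csumZ //; last exact: casumZ.
 rewrite (csum_bij bsw a2) e1 e2 hT.
 have -> : - (y - x') = x' - y by rewrite opprB.
 have ee : cexp (\sum_j (x j * y j + x' j * y' j)) * cexp (\sum_j (y - x') j * (y' - x) j) =
   cexp (\sum_j (x j * x' j + y j * y' j)).
  rewrite -cexpD; congr cexp; rewrite -big_split; apply: eq_bigr => j _.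
  by rewrite /= !ffunE; ring.
 move: ee; move: (T4 p2 _ _) (cexp (\sum_j (x j * y j + x' j * y' j))) (cexp (\sum_j (y - x') j * (y' - x) j))
  (cexp (\sum_j (x j * x' j + y j * y' j))) => t A1 A2 A3 <-; ring.
by apply: (uniq4 (a := a)) => x y x' y'; have [] := key x y x' y'.
Qed.
End IntertwiningIdentity.

(** * Inner products, kernel operators and moment problems in l2 *)

Section HilbertTools.
Variable R : realType.
Local Notation C := R[i].

Section OneIndex.
Variable I : choiceType.
Implicit Types f g : I -> C.

Definition ip f g : C := csum (fun i => f i * conjc (g i)).

Lemma casum_ip f g : l2 f -> l2 g -> casum (fun i => f i * conjc (g i)).
Proof. by move=> lf lg; apply: casum_l2 => //; exact: l2_conj. Qed.
Lemma cabs_ip f g : l2 f -> l2 g -> cabs (ip f g) ^+ 2 <= n2 f * n2 g.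
Proof.
by move=> lf lg; rewrite cabs_sqr -(n2_conj g); apply: cauchy_schwarz => //; exact: l2_conj.
Qed.
Lemma ip_refl f : l2 f -> ip f f = (n2 f)%:C.
Proof. by move=> lf; rewrite n2E. Qed.
Lemma ip_conj f g : l2 f -> l2 g -> conjc (ip f g) = ip g f.
Proof.
move=> lf lg; rewrite /ip -csum_conj; last exact: casum_ip.
by apply: eq_csum => i; rewrite conjM conjcK mulrC.
Qed.
Lemma sqrt_ip f g : l2 f -> l2 g -> cabs (ip f g) <= Num.sqrt (n2 f) * Num.sqrt (n2 g).
Proof.
move=> lf lg; rewrite -sqrtrM ?n2_ge0 // -[leLHS]ger0_norm ?cabs_ge0 // -sqrtr_sqr.
by rewrite ler_sqrt ?mulr_ge0 ?n2_ge0 //; exact: cabs_ip.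
Qed.
Lemma ipDl f f' g : l2 f -> l2 f' -> l2 g -> ip (fun i => f i + f' i) g = ip f g + ip f' g.
Proof.
move=> lf lf' lg; rewrite /ip -csumD; [|exact: casum_ip..].
by apply: eq_csum => i; rewrite mulrDl.
Qed.
Lemma ipZl c f g : l2 f -> l2 g -> ip (fun i => c * f i) g = c * ip f g.
Proof.
move=> lf lg; rewrite /ip -csumZ; last exact: casum_ip.
by apply: eq_csum => i; rewrite mulrA.
Qed.
Lemma ipBl f f' g : l2 f -> l2 f' -> l2 g -> ip (fun i => f i - f' i) g = ip f g - ip f' g.
Proof.
move=> lf lf' lg; rewrite /ip -csumB; [|exact: casum_ip..].
by apply: eq_csum => i; rewrite mulrBl.
Qed.
Lemma ipBr f g g' : l2 f -> l2 g -> l2 g' -> ip f (fun i => g i - g' i) = ip f g - ip f g'.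
Proof.
move=> lf lg lg'; rewrite /ip -csumB; [|exact: casum_ip..].
by apply: eq_csum => i; rewrite conjB mulrBr.
Qed.
Lemma l2B f g : l2 f -> l2 g -> l2 (fun i => f i - g i).
Proof.
move=> lf lg; have := l2D lf (l2Z (-1) lg); apply: rasum_le => i.
by rewrite mulN1r.
Qed.
Lemma l2_sum (T : Type) (s : seq T) (c : T -> C) (g : T -> I -> C) : (forall t, l2 (g t)) ->
 l2 (fun i => \sum_(t <- s) c t * g t i).
Proof.
move=> lg; elim: s => [|t s IH].
 by apply: (l2_fin (s := [::])) => i _; rewrite big_nil.
have := l2D (l2Z (c t) (lg t)) IH; apply: rasum_le => i; by rewrite big_cons.
Qed.
Lemma ip_suml (T : Type) (s : seq T) (c : T -> C) (g : T -> I -> C) h : (forall t, l2 (g t)) -> l2 h ->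
 ip (fun i => \sum_(t <- s) c t * g t i) h = \sum_(t <- s) c t * ip (g t) h.
Proof.
move=> lg lh; elim: s => [|t s IH].
 by rewrite big_nil /ip (eq_csum (g := fun=> 0)) ?csum0 // => i; rewrite big_nil mul0r.
rewrite big_cons -IH -ipZl // -ipDl //; first by apply: eq_csum => i; rewrite big_cons.
 exact: l2Z.
exact: l2_sum.
Qed.
Lemma n2_lincomb (T : Type) (s : seq T) (c : T -> C) (g : T -> I -> C) : (forall t, l2 (g t)) ->
 (n2 (fun i => \sum_(t <- s) c t * g t i))%:C =
 \sum_(t <- s) \sum_(t' <- s) c t * conjc (c t') * ip (g t) (g t').
Proof.
move=> lg; have ls := l2_sum s c lg; rewrite -ip_refl // ip_suml //; apply: eq_bigr => t _.
rewrite -ip_conj // ip_suml // conj_sum mulr_sumr; apply: eq_bigr => t' _.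
by rewrite conjM ip_conj // mulrA.
Qed.

Definition l2c (x : nat -> I -> C) f :=
 [/\ forall n, l2 (x n), l2 f & (fun n => n2 (fun i => x n i - f i)) @ \oo --> (0 : R)].

Lemma n2_fin f (s : seq I) : uniq s -> (forall i, i \notin s -> f i = 0) ->
 n2 f = \sum_(i <- s) cabs2 (f i).
Proof.
move=> us hs; have lf := l2_fin hs; apply/le_anti/andP; split; last exact: rsum_ub.
apply: rsum_le => A uA; rewrite (bigID (fun i => i \in s)) /= [X in _ + X]big1 ?addr0.
 rewrite -big_filter; apply: ler_sum_sub; [by move=> i; exact: cabs2_ge0|exact: filter_uniq|].
 by move=> i; rewrite mem_filter => /andP[].
by move=> i /hs ->; rewrite cabs2R expr0n.
Qed.

Lemma l2c_cst f : l2 f -> l2c (fun=> f) f.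
Proof.
move=> lf; split=> //; rewrite (_ : (fun n => _) = fun=> 0); first exact: cvg_cst.
apply/funext => n; rewrite (n2_fin (s := [::])) ?big_nil // => i _; exact: subrr.
Qed.

Lemma cvg0_le (u b : nat -> R) : (forall n, 0 <= u n <= b n) -> b @ \oo --> (0 : R) -> u @ \oo --> (0 : R).
Proof.
by move=> h hb; apply: (squeeze_cvgr (nearW _ h) _ hb); exact: cvg_cst.
Qed.
Lemma sqrt_cvg0 (u : nat -> R) : u @ \oo --> (0 : R) -> (fun n => Num.sqrt (u n)) @ \oo --> (0 : R).
Proof. by move=> hu; rewrite -sqrtr0; apply: continuous_cvg => //; exact: sqrt_continuous. Qed.

Lemma ccvg_ip x y f g : l2c x f -> l2c y g -> ccvg (fun n => ip (x n) (y n)) (ip f g).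
Proof.
move=> [lx lf xf] [ly lg yg].
pose p n := Num.sqrt (n2 (fun i => x n i - f i)); pose q n := Num.sqrt (n2 (fun i => y n i - g i)).
apply: (ccvg_squeeze (b := fun n => p n * q n + (p n * Num.sqrt (n2 g) + Num.sqrt (n2 f) * q n))).
 move=> n; have lxf := l2B (lx n) lf; have lyg := l2B (ly n) lg.
 have -> : ip (x n) (y n) - ip f g = ip (fun i => x n i - f i) (fun i => y n i - g i) +
   (ip (fun i => x n i - f i) g + ip f (fun i => y n i - g i)).
  by rewrite ipBr // !ipBl // !ipBr //; ring.
 apply: le_trans (cabsD _ _) (lerD (sqrt_ip lxf lyg) _).
 exact: le_trans (cabsD _ _) (lerD (sqrt_ip lxf lg) (sqrt_ip lf lyg)).
have cp := sqrt_cvg0 xf; have cq := sqrt_cvg0 yg.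
rewrite -[X in _ --> X](addr0 0) -[X in X + _](mul0r 0) -[X in _ --> _ + X](addr0 0).
apply: cvgD; first exact: cvgM.
rewrite -[X in _ --> X + _](mul0r (Num.sqrt (n2 g))) -[X in _ --> _ + X](mulr0 (Num.sqrt (n2 f))).
by apply: cvgD; apply: cvgM => //; exact: cvg_cst.
Qed.

Lemma cabs2_le_n2 f i : l2 f -> cabs2 (f i) <= n2 f.
Proof. exact: rsum_ub1. Qed.

(** Density of finite support: identities between bounded operators are proved on truncations and
    extended. That each entry is either kept or set to 0 gives truncations dominated by [f]. *)
Lemma l2_truncate f : l2 f -> exists x : nat -> I -> C, [/\ l2c x f, forall n, exists s : seq I, forall i, i \notin s -> x n i = 0 &
 forall n i, x n i = f i \/ x n i = 0].
Proof.
move=> lf.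
have /choice[A hA] : forall n : nat, exists A : seq I, uniq A /\ forall B, uniq B -> {subset A <= B} ->
  n2 f - n.+1%:R^-1 < \sum_(i <- B) cabs2 (f i).
 move=> n; have n0 : 0 < n.+1%:R^-1 :> R by rewrite invr_gt0.
 have [B uB hB] := rsum_approx (fun i => cabs2_ge0 (f i)) lf n0; by exists B.
pose x n i := if i \in A n then f i else 0.
have lx n : l2 (x n) by apply: (l2_fin (s := A n)) => i /negbTE iA; rewrite /x iA.
exists x; split=> [|n|n i]; last by rewrite /x; case: ifP; [left|right].
 split=> //; apply: (cvg0_le (b := fun n => n.+1%:R^-1)) => [n|]; last exact: cvg_harmonic.
  rewrite n2_ge0 /=; last exact: l2B.
  apply: rsum_le => B uB.
  rewrite (bigID (fun i => i \in A n)) /= big1 ?add0r => [|i iA]; last first.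
   by rewrite /x iA subrr cabs2R expr0n.
  rewrite (eq_bigr (fun i => cabs2 (f i))) => [|i /negbTE iA]; last first.
   by rewrite /x iA sub0r -cabs_sqr cabsN cabs_sqr.
  rewrite -big_filter; set B' := seq.filter _ B.
  have uAB : uniq (A n ++ B').
   rewrite cat_uniq (hA n).1 filter_uniq // andbT /=; apply/hasPn => i.
   by rewrite mem_filter => /andP[].
  have sAB : {subset A n <= A n ++ B'} by move=> i iA; rewrite mem_cat iA.
  have h1 : \sum_(i <- A n ++ B') cabs2 (f i) <= n2 f by exact: rsum_ub lf uAB.
  have h2 := (hA n).2 (A n) (hA n).1 (fun i => id).
  rewrite big_cat /= in h1; move: h1 h2.
  by move: (\sum_(i <- A n) _) (\sum_(i <- B') _) (n2 f) (n.+1%:R^-1) => x1 x2 x3 x4; lra.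
by exists (A n) => i /negbTE iA; rewrite /x iA.
Qed.

Lemma l2c_n2 (x : nat -> I -> C) f : l2c x f -> (fun n => n2 (x n)) @ \oo --> n2 f.
Proof.
move=> h; have := ccvg_Re (ccvg_ip h h); have [lx lf _] := h.
by rewrite ip_refl // (funext (fun n => congr1 _ (ip_refl (lx n)))).
Qed.

(** A bound on each finite partial sum passes to the pointwise limit. *)
Lemma l2_fatou x f (M : R) : (forall n, l2 (x n)) -> (forall i, ccvg (x ^~ i) (f i)) ->
 (forall n, n2 (x n) <= M) -> l2 f /\ n2 f <= M.
Proof.
move=> lx xf hM.
have h A : uniq A -> \sum_(i <- A) cabs2 (f i) <= M.
 move=> uA; have E g : \sum_(i <- A) cabs2 (g i) = cabs (\sum_(i <- A) g i * conjc (g i)).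
  rewrite (eq_bigr (fun i => (cabs2 (g i))%:C)) => [|i _]; last exact: mul_conj.
  by rewrite -raddf_sum /= cabsR ger0_norm // sumr_ge0 // => i _; exact: cabs2_ge0.
 rewrite E; apply: (ccvg_cabs_le (u := fun n => \sum_(i <- A) x n i * conjc (x n i))).
  by apply: ccvg_sum => i; apply: ccvgM => //; exact: ccvg_conj.
 by move=> n; rewrite -(E (x n)); apply: le_trans (hM n); exact: rsum_ub (lx n) uA.
by split; [exists M|exact: rsum_le].
Qed.

Lemma n2_triangle f g : l2 f -> l2 g ->
 Num.sqrt (n2 (fun i => f i + g i)) <= Num.sqrt (n2 f) + Num.sqrt (n2 g).
Proof.
move=> lf lg; have lfg := l2D lf lg.
have a0 := sqrtr_ge0 (n2 f); have b0 := sqrtr_ge0 (n2 g).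
rewrite -[leRHS]ger0_norm ?addr_ge0 // -sqrtr_sqr ler_sqrt ?sqr_ge0 //.
have e : (n2 (fun i => f i + g i))%:C = (n2 f)%:C + (n2 g)%:C + (ip f g + conjc (ip f g)).
 rewrite -!ip_refl // ip_conj // ipDl // -(ip_conj lfg lf) -(ip_conj lfg lg) !ipDl //.
 by rewrite !conjD !ip_conj //; ring.
rewrite sqrrD !sqr_sqrtr ?n2_ge0 // [leRHS]addrAC.
have : Re (ip f g) <= Num.sqrt (n2 f) * Num.sqrt (n2 g).
 apply: le_trans (ler_norm _) _; apply: le_trans (cabsRe _) _.
 by rewrite -sqrtrM ?n2_ge0 // -[leLHS]ger0_norm ?cabs_ge0 // -sqrtr_sqr ler_sqrt ?mulr_ge0 ?n2_ge0 // cabs_ip.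
move: e; move: (ip f g) => z /(congr1 (@Re R)); rewrite !ReD Re_conj /= => ->.
by rewrite lerD2l mulr2n => h; rewrite lerD.
Qed.
End OneIndex.

(** The limit is the supremum of the lower ends [u n - e n], all of which lie below every upper
    end. *)
Lemma cauchy_limit_real (u e : nat -> R) : (forall n m, (n <= m)%N -> `|u m - u n| <= e n) ->
 exists l, forall n, `|l - u n| <= e n.
Proof.
move=> h; pose A := [set u n - e n | n in setT].
have ub m : ubound A (u m + e m).
 move=> _ [n _ <-]; have [nm|mn] := leqP n m.
  have := h _ _ nm; have := h _ _ (leqnn m); rewrite subrr normr0 => h0; rewrite ler_norml => /andP[]; lra.
 have := h _ _ (ltnW mn); have := h _ _ (leqnn n); rewrite subrr normr0 => h0; rewrite ler_norml => /andP[]; lra.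
have sA : has_sup A by split; [exists (u 0%N - e 0%N), 0%N|exists (u 0%N + e 0%N); exact: ub].
exists (sup A) => n; rewrite ler_norml.
have h1 : u n - e n <= sup A by apply: sup_ubound; [exact: sA.2|exists n].
have h2 : sup A <= u n + e n by apply: ge_sup; [exact: sA.1|exact: ub].
by apply/andP; split; lra.
Qed.

Lemma cauchy_limit (u : nat -> C) (e : nat -> R) : (forall n m, (n <= m)%N -> cabs (u m - u n) <= e n) ->
 e @ \oo --> (0 : R) -> exists l, ccvg u l.
Proof.
move=> h e0.
have [a ha] : exists l, forall n, `|l - Re (u n)| <= e n.
 apply: cauchy_limit_real => n m nm; apply: le_trans (h n m nm).
 by rewrite -ReN -ReD; exact: cabsRe.
have [b hb] : exists l, forall n, `|l - Im (u n)| <= e n.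
 apply: cauchy_limit_real => n m nm; apply: le_trans (h n m nm).
 by rewrite -ImN -ImD; exact: cabsIm.
exists (a +i* b); apply: (ccvg_squeeze (b := fun n => e n + e n)).
 by move=> n; rewrite cabs_distC; apply: le_trans (cabs_ReIm _) _; rewrite ReD ImD ReN ImN lerD.
by rewrite -[X in _ --> X](addr0 0); exact: cvgD.
Qed.

Section KernelOperators.
Variables (I J : choiceType) (k : I -> J -> C) (M : R).
Definition kop (f : J -> C) (i : I) : C := csum (fun j => f j * k i j).
Hypothesis lk : forall i, l2 (k i).

Lemma kopB f g i : l2 f -> l2 g -> kop (fun j => f j - g j) i = kop f i - kop g i.
Proof.
move=> lf lg; rewrite /kop -csumB; [|exact: casum_l2..].
by apply: eq_csum => j; rewrite mulrBl.
Qed.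
Lemma kop_ip f i : kop f i = ip f (fun j => conjc (k i j)).
Proof. by apply: eq_csum => j; rewrite conjcK. Qed.

Lemma kop_ccvg x f i : l2c x f -> ccvg (fun n => kop (x n) i) (kop f i).
Proof.
move=> h; rewrite kop_ip; under eq_fun do rewrite kop_ip.
apply: ccvg_ip => //; apply: l2c_cst; exact: l2_conj.
Qed.

Hypothesis M0 : 0 <= M.
Hypothesis bk : forall f (s : seq J), (forall j, j \notin s -> f j = 0) ->
 l2 (kop f) /\ n2 (kop f) <= M * n2 f.

(** The values on truncations converge entrywise, by Cauchy-Schwarz on the rows, and Fatou keeps the
    bound. *)
Lemma kop_l2 f : l2 f -> l2 (kop f) /\ n2 (kop f) <= M * n2 f.
Proof.
move=> lf; have [x [xf fx hx]] := l2_truncate lf; have [lx _ _] := xf.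
apply: (l2_fatou (x := fun n => kop (x n))) => [n|i|n].
- by have [s hs] := fx n; have [] := bk hs.
- exact: kop_ccvg.
have [s hs] := fx n; have [_ h] := bk hs; apply: le_trans h (ler_wpM2l M0 _).
apply: ler_rsum lf => i; case: (hx n i) => -> //.
by rewrite cabs2R expr0n cabs2_ge0.
Qed.

Lemma kop_l2c x f : l2c x f -> l2c (fun n => kop (x n)) (kop f).
Proof.
move=> [lx lf xf]; split=> [n||]; [exact: (kop_l2 (lx n)).1|exact: (kop_l2 lf).1|].
apply: (cvg0_le (b := fun n => M * n2 (fun j => x n j - f j))) => [n|].
- have lxf := l2B (lx n) lf; have [l1 h1] := kop_l2 lxf.
 have -> : (fun i => kop (x n) i - kop f i) = kop (fun j => x n j - f j).
  by apply/funext => i; rewrite kopB.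
 by rewrite n2_ge0.
- by rewrite -[X in _ --> X](mulr0 M); apply: cvgM => //; exact: cvg_cst.
Qed.
End KernelOperators.

Section RieszSurjectivity.
Variables (S : countType) (I : choiceType) (K : S -> I -> C).
Hypothesis lK : forall s, l2 (K s).

Definition surjective_l2 := forall al : S -> C, l2 al ->
 exists a, l2 a /\ forall s, kop K a s = al s.
Definition riesz := exists2 A : R, 0 < A & forall (ss : seq S) (c : S -> C), uniq ss ->
 A * \sum_(s <- ss) cabs2 (c s) <= n2 (fun i => \sum_(s <- ss) c s * K s i).

Lemma kop_pairing (ss : seq S) (c : S -> C) a : l2 a ->
 \sum_(s <- ss) c s * kop K a s = csum (fun i => a i * \sum_(s <- ss) c s * K s i).
Proof.
move=> la; rewrite (eq_csum (g := fun i => \sum_(s <- ss) c s * (a i * K s i))); last first.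
 by move=> i; rewrite mulr_sumr; apply: eq_bigr => s _; rewrite mulrCA.
rewrite csum_sum => [|s]; last by apply: casumZ; exact: casum_l2.
by apply: eq_bigr => s _; rewrite csumZ //; exact: casum_l2.
Qed.

(* The uniform boundedness principle by Sokal's gliding hump: if no Riesz bound holds, unit
  vectors u_j with |sum u_j(s) K_s| tiny combine to al = sum_j 4^-j conj u_j (over suitable j),
  which pairs with every u_j to at least 4^-j / 6. *)
Lemma surjective_riesz : surjective_l2 -> riesz.
Proof.
move=> sj; apply: contrapT => nr.
pose t j : R := 4^-1 ^+ j.
have t0 j : 0 < t j by rewrite exprn_gt0 // invr_gt0.
have tS j : t j.+1 = t j / 4 by rewrite /t exprS mulrC.
have /choice[q hq] : forall j : nat, exists q : seq S * (S -> C), [/\ uniq q.1,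
  \sum_(s <- q.1) cabs2 (q.2 s) = 1 & n2 (fun i => \sum_(s <- q.1) q.2 s * K s i) <= t j ^+ 2 / j.+1%:R].
 move=> j; pose e := t j ^+ 2 / j.+1%:R; have e0 : 0 < e by rewrite divr_gt0 ?exprn_gt0.
 apply: contrapT => hn; apply: nr; exists e => // ss c us; rewrite leNgt; apply/negP => h.
 pose N := \sum_(s <- ss) cabs2 (c s).
 have lc := l2_sum ss c lK.
 have N0 : 0 < N by rewrite -(pmulr_rgt0 _ e0); apply: le_lt_trans h; exact: n2_ge0.
 have v2 : cabs2 ((Num.sqrt N)^-1%:C : C) = N^-1 by rewrite cabs2R exprVn sqr_sqrtr // ltW.
 apply: hn; exists (ss, fun s => (Num.sqrt N)^-1%:C * c s); split=> //=.
  under eq_bigr do rewrite cabs2M v2.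
  by rewrite -mulr_sumr mulVf // gt_eqF.
 rewrite (_ : (fun i => _) = (fun i => (Num.sqrt N)^-1%:C * \sum_(s <- ss) c s * K s i)); last first.
  by apply/funext => i; rewrite mulr_sumr; apply: eq_bigr => s _; rewrite mulrA.
 by rewrite n2Z // v2 mulrC ler_pdivrMr // ltW.
pose u j s : C := if s \in (q j).1 then conjc ((q j).2 s) else 0.
have u0 j s : s \notin (q j).1 -> u j s = 0 by rewrite /u => /negbTE ->.
have lu j : l2 (u j) by exact: l2_fin (u0 j).
have nu j : n2 (u j) = 1.
 have [uq e1 _] := hq j; rewrite (n2_fin uq (u0 j)) -[RHS]e1.
 by rewrite big_seq [RHS]big_seq; apply: eq_bigr => s sq; rewrite /u sq cabs2_conj.
pose L j (v : S -> C) : C := \sum_(s <- (q j).1) (q j).2 s * v s.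
have Lle j v : l2 v -> cabs (L j v) <= Num.sqrt (n2 v).
 move=> lv; have -> : L j v = ip v (u j).
  have [uq _ _] := hq j; rewrite /ip (csum_fin uq) => [|s /u0 ->]; last by rewrite conjc0 mulr0.
  by rewrite /L big_seq [RHS]big_seq; apply: eq_bigr => s sq; rewrite /u sq conjcK mulrC.
 rewrite -[leLHS]ger0_norm ?cabs_ge0 // -sqrtr_sqr ler_sqrt ?n2_ge0 //.
 by apply: le_trans (cabs_ip lv (lu j)) _; rewrite nu mulr1.
have Lu j : L j (u j) = 1.
 have [_ e1 _] := hq j; rewrite /L (_ : 1 = (\sum_(s <- (q j).1) cabs2 ((q j).2 s))%:C); last by rewrite e1.
 rewrite raddf_sum /= big_seq [RHS]big_seq.
 by apply: eq_bigr => s sq; rewrite /u sq mul_conj.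
have LD j v w : L j (fun s => v s + w s) = L j v + L j w.
 by rewrite /L -big_split; apply: eq_bigr => s _; rewrite mulrDr.
have LZ j c v : L j (fun s => c * v s) = c * L j v.
 by rewrite /L mulr_sumr; apply: eq_bigr => s _; rewrite mulrCA.
(* The hump [t j * u j] is added only if [L j] does not yet reach [t j / 2] on the sum so far; in
   both cases it does afterwards. *)
pose stp j (al : S -> C) : C := if t j / 2 <= cabs (L j al) then 0 else (t j)%:C.
pose alp := fix alp n := if n is j.+1 then (fun s => alp j s + stp j (alp j) * u j s) else (fun=> 0).
pose sg j := stp j (alp j).
have sgle j : cabs (sg j) <= t j.
 have tj := ltW (t0 j).
 by rewrite /sg /stp; case: ifP => _; rewrite ?cabs0 ?cabsR ?ger0_norm.
have alpS j s : alp j.+1 s = alp j s + sg j * u j s by [].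
have alpE n s : alp n s = \sum_(j < n) sg j * u j s.
 by elim: n => [|n IH]; rewrite ?big_ord0 // big_ord_recr /= -/(sg n) -IH.
have ule j s : cabs (u j s) <= 1.
 rewrite -(@ler_pXn2r _ 2) ?nnegrE ?cabs_ge0 // expr1n cabs_sqr -(nu j); exact: cabs2_le_n2.
have gt : rasum t by apply: rasum_geom; rewrite invr_ge0 ler0n /= invf_lt1 // ltr1n.
have cs s : casum (fun j => sg j * u j s).
 by apply: rasum_le gt => j; rewrite cabsM -[leRHS]mulr1; apply: ler_pM; rewrite ?cabs_ge0.
pose al s := csum (fun j => sg j * u j s).
have cal s : ccvg (alp ^~ s) (al s).
 by rewrite (_ : alp ^~ s = fun n => \sum_(j < n) sg j * u j s); [exact: csum_ccvg|apply/funext => n].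
have lsg j : l2 (fun s => sg j * u j s) by exact: l2Z.
have nsg j : Num.sqrt (n2 (fun s => sg j * u j s)) <= t j.
 by rewrite n2Z // nu mulr1 -cabs_sqr sqrtr_sqr ger0_norm ?cabs_ge0.
have lalp n : l2 (alp n) /\ Num.sqrt (n2 (alp n)) <= 2 - 2 * t n.
 elim: n => [|n [l1 h1]].
  split; first by apply: (l2_fin (s := [::])).
  by rewrite (n2_fin (s := [::])) // big_nil sqrtr0 /t expr0 mulr1 subrr.
 split; first exact: l2D l1 (lsg n).
 apply: le_trans (n2_triangle l1 (lsg n)) _; have := nsg n; rewrite tS; have := t0 n; lra.
have [lal _] : l2 al /\ n2 al <= 4.
 apply: (l2_fatou (x := alp)) => [n||n] //; first exact: (lalp n).1.
 rewrite -[n2 _]sqr_sqrtr; last exact: n2_ge0 (lalp n).1.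
 have := (lalp n).2; have := t0 n; have := sqrtr_ge0 (n2 (alp n)); nra.
(* All later humps together move [L j] by at most [t j / 4 + t j / 16 + ... = t j / 3]. *)
have Lfar j n : cabs (L j (alp (j.+1 + n)%N) - L j (alp j.+1)) <= t j / 3 - t (j + n)%N / 3.
 elim: n => [|n IH]; first by rewrite !addn0 !subrr cabs0.
 move: IH; rewrite !addnS !addSn => IH.
 rewrite -[alp (j + n).+2]/(fun s => alp (j + n).+1 s + sg (j + n).+1 * u (j + n).+1 s) LD addrAC.
 apply: le_trans (cabsD _ _) _; apply: le_trans (lerD IH (le_trans (Lle j _ (lsg _)) (nsg _))) _.
 by rewrite !tS; lra.
have Lal j : t j / 6 <= cabs (L j al).
 have h1 : cabs (L j al - L j (alp j.+1)) <= t j / 3.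
  apply: (ccvg_cabs_le (u := fun n => L j (alp (j.+1 + n)%N) - L j (alp j.+1))).
   apply: ccvgB; last exact: ccvg_cst.
   apply: ccvg_sum => s; apply: ccvgZ => e e0; have [N hN] := cal s e e0.
   by exists N => n Nn; apply: hN; apply: leq_trans Nn (leq_addl _ _).
  by move=> n; apply: le_trans (Lfar j n) _; have := t0 (j + n)%N; lra.
 have h2 : t j / 2 <= cabs (L j (alp j.+1)).
  rewrite -[alp j.+1]/(fun s => alp j s + sg j * u j s) LD LZ Lu mulr1 /sg /stp.
  case: ifP => [h|/negbT]; first by rewrite addr0.
  rewrite -ltNge => h; have := cabsB (L j (alp j) + (t j)%:C) (L j (alp j)).
  by rewrite addrAC subrr add0r cabsR gtr0_norm //; lra.
 have := cabsB (L j al - L j (alp j.+1)) (L j al).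
 by rewrite addrAC subrr add0r cabsN; lra.
have [a [la ha]] := sj al lal.
(* Pairing with a solution [a] of the moment problem for [al] bounds [t j / 6] by the norm of [a]
   times [t j / sqrt (j + 1)]. The division by [j.+1] in the choice of [q] makes this impossible for
   large [j]. *)
have contra j : j.+1%:R <= 36 * n2 a.
 have [uq e1 e2] := hq j; have := Lal j.
 have -> : L j al = csum (fun i => a i * \sum_(s <- (q j).1) (q j).2 s * K s i).
  by rewrite -kop_pairing //; apply: eq_bigr => s _; rewrite ha.
 move=> h3; have h4 := cauchy_schwarz la (l2_sum (q j).1 (q j).2 lK).
 rewrite -cabs_sqr in h4.
 have h5 : (t j / 6) ^+ 2 <= n2 a * (t j ^+ 2 / j.+1%:R).
  apply: le_trans (le_trans _ h4) (ler_wpM2l (n2_ge0 la) e2).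
  by rewrite lerXn2r ?nnegrE ?cabs_ge0 // divr_ge0 // ltW.
 have p1 : 0 < t j ^+ 2 by rewrite exprn_gt0.
 have p2 : 0 < j.+1%:R :> R by [].
 have : (t j ^+ 2 / j.+1%:R) * j.+1%:R <= (t j ^+ 2 / j.+1%:R) * (36 * n2 a).
  move: h5; rewrite expr_div_n mulrA [in X in _ -> _ <= X]mulrCA divfK ?gt_eqF //.
  have -> : 6 ^+ 2 = 36 :> R by rewrite -natrX.
  by rewrite -mulrA [n2 a * _]mulrC ler_pdivrMr // [_ * 36]mulrC.
 by rewrite ler_pM2l // divr_gt0.
have := contra (Num.truncn (36 * n2 a)); rewrite leNgt.
by rewrite truncnS_gt.
Qed.

Lemma riesz_injective (A : R) (ss : seq S) (c : S -> C) : 0 < A ->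
 A * \sum_(s <- ss) cabs2 (c s) <= 0 -> forall s, s \in ss -> c s = 0.
Proof.
move=> A0; rewrite pmulr_rle0 // => h s sq; apply/eqP; rewrite -cabs_eq0 -sqrf_eq0 cabs_sqr.
have : \sum_(s <- ss) cabs2 (c s) == 0.
 by rewrite eq_le h sumr_ge0 // => i _; exact: cabs2_ge0.
by rewrite psumr_eq0 => [/allP /(_ s sq) //|i _]; exact: cabs2_ge0.
Qed.

(* Minimal norm interpolants of the first N prescribed values form a Cauchy sequence, since the
  increments are orthogonal to the previous interpolants. *)
Lemma riesz_surjective : riesz -> surjective_l2.
Proof.
move=> [A A0 hA] al lal.
pose Kc s i := conjc (K s i).
have lKc s : l2 (Kc s) by exact: l2_conj.
have solve (ss : seq S) : uniq ss -> exists c : S -> C, forall s, s \in ss ->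
  \sum_(t <- ss) c t * ip (K s) (K t) = al s.
 move=> us; case: ss us => [|s0 ss'] us; first by exists (fun=> 0).
 set ss := s0 :: ss' in us *.
 pose n := size ss; pose G := \matrix_(j < n, i < n) ip (K (nth s0 ss i)) (K (nth s0 ss j)).
 have idx (j : 'I_n) : inord (index (nth s0 ss j) ss) = j by rewrite index_uniq // inord_val.
 have sumE (v : 'rV[C]_n) s : \sum_(t <- ss) v 0 (inord (index t ss)) * ip (K s) (K t) =
   \sum_(j < n) v 0 j * ip (K s) (K (nth s0 ss j)).
  rewrite (big_nth s0) big_mkord; apply: eq_bigr => j _; congr (v 0 _ * _).
  exact: idx.
 (* A kernel vector of the Gram matrix gives a combination of the [K s] of norm 0, which the Riesz
    bound excludes. *)
 have uG : G \in unitmx.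
  rewrite -row_free_unit; apply: inj_row_free => v vG.
  pose c t := v 0 (inord (index t ss)).
  have h0 : n2 (fun i => \sum_(t <- ss) conjc (c t) * K t i) = 0.
   have : (n2 (fun i => \sum_(t <- ss) conjc (c t) * K t i))%:C = 0 :> C.
    rewrite n2_lincomb // big_seq big1 // => s sq; under eq_bigr do rewrite conjcK -mulrA.
    rewrite -mulr_sumr sumE; have := congr1 (fun B : 'rV_n => B 0 (inord (index s ss))) vG.
    rewrite !mxE => e; rewrite -[X in _ * X = 0]/(\sum_(j < n) _).
    rewrite (_ : \sum_(j < n) _ = 0) ?mulr0 // -[RHS]e; apply: eq_bigr => j _; rewrite mxE.
    by rewrite inordK ?nth_index // index_mem.
   by move=> [].
  have h1 := hA ss (fun t => conjc (c t)) us; rewrite h0 in h1.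
  apply/rowP => j; rewrite mxE.
  have := riesz_injective A0 h1 (mem_nth s0 (ltn_ord j)); rewrite /c (idx j).
  by move/eqP; rewrite -cabs_eq0 cabs_conj cabs_eq0 => /eqP.
 pose v := (\row_(i < n) al (nth s0 ss i)) *m invmx G.
 exists (fun t => v 0 (inord (index t ss))) => s sq; rewrite sumE.
 have : v *m G = \row_(i < n) al (nth s0 ss i) by rewrite mulmxKV.
 move=> /(congr1 (fun B : 'rV_n => B 0 (inord (index s ss)))); rewrite !mxE inordK ?index_mem // nth_index // => <-.
 by apply: eq_bigr => j _; rewrite [G _ _]mxE inordK ?index_mem // nth_index.
pose fs N := pmap (@pickle_inv S) (iota 0 N).
have ufs N : uniq (fs N) by apply: (pmap_uniq (@pickle_invK S)); exact: iota_uniq.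
have mfs N s : (s \in fs N) = (pickle s < N)%N.
 rewrite /fs mem_pmap; apply/mapP/idP => [[x]|sN].
  by rewrite mem_iota => /= xN e; have := @pickle_invK S x; rewrite -e /= => ->.
 by exists (pickle s); rewrite ?mem_iota // pickleK_inv.
have /choice[c hc] N := solve _ (ufs N).
pose b N i := \sum_(t <- fs N) c N t * Kc t i.
have lb N : l2 (b N) by exact: l2_sum.
have kb N s : s \in fs N -> kop K (b N) s = al s.
 move=> sN; rewrite kop_ip ip_suml //; last exact: l2_conj.
 rewrite -(hc N s sN); apply: eq_bigr => t _; congr (_ * _); rewrite -ip_conj //; last exact: l2_conj.
 rewrite /ip.
 rewrite -[LHS]csum_conj; last exact: (casum_l2 (l2_conj (lK s)) (l2_conj (lKc t))).
 by apply: eq_csum => i; rewrite conjM /Kc !conjcK.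
have ipb N g : l2 g -> (forall s, s \in fs N -> kop K g s = al s) ->
  ip g (b N) = \sum_(t <- fs N) conjc (c N t) * al t.
 move=> lg hg; rewrite -ip_conj // ip_suml // conj_sum big_seq [RHS]big_seq.
 by apply: eq_bigr => t tN; rewrite conjM ip_conj // -hg // kop_ip.
have pyth N g : l2 g -> (forall s, s \in fs N -> kop K g s = al s) ->
  n2 (fun i => g i - b N i) = n2 g - n2 (b N).
 move=> lg hg; have lgb := l2B lg (lb N).
 have e1 : ip g (b N) = (n2 (b N))%:C by rewrite -ip_refl // !(ipb N) // => s; exact: kb.
 have : (n2 (fun i => g i - b N i))%:C = (n2 g - n2 (b N))%:C :> C.
  rewrite -ip_refl // ipBl // !ipBr // -[ip (b N) g]ip_conj // e1 !ip_refl // conjR realCB.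
  by ring.
 by move=> [].
(* The squared norm of [b N] is the pairing of its coefficients with [al], and the Riesz bound
   controls those coefficients by the norm of [b N] itself. *)
have bound N : n2 (b N) <= n2 al / A.
 pose c' s := if s \in fs N then conjc (c N s) else 0.
 have c'0 s : s \notin fs N -> c' s = 0 by rewrite /c' => /negbTE ->.
 have e1 : (n2 (b N))%:C = csum (fun s => c' s * al s).
  rewrite -ip_refl // (ipb N) // => [|s]; last exact: kb.
  rewrite (csum_fin (ufs N)) => [|s /c'0 ->]; last by rewrite mul0r.
  by rewrite big_seq [RHS]big_seq; apply: eq_bigr => s sN; rewrite /c' sN.
 have h1 : n2 (b N) ^+ 2 <= n2 c' * n2 al.
  rewrite -[X in X <= _]cabs2R e1; exact: cauchy_schwarz (l2_fin c'0) lal.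
 have h2 : A * n2 c' <= n2 (b N).
  have -> : n2 c' = \sum_(s <- fs N) cabs2 (conjc (c N s)).
   rewrite (n2_fin (ufs N) c'0) big_seq [RHS]big_seq; apply: eq_bigr => s sN; by rewrite /c' sN.
  apply: le_trans (hA _ _ (ufs N)) _; apply/eq_ler.
  rewrite -n2_conj; apply: eq_rsum => i; rewrite conj_sum; congr cabs2.
  by apply: eq_bigr => t _; rewrite conjM conjcK.
 have n0 := n2_ge0 (lb N); have a0 := n2_ge0 lal; have c0 := n2_ge0 (l2_fin c'0).
 rewrite ler_pdivlMr //; have [->|nz] := eqVneq (n2 (b N)) 0; first by rewrite mul0r.
 have np : 0 < n2 (b N) by rewrite lt_def nz.
 rewrite -(ler_pM2l np); move: h1 h2 => h1 h2.
 have := ler_wpM2l (ltW A0) h1; have := ler_wpM2r a0 h2; move: (n2 _) (n2 _) (n2 _) => x y z; nra.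
have mono n m : (n <= m)%N -> n2 (fun i => b m i - b n i) = n2 (b m) - n2 (b n).
 move=> nm; apply: pyth => // s sn; apply: kb; move: sn; rewrite !mfs => /leq_trans; exact.
have nd : nondecreasing_seq (fun N => n2 (b N)).
 by move=> n m nm; rewrite -subr_ge0 -mono // n2_ge0 //; exact: l2B.
have cl : (fun N => n2 (b N)) @ \oo --> sup (range (fun N => n2 (b N))).
 by apply: nondecreasing_cvgn => //; exists (n2 al / A) => _ [N _ <-].
set l := sup _ in cl; pose e N := l - n2 (b N).
have ele n m : (n <= m)%N -> n2 (fun i => b m i - b n i) <= e n.
 move=> nm; rewrite mono // lerD2r; apply: sup_ubound; last by exists m.
 by exists (n2 al / A) => _ [N _ <-].
have e0 : e @ \oo --> (0 : R) by rewrite -(subrr l); apply: cvgB => //; exact: cvg_cst.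
have sqe : (fun n => Num.sqrt (e n)) @ \oo --> (0 : R) by exact: sqrt_cvg0.
have /choice[f hf] i : exists z, ccvg (b ^~ i) z.
 apply: cauchy_limit sqe => n m nm; rewrite -[leLHS]ger0_norm ?cabs_ge0 // -sqrtr_sqr cabs_sqr.
 have h := ele n m nm; rewrite ler_sqrt; last by apply: le_trans h; exact: n2_ge0 (l2B (lb m) (lb n)).
 by apply: le_trans h; exact: (cabs2_le_n2 i (l2B (lb m) (lb n))).
have [lf _] : l2 f /\ n2 f <= n2 al / A by exact: (l2_fatou lb).
have bf : l2c b f.
 split=> //; apply: (cvg0_le (b := e)) => // n.
 rewrite n2_ge0 /=; last exact: l2B.
 have -> : n2 (fun i => b n i - f i) = n2 (fun i => f i - b n i).
  by apply: eq_rsum => i; rewrite -!cabs_sqr cabs_distC.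
 apply: (l2_fatou (x := fun m i => b (m + n)%N i - b n i) (M := e n) _ _ _).2 => [m|i|m].
 - exact: l2B.
 - apply: ccvgB; last exact: ccvg_cst.
  move=> ee ee0; have [N hN] := hf i ee ee0; exists N => m Nm; apply: hN.
  exact: leq_trans Nm (leq_addr _ _).
 - by apply: ele; exact: leq_addl.
exists f; split=> // s; apply: (ccvg_uniq (kop_ccvg lK s bf)) => ee ee0.
exists (pickle s).+1 => n sn; rewrite kb ?mfs // subrr cabs0 //.
Qed.
End RieszSurjectivity.
End HilbertTools.

(** * Janssen's representation and the duality between sampling and Riesz bounds *)

Section Duality.
Variable R : realType.
Local Notation C := R[i].
Local Notation Cd := (Cd R).
Variable d : nat.
Local Notation NI := (NI d).
Implicit Types (w z : Cd d) (k m : NI) (f g : NI -> C).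

Lemma phaseDl w w' z : phase (w + w') z = phase w z * phase w' z.
Proof.
rewrite /phase -cexpD -imD -mulrDr -big_split; congr (cexp (0 +i* (pi * _))).
by apply: eq_bigr => j _; rewrite ffunE mulrDl ImD.
Qed.
Lemma phaseNl w z : phase (- w) z = phase z w.
Proof.
rewrite /phase; congr (cexp (0 +i* (pi * _))); apply: eq_bigr => j _.
by rewrite ffunE ImM !ImM /= !Re_conj !Im_conj; ring.
Qed.
Lemma phaseDr w z z' : phase w (z + z') = phase w z * phase w z'.
Proof. by rewrite -!(phaseNl _ w) -phaseDl opprD. Qed.
Lemma phaseNr w z : phase w (- z) = phase z w.
Proof. by rewrite -phaseNl opprK. Qed.
Lemma phaseV w z : phase w z * phase z w = 1.
Proof. by rewrite -(phase_conj w z) mul_conj -cabs_sqr cabs_phase expr1n. Qed.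

(** The unitary operators of the projective representation on coefficient sequences. For a Fock
    function with coefficients [f], [V z f k] is its inner product with [beta_z e_k], by
    [finner_coef]. *)
Definition V z : (NI -> C) -> NI -> C := kop (fun k m => U k m z).

Lemma U_col k m z : U k m z = conjc (U m k (- z)).
Proof. by rewrite U_neg conjcK. Qed.
Lemma col_l2 m z : l2 (fun k => U k m z).
Proof. by rewrite (funext (fun k => U_col k m z)); apply: l2_conj; exact: (U_l2 _ _).1. Qed.
Lemma ip_row k k' w z : ip (fun m => U k m w) (fun m => U k' m z) = phase w z * U k k' (w - z).
Proof. exact: (U_add _ _ _ _).2. Qed.
Lemma ip_col m m' w z : ip (fun k => U k m w) (fun k => U k m' z) = phase z w * U m' m (w - z).
Proof.
have := ip_row m' m (- z) (- w); rewrite phaseNl phaseNl opprK [_ + w]addrC => <-; rewrite /ip.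
by apply: eq_csum => k; rewrite (U_col k m w) (U_col k m' z) conjcK mulrC.
Qed.

Lemma fin_supp f (s : seq NI) : (forall m, m \notin s -> f m = 0) ->
 exists s' : seq NI, uniq s' /\ forall m, m \notin s' -> f m = 0.
Proof.
by move=> hs; exists (undup s); split=> [|m]; rewrite ?undup_uniq ?mem_undup //; exact: hs.
Qed.
Lemma kop_fin (I : choiceType) (k : I -> NI -> C) f (s : seq NI) i : uniq s -> (forall m, m \notin s -> f m = 0) ->
 kop k f i = \sum_(m <- s) f m * k i m.
Proof. by move=> us hs; rewrite /kop (csum_fin us) // => m /hs ->; rewrite mul0r. Qed.
Lemma ip_finr f g (s : seq NI) : uniq s -> (forall m, m \notin s -> g m = 0) ->
 ip f g = \sum_(m <- s) f m * conjc (g m).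
Proof. by move=> us hs; rewrite /ip (csum_fin us) // => m /hs ->; rewrite conjc0 mulr0. Qed.

Lemma V_bound z f (s : seq NI) : (forall m, m \notin s -> f m = 0) -> l2 (V z f) /\ n2 (V z f) <= 1 * n2 f.
Proof.
move=> /fin_supp[t [ut ht]]; have lf := l2_fin ht.
have E : V z f = fun k => \sum_(m <- t) f m * U k m z by apply/funext => k; exact: kop_fin.
rewrite E; split; first exact: (l2_sum t f (fun m => col_l2 m z)).
rewrite mul1r; apply/eq_ler.
have : (n2 (fun k => \sum_(m <- t) f m * U k m z))%:C = (n2 f)%:C :> C.
 rewrite (n2_lincomb t f (fun m => col_l2 m z)) (n2_fin ut ht) raddf_sum /= big_seq [RHS]big_seq.
 apply: eq_bigr => m mt; rewrite (bigD1_seq m) //= ip_col subrr phase_refl mul1r U0 eqxx mulr1.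
 rewrite mul_conj big1 ?addr0 // => m' mm'; rewrite ip_col subrr phase_refl U0 (negbTE mm') !mulr0 //.
by move=> [].
Qed.

Let lU k z : l2 (fun m => U k m z). Proof. exact: (U_l2 _ _).1. Qed.

Lemma V_l2 z f : l2 f -> l2 (V z f) /\ n2 (V z f) <= n2 f.
Proof.
by move=> lf; have := kop_l2 (fun k => lU k z) ler01 (@V_bound z) lf; rewrite mul1r.
Qed.
Lemma V_l2c z x f : l2c x f -> l2c (fun n => V z (x n)) (V z f).
Proof. exact: (kop_l2c (fun k => lU k z) ler01 (@V_bound z)). Qed.
Lemma V_ccvg z x f k : l2c x f -> ccvg (fun n => V z (x n) k) (V z f k).
Proof. exact: kop_ccvg. Qed.

(** For finitely supported [f] this is [U_add]; both sides are continuous in [f]. *)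
Lemma V_comp w z f k : l2 f -> V w (V z f) k = phase w (- z) * V (w + z) f k.
Proof.
move=> lf; have [x [xf fx _]] := l2_truncate lf; have xz := V_l2c z xf.
apply: ccvg_uniq (V_ccvg w k xz) _.
rewrite (_ : (fun n => _) = (fun n => phase w (- z) * V (w + z) (x n) k)).
 by apply: ccvgZ; exact: V_ccvg.
apply/funext => n; have [s hs] := fx n; have [t [ut ht]] := fin_supp hs.
have E : V z (x n) = fun k => \sum_(m <- t) x n m * U k m z by apply/funext => l; exact: kop_fin.
rewrite E {1}/V kop_ip (ip_suml t (x n) (fun m => col_l2 m z)); last exact: l2_conj.
rewrite /V (kop_fin (fun k m => U k m (w + z)) k ut ht) mulr_sumr; apply: eq_bigr => m _.
rewrite mulrCA; congr (_ * _); have := ip_row k m w (- z); rewrite opprK => <-.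
by apply: eq_csum => l; rewrite conjcK (U_col l m z) mulrC.
Qed.

Lemma V0 f k : V 0 f k = f k.
Proof.
rewrite /V /kop (@csum1 _ _ _ k) => [|m mk]; first by rewrite U0 eqxx mulr1.
by rewrite U0 eq_sym (negbTE mk) mulr0.
Qed.

Lemma V_ip z f g : l2 f -> l2 g -> ip (V z f) (V z g) = ip f g.
Proof.
move=> lf lg; have [x [xf fx _]] := l2_truncate lf; have [y [yg gy _]] := l2_truncate lg.
apply: ccvg_uniq (ccvg_ip (V_l2c z xf) (V_l2c z yg)) _.
rewrite (_ : (fun n => _) = fun n => ip (x n) (y n)); first exact: ccvg_ip.
apply/funext => n; have [s hs] := fx n; have [t [ut ht]] := fin_supp hs.
have [s' hs'] := gy n; have [t' [ut' ht']] := fin_supp hs'.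
have E : V z (x n) = fun k => \sum_(m <- t) x n m * U k m z by apply/funext => l; exact: kop_fin.
have E' : V z (y n) = fun k => \sum_(m <- t') y n m * U k m z by apply/funext => l; exact: kop_fin.
have ly : l2 (V z (y n)) by have [] := V_l2 z (l2_fin ht').
rewrite E (ip_suml t (x n) (fun m => col_l2 m z) ly) -ip_conj; [|exact: l2_fin ht'|exact: l2_fin ht].
rewrite (ip_finr (y n) ut ht) conj_sum; apply: eq_bigr => m _; rewrite conjM conjcK mulrC; congr (_ * _).
rewrite -(ip_conj ly (col_l2 m z)) E' (ip_suml t' (y n) (fun m => col_l2 m z) (col_l2 m z)).
congr conjc; have [mt|mt] := boolP (m \in t'); last first.
 rewrite (ht' _ mt) big_seq big1 // => m' m't; rewrite ip_col subrr phase_refl U0.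
 by case: eqP m't mt => [->->|]; rewrite ?mulr0.
rewrite (bigD1_seq m) //= ip_col subrr phase_refl U0 eqxx !mulr1 big1 ?addr0 // => m' mm'.
by rewrite ip_col subrr U0 eq_sym (negbTE mm') !mulr0.
Qed.

(** Summability at every Gaussian rate, not only at [pi], because estimates such as [casum_U] give
    up part of the exponent. *)
Definition gsumc (J : choiceType) (pt : J -> Cd d) := forall c r : R, 0 < c ->
 rasum (fun n => expR (- c * nrm2 (pt n) + r * nrm1 (pt n))).

Lemma gsumc_gsum (J : choiceType) (pt : J -> Cd d) : gsumc pt -> gsum pt.
Proof. by move=> h r; exact: h (pi_gt0 R). Qed.

(** A single coefficient is one term of the absolute generating series at [x = y = (1, ..., 1)], so
    the Gaussian bound of [U_gen] applies to it. Undoing the translation by [w] lowers the rate from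
    [pi / 2] to [pi / 4]. *)
Lemma casum_U (J : choiceType) (pt : J -> Cd d) k m w : gsumc pt -> casum (fun n => U k m (pt n + w)).
Proof.
move=> hpt; pose o : Cd d := [ffun=> 1].
have o1 (j : 'I_d) : cabs (o j) <= 1 /\ cabs (o j) <= 1 by rewrite ffunE cabs1.
have m1 (l : NI) : mon l o = 1 by apply: big1 => j _; rewrite ffunE expr1n.
pose r : R := sq R * 2 * 1.
have r0 : 0 <= r by rewrite !mulr_ge0 // ltW // sq_gt0.
pose c := cabs (fsd R k m)%:C * expR (pi / 2 * nrm2 w + r * nrm1 w + d%:R * 1 ^+ 2).
have p4 : 0 < pi / 4 :> R by rewrite divr_gt0 // pi_gt0.
apply: rasum_le (rasumZ (_ : 0 <= c) (hpt (pi / 4) r p4)) => [n|]; last first.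
 by rewrite mulr_ge0 ?cabs_ge0 ?expR_ge0.
have [a _ /(_ 1 o1) h] := U_gen (pt n + w) o o.
have := le_trans (rsum_ub1 (k, m) a) h; rewrite /= !m1 mulr1 mul1r cabsM cabsV => h1.
have f0 : 0 < cabs (fsd R k m)%:C by rewrite cabs_gt0 // fsd_neq0.
rewrite ler_pdivrMr // in h1; apply: le_trans h1 _.
rewrite /c -[leRHS]mulrA -expRD [leLHS]mulrC; apply: ler_wpM2l; first exact: ltW.
rewrite ler_expR.
have h2 : nrm2 (pt n) <= 2 * nrm2 (pt n + w) + 2 * nrm2 w.
 rewrite /nrm2 !mulr_sumr -big_split; apply: ler_sum => j _.
 have := cabs2D (pt n j + w j) (- w j); rewrite addrK ffunE.
 by rewrite -[cabs2 (- _)]cabs_sqr cabsN cabs_sqr.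
have h3 : nrm1 (pt n + w) <= nrm1 (pt n) + nrm1 w.
 by rewrite /nrm1 -big_split; apply: ler_sum => j _; rewrite ffunE; exact: cabsD.
have := ler_wpM2l r0 h3; have := ler_wpM2l (ltW p4) h2; rewrite /r; lra.
Qed.

Section Pair.
Variables (J : zmodType) (mu la : J -> Cd d) (c : R).
Hypotheses (c0 : 0 < c) (hmu : gsumc mu) (hla : gsumc la).
Hypothesis tw : forall k m k' m', S4 mu k m k' m' = c%:C * S4 la k k' m m'.

(** Analysis operator of the [k]-th window along [mu]: the sequence of samples that enters the
    sampling bound. *)
Definition W k : (NI -> C) -> J -> C := kop (fun n m => U k m (mu n)).

Lemma WE k f n : W k f n = V (mu n) f k. Proof. by []. Qed.

Lemma casum_UU (pt : J -> Cd d) k m k' m' : gsumc pt ->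
 casum (fun n => U k m (pt n) * conjc (U k' m' (pt n))).
Proof.
move=> /(casum_U k m 0); apply: rasum_le => n; rewrite addr0 cabsM cabs_conj.
by rewrite ler_piMr ?cabs_ge0 // U_le1.
Qed.
Lemma la_casum k m : casum (fun n => U k m (la n)).
Proof. by have := casum_U k m 0 hla; apply: rasum_le => n; rewrite addr0. Qed.
Lemma mucol_l2 k m : l2 (fun n => U k m (mu n)).
Proof.
have := casum_UU k m k m hmu; apply: rasum_le => n.
by rewrite mul_conj cabsR ger0_norm ?cabs2_ge0.
Qed.

Lemma ipV_bound z f g : l2 f -> l2 g -> cabs (ip (V z f) g) <= Num.sqrt (n2 f) * Num.sqrt (n2 g).
Proof.
move=> lf lg; have [lV hV] := V_l2 z lf; apply: le_trans (sqrt_ip lV lg) _.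
by rewrite ler_wpM2r ?sqrtr_ge0 // ler_sqrt // n2_ge0.
Qed.
Lemma sqrt2_ge0 f g : 0 <= Num.sqrt (n2 f) * Num.sqrt (n2 g).
Proof. by rewrite mulr_ge0 ?sqrtr_ge0. Qed.
Lemma UV_term (b : bool) k n f g : l2 f -> l2 g -> cabs (b%:R * (U k k (la n) * ip (V (- la n) f) g)) <=
 Num.sqrt (n2 f) * Num.sqrt (n2 g) * cabs (U k k (la n)).
Proof.
move=> lf lg; case: b; last by rewrite mul0r cabs0 mulr_ge0 ?sqrt2_ge0 ?cabs_ge0.
by rewrite mul1r cabsM mulrC ler_wpM2r ?cabs_ge0 //; exact: ipV_bound.
Qed.
Lemma UV_sum (b : J -> bool) k f g (h := fun n => (b n)%:R * (U k k (la n) * ip (V (- la n) f) g)) : l2 f -> l2 g ->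
 casum h /\ cabs (csum h) <= rsum (fun n => cabs (U k k (la n))) * (Num.sqrt (n2 f) * Num.sqrt (n2 g)).
Proof.
move=> lf lg; have le n := UV_term (b n) k n lf lg.
have a : casum h := rasum_le le (rasumZ (sqrt2_ge0 f g) (la_casum k k)); split=> //.
apply: le_trans (cabs_csum a) _; apply: rsum_le => A uA.
apply: le_trans (ler_sum _ (fun n _ => le n)) _; rewrite -mulr_sumr mulrC ler_wpM2r ?sqrt2_ge0 //.
exact: rsum_ub (la_casum k k) uA.
Qed.
Lemma casum_UV k f g : l2 f -> l2 g -> casum (fun n => U k k (la n) * ip (V (- la n) f) g).
Proof. by move=> lf lg; have [+ _] := UV_sum xpredT k lf lg; under eq_fun do rewrite mul1r. Qed.

Lemma janssen_fin k f g (s s' : seq NI) : (forall m, m \notin s -> f m = 0) -> (forall m, m \notin s' -> g m = 0) ->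
 [/\ l2 (W k f), l2 (W k g) &
 ip (W k f) (W k g) = c%:C * csum (fun n => U k k (la n) * ip (V (- la n) f) g)].
Proof.
move=> /fin_supp[t [ut ht]] /fin_supp[t' [ut' ht']].
have E : W k f = fun n => \sum_(m <- t) f m * U k m (mu n) by apply/funext => l; exact: kop_fin.
have E' : W k g = fun n => \sum_(m <- t') g m * U k m (mu n) by apply/funext => l; exact: kop_fin.
have lf : l2 (W k f) by rewrite E; exact: (l2_sum t f (mucol_l2 k)).
have lg : l2 (W k g) by rewrite E'; exact: (l2_sum t' g (mucol_l2 k)).
split=> //; rewrite E (ip_suml t f (mucol_l2 k) lg).
have E2 n : U k k (la n) * ip (V (- la n) f) g =
  \sum_(m <- t) \sum_(m' <- t') f m * conjc (g m') * (U k k (la n) * conjc (U m m' (la n))).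
 rewrite (ip_finr _ ut' ht') exchange_big /= mulr_sumr; apply: eq_bigr => m' _.
 rewrite /V (kop_fin _ _ ut ht) mulr_suml mulr_sumr; apply: eq_bigr => m _.
 by rewrite U_neg; ring.
rewrite (eq_csum E2) csum_sum => [|m]; last first.
 by apply: casum_sum => m'; apply: casumZ; exact: casum_UU.
rewrite mulr_sumr; apply: eq_bigr => m _; rewrite csum_sum => [|m']; last by apply: casumZ; exact: casum_UU.
rewrite -(ip_conj lg (mucol_l2 k m)) E' (ip_suml t' g (mucol_l2 k) (mucol_l2 k m)).
rewrite conj_sum !mulr_sumr; apply: eq_bigr => m' _; rewrite csumZ; last exact: casum_UU.
rewrite conjM ip_conj; [|exact: mucol_l2..].
by have := tw k m k m'; rewrite /S4 /ip => ->; ring.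
Qed.

Lemma W_bound k f (s : seq NI) : (forall m, m \notin s -> f m = 0) ->
 l2 (W k f) /\ n2 (W k f) <= c * rsum (fun n => cabs (U k k (la n))) * n2 f.
Proof.
move=> hs; have [lW _ e] := janssen_fin k hs hs; have lf := l2_fin hs; split=> //.
have -> : n2 (W k f) = cabs (ip (W k f) (W k f)).
 by rewrite ip_refl // cabsR ger0_norm // n2_ge0.
rewrite e cabsM cabsR ger0_norm ?(ltW c0) // -mulrA ler_wpM2l ?(ltW c0) //.
have [_] := UV_sum xpredT k lf lf; under eq_csum do rewrite mul1r.
by rewrite -expr2 sqr_sqrtr // n2_ge0.
Qed.

Let M0 k : 0 <= c * rsum (fun n => cabs (U k k (la n))).
Proof. by rewrite mulr_ge0 ?(ltW c0) // rsum_ge0 //; exact: la_casum. Qed.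

Lemma W_l2 k f : l2 f -> l2 (W k f) /\ n2 (W k f) <= c * rsum (fun n => cabs (U k k (la n))) * n2 f.
Proof. exact: (kop_l2 (fun n => lU k (mu n)) (M0 k) (@W_bound k)). Qed.
Lemma W_l2c k x f : l2c x f -> l2c (fun n => W k (x n)) (W k f).
Proof. exact: (kop_l2c (fun n => lU k (mu n)) (M0 k) (@W_bound k)). Qed.

(** After exchange of the sums, [tw] replaces the sum over [mu] by one over [la], in which the
    indices of [f] and [g] recombine into [V (- la n)]. Summability of the diagonal entries
    [U k k (la n)] carries the identity from finite support to l2. *)
Theorem janssen k f g : l2 f -> l2 g ->
 ip (W k f) (W k g) = c%:C * csum (fun n => U k k (la n) * ip (V (- la n) f) g).
Proof.
move=> lf lg; have [x [xf fx hx]] := l2_truncate lf; have [y [yg gy hy]] := l2_truncate lg.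
have tr (u : nat -> NI -> C) h : (forall n i, u n i = h i \/ u n i = 0) -> l2 h -> forall n, n2 (u n) <= n2 h.
 move=> hu lh n; apply: ler_rsum lh => i; case: (hu n i) => -> //.
 by rewrite cabs2R expr0n cabs2_ge0.
apply: ccvg_uniq (ccvg_ip (W_l2c k xf) (W_l2c k yg)) _.
rewrite (_ : (fun n => _) = fun N => c%:C * csum (fun n => U k k (la n) * ip (V (- la n) (x N)) (y N))); last first.
 apply/funext => n; have [s hs] := fx n; have [s' hs'] := gy n.
 by have [_ _ ->] := janssen_fin k hs hs'.
apply: ccvgZ; have B0 := sqrt2_ge0 f g.
apply: (csum_dct (rasumZ B0 (la_casum k k))) => [N n|n]; last first.
 by apply: ccvgZ; apply: ccvg_ip => //; exact: V_l2c.
rewrite cabsM mulrC ler_wpM2r ?cabs_ge0 //.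
have [lx _ _] := xf; have [ly _ _] := yg.
apply: le_trans (ipV_bound _ (lx N) (ly N)) _.
by rewrite ler_pM ?sqrtr_ge0 // ler_sqrt ?n2_ge0 //; exact: tr.
Qed.

Definition e0 : NI := [ffun=> 0%N].

Lemma pk_parity (k m : nat) (a b : C) : pk k m (- a) (- b) = (-1) ^+ (k + m) * pk k m a b.
Proof.
elim: k m => [|k IH] m /=; first by rewrite add0n [LHS]exprNn.
rewrite !IH; case: m => [|m] /=; first by rewrite !mul0r !addr0 !addn0 exprS; ring.
by rewrite addSn !addnS !exprS; ring.
Qed.
(** [pk k k] has even parity. This allows a Janssen sum to be reflected, [la n] against [- la n]. *)
Lemma U_diag_even (k : NI) (z : Cd d) : U k k (- z) = U k k z.
Proof.
apply: eq_bigr => j _; rewrite ffunE /u -[cabs2 (- _)]cabs_sqr cabsN cabs_sqr.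
have -> : conjc (- z j) = - conjc (z j) by apply: ceq; rewrite ?(Re_conj, Im_conj, ReN, ImN).
by rewrite !mulrN pk_parity addnn -mul2n exprM sqrrN !expr1n mul1r.
Qed.

Lemma sum_csum (T : finType) (I : choiceType) (f : T -> I -> C) : (forall r, casum (f r)) ->
 \sum_(r : T) csum (f r) = csum (fun n => \sum_(r : T) f r n).
Proof. by move=> h; rewrite csum_sum. Qed.

Variables (T : nat -> finType) (v : forall N, T N -> Cd d) (P : nat -> J -> bool).

(** The translates [v r] fill in a refined lattice. Their squared phases are characters whose mean
    is the indicator [P N]; in the application [P N n] says that [N + 1] divides [n], so in the
    limit only the index 0 persists. *)
Definition averaging (pt : J -> Cd d) :=
 [/\ forall N n, \sum_(r : T N) phase (pt n) (v r) ^+ 2 = (#|T N|%:R : R)%:C * (P N n)%:R,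
   forall N, P N 0, forall n, n != 0 -> exists N0, forall N, (N0 <= N)%N -> P N n = false
  & forall N, (0 < #|T N|)%N].

Hypotheses (la0 : la 0 = 0) (av : averaging la).

Definition fine N f g : C := \sum_(r : T N) ip (fun n => V (mu n + v r) f e0) (fun n => V (mu n + v r) g e0).

Lemma shift_W w f n : l2 f -> V (mu n + w) f e0 = phase (mu n) w * W e0 (V w f) n.
Proof. by move=> lf; rewrite WE V_comp // mulrA phaseNr phaseV mul1r. Qed.

(** The commutator of two shifts is the scalar [phase ^+ 2]: the origin of the characters that are
    averaged. *)
Lemma V_swap (z w : Cd d) (f : NI -> C) : l2 f -> V (- z) (V w f) = (fun k => phase z w ^+ 2 * V w (V (- z) f) k).
Proof.
move=> lf; apply/funext => k; rewrite !V_comp // opprK !phaseNl [- z + w]addrC mulrA.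
by congr (_ * _); rewrite expr2 -mulrA phaseV mulr1.
Qed.

Lemma shift_l2 w f : l2 f -> l2 (fun n => V (mu n + w) f e0).
Proof.
move=> lf; have [lW _] := W_l2 e0 (V_l2 w lf).1.
apply: rasum_le lW => n; rewrite shift_W // cabs2M -cabs_sqr cabs_phase expr1n mul1r //.
Qed.

Lemma shift_n2 w f : l2 f -> n2 (fun n => V (mu n + w) f e0) <=
 c * rsum (fun n => cabs (U e0 e0 (la n))) * n2 f.
Proof.
move=> lf; have [lV hV] := V_l2 w lf; have [lW hW] := W_l2 e0 lV.
apply: (@le_trans _ _ (n2 (W e0 (V w f)))).
 by apply: ler_rsum lW => n; rewrite shift_W // cabs2M -cabs_sqr cabs_phase expr1n mul1r.
apply: le_trans hW _; apply: ler_wpM2l hV.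
by rewrite mulr_ge0 ?(ltW c0) // rsum_ge0 //; exact: la_casum.
Qed.

Lemma fine_ip w f g : l2 f -> l2 g ->
 ip (fun n => V (mu n + w) f e0) (fun n => V (mu n + w) g e0) =
 c%:C * csum (fun n => phase (la n) w ^+ 2 * (U e0 e0 (la n) * ip (V (- la n) f) g)).
Proof.
move=> lf lg; have lwf := (V_l2 w lf).1; have lwg := (V_l2 w lg).1.
transitivity (ip (W e0 (V w f)) (W e0 (V w g))).
 apply: eq_csum => n; rewrite !shift_W // conjM mulrACA phase_conj phaseV mul1r //.
rewrite janssen //; congr (_ * _); apply: eq_csum => n.
have lV := (V_l2 (- la n) lf).1.
rewrite V_swap // (ipZl _ (V_l2 w lV).1 lwg).
by rewrite V_ip // mulrCA.
Qed.

Lemma fineE N f g : l2 f -> l2 g -> fine N f g =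
 (c * #|T N|%:R)%:C * csum (fun n => (P N n)%:R * (U e0 e0 (la n) * ip (V (- la n) f) g)).
Proof.
move=> lf lg; have [hv _ _ _] := av; rewrite /fine; under eq_bigr do rewrite fine_ip //.
have cU := casum_UV e0 lf lg.
rewrite -mulr_sumr realCM -mulrA; congr (_ * _); rewrite sum_csum => [|r]; last first.
 by apply: rasum_le cU => n; rewrite cabsM cabsX cabs_phase expr1n mul1r.
rewrite -csumZ; last exact: (UV_sum _ _ lf lg).1.
by apply: eq_csum => n; rewrite -mulr_suml hv -mulrA.
Qed.

Let D N : R := c * #|T N|%:R.
Let D0 N : 0 < D N. Proof. by have [_ _ _ T0] := av; rewrite mulr_gt0 // ltr0n. Qed.

Lemma fine_bound N f g : l2 f -> l2 g -> cabs ((D N)^-1%:C * fine N f g) <=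
 rsum (fun n => cabs (U e0 e0 (la n))) * (Num.sqrt (n2 f) * Num.sqrt (n2 g)).
Proof.
by move=> lf lg; rewrite fineE // mulrA -realCM mulVf ?gt_eqF // mul1r; exact: (UV_sum _ _ lf lg).2.
Qed.

(* As N grows, only n = 0 survives on the dual side, so the Riemann sums over the refined
  lattice recover the inner product. *)
Theorem fine_limit f g : l2 f -> l2 g -> ccvg (fun N => (D N)^-1%:C * fine N f g) (ip f g).
Proof.
move=> lf lg; have [_ P0 Pn0 _] := av; have B0 := sqrt2_ge0 f g.
pose h (n : J) : C := if n == 0 then ip f g else 0.
have -> : ip f g = csum h.
 by rewrite (@csum1 _ _ _ 0) /h ?eqxx // => j /negbTE ->.
rewrite (_ : (fun N => _) = (fun N => csum (fun n => (P N n)%:R * (U e0 e0 (la n) * ip (V (- la n) f) g)))); last first.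
 by apply/funext => N; rewrite fineE // mulrA -realCM mulVf ?gt_eqF // mul1r.
apply: (csum_dct (rasumZ B0 (la_casum e0 e0))) => [N n|n]; first exact: UV_term.
rewrite /h; have [->|n0] := eqVneq n 0.
 rewrite la0 oppr0 U0 eqxx (funext (fun k => V0 f k)) => e ee; exists 0%N => N _.
 by rewrite P0 !mul1r subrr cabs0.
have [N0 hN] := Pn0 _ n0 => e ee; exists N0 => N /hN ->.
by rewrite mul0r subrr cabs0.
Qed.
End Pair.

Section Main.
Variables (J : zmodType) (T : nat -> finType) (v : forall N, T N -> Cd d) (P : nat -> J -> bool).
Variables (mu la : J -> Cd d) (c : R).
Variables (K : finType) (kk : K -> NI).
Hypotheses (c0 : 0 < c) (hmu : gsumc mu) (hla : gsumc la).
Hypothesis tw : forall k m k' m', S4 mu k m k' m' = c%:C * S4 la k k' m m'.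
Hypothesis tw' : forall k m k' m', S4 la k m k' m' = (c^-1)%:C * S4 mu k k' m m'.
Hypotheses (la_add : {morph la : x y / x + y}) (mu_add : {morph mu : x y / x + y}).
Hypothesis comm : forall n m : J, phase (la n) (mu m) = phase (mu m) (la n).

Definition sampling := exists2 A : R, 0 < A & forall f, l2 f -> A * n2 f <= \sum_k n2 (W mu (kk k) f).
Definition riesz_bound (A : R) := forall (ss : seq J) (x : J -> C), uniq ss ->
 A * \sum_(s <- ss) cabs2 (x s) <= \sum_k n2 (fun m => \sum_(s <- ss) x s * U (kk k) m (la s)).
Definition rieszL := exists2 A : R, 0 < A & riesz_bound A.

Let la0 : la 0 = 0. Proof. by apply: (addrI (la 0)); rewrite -la_add !addr0. Qed.
Let mu0 : mu 0 = 0. Proof. by apply: (addrI (mu 0)); rewrite -mu_add !addr0. Qed.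
Let laN n : la (- n) = - la n.
Proof. by apply: (addrI (la n)); rewrite -la_add !subrr. Qed.
Let muN n : mu (- n) = - mu n.
Proof. by apply: (addrI (mu n)); rewrite -mu_add !subrr. Qed.

(** The sampling bound is applied to superpositions [h w] of translated Gaussians with coefficients
    from [x]. Their samples in window [k] at [mu n] have the modulus of the Gaussian samples of
    [fb k] at [mu (- n) + w]; averaging over [w] returns the norm of [x] on one side and the norms
    of the [f k] on the other. *)
Theorem sampling_riesz : averaging v P la -> sampling -> rieszL.
Proof.
move=> av [A A0 hA]; have [hv P0 Pn0 T0] := av; exists (A / c) => [|ss x us]; first exact: divr_gt0.
pose f k m := \sum_(s <- ss) x s * U k m (la s).
have lf k : l2 (f k) by exact: (l2_sum ss x (fun s => (U_l2 k (la s)).1)).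
pose fb k m := conjc (f k m).
have lfb k : l2 (fb k) by exact: l2_conj.
pose zt (w : Cd d) s := la s - w.
pose h w m := \sum_(s <- ss) (x s * phase (la s) w) * U m e0 (zt w s).
have lh w : l2 (h w) by exact: (l2_sum ss _ (fun s => col_l2 e0 (zt w s))).
(* The phases in [h] are chosen to match the cocycles on both sides up to one common unimodular
   factor; the hypothesis [comm] on the two lattices enters here. *)
have key w n k : cabs2 (V (mu n) (h w) k) = cabs2 (V (mu (- n) + w) (fb k) e0).
 have -> : V (mu n) (h w) k = phase (mu n) w * conjc (V (mu (- n) + w) (fb k) e0).
  rewrite {1}/V kop_ip (ip_suml ss _ (fun s => col_l2 e0 (zt w s))); last by apply: l2_conj; exact: (U_l2 _ _).1.
  have -> : V (mu (- n) + w) (fb k) e0 = \sum_(s <- ss) conjc (x s) * (phase (mu (- n) + w) (la s) * U e0 k (mu (- n) + w - la s)).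
   rewrite /V kop_ip /fb /f (_ : (fun m => conjc _) = (fun m => \sum_(s <- ss) conjc (x s) * conjc (U k m (la s)))); last first.
    by apply/funext => m; rewrite conj_sum; apply: eq_bigr => s _; rewrite conjM.
   rewrite (ip_suml ss _ (g := fun s m => conjc (U k m (la s)))); last 2 first.
   - by move=> s; apply: l2_conj; exact: (U_l2 _ _).1.
   - by apply: l2_conj; exact: (U_l2 _ _).1.
   apply: eq_bigr => s _; congr (_ * _); rewrite -ip_row.
   by apply: eq_csum => m; rewrite conjcK mulrC.
  rewrite conj_sum mulr_sumr; apply: eq_bigr => s _; rewrite (conjM (conjc (x s))) conjcK (conjM (phase _ _)) phase_conj.
  have -> : ip (fun m => U m e0 (zt w s)) (fun m => conjc (U k m (mu n))) =
    phase (mu n) (w - la s) * U k e0 (mu n + (la s - w)).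
   have := ip_row k e0 (mu n) (w - la s).
   have -> : mu n - (w - la s) = mu n + (la s - w) by rewrite opprB.
   move=> <-; apply: eq_csum => m; rewrite conjcK (U_col m e0) mulrC /zt.
   by rewrite opprB.
  rewrite -U_neg.
  have -> : - (mu (- n) + w - la s) = mu n + (la s - w).
   by rewrite muN !opprD !opprK -addrA [- w + _]addrC.
  rewrite muN !phaseDr phaseNr phaseNr -comm.
  move: (phase _ _) (phase _ _) (phase _ _) (U _ _ _) => p1 p2 p3 q; ring.
 by rewrite cabs2M -cabs_sqr cabs_phase expr1n mul1r cabs2_conj.
have lsh w g : l2 g -> l2 (fun n => V (mu n + w) g e0).
 by move=> lg; exact: (shift_l2 c0 hmu hla tw w lg).
have key2 w k : n2 (W mu k (h w)) = n2 (fun n => V (mu n + w) (fb k) e0).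
 transitivity (n2 (fun n => V (mu (- n) + w) (fb k) e0)); first by apply: eq_rsum => n; rewrite WE key.
 apply: (@rsum_bij _ _ _ (fun n : J => - n) (fun n => cabs2 (V (mu n + w) (fb k) e0))).
 - by exists (fun n => - n) => n; rewrite opprK.
 - exact: lsh.
 - by move=> n; exact: cabs2_ge0.
have nh w : (n2 (h w))%:C = \sum_(s <- ss) \sum_(t <- ss) x s * conjc (x t) *
  (phase (la t) (la s) * U e0 e0 (la s - la t)) * phase (la (s - t)) w ^+ 2.
 rewrite (n2_lincomb ss _ (fun s => col_l2 e0 (zt w s))); apply: eq_bigr => s _; apply: eq_bigr => t _.
 rewrite ip_col /zt la_add laN.
 have -> : la s - w - (la t - w) = la s - la t by rewrite opprB addrA subrK.
 rewrite (conjM (x t)) phase_conj !phaseDl !phaseDr !phaseNr !phaseNl phase_refl.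
 move: (phase _ _) (phase _ _) (phase _ _) (U _ _ _) => p1 p2 p3 q; ring.
(* Only finitely many differences [s - t] occur, so the cross terms of the averaged norm vanish
   exactly once [N] is large. *)
have [N0 hN0] : exists N0, forall N, (N0 <= N)%N -> forall s t, s \in ss -> t \in ss -> s != t -> P N (s - t) = false.
 have /choice[g hg] : forall n, exists N0, n != 0 -> forall N, (N0 <= N)%N -> P N n = false.
  by move=> n; have [->|n0] := eqVneq n 0; [exists 0%N|have [N0 hN] := Pn0 _ n0; exists N0].
 exists (\max_(s <- ss) \max_(t <- ss) g (s - t)%R)%N => N hN s t ss' ts st.
 apply: hg; first by rewrite subr_eq0.
 apply: leq_trans hN; rewrite (big_rem s) //= leq_max; apply/orP; left.
 by rewrite (big_rem t) //= leq_max leqnn.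
have sumnh N : (N0 <= N)%N -> \sum_(r : T N) n2 (h (v r)) = #|T N|%:R * \sum_(s <- ss) cabs2 (x s).
 move=> hN; have : (\sum_(r : T N) n2 (h (v r)))%:C = (#|T N|%:R * \sum_(s <- ss) cabs2 (x s))%:C :> C.
  rewrite raddf_sum /=; under eq_bigr do rewrite nh.
  rewrite exchange_big realCM raddf_sum mulr_sumr /= big_seq [RHS]big_seq; apply: eq_bigr => s sS.
  rewrite exchange_big /= (bigD1_seq s) //= [X in _ + X]big_seq_cond [X in _ + X]big1 ?addr0.
   rewrite -mulr_sumr hv subrr P0 mulr1 phase_refl subrr U0 eqxx !mulr1 mul_conj mulrC //.
  move=> t /andP[tS ts]; rewrite -mulr_sumr hv (hN0 N hN) ?mulr0 //; last by rewrite eq_sym.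
 by move=> [].
pose D N : R := c * #|T N|%:R.
have D0 N : 0 < D N by rewrite mulr_gt0 // ltr0n.
have lim : (fun N => Re (\sum_k ((D N)^-1%:C * fine mu v N (fb (kk k)) (fb (kk k))))) @ \oo -->
  Re (\sum_k ip (fb (kk k)) (fb (kk k))).
 by apply: ccvg_Re; apply: ccvg_sum => k; exact: (fine_limit c0 hmu hla tw la0 av (lfb _) (lfb _)).
have -> : \sum_k n2 (fun m => \sum_(s <- ss) x s * U (kk k) m (la s)) = Re (\sum_k ip (fb (kk k)) (fb (kk k))).
 by rewrite Re_sum; apply: eq_bigr => k _; rewrite ip_refl //= /fb n2_conj.
apply: (cvgr_to_ge lim); exists N0 => // N hN /=.
have e1 : \sum_k ((D N)^-1%:C * fine mu v N (fb (kk k)) (fb (kk k))) =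
  ((D N)^-1 * \sum_(r : T N) \sum_k n2 (W mu (kk k) (h (v r))))%:C.
 rewrite realCM -mulr_sumr; congr (_ * _); rewrite exchange_big raddf_sum /=.
 apply: eq_bigr => k _; rewrite /fine raddf_sum; apply: eq_bigr => r _ /=.
 by rewrite key2 ip_refl //; exact: lsh.
rewrite e1 /=.
have : A * \sum_(r : T N) n2 (h (v r)) <= \sum_(r : T N) \sum_k n2 (W mu (kk k) (h (v r))).
 by rewrite mulr_sumr; apply: ler_sum => r _; exact: hA.
rewrite sumnh // => hh; have := ler_wpM2l (_ : 0 <= (D N)^-1) hh; rewrite invr_ge0 ltW // => /(_ isT).
apply: le_trans; apply/eq_ler; rewrite /D.
have : #|T N|%:R != 0 :> R by rewrite pnatr_eq0 -lt0n.
by move: (#|T N|%:R) (\sum_(s <- ss) _) => y z y0; field; rewrite y0 gt_eqF.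
Qed.

Let ci0 : 0 < c^-1. Proof. by rewrite invr_gt0. Qed.
Let a (z : Cd d) : C := \sum_k U (kk k) (kk k) z.

Lemma casum_a : casum (fun n => a (la n)).
Proof. by apply: casum_sum => k; exact: (la_casum hla). Qed.

Lemma riesz_form (ss : seq J) (x : J -> C) :
 (\sum_k n2 (fun m => \sum_(s <- ss) x s * U (kk k) m (la s)))%:C =
 \sum_(s <- ss) \sum_(t <- ss) x s * conjc (x t) * (phase (la s) (la t) * a (la s - la t)).
Proof.
rewrite raddf_sum /=; under eq_bigr do rewrite (n2_lincomb ss x (fun s => (U_l2 _ (la s)).1)).
rewrite exchange_big; apply: eq_bigr => s _; rewrite exchange_big; apply: eq_bigr => t _ /=.
by rewrite /a !mulr_sumr; apply: eq_bigr => k _; rewrite ip_row.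
Qed.

(** The double sum converges absolutely, so the finite forms over [ss' x ss'] approach it; enlarging
    [ss] to [ss'] only increases the sum of squares on the left. *)
Lemma riesz_infinite (A : R) (x : J -> C) : riesz_bound A ->
 0 < A -> casum x ->
 let G := fun p : J * J => x p.1 * conjc (x p.2) * (phase (la p.1) (la p.2) * a (la p.1 - la p.2)) in
 casum G /\ A * n2 x <= Re (csum G).
Proof.
move=> hA A0 cx G.
have al z : cabs (a z) <= #|K|%:R.
 apply: le_trans (cabs_sum _ _ _) _; rewrite -[#|K|]muln1 -sum_nat_const natr_sum.
 by apply: ler_sum => k _; exact: U_le1.
have cG : casum G.
 have := rasumZ (ler0n R #|K|) (rasum_prod (fun _ => cabs_ge0 _) (fun _ => cabs_ge0 _) cx cx).
 apply: rasum_le => p; rewrite /G (cabsM (x p.1 * _)) (cabsM (phase _ _)) cabs_phase mul1r.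
 by rewrite (cabsM (x p.1)) cabs_conj mulrC ler_wpM2r ?mulr_ge0 ?cabs_ge0.
split=> //; rewrite -ler_pdivlMl //; apply: rsum_le => ss us; rewrite ler_pdivlMl //.
apply/ler_addgt0Pr => e ee; have [B hB] := has_csumP cG ee.
pose ss' := undup (ss ++ (map fst B ++ map snd B)).
have us' : uniq ss' by exact: undup_uniq.
apply: (@le_trans _ _ (A * \sum_(s <- ss') cabs2 (x s))).
 rewrite ler_wpM2l ?(ltW A0) //; apply: ler_sum_sub => // [s|s sS]; first exact: cabs2_ge0.
 by rewrite mem_undup mem_cat sS.
apply: le_trans (hA ss' x us') _.
have e1 := riesz_form ss' x; have {e1} := congr1 (@Re R) e1; rewrite [LHS]/= => ->.
have -> : \sum_(s <- ss') \sum_(t <- ss') x s * conjc (x t) * (phase (la s) (la t) * a (la s - la t)) =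
  \sum_(p <- [seq (s, t) | s <- ss', t <- ss']) G p by rewrite -(sum_allpairs G).
have /hB : uniq [seq (s, t) | s <- ss', t <- ss'] by apply: allpairs_uniq => // -[? ?] [? ?].
move=> /(_ _)/ltW h; rewrite -lerBlDl; apply: le_trans (h _).
 by rewrite -ReN -ReD; apply: le_trans (ler_norm _) (cabsRe _).
move=> [s t] pB; apply/allpairsP; exists (s, t); rewrite !mem_undup !mem_cat; split=> //.
 by rewrite (map_f fst pB) orbT.
by rewrite (map_f snd pB) !orbT.
Qed.

(** The Riesz bound is tested on the Gaussian samples [x w] of [f] along [la + w], absolutely
    summable because [f] has finite support. Averaged over [w], the left side gives [n2 f] and the
    form gives the sum of [a (la n) <V (la n) f, f>], which Janssen's representation identifies with
    the energy of the samples on [mu]. *)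
Lemma riesz_sampling_fin (A : R) (f : NI -> C) (s0 : seq NI) : averaging v P mu -> riesz_bound A ->
 0 < A -> (forall m, m \notin s0 -> f m = 0) -> A * c * n2 f <= \sum_k n2 (W mu (kk k) f).
Proof.
move=> av hA A0 /fin_supp[t0 [ut ht]]; have lf := l2_fin ht.
have lV z := (V_l2 z lf).1.
pose x w s := phase (la s) w * V (la s + w) f e0.
have cx w : casum (x w).
 have : casum (fun s => \sum_(m <- t0) f m * U e0 m (la s + w)).
  by apply: casum_sum => m; apply: casumZ; exact: casum_U.
 apply: rasum_le => s; rewrite /x cabsM cabs_phase mul1r /V (kop_fin _ _ ut ht) //.
pose I w n := ip (fun t => V (la t + w) (V (la n) f) e0) (fun t => V (la t + w) f e0).
have step w : A * n2 (fun s => V (la s + w) f e0) <= Re (csum (fun n => a (la n) * I w n)).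
 have -> : n2 (fun s => V (la s + w) f e0) = n2 (x w).
  by apply: eq_rsum => s; rewrite /x cabs2M -[cabs2 (phase _ _)]cabs_sqr cabs_phase expr1n mul1r.
 have [cG hG] := riesz_infinite hA A0 (cx w); apply: le_trans hG _.
 set G := (fun p : J * J => _) in cG *.
 (* The form is reordered by the difference [n] of the two lattice indices, so that each diagonal is
    an inner product of translated samples. *)
 have bij : bijective (fun p : J * J => (p.1 + p.2, p.2)).
  by exists (fun p : J * J => (p.1 - p.2, p.2)) => -[u t] /=; rewrite ?addrK ?subrK.
 rewrite -(csum_bij bij cG) csum_pair; last exact: (rasum_inj (bij_inj bij) cG).
 apply/eq_ler; congr (Re _); apply: eq_csum => n.
 rewrite /I /ip -csumZ; last first.
  exact: casum_ip (shift_l2 ci0 hla hmu tw' w (lV (la n))) (shift_l2 ci0 hla hmu tw' w lf).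
 apply: eq_csum => t; transitivity (x w (n + t) * conjc (x w t) * (phase (la (n + t)) (la t) * a (la (n + t) - la t))) => //.
 rewrite /x la_add addrK V_comp // (conjM (phase _ _)) phase_conj !phaseDl !phaseNr phase_refl.
 have -> : la t + w + la n = la n + la t + w by rewrite addrC addrA.
 have h2 := phaseV (la t) w.
 move: (V _ f e0) (conjc _) (a _) => y y' z.
 transitivity ((phase (la n) w * (phase (la t) w * phase w (la t)) * (phase (la n) (la t))) * (y * y' * z)); first by ring.
 rewrite h2 mulr1; ring.
pose D N : R := c^-1 * #|T N|%:R.
have D0 N : 0 < D N by have [_ _ _ T0] := av; rewrite mulr_gt0 // ltr0n.
have key N : A * Re ((D N)^-1%:C * fine la v N f f) <=
  Re (csum (fun n => a (la n) * ((D N)^-1%:C * fine la v N (V (la n) f) f))).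
 have cI w : casum (fun n => a (la n) * I w n).
  pose B := c^-1 * rsum (fun n => cabs (U e0 e0 (mu n))) * n2 f.
  have Bn g : l2 g -> n2 g <= n2 f -> n2 (fun t => V (la t + w) g e0) <= B.
   move=> lg hg; apply: le_trans (shift_n2 ci0 hla hmu tw' w lg) _; rewrite ler_wpM2l //.
   by rewrite mulr_ge0 ?(ltW ci0) // rsum_ge0 //; exact: (la_casum hmu).
  have B0 : 0 <= B by apply: le_trans (Bn f lf (lexx _)); exact: n2_ge0 (shift_l2 ci0 hla hmu tw' w lf).
  apply: rasum_le (rasumZ B0 casum_a) => n; rewrite cabsM mulrC ler_wpM2r ?cabs_ge0 //.
  have l1 := shift_l2 ci0 hla hmu tw' w (lV (la n)); have l2' := shift_l2 ci0 hla hmu tw' w lf.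
  apply: le_trans (sqrt_ip l1 l2') _; rewrite -[leRHS](@sqr_sqrtr _ B) // expr2.
  by apply: ler_pM; rewrite ?sqrtr_ge0 // ler_sqrt // ; apply: Bn => //; exact: (V_l2 _ lf).2.
 have -> : csum (fun n => a (la n) * ((D N)^-1%:C * fine la v N (V (la n) f) f)) =
   (D N)^-1%:C * \sum_(r : T N) csum (fun n => a (la n) * I (v r) n).
  rewrite sum_csum // -csumZ; last by apply: casum_sum.
  by apply: eq_csum => n; rewrite mulrCA; congr (_ * _); rewrite /fine mulr_sumr.
 rewrite /fine !mulr_sumr !Re_sum mulr_sumr; apply: ler_sum => r _.
 have ReZ (y : R) (z : C) : Re (y%:C * z) = y * Re z by rewrite ReM /= mul0r subr0.
 rewrite !ReZ mulrCA ler_wpM2l ?invr_ge0 ?(ltW (D0 N)) // ip_refl; first exact: step.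
 exact: (shift_l2 ci0 hla hmu tw' _ lf).
have l1 := ccvg_Re (fine_limit ci0 hla hmu tw' mu0 av lf lf).
have l2' : ccvg (fun N => csum (fun n => a (la n) * ((D N)^-1%:C * fine la v N (V (la n) f) f)))
  (csum (fun n => a (la n) * ip (V (la n) f) f)).
 pose B := rsum (fun n => cabs (U e0 e0 (mu n))) * (Num.sqrt (n2 f) * Num.sqrt (n2 f)).
 have r0 : 0 <= rsum (fun n => cabs (U e0 e0 (mu n))) by apply: rsum_ge0; exact: (la_casum hmu).
 have B0 : 0 <= B by rewrite !mulr_ge0 ?sqrtr_ge0.
 apply: (csum_dct (rasumZ B0 casum_a)) => [N n|n].
  rewrite cabsM mulrC ler_wpM2r ?cabs_ge0 //.
  apply: le_trans (fine_bound ci0 hla hmu tw' av N (lV (la n)) lf) _.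
  rewrite ler_wpM2l // ler_wpM2r ?sqrtr_ge0 // ler_sqrt ?n2_ge0 //; exact: (V_l2 _ lf).2.
 by apply: ccvgZ; exact: (fine_limit ci0 hla hmu tw' mu0 av (lV _) lf).
have fin : A * n2 f <= Re (csum (fun n => a (la n) * ip (V (la n) f) f)).
 have l1' : (fun N => A * Re ((D N)^-1%:C * fine la v N f f)) @ \oo --> A * n2 f.
  by apply: cvgM; [exact: cvg_cst|move: l1; rewrite ip_refl].
 by apply: ler_cvg_to l1' (ccvg_Re l2') _; apply: nearW => N; exact: key.
have -> : \sum_k n2 (W mu (kk k) f) = c * Re (csum (fun n => a (la n) * ip (V (la n) f) f)).
 have e1 : (\sum_k n2 (W mu (kk k) f))%:C = c%:C * csum (fun n => a (la n) * ip (V (la n) f) f).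
  have cc (k : K) := casum_UV hla (kk k) lf lf.
  have eW (k : K) : (n2 (W mu (kk k) f))%:C = c%:C * csum (fun n => U (kk k) (kk k) (la n) * ip (V (- la n) f) f).
   by rewrite -(janssen c0 hmu hla tw) // ip_refl //; exact: (W_l2 c0 hmu hla tw _ lf).1.
  rewrite raddf_sum (eq_bigr _ (fun (k : K) _ => eW k)) -mulr_sumr sum_csum //; congr (_ * _).
  have E n : \sum_k U (kk k) (kk k) (la n) * ip (V (- la n) f) f = a (la (- n)) * ip (V (la (- n)) f) f.
   by rewrite laN -mulr_suml /a; congr (_ * _); apply: eq_bigr => k _; rewrite U_diag_even.
  have bN : bijective (fun n : J => - n) by exists (fun n => - n) => n; rewrite opprK.
  rewrite (eq_csum E); pose F n := a (la n) * ip (V (la n) f) f.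
  rewrite -[LHS]/(csum (fun n => F (- n))) -[RHS]/(csum F); apply: (csum_bij bN); rewrite /F.
  have B0 := sqrt2_ge0 f f.
  apply: rasum_le (rasumZ B0 casum_a) => n; rewrite cabsM mulrC ler_wpM2r ?cabs_ge0 //; exact: ipV_bound.
 by have := congr1 (@Re R) e1; rewrite ReM [LHS]/= => ->; rewrite /= mul0r subr0.
by rewrite -mulrA mulrCA ler_wpM2l ?(ltW c0).
Qed.

Theorem riesz_sampling : averaging v P mu -> rieszL -> sampling.
Proof.
move=> av [A A0 hA]; exists (A * c) => [|f lf]; first exact: mulr_gt0.
have [x [xf fx _]] := l2_truncate lf.
have l1 : (fun n => A * c * n2 (x n)) @ \oo --> A * c * n2 f.
 by apply: cvgM; [exact: cvg_cst|exact: l2c_n2].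
have l2' : (fun n => \sum_k n2 (W mu (kk k) (x n))) @ \oo --> \sum_k n2 (W mu (kk k) f).
 have := ccvg_Re (ccvg_sum (index_enum K) (fun k : K => ccvg_ip (W_l2c c0 hmu hla tw (kk k) xf) (W_l2c c0 hmu hla tw (kk k) xf))).
 have E y : l2 y -> Re (\sum_k ip (W mu (kk k) y) (W mu (kk k) y)) = \sum_k n2 (W mu (kk k) y).
  by move=> ly; rewrite Re_sum; apply: eq_bigr => k _; rewrite ip_refl //; exact: (W_l2 c0 hmu hla tw _ ly).1.
 have [lx _ _] := xf.
 by rewrite E // (funext (fun n => E _ (lx n))).
apply: ler_cvg_to l1 l2' _; apply: nearW => n; have [s hs] := fx n; exact: riesz_sampling_fin av hA A0 hs.
Qed.
End Main.
End Duality.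

(** * Gaussian dominated integrals over the plane and over C^d *)

Section PlaneIntegrals.
Variable R : realType.
Local Notation C := R[i].
Local Notation leb := (@lebesgue_measure R).

Lemma affine_substitution (G : R -> R) (a t : R) : 0 < a -> continuous G -> (forall x, 0 <= G x) ->
 (\int[leb]_x (G x)%:E = \int[leb]_x (G (a * x + t) * a)%:E)%E.
Proof.
move=> a0 cG G0; pose F x := a * x + t.
have dF (x : R) : is_derive x (1 : R) F a.
 rewrite /F; apply: is_derive_eq; by rewrite addr0 /GRing.scale /= mulr1.
have F' : derive1 F = cst a by apply/funext => x; rewrite derive1E derive_val.
rewrite (@increasing_ge0_integration_by_substitutionT R F G) ?F' //.
- by move=> x y xy; rewrite /F ltrD2r ltr_pM2l.
- by move=> x; exact: cvg_cst.
- exact: is_cvg_cst.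
- exact: is_cvg_cst.
- apply: (@cvg_comp _ _ _ (fun x => a * x) (fun x => x + t) _ -oo%R).
  exact: gt0_cvgMrNy.
 by apply: cvg_addrr_Ny.
- apply: (@cvg_comp _ _ _ (fun x => a * x) (fun x => x + t) _ +oo%R).
  exact: gt0_cvgMry.
 by apply: cvg_addrr.
Qed.

Lemma continuous_gauss (c : R) : continuous (fun x : R => expR (- c * x ^+ 2)).
Proof.
move=> x; apply: continuous_comp; last exact: continuous_expR.
by apply: continuousM; [exact: cst_continuous|exact: exprn_continuous].
Qed.

Lemma gauss_total (c : R) : 0 < c ->
 (\int[leb]_x (expR (- c * x ^+ 2))%:E = (Num.sqrt pi / Num.sqrt c)%:E)%E.
Proof.
move=> c0; have s0 : 0 < Num.sqrt c by rewrite sqrtr_gt0.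
have cg := @continuous_gauss c.
have E : (\int[leb]_x (gauss_fun x)%:E = (Num.sqrt c)%:E * \int[leb]_x (expR (- c * x ^+ 2))%:E)%E.
 rewrite (@affine_substitution _ _ 0 s0); last 2 first.
 - exact: continuous_gauss_fun.
 - exact: gauss_fun_ge0.
 rewrite -ge0_integralZl //; last by apply/measurable_EFinP; exact: continuous_measurable_fun.
 apply: eq_integral => x _; rewrite -EFinM /gauss_fun addr0 exprMn sqr_sqrtr ?(ltW c0) //.
 by rewrite mulNr mulrC.
rewrite integralT_gauss in E.
have i0 : (0 <= \int[leb]_x (expR (- c * x ^+ 2))%:E)%E by apply: integral_ge0 => x _; rewrite lee_fin expR_ge0.
move: E i0; case: (integral _ _ _) => [r| |] // E _.
 by move: E; rewrite -EFinM => -[->]; rewrite mulrC mulKf // gt_eqF.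
by move: E; rewrite gt0_muley ?lte_fin.
Qed.

Lemma gauss_ign (c : R) : 0 < c -> ign setT (fun x : R => expR (- c * x ^+ 2)).
Proof.
move=> c0; apply/integrableP; split.
 by apply/measurable_EFinP; exact: continuous_measurable_fun (continuous_gauss (c := c)).
under eq_integral do rewrite /= ger0_norm ?expR_ge0 //.
by rewrite gauss_total // ltry.
Qed.
Lemma rcont_Re (f : R -> C) : rcont f -> continuous (fun x => Re (f x)).
Proof. by move=> cf x; apply: seq_continuous => v vx; apply: ccvg_Re; exact: cf. Qed.
Lemma rcont_Im (f : R -> C) : rcont f -> continuous (fun x => Im (f x)).
Proof. by move=> cf x; apply: seq_continuous => v vx; apply: ccvg_Im; exact: cf. Qed.

Lemma Rintegral_shift (g : R -> R) (t : R) : continuous g ->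
 (\int[leb]_x g (x + t) = \int[leb]_x g x)%R.
Proof.
move=> cg; rewrite /Rintegral; suff -> : (\int[leb]_x (g (x + t))%:E = \int[leb]_x (g x)%:E)%E by []; rewrite integralE [RHS]integralE.
have pos (h : R -> R) : continuous h -> (forall x, 0 <= h x) ->
  (\int[leb]_x (h (x + t))%:E = \int[leb]_x (h x)%:E)%E.
 move=> ch h0; rewrite [RHS](@affine_substitution h 1 t ltr01 ch h0).
 by apply: eq_integral => x _; rewrite mul1r mulr1.
have cmax (h : R -> R) : continuous h -> continuous (fun x => Num.max (h x) 0).
 by move=> ch x; apply: continuous_max; [exact: ch|exact: cst_continuous].
have cp := cmax _ cg.
have cN : continuous (fun x => - g x) by move=> x; apply: continuousN; exact: cg.
have cn := cmax _ cN.
congr (_ - _)%E.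
 transitivity (\int[leb]_x (Num.max (g (x + t)) 0)%:E)%E.
  by apply: eq_integral => x _; rewrite numfun.funeposE EFin_max.
 rewrite (pos _ cp); last by move=> x; rewrite le_max lexx orbT.
 by apply: eq_integral => x _; rewrite numfun.funeposE EFin_max.
transitivity (\int[leb]_x (Num.max (- g (x + t)) 0)%:E)%E.
 by apply: eq_integral => x _; rewrite numfun.funenegE EFin_max.
rewrite (pos _ cn); last by move=> x; rewrite le_max lexx orbT.
by apply: eq_integral => x _; rewrite numfun.funenegE EFin_max.
Qed.

Lemma lint_shift (f : R -> C) (t : R) : rcont f -> lint setT (fun x => f (x + t)) = lint setT f.
Proof.
move=> cf; apply: ceq.
 exact: (Rintegral_shift t (rcont_Re cf)).
exact: (Rintegral_shift t (rcont_Im cf)).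
Qed.

Definition joint (g : R -> R -> C) := forall (u v : nat -> R) a b, u @ \oo --> a -> v @ \oo --> b ->
 ccvg (fun n => g (u n) (v n)) (g a b).

(** Rounding the first variable to a grid gives functions that are measurable on each of countably
    many strips, and they converge pointwise. Fubini asks for this joint measurability. *)
Lemma joint_measurable (r : C -> R) (g : R -> R -> C) :
 (forall u a, ccvg u a -> (fun n => r (u n)) @ \oo --> r a) ->
 joint g -> measurable_fun setT (fun p : R * R => r (g p.1 p.2)).
Proof.
move=> hr jg; pose fl (n : nat) (x : R) : R := (Num.floor (x * n.+1%:R))%:~R / n.+1%:R.
have fl_cvg x : (fun n => fl n x) @ \oo --> x.
 apply: (cvg_sub0 (f := fun n => fl n x) (g := fun=> x)); last exact: cvg_cst.
 apply: (squeeze_cvgr (f := fun n => - n.+1%:R^-1) (h := fun n => n.+1%:R^-1)).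
 - apply: nearW => n; have n0 : 0 < n.+1%:R :> R by [].
  have h1 := ge_floor (x * n.+1%:R); have h2 := floorD1_gt (x * n.+1%:R).
  rewrite intrD1 in h2 *.
  have e : fl n x - x = ((Num.floor (x * n.+1%:R))%:~R - x * n.+1%:R) / n.+1%:R.
   by rewrite mulrBl mulfK ?gt_eqF.
  rewrite -[X in _ <= X <= _]/(fl n x - x) e -[X in - X]mul1r -mulNr ler_pM2r ?invr_gt0 // ler_pdivrMr // mulVf ?gt_eqF //.
  by apply/andP; split; lra.
 - by rewrite -oppr0; apply: cvgN; exact: cvg_harmonic.
 - exact: cvg_harmonic.
apply: (measurable_fun_cvg (h := fun n (p : R * R) => r (g (fl n p.1) p.2))) => [n|p _]; last first.
 by apply: hr; apply: jg; [exact: fl_cvg|exact: cvg_cst].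
move=> _ Y mY; rewrite setTI.
have mg a : measurable_fun setT (fun y => r (g a y)).
 apply: continuous_measurable_fun => y; apply: seq_continuous => v vy; apply: hr.
 by apply: jg => //; exact: cvg_cst.
have -> : (fun p : R * R => r (g (fl n p.1) p.2)) @^-1` Y =
  \bigcup_(i : int) ((fun x : R => Num.floor (x * n.+1%:R)) @^-1` [set i] `*`
   ((fun y => r (g (i%:~R / n.+1%:R) y)) @^-1` Y)).
 apply/seteqP; split=> [[x y] /= h|[x y] [i _ [/= <- h]]] //.
 by exists (Num.floor (x * n.+1%:R)).
apply: countable_bigcupT_measurable => [|i]; first exact: countableP.
apply: measurableX; last by rewrite -[X in measurable X]setTI; exact: mg.
have -> : (fun x : R => Num.floor (x * n.+1%:R)) @^-1` [set i] =
  `[i%:~R / n.+1%:R, (i + 1)%:~R / n.+1%:R[%classic.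
 apply/seteqP; split=> x /=; rewrite in_itv /= ler_pdivrMr // ltr_pdivlMr //.
  by move=> <-; rewrite ge_floor floorD1_gt.
 by move=> h; apply: floor_def; rewrite h.
exact: measurable_itv.
Qed.

Let mT : measurable (setT : set R) := measurableT.

Definition dom1 (M c : R) (f : R -> C) := rcont f /\ forall x, cabs (f x) <= M * expR (- c * x ^+ 2).
Definition gK (c : R) : R := Num.sqrt pi / Num.sqrt c.

Lemma gK_ge0 c : 0 <= gK c. Proof. by rewrite divr_ge0 ?sqrtr_ge0. Qed.
Lemma dom1_ign M c : 0 < c -> ign setT (fun x : R => M * expR (- c * x ^+ 2)).
Proof. by move=> c0; apply: ignZ => //; exact: gauss_ign. Qed.
Lemma dom1_bound M c f : 0 < c -> dom1 M c f -> cabs (lint setT f) <= 2 * (M * gK c).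
Proof.
move=> c0 [cf hf]; apply: le_trans (lint_bound mT cf (dom1_ign M c0) (fun x _ => hf x)) _.
rewrite RintegralZl //; last exact: gauss_ign.
by rewrite /Rintegral gauss_total.
Qed.

(** Domination by a product Gaussian makes every slice integrable and the inner integral again
    dominated by a Gaussian. *)
Definition dom2 (M c : R) (g : R -> R -> C) := joint g /\
 forall x y, cabs (g x y) <= M * expR (- c * (x ^+ 2 + y ^+ 2)).
Definition int2 (g : R -> R -> C) : C := lint setT (fun x => lint setT (g x)).

Lemma dom2_expr M c g x y : dom2 M c g -> cabs (g x y) <= M * expR (- c * x ^+ 2) * expR (- c * y ^+ 2).
Proof. by move=> [_ h]; rewrite -mulrA -expRD -mulrDr. Qed.
Lemma dom2_M M c g : dom2 M c g -> 0 <= M.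
Proof.
move=> h; have := le_trans (cabs_ge0 _) (dom2_expr 0 0 h).
by rewrite !expr0n !mulr0 expR0 !mulr1.
Qed.
Lemma dom2_slice M c g x : dom2 M c g -> dom1 (M * expR (- c * x ^+ 2)) c (g x).
Proof.
move=> h; split=> [v l vl|y]; last exact: dom2_expr.
by apply: h.1 => //; exact: cvg_cst.
Qed.
Lemma dom2_sliceM M c g x : 0 < c -> dom2 M c g -> dom1 M c (g x).
Proof.
move=> c0 h; have [h1 h2] := dom2_slice x h; split=> // y; apply: le_trans (h2 y) _.
rewrite ler_wpM2r ?expR_ge0 // ler_piMr ?(dom2_M h) // -[leRHS]expR0 ler_expR.
by rewrite mulNr oppr_le0 mulr_ge0 ?sqr_ge0 // ltW.
Qed.
Lemma dom2_inner M c g : 0 < c -> dom2 M c g ->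
 dom1 (2 * M * gK c) c (fun x => lint setT (g x)).
Proof.
move=> c0 h; split=> [v l vl|x]; last first.
 apply: le_trans (dom1_bound c0 (dom2_slice x h)) _.
 by apply/eq_ler; ring.
apply: (lint_dct mT (g := fun y => M * expR (- c * y ^+ 2))) => [n||||y _].
- exact: (dom2_slice _ h).1.
- exact: (dom2_slice _ h).1.
- exact: dom1_ign.
- by move=> n y _; exact: (dom2_sliceM _ c0 h).2.
- by apply: h.1 => //; exact: cvg_cst.
Qed.
Lemma int2_bound M c g : 0 < c -> dom2 M c g -> cabs (int2 g) <= M * (4 * gK c ^+ 2).
Proof.
move=> c0 h; apply: le_trans (dom1_bound c0 (dom2_inner c0 h)) _.
by apply/eq_ler; ring.
Qed.
Lemma int2D M M' c g g' : 0 < c -> dom2 M c g -> dom2 M' c g' ->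
 int2 (fun x y => g x y + g' x y) = int2 g + int2 g'.
Proof.
move=> c0 h h'; have i := dom2_inner c0 h; have i' := dom2_inner c0 h'.
rewrite /int2 -(lintD mT i.1 i'.1 (dom1_ign _ c0) (dom1_ign _ c0) (fun x _ => i.2 x) (fun x _ => i'.2 x)).
congr lint; apply/funext => x; have s := dom2_slice x h; have s' := dom2_slice x h'.
exact: (lintD mT s.1 s'.1 (dom1_ign _ c0) (dom1_ign _ c0) (fun x _ => s.2 x) (fun x _ => s'.2 x)).
Qed.
Lemma int2Z M c b g : 0 < c -> dom2 M c g -> int2 (fun x y => b * g x y) = b * int2 g.
Proof.
move=> c0 h; have i := dom2_inner c0 h.
rewrite /int2 -(lintZ mT b i.1 (dom1_ign _ c0) (fun x _ => i.2 x)).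
congr lint; apply/funext => x; have s := dom2_slice x h.
exact: (lintZ mT b s.1 (dom1_ign _ c0) (fun x _ => s.2 x)).
Qed.
Lemma int2_dct M c (g : nat -> R -> R -> C) h : 0 < c -> (forall n, dom2 M c (g n)) -> dom2 M c h ->
 (forall x y, ccvg (fun n => g n x y) (h x y)) -> ccvg (fun n => int2 (g n)) (int2 h).
Proof.
move=> c0 hg hh cv.
apply: (lint_dct mT (g := fun x => 2 * M * gK c * expR (- c * x ^+ 2))) => [n||||x _].
- exact: (dom2_inner c0 (hg n)).1.
- exact: (dom2_inner c0 hh).1.
- exact: dom1_ign.
- by move=> n x _; exact: (dom2_inner c0 (hg n)).2.
- apply: (lint_dct mT (g := fun y => M * expR (- c * y ^+ 2))) => [n||||y _] //.
 + exact: (dom2_slice x (hg n)).1.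
 + exact: (dom2_slice x hh).1.
 + exact: dom1_ign.
 + by move=> n y _; exact: (dom2_sliceM x c0 (hg n)).2.
Qed.

(** Integrability over the product is inherited from the product Gaussian, whose iterated integral
    is explicit. *)
Lemma int2_swap M c g : 0 < c -> dom2 M c g -> int2 g = int2 (fun x y => g y x).
Proof.
move=> c0 h.
have key (r : C -> R) : (forall u a, ccvg u a -> (fun n => r (u n)) @ \oo --> r a) ->
  (forall w, `|r w| <= cabs w) ->
  (\int[leb]_x \int[leb]_y r (g x y))%R = (\int[leb]_y \int[leb]_x r (g x y))%R.
 move=> rc rb; pose phi (p : R * R) := (r (g p.1 p.2))%:E.
 have mphi : measurable_fun setT phi by apply/measurable_EFinP; exact: joint_measurable rc h.1.
 pose D (p : R * R) := (M * expR (- c * p.1 ^+ 2) * expR (- c * p.2 ^+ 2))%:E.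
 have D0 (p : R * R) : 0 <= M * expR (- c * p.1 ^+ 2) * expR (- c * p.2 ^+ 2).
  by rewrite !mulr_ge0 ?expR_ge0 ?(dom2_M h).
 have jD : joint (fun x y => (M * expR (- c * x ^+ 2) * expR (- c * y ^+ 2))%:C).
  have cgs (u : nat -> R) (a : R) : u @ \oo --> a -> (fun n => expR (- c * u n ^+ 2)) @ \oo --> expR (- c * a ^+ 2).
   by move=> ua; apply: (cvg_comp u (fun x => expR (- c * x ^+ 2)) ua); exact: continuous_gauss.
  move=> u v a b ua vb; apply: ccvg_real; apply: cvgM; last exact: cgs.
  by apply: cvgM; [exact: cvg_cst|exact: cgs].
 have mD : measurable_fun setT D.
  apply/measurable_EFinP; exact: (joint_measurable (r := @Re R) (fun u a => @ccvg_Re R u a) jD).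
 have iD : (leb \x leb)%E.-integrable setT D.
  apply/integrable12ltyP => //.
  have -> : (\int[leb]_x \int[leb]_y `|D (x, y)| = \int[leb]_x ((M * gK c) * expR (- c * x ^+ 2))%:E)%E.
   apply: eq_integral => x _.
   have Mx : (0 <= (M * expR (- c * x ^+ 2))%:E)%E by rewrite lee_fin mulr_ge0 ?expR_ge0 // (dom2_M h).

   transitivity ((M * expR (- c * x ^+ 2))%:E * \int[leb]_y (expR (- c * y ^+ 2))%:E)%E; last first.
    by rewrite gauss_total // -EFinM; congr EFin; rewrite /gK; ring.
   rewrite -ge0_integralZl //; last first.
    by apply/measurable_EFinP; exact: continuous_measurable_fun (@continuous_gauss c).
   apply: eq_integral => y _; rewrite /D -EFinM.
   by have := D0 (x, y); rewrite /= => d0; rewrite ger0_norm.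
  have /integrableP[_] := dom1_ign (M * gK c) c0; apply: le_lt_trans.
  apply: ge0_le_integral => //.
  - by move=> x _; rewrite lee_fin !mulr_ge0 ?expR_ge0 ?gK_ge0 ?(dom2_M h).
  - apply/measurable_EFinP; apply: measurable_funM => //.
   exact: continuous_measurable_fun (@continuous_gauss c).
  - apply: measurableT_comp => //; apply/measurable_EFinP; apply: measurable_funM => //.
   exact: continuous_measurable_fun (@continuous_gauss c).
  by move=> x _; rewrite /= lee_fin ler_norm.
 have iphi : (leb \x leb)%E.-integrable setT phi.
  apply: (le_integrable _ _ _ iD) => // p _; rewrite /phi /D /= lee_fin.
  by rewrite [leRHS]ger0_norm ?D0 //; apply: le_trans (rb _) _; exact: dom2_expr.
 have ir1 x : ign setT (fun y => r (g x y)).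
  apply: (le_integrable _ _ _ (dom1_ign M c0)) => // [|y _ /=].
   apply/measurable_EFinP; apply: continuous_measurable_fun => y; apply: seq_continuous => v vy.
   by apply: rc; apply: h.1 => //; exact: cvg_cst.
  by rewrite lee_fin (le_trans (rb _)) // (le_trans _ (ler_norm _)) //; exact: (dom2_sliceM x c0 h).2.
 have ir2 y : ign setT (fun x => r (g x y)).
  apply: (le_integrable _ _ _ (dom1_ign M c0)) => // [|x _ /=].
   apply/measurable_EFinP; apply: continuous_measurable_fun => x; apply: seq_continuous => v vx.
   by apply: rc; apply: h.1 => //; exact: cvg_cst.
  rewrite lee_fin (le_trans (rb _)) // (le_trans _ (ler_norm _)) // (le_trans (dom2_expr x y h)) //.
  rewrite -[leRHS]mulr1 ler_pM ?mulr_ge0 ?expR_ge0 ?(dom2_M h) // -[leRHS]expR0 ler_expR.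
  by rewrite mulNr oppr_le0 mulr_ge0 ?sqr_ge0 // ltW.
 have fn (f : R -> R) : ign setT f -> (\int[leb]_y (f y)%:E = (\int[leb]_y f y)%:E)%E.
  by move=> fi; rewrite /Rintegral fineK //; apply: integrable_fin_num.
 have := Fubini iphi; rewrite /phi /=.
 under eq_integral do rewrite fn //.
 under [in X in _ = X]eq_integral do rewrite fn //.
 by rewrite /Rintegral => ->.
apply: ceq.
 by have := key (@Re R) (fun u a => @ccvg_Re R u a) (@cabsRe R).
by have := key (@Im R) (fun u a => @ccvg_Im R u a) (@cabsIm R).
Qed.

Lemma int2_shift M c g s t : 0 < c -> dom2 M c g -> int2 (fun x y => g (x + s) (y + t)) = int2 g.
Proof.
move=> c0 h; rewrite /int2 -[RHS](lint_shift s (dom2_inner c0 h).1); congr lint; apply/funext => x.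
exact: lint_shift (dom2_slice (x + s) h).1.
Qed.
Lemma int2_sheary M c g a : dom2 M c g -> int2 (fun x y => g x (y + a * x)) = int2 g.
Proof.
by move=> h; congr lint; apply/funext => x; exact: lint_shift (dom2_slice x h).1.
Qed.
Lemma dom2_swap M c g : dom2 M c g -> dom2 M c (fun x y => g y x).
Proof. by move=> [j h]; split=> [u v a b ua vb|x y]; [exact: j|rewrite addrC]. Qed.
(** With [Y = y + a x] one has [y^2 <= 2 Y^2 + 2 a^2 x^2]; the rate therefore drops at most by the
    factor [3 + 2 a^2]. *)
Lemma dom2_sheary M c g a : 0 < c -> dom2 M c g -> dom2 M (c / (3 + 2 * a ^+ 2)) (fun x y => g x (y + a * x)).
Proof.
move=> c0 h; split=> [u v x y ux vy|x y].
 by apply: h.1 => //; apply: cvgD => //; apply: cvgM => //; exact: cvg_cst.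
apply: le_trans (h.2 _ _) _; rewrite ler_wpM2l ?(dom2_M h) // ler_expR !mulNr lerN2.
have K0 : 0 < 3 + 2 * a ^+ 2 by rewrite ltr_pwDl // mulr_ge0 ?sqr_ge0.
rewrite mulrAC ler_pdivrMr // -mulrA ler_wpM2l ?(ltW c0) //.
have := sqr_ge0 (y + a * x + a * x); have := sqr_ge0 (a * (y + a * x)); have := sqr_ge0 (y + a * x).
have := sqr_ge0 x; have := sqr_ge0 (a * x); nra.
Qed.
Lemma int2_shearx M c g a : 0 < c -> dom2 M c g -> int2 (fun x y => g (x + a * y) y) = int2 g.
Proof.
move=> c0 h; have hs := dom2_swap h; have h' := dom2_swap (dom2_sheary a c0 hs).
have K0 : 0 < c / (3 + 2 * a ^+ 2) by rewrite divr_gt0 // ltr_pwDl // mulr_ge0 ?sqr_ge0.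
by rewrite (int2_swap K0 h') (int2_sheary a hs) (int2_swap c0 h).
Qed.
Lemma dom2_shearx M c g a : 0 < c -> dom2 M c g -> dom2 M (c / (3 + 2 * a ^+ 2)) (fun x y => g (x + a * y) y).
Proof. by move=> c0 h; exact: dom2_swap (dom2_sheary a c0 (dom2_swap h)). Qed.

(* A rotation is a product of three shears. *)
Lemma int2_rotation M c g (co si : R) : 0 < c -> dom2 M c g -> co ^+ 2 + si ^+ 2 = 1 -> co != -1 ->
 int2 (fun x y => g (co * x - si * y) (si * x + co * y)) = int2 g.
Proof.
(* [t] is minus the tangent of half the angle; the half-turn is excluded for this reason. *)
move=> c0 h cs co1; pose t := - (si / (1 + co)).
have n0 : 1 + co != 0 by rewrite addrC -[1]opprK subr_eq0.
have K0 b : 0 < 3 + 2 * b ^+ 2 :> R by rewrite ltr_pwDl // mulr_ge0 ?sqr_ge0.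
have h1 := dom2_shearx t c0 h; have c1 : 0 < c / (3 + 2 * t ^+ 2) by rewrite divr_gt0.
have h2 := dom2_sheary si c1 h1; have c2 : 0 < c / (3 + 2 * t ^+ 2) / (3 + 2 * si ^+ 2) by rewrite divr_gt0.
rewrite -(int2_shearx t c0 h) -(int2_sheary si h1) -(int2_shearx t c2 h2).
congr int2; apply/funext => x; apply/funext => y.
have s2 : si ^+ 2 = (1 - co) * (1 + co) by have -> : (1 - co) * (1 + co) = 1 - co ^+ 2 by [ring]; rewrite -cs; ring.
have ts : 1 + t * si = co.
 rewrite /t mulNr mulrAC -expr2 s2 mulfK //; ring.
have e2 : si * (x + t * y) + y = si * x + co * y by rewrite -ts; ring.
have e1 : x + t * y + t * (si * (x + t * y) + y) = co * x - si * y.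
 have t2 : t * (1 + co) = - si by rewrite /t mulNr divfK.
 have -> : x + t * y + t * (si * (x + t * y) + y) = (1 + t * si) * x + (t * (1 + (1 + t * si))) * y by ring.
 by rewrite ts t2; ring.
by rewrite [y + _]addrC e2 -e1 e2.
Qed.

Local Notation Cd := (Cd R).

Definition pint (G : C -> C) : C := int2 (fun x y => G (x +i* y)).
Definition domC (M c : R) (G : C -> C) := ccont G /\ forall z, cabs (G z) <= M * expR (- c * cabs2 z).

Lemma domC_dom2 M c G : domC M c G -> dom2 M c (fun x y => G (x +i* y)).
Proof.
move=> [cG h]; split=> [u v a b ua vb|x y]; last exact: h.
by apply: cG; exact: ccvg_ReIm.
Qed.

(** Invariance under a single rotation suffices: its angle makes [w ^+ |a - b|] equal to [i], so the
    integral is multiplied by [i] or [- i] and must vanish. The rotation is at most a quarter turn,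
    within reach of [int2_rotation]. *)
Lemma pint_mode G a b M c : 0 < c -> domC M c G ->
 (forall w z, cabs w = 1 -> G (w * z) = w ^+ a * conjc w ^+ b * G z) -> a != b -> pint G = 0.
Proof.
move=> c0 dG hG ab.
have nu0 : (0 < maxn a b - minn a b)%N by move: ab; rewrite neq_ltn => /orP[] lt; lia.
pose nu := (maxn a b - minn a b)%N; pose th : R := pi / 2 / nu%:R.
have nR : 0 < nu%:R :> R by rewrite ltr0n.
have th_le : th <= pi / 2 by rewrite /th ler_pdivrMr // ler_peMr ?ler1n // divr_ge0 ?pi_ge0.
have th0 : 0 <= th by rewrite !divr_ge0 ?pi_ge0.
pose w := cexp (0 +i* th).
have wE : w = cos th +i* sin th.
 by rewrite /w /cexp /= expR0; apply: ceq; rewrite /= ?mul1r ?mul0r ?subr0 ?addr0.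
have w1 : cabs w = 1 by rewrite cabs_cexp /= expR0.
have ww : w * conjc w = 1 by rewrite mul_conj -cabs_sqr w1 expr1n.
have wnu : w ^+ nu = 0 +i* 1.
 rewrite -cexp_natM.
 have -> : nu%:R * (0 +i* th) = 0 +i* (pi / 2) :> C.
  rewrite -realCn /th; apply: ceq; rewrite /= ?mulr0 ?mul0r ?subrr ?addr0 //.
  by rewrite mulrC divfK // gt_eqF.
 by rewrite /cexp /= expR0 cos_pihalf sin_pihalf; apply: ceq; rewrite /= ?mul1r ?mul0r ?subr0 ?addr0.
have ne1 : w ^+ a * conjc w ^+ b != 1.
 have [ab'|ba] := leqP a b.
  have -> : w ^+ a * conjc w ^+ b = conjc (w ^+ nu).
   rewrite /nu (maxn_idPr ab') (minn_idPl ab') -{1}(subnK ab') exprD mulrCA -exprMn ww expr1n mulr1.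
   by rewrite conjX.
  by rewrite wnu; apply/eqP => /(congr1 (@Im R)) /= /eqP; rewrite oppr_eq0 oner_eq0.
 have ba' := ltnW ba.
 have -> : w ^+ a * conjc w ^+ b = w ^+ nu.
  by rewrite /nu (maxn_idPl ba') (minn_idPr ba') -{1}(subnK ba') exprD -mulrA -exprMn ww expr1n mulr1.
 by rewrite wnu; apply/eqP => /(congr1 (@Im R)) /= /eqP; rewrite oner_eq0.
have d2 := domC_dom2 dG.
have cos0 : 0 <= cos th by apply: cos_ge0_pihalf; rewrite th_le andbT (le_trans _ th0) // oppr_le0 divr_ge0 ?pi_ge0.
have co1 : cos th != -1 by rewrite gt_eqF // (lt_le_trans _ cos0) // ltrN10.
have := int2_rotation c0 d2 (cos2Dsin2 th) co1.
have -> : (fun x y => G ((cos th * x - sin th * y) +i* (sin th * x + cos th * y))) =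
  (fun x y => w ^+ a * conjc w ^+ b * G (x +i* y)).
 apply/funext => x; apply/funext => y; rewrite -hG //; congr G; rewrite wE.
 by apply: ceq; rewrite /=; ring.
rewrite (int2Z _ c0 d2) -/(pint G) => /eqP.
rewrite -subr_eq0 -{2}[pint G]mul1r -mulrBl mulf_eq0 subr_eq0 (negbTE ne1) => /eqP.
by [].
Qed.

(** Integrand of the generating function of the Gaussian moments; [pint_gE] evaluates its integral
    to [exp (w w')]. *)
Definition gE (w w' z : C) : C := cexp (- (pi%:C * (z * conjc z)) + (sq R)%:C * (z * w + conjc z * w')).

Lemma ccont_gE w w' : ccont (gE w w').
Proof.
move=> u l ul; apply: cexp_cont; have uc := ccvg_conj ul.
apply: ccvgD; first by apply: ccvgN; apply: ccvgZ; exact: ccvgM.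
by apply: ccvgZ; apply: ccvgD; apply: ccvgM => //; exact: ccvg_cst.
Qed.
Lemma expbound_ge0 (M x : R) (w : C) : cabs w <= M * expR x -> 0 <= M.
Proof. by move/(le_trans (cabs_ge0 _)); rewrite pmulr_lge0 ?expR_gt0. Qed.

Lemma gauss_absorb (K t : R) : expR (- pi * t ^+ 2) * expR (K * t) <= expR (K ^+ 2 / (2 * pi)) * expR (- (pi / 2) * t ^+ 2).
Proof.
rewrite -!expRD ler_expR; have := quad_le K t (pi_gt0 R).
by move: (t ^+ 2) (K * t) (K ^+ 2 / _) => x y z; lra.
Qed.

Lemma cabs_gE w w' z : cabs (gE w w' z) <= expR (- pi * cabs z ^+ 2) * expR (sq R * (cabs w + cabs w') * cabs z).
Proof.
rewrite cabs_cexp ReD expRD; apply: ler_pM; rewrite ?expR_ge0 //.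
 by rewrite mul_conj -realCM -rmorphN /= cabs_sqr mulNr.
rewrite ler_expR; apply: le_trans (ler_norm _) _; apply: le_trans (cabsRe _) _.
rewrite cabsM cabsR (ger0_norm (ltW (sq_gt0 R))) -mulrA ler_wpM2l ?(ltW (sq_gt0 R)) //.
by apply: le_trans (cabsD _ _) _; rewrite !cabsM cabs_conj -mulrDr mulrC.
Qed.

Lemma domC_gE w w' : domC (expR ((sq R * (cabs w + cabs w')) ^+ 2 / (2 * pi))) (pi / 2) (gE w w').
Proof.
split; first exact: ccont_gE.
move=> z; apply: le_trans (cabs_gE _ _ _) _; apply: le_trans (gauss_absorb _ _) _.
by rewrite cabs_sqr.
Qed.
Lemma lint_real (f : R -> R) : lint setT (fun x => (f x)%:C) = (\int[leb]_x f x)%:C.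
Proof. by apply: ceq; rewrite //= Rintegral_cst // mul0r. Qed.

Lemma pint_gE00 : pint (gE 0 0) = 1.
Proof.
have e1 : (\int[leb]_x expR (- pi * x ^+ 2))%R = 1 :> R.
 by rewrite /Rintegral gauss_total ?pi_gt0 // divff // gt_eqF // sqrtr_gt0 pi_gt0.
have i1 : lint setT (fun x : R => (expR (- pi * x ^+ 2))%:C) = 1 by rewrite lint_real e1.
have d1 : dom1 1 pi (fun x : R => (expR (- pi * x ^+ 2))%:C).
 split=> [v l vl|x]; last by rewrite cabsR ger0_norm ?expR_ge0 // mul1r.
 by apply: ccvg_real; apply: (cvg_comp v (fun x => expR (- pi * x ^+ 2)) vl); exact: continuous_gauss.
rewrite /pint /int2 -[RHS]i1; congr lint; apply/funext => x.
rewrite (_ : (fun y => _) = (fun y => (expR (- pi * x ^+ 2))%:C * (expR (- pi * y ^+ 2))%:C)); last first.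
 apply/funext => y; rewrite -realCM -expRD -cexp_real /gE; congr cexp.
 by rewrite !mulr0 addr0 mulr0 addr0; apply: ceq; rewrite /=; ring.
by rewrite (lintZ measurableT _ d1.1 (dom1_ign 1 (pi_gt0 R)) (fun x _ => d1.2 x)) i1 mulr1.
Qed.

(** Complex counterpart of [iint], in the same order of integration. For Gaussian dominated
    functions [iint_CI] identifies the two, and linearity and limits are handled on this side. *)
Fixpoint CI d (k : nat) (h : Cd d -> C) (z : Cd d) : C :=
 if k is k'.+1 then
  if insub k' is Some j then int2 (fun x y => CI k' h (upd z j (x +i* y))) else CI k' h z
 else h z.

Section Iterated.
Variable d : nat.
Implicit Types (h : Cd d -> C) (z : Cd d).
Definition gdom (M c : R) h := dcont h /\ forall z, cabs (h z) <= M * expR (- c * nrm2 z).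
Definition tail (k : nat) z : R := \sum_(j < d | (k <= j)%N) cabs2 (z j).

Lemma tail_ge0 k z : 0 <= tail k z.
Proof. by apply: sumr_ge0 => j _; exact: cabs2_ge0. Qed.
Lemma tail_upd (j : 'I_d) z w : tail j (upd z j w) = cabs2 w + tail j.+1 z.
Proof.
rewrite /tail (bigD1 j) //= updE eqxx; congr (_ + _); apply: eq_big => [i|i /andP[_ /negbTE ij]].
 by rewrite ltn_neqAle eq_sym andbC; congr (_ && _); rewrite -val_eqE eq_sym.
by rewrite updE ij.
Qed.

Definition gB (c : R) : R := 4 * gK c ^+ 2.
Lemma gB_ge0 c : 0 <= gB c. Proof. by rewrite mulr_ge0 ?sqr_ge0. Qed.

(** Two bounds: one keeps the Gaussian in the remaining variables and continues the induction, the
    other is uniform in [z] and serves dominated convergence. *)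
Lemma dom2_CI M c k h (j : 'I_d) z (F := fun x y => CI k h (upd z j (x +i* y))) :
 nat_of_ord j = k -> 0 <= M -> 0 < c -> dcont (CI k h) ->
 (forall z, cabs (CI k h z) <= M * gB c ^+ k * expR (- c * tail k z)) ->
 dom2 (M * gB c ^+ k * expR (- c * tail k.+1 z)) c F /\ dom2 (M * gB c ^+ k) c F.
Proof.
move=> jk M0 c0 cI hI; suff hF : dom2 (M * gB c ^+ k * expR (- c * tail k.+1 z)) c F.
 split=> //; split=> [|x y]; first exact: hF.1.
 apply: le_trans (hF.2 x y) _; rewrite ler_wpM2r ?expR_ge0 // ler_piMr ?mulr_ge0 ?exprn_ge0 ?gB_ge0 //.
 by rewrite -[leRHS]expR0 ler_expR mulNr oppr_le0 mulr_ge0 ?tail_ge0 // ltW.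
split=> [u v a b ua vb|x y].
 by apply: cI; apply: dcvg_upd; [exact: dcvg_cst|exact: ccvg_ReIm].
by apply: le_trans (hI _) _; rewrite -[leRHS]mulrA -expRD -mulrDr -jk tail_upd addrC.
Qed.

Lemma CI_dom M c k h : 0 < c -> gdom M c h -> (k <= d)%N ->
 dcont (CI k h) /\ forall z, cabs (CI k h z) <= M * gB c ^+ k * expR (- c * tail k z).
Proof.
move=> c0 [ch hh] kd.
have M0 := expbound_ge0 (hh 0).
elim: k kd => [|k IH] kd.
 split=> [//|z]; apply: le_trans (hh z) _; rewrite expr0 mulr1 ler_wpM2l // ler_expR.
have [cI hI] := IH (ltnW kd); have d2 z := dom2_CI z (erefl (nat_of_ord (Ordinal kd))) M0 c0 cI hI.
rewrite /= insubT; split=> [z l zl|z]; last first.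
 apply: le_trans (int2_bound c0 (d2 z).1) _.
 apply/eq_ler; rewrite /= [in RHS]exprS -[4 * _]/(gB c).
 by move: (gB c ^+ k) (expR _) => x y; ring.
apply: (int2_dct (M := M * gB c ^+ k) c0) => [n||x y]; [exact: (d2 (z n)).2|exact: (d2 l).2|].
by apply: cI; apply: dcvg_upd => //; exact: ccvg_cst.
Qed.

Lemma CI_dom2 M c h (j : 'I_d) z : 0 < c -> gdom M c h ->
 dom2 (M * gB c ^+ j) c (fun x y => CI j h (upd z j (x +i* y))).
Proof.
move=> c0 g; have [cI hI] := CI_dom c0 g (ltnW (ltn_ord j)).
have M0 := expbound_ge0 (g.2 0).
exact: (dom2_CI z (erefl _) M0 c0 cI hI).2.
Qed.
Lemma CI_S k h (kd : (k < d)%N) z : CI k.+1 h z = int2 (fun x y => CI k h (upd z (Ordinal kd) (x +i* y))).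
Proof. by rewrite /= insubT. Qed.

Lemma CI_D M M' c k h h' z : 0 < c -> gdom M c h -> gdom M' c h' -> (k <= d)%N ->
 CI k (fun z => h z + h' z) z = CI k h z + CI k h' z.
Proof.
move=> c0 g g'; elim: k z => [|k IH] z kd //; rewrite !(CI_S _ kd).
rewrite -(int2D c0 (CI_dom2 (Ordinal kd) z c0 g) (CI_dom2 (Ordinal kd) z c0 g')).
by congr int2; apply/funext => x; apply/funext => y; rewrite IH // ltnW.
Qed.
Lemma CI_Z M c k b h z : 0 < c -> gdom M c h -> (k <= d)%N ->
 CI k (fun z => b * h z) z = b * CI k h z.
Proof.
move=> c0 g; elim: k z => [|k IH] z kd //; rewrite !(CI_S _ kd).
rewrite -(int2Z b c0 (CI_dom2 (Ordinal kd) z c0 g)).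
by congr int2; apply/funext => x; apply/funext => y; rewrite IH // ltnW.
Qed.
Lemma CI_dct M c k (h : nat -> Cd d -> C) h' z : 0 < c -> (forall n, gdom M c (h n)) -> gdom M c h' ->
 (forall z, ccvg (fun n => h n z) (h' z)) -> (k <= d)%N -> ccvg (fun n => CI k (h n) z) (CI k h' z).
Proof.
move=> c0 g g' cv; elim: k z => [|k IH] z kd; first exact: cv.
rewrite (CI_S _ kd); under eq_fun do rewrite (CI_S _ kd).
apply: (int2_dct c0 (fun n => CI_dom2 (Ordinal kd) z c0 (g n)) (CI_dom2 (Ordinal kd) z c0 g')) => x y.
by apply: IH; exact: ltnW.
Qed.

Lemma fin_int M c (f : R -> C) : 0 < c -> dom1 M c f ->
 (\int[leb]_x (Re (f x))%:E = (Re (lint setT f))%:E)%E /\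
 (\int[leb]_x (Im (f x))%:E = (Im (lint setT f))%:E)%E.
Proof.
move=> c0 [cf hf]; have [i1 i2] := dom_int measurableT cf (dom1_ign M c0) (fun x _ => hf x).
by rewrite /lint /= /Rintegral !fineK //; apply: integrable_fin_num.
Qed.

Lemma iint_CI M c k h z : 0 < c -> gdom M c h -> (k <= d)%N ->
 iint k (fun z => (Re (h z))%:E) z = (Re (CI k h z))%:E /\
 iint k (fun z => (Im (h z))%:E) z = (Im (CI k h z))%:E.
Proof.
move=> c0 g; elim: k z => [|k IH] z kd //; rewrite !(CI_S _ kd) /= insubT.
have d2 := CI_dom2 (Ordinal kd) z c0 g.
have [e1 e2] := fin_int c0 (dom2_inner c0 d2).
rewrite /int2 -e1 -e2; split; apply: eq_integral => x _.
 have [<- _] := fin_int c0 (dom2_slice x d2).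
 by apply: eq_integral => y _; exact: (IH _ (ltnW kd)).1.
have [_ <-] := fin_int c0 (dom2_slice x d2).
by apply: eq_integral => y _; exact: (IH _ (ltnW kd)).2.
Qed.

Lemma CI_prod M c (g : 'I_d -> C -> C) z k : 0 < c -> (forall j, domC M c (g j)) -> (k <= d)%N ->
 CI k (fun z => \prod_j g j (z j)) z =
 \prod_(j < d) (if (j < k)%N then pint (g j) else g j (z j)).
Proof.
move=> c0 hg; elim: k z => [|k IH] z kd.
 by apply: eq_bigr.
rewrite (CI_S _ kd); set j0 := Ordinal kd.
rewrite (_ : (fun x y => _) = (fun x y => \prod_(j < d | j != j0) (if (j < k.+1)%N then pint (g j) else g j (z j))
  * g j0 (x +i* y))); last first.
 apply/funext => x; apply/funext => y; rewrite IH ?(ltnW kd) // (bigD1 j0) //= ltnn updE eqxx mulrC.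
 congr (_ * _); apply: eq_bigr => j jj0; rewrite updE (negbTE jj0) [in RHS]ltnS [in RHS]leq_eqVlt.
 by have /negbTE -> : (j : nat) != k by apply: contraNneq jj0 => e; apply/eqP/val_inj.
rewrite (int2Z _ c0 (domC_dom2 (hg j0))) -/(pint _) [RHS](bigD1 j0) //= ltnSn mulrC //.
Qed.
End Iterated.
End PlaneIntegrals.

(** * Gaussian moments and orthogonality of the polynomials in one variable *)

Section Orthonormality.
Variable R : realType.
Local Notation C := R[i].
Local Notation Cd := (Cd R).

(** Exponential growth is stable under sums, products and powers and is absorbed by the Gaussian, so
    integrability of polynomial expressions comes for free. *)
Definition egrow (f : C -> C) := ccont f /\ exists M K : R, 0 <= M /\ forall z, cabs (f z) <= M * expR (K * cabs z).

Lemma egrow_weaken (M K K' : R) (z : C) : 0 <= M -> K <= K' -> M * expR (K * cabs z) <= M * expR (K' * cabs z).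
Proof. by move=> M0 h; rewrite ler_wpM2l // ler_expR ler_wpM2r ?cabs_ge0. Qed.
Lemma egrow_cst c : egrow (fun=> c).
Proof.
split=> [u l _|]; first exact: ccvg_cst.
by exists (cabs c), 0; split=> [|z]; rewrite ?cabs_ge0 // mul0r expR0 mulr1.
Qed.
Lemma egrow_id : egrow id.
Proof.
split=> //; exists 1, 1; split=> // z; rewrite !mul1r.
by apply: le_trans (expR_ge1Dx _); rewrite lerDr.
Qed.
Lemma egrow_conj : egrow (@conjc R).
Proof.
have [_ [M [K [M0 h]]]] := egrow_id; split=> [u l|]; first exact: ccvg_conj.
by exists M, K; split=> // z; rewrite cabs_conj.
Qed.
Lemma egrowD f g : egrow f -> egrow g -> egrow (fun z => f z + g z).
Proof.
move=> [cf [M [K [M0 hf]]]] [cg [M' [K' [M'0 hg]]]]; split=> [u l ul|].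
 by apply: ccvgD; [exact: cf|exact: cg].
exists (M + M'), (Num.max K K'); split=> [|z]; first exact: addr_ge0.
apply: le_trans (cabsD _ _) _; rewrite mulrDl; apply: lerD.
 by apply: le_trans (hf z) _; apply: egrow_weaken; rewrite ?le_max ?lexx.
by apply: le_trans (hg z) _; apply: egrow_weaken; rewrite ?le_max ?lexx ?orbT.
Qed.
Lemma egrowM f g : egrow f -> egrow g -> egrow (fun z => f z * g z).
Proof.
move=> [cf [M [K [M0 hf]]]] [cg [M' [K' [M'0 hg]]]]; split=> [u l ul|].
 by apply: ccvgM; [exact: cf|exact: cg].
exists (M * M'), (K + K'); split=> [|z]; first exact: mulr_ge0.
by rewrite cabsM mulrDl expRD mulrACA ler_pM ?cabs_ge0.
Qed.
Lemma egrowX f n : egrow f -> egrow (fun z => f z ^+ n).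
Proof.
move=> hf; elim: n => [|n IH]; first exact: egrow_cst.
by rewrite (_ : (fun z => _) = (fun z => f z * f z ^+ n)); [exact: egrowM|apply/funext => z; rewrite exprS].
Qed.
Lemma egrow_sum I (r : seq I) (f : I -> C -> C) : (forall i, egrow (f i)) -> egrow (fun z => \sum_(i <- r) f i z).
Proof.
move=> hf; elim: r => [|i r IH].
 by rewrite (_ : (fun z => _) = (fun=> 0)); [exact: egrow_cst|apply/funext => z; rewrite big_nil].
rewrite (_ : (fun z => _) = (fun z => f i z + \sum_(i <- r) f i z)); first exact: egrowD.
by apply/funext => z; rewrite big_cons.
Qed.

Local Notation hpi := (pi / 2).
Lemma hpi_gt0 : 0 < hpi :> R. Proof. by rewrite divr_gt0 // pi_gt0. Qed.
Lemma gE00 z : gE 0 0 z = (expR (- pi * cabs2 z))%:C :> C.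
Proof. by rewrite -cexp_real /gE; congr cexp; rewrite !mulr0 addr0 mulr0 addr0 mul_conj -realCM mulNr rmorphN. Qed.

Lemma domC_gauss f : egrow f -> exists M, domC M hpi (fun z => gE 0 0 z * f z).
Proof.
move=> [cf [M [K [M0 hf]]]]; exists (M * expR (K ^+ 2 / (2 * pi))); split=> [u l ul|z].
 by apply: ccvgM; [exact: ccont_gE|exact: cf].
rewrite cabsM gE00 cabsR ger0_norm ?expR_ge0 // -mulrA.
apply: le_trans (ler_wpM2l (expR_ge0 _) (hf z)) _; rewrite mulrCA ler_wpM2l //.
by rewrite -cabs_sqr; exact: gauss_absorb.
Qed.

(** Integration against the probability measure [exp (- pi |z|^2) dz]. *)
Definition gL (f : C -> C) : C := pint (fun z => gE 0 0 z * f z).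
Lemma gLD f g : egrow f -> egrow g -> gL (fun z => f z + g z) = gL f + gL g.
Proof.
move=> /domC_gauss[M hf] /domC_gauss[M' hg].
rewrite /gL /pint -(int2D hpi_gt0 (domC_dom2 hf) (domC_dom2 hg)); congr int2.
by apply/funext => x; apply/funext => y; rewrite mulrDr.
Qed.
Lemma gLZ c f : egrow f -> gL (fun z => c * f z) = c * gL f.
Proof.
move=> /domC_gauss[M hf]; rewrite /gL /pint -(int2Z c hpi_gt0 (domC_dom2 hf)); congr int2.
by apply/funext => x; apply/funext => y; rewrite mulrCA.
Qed.
Lemma gL_sum I (r : seq I) (f : I -> C -> C) : (forall i, egrow (f i)) ->
 gL (fun z => \sum_(i <- r) f i z) = \sum_(i <- r) gL (f i).
Proof.
move=> hf; elim: r => [|i r IH].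
 rewrite big_nil -[RHS](mul0r (gL (fun=> 0))) -gLZ; last exact: egrow_cst.
 by congr gL; apply/funext => z; rewrite big_nil mulr0.
rewrite big_cons -IH -(gLD (hf i) (egrow_sum r hf)).
by congr gL; apply/funext => z; rewrite big_cons.
Qed.
Lemma gL_mode f a b : egrow f -> (forall w z, cabs w = 1 -> f (w * z) = w ^+ a * conjc w ^+ b * f z) ->
 a != b -> gL f = 0.
Proof.
move=> /domC_gauss[M hf] h; apply: (pint_mode hpi_gt0 hf) => w z w1.
by rewrite !gE00 cabs2M -(cabs_sqr w) w1 expr1n mul1r (h _ _ w1) mulrCA.
Qed.

Definition ba z : C := (sq R)%:C * z.
Definition bb z : C := (sq R)%:C * conjc z.
Lemma egrow_ba : egrow ba. Proof. by apply: egrowM egrow_id; exact: egrow_cst. Qed.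
Lemma egrow_bb : egrow bb. Proof. by apply: egrowM egrow_conj; exact: egrow_cst. Qed.
Definition mom m m' := gL (fun z => ba z ^+ m * bb z ^+ m').
Lemma egrow_mom m m' : egrow (fun z => ba z ^+ m * bb z ^+ m').
Proof. by apply: egrowM; apply: egrowX; [exact: egrow_ba|exact: egrow_bb]. Qed.
Lemma mom_neq m m' : m != m' -> mom m m' = 0.
Proof.
apply: gL_mode (egrow_mom m m') _ => w z w1; rewrite /ba /bb conjM.
by rewrite [(sq R)%:C * (w * z)]mulrCA [(sq R)%:C * (conjc w * _)]mulrCA !exprMn mulrACA.
Qed.

Lemma exp_partial (w : C) N : cabs (\sum_(n < N) w ^+ n / n`!%:R) <= expR (cabs w).
Proof.
apply: le_trans (cabs_sum _ _ _) _.
under eq_bigr do rewrite cabsM cabsV cabsX cabs_nat.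
rewrite -(big_mkord xpredT (fun n => cabs w ^+ n / n`!%:R)).
apply: (nondecreasing_cvgn_le (u_ := series (exp_coeff (cabs w)))).
 by apply: nondecreasing_series => n _ _; rewrite exp_coeff_ge0 // cabs_ge0.
exact: is_cvg_series_exp_coeff.
Qed.

Section Series.
Variables x y : C.
Let c n := mom n n / (n`!%:R * n`!%:R).
Let e N (w : C) := \sum_(n < N) w ^+ n / n`!%:R.
Let S N z := e N (x * ba z) * e N (y * bb z).
Let M : R := expR ((sq R * (cabs x + cabs y)) ^+ 2 / (2 * pi)).
Let gS N : egrow (S N).
Proof.
have eg f : egrow f -> egrow (fun z => e N (f z)).
 by move=> hf; apply: egrow_sum => n; apply: egrowM (egrow_cst _); exact: egrowX.
by apply: egrowM; apply: eg; apply: egrowM (egrow_cst _) _; [exact: egrow_ba|exact: egrow_bb].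
Qed.
(** Rotation invariance kills the mixed moments in the product of the two partial exponentials,
    leaving a polynomial in [x y]. *)
Let SE N : gL (S N) = \sum_(n < N) c n * (x * y) ^+ n.
Proof.
pose f n m z := (x ^+ n * y ^+ m / (n`!%:R * m`!%:R)) * (ba z ^+ n * bb z ^+ m) : C.
have gf n m : egrow (f n m) by apply: egrowM (egrow_cst _) (egrow_mom _ _).
have -> : S N = (fun z => \sum_(n < N) \sum_(m < N) f n m z).
 apply/funext => z; rewrite /S /e mulr_suml; apply: eq_bigr => n _; rewrite mulr_sumr.
 by apply: eq_bigr => m _; rewrite (exprMn _ x) (exprMn _ y) /f invfM; move: (ba z ^+ n) (bb z ^+ m) (_^-1) (_^-1) => *; ring.
rewrite gL_sum => [|n]; last by apply: egrow_sum => m; exact: gf.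
apply: eq_bigr => n _; rewrite gL_sum // (bigD1 n) //= big1 ?addr0 => [|m mn].
 by rewrite [LHS](gLZ _ (egrow_mom n n)) -/(mom n n) /c exprMn; move: (_^-1) => *; ring.
by rewrite [LHS](gLZ _ (egrow_mom n m)) -/(mom n m) mom_neq ?mulr0 // eq_sym.
Qed.
Let bd N : domC M hpi (fun z => gE 0 0 z * S N z).
Proof.
have [? h] := domC_gauss (gS N); split; first exact: h.1.
move=> z; rewrite cabsM gE00 cabsR ger0_norm ?expR_ge0 // -!cabs_sqr.
apply: le_trans (gauss_absorb _ _); rewrite ler_wpM2l ?expR_ge0 //.
have -> : sq R * (cabs x + cabs y) * cabs z = cabs (x * ba z) + cabs (y * bb z).
 by rewrite /ba /bb !cabsM cabs_conj cabsR ger0_norm ?(ltW (sq_gt0 R)) //; ring.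
by rewrite [cabs (S N z)]cabsM expRD; apply: ler_pM; rewrite ?cabs_ge0 ?exp_partial.
Qed.
Lemma mom_bound N : cabs (\sum_(n < N) c n * (x * y) ^+ n) <= M * (4 * gK hpi ^+ 2).
Proof. by rewrite -SE; exact: int2_bound hpi_gt0 (domC_dom2 (bd N)). Qed.
Lemma mom_cvg : ccvg (fun N => \sum_(n < N) c n * (x * y) ^+ n) (pint (gE x y)).
Proof.
rewrite (_ : (fun N => _) = (fun N => gL (S N))); last by apply/funext => N; rewrite SE.
apply: int2_dct hpi_gt0 (fun N => domC_dom2 (bd N)) (domC_dom2 (domC_gE x y)) _ => a b.
set z := a +i* b.
have -> : gE x y z = gE 0 0 z * (cexp (x * ba z) * cexp (y * bb z)).
 by rewrite /gE -!cexpD; congr cexp; rewrite /ba /bb !mulr0 !addr0 !mulr0 !addr0; ring.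
by apply: ccvgZ; apply: ccvgM; rewrite -csum_exp; apply: csum_ccvg; exact: casum_exp.
Qed.
End Series.

(** At [x = 0] every nonempty partial sum reduces to the zeroth moment. *)
Lemma pint_gE0 v : pint (gE 0 v) = 1 :> C.
Proof.
apply: ccvg_uniq (mom_cvg 0 v) _ => e e0; exists 1%N => -[|N] // _.
rewrite mul0r big_ord_recl big1 => [|i _]; last by rewrite expr0n mulr0.
rewrite fact0 expr0 !mulr1 divr1 addr0 /mom /gL (_ : (fun z => _) = gE 0 0) ?pint_gE00 ?subrr ?cabs0 //.
by apply/funext => z; rewrite !mulr1.
Qed.

(** Translating the plane by [conj(w) / sqrt pi] completes the square and leaves an integrand with
    first parameter 0. *)
Lemma pint_gE (w w' : C) : pint (gE w w') = cexp (w * w').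
Proof.
have p2 : 0 < pi / 2 :> R by rewrite divr_gt0 // pi_gt0.
pose h := (sq R)^-1%:C * conjc w.
have s0 : sq R != 0 by rewrite gt_eqF // sq_gt0.
have hE : (sq R)%:C * h = conjc w by rewrite /h mulrA -realCM divff // mul1r.
have hc : (sq R)%:C * conjc h = w by rewrite -conjR -conjM hE conjcK.
rewrite /pint -(int2_shift (Re h) (Im h) p2 (domC_dom2 (domC_gE w w'))).
have E z : gE w w' (z + h) = cexp (w * w') * gE 0 (w' - conjc w) z.
 rewrite /gE -cexpD; congr cexp.
 have pE : pi%:C = (sq R)%:C * (sq R)%:C :> C by rewrite -realCM -expr2 sq_sqr.
 rewrite conjD mulr0 add0r.
 transitivity (- (pi%:C * (z * conjc z)) - ((sq R)%:C * z) * ((sq R)%:C * conjc h) - ((sq R)%:C * conjc z) * ((sq R)%:C * h)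
  - ((sq R)%:C * h) * ((sq R)%:C * conjc h) + ((sq R)%:C * z * w + ((sq R)%:C * h) * w + (sq R)%:C * conjc z * w' + ((sq R)%:C * conjc h) * w')).
  by rewrite pE; ring.
 by rewrite hE hc; ring.
rewrite (_ : (fun x y => _) = (fun x y => cexp (w * w') * gE 0 (w' - conjc w) (x +i* y))); last first.
 by apply/funext => x; apply/funext => y; rewrite -E; congr gE; rewrite [h]cE.
rewrite (int2Z _ p2 (domC_dom2 (domC_gE 0 (w' - conjc w)))) -/(pint _) pint_gE0 mulr1 //.
Qed.

Lemma mom_series (x : C) (c := fun n => mom n n / (n`!%:R * n`!%:R)) :
 casum (fun n => c n * x ^+ n) /\ csum (fun n => c n * x ^+ n) = cexp x.
Proof.
have hc : casum (fun n => c n * x ^+ n).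
 (* Partial sums bounded at [2 x] yield terms with a geometric factor [2^-1 ^+ n] at [x]. *)
 pose K : R := expR ((sq R * (cabs (2 * x) + cabs (1 : C))) ^+ 2 / (2 * pi)) * (4 * gK hpi ^+ 2).
 have B N : cabs (\sum_(n < N) c n * (2 * x) ^+ n) <= K by have := mom_bound (2 * x) 1 N; rewrite mulr1.
 have h n : cabs (c n * x ^+ n) <= (K + K) * 2^-1 ^+ n.
  rewrite exprVn ler_pdivlMr ?exprn_gt0 //.
  have -> : cabs (c n * x ^+ n) * 2 ^+ n = cabs (c n * (2 * x) ^+ n).
   by rewrite !cabsM !cabsX cabsM cabs_nat exprMn; ring.
  have -> : c n * (2 * x) ^+ n = \sum_(i < n.+1) c i * (2 * x) ^+ i - \sum_(i < n) c i * (2 * x) ^+ i.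
   by rewrite big_ord_recr /= [X in X - _]addrC addrK.
  by apply: le_trans (cabsB _ _) _; apply: lerD; exact: B.
 have K0 : 0 <= K + K by have := le_trans (cabs_ge0 _) (h 0%N); rewrite expr0 mulr1.
 apply: rasum_le h _; apply: rasumZ K0 _; apply: rasum_geom.
 by rewrite invr_ge0 ler0n invf_lt1 // ltr1n.
split=> //; apply: ccvg_uniq (csum_ccvg hc) _.
by have := mom_cvg x 1; rewrite pint_gE !mulr1.
Qed.

(** The normalised diagonal moments and the exponential series are power series with the same sum,
    the integral of [gE]; their coefficients therefore agree. *)
Lemma momE m m' : mom m m' = (m == m')%:R * m`!%:R.
Proof.
have [<-|/mom_neq ->] := eqVneq m m'; last by rewrite mul0r.
pose b n : C := mom n n / (n`!%:R * n`!%:R) - n`!%:R^-1.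
have E x n : b n * x ^+ n = mom n n / (n`!%:R * n`!%:R) * x ^+ n - x ^+ n / n`!%:R.
 by rewrite /b mulrBl [_^-1 * _]mulrC.
have f0 n : n`!%:R != 0 :> C by rewrite pnatr_eq0 -lt0n fact_gt0.
have b0 : forall n, b n = 0.
 apply: power_series_uniq1 => [r r0|x].
  have [h _] := mom_series r%:C; apply: rasum_le (rasumD h (casum_exp r%:C)) => n.
  rewrite -[r in r ^+ n](ger0_norm r0) -cabsR -cabsX -cabsM E; exact: cabsB.
 have [h e] := mom_series x; rewrite (eq_csum (E x)) csumB ?e ?csum_exp ?subrr //; exact: casum_exp.
have /eqP := b0 m; rewrite /b subr_eq0 => /eqP e; rewrite mul1r.
by rewrite -[LHS](divfK (mulf_neq0 (f0 m) (f0 m))) e mulrA mulVf // mul1r.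
Qed.

Lemma egrow_pk k m f g : egrow f -> egrow g -> egrow (fun z => pk k m (f z) (g z)).
Proof.
move=> hf hg; elim: k m => [|k IH] m /=; first exact: egrowX.
by apply: egrowD; apply: egrowM => //; exact: egrow_cst.
Qed.
Lemma egrowN f : egrow f -> egrow (fun z => - f z).
Proof.
move=> hf; rewrite (_ : (fun z => _) = (fun z => -1 * f z)); first by apply: egrowM (egrow_cst _) hf.
by apply/funext => z; rewrite mulN1r.
Qed.

(* pk k m (- bb) ba and pk k m (- ba) bb are complex conjugate. The induction is on the first
  index, through the recursion of pk on one side and of its mirror image pk_Sr on the other. *)
Lemma gL_pk k m k' m' : gL (fun z => pk k m (- bb z) (ba z) * pk k' m' (- ba z) (bb z)) =
 ((k == k') && (m == m'))%:R * (k`!%:R * m`!%:R).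
Proof.
have gp k1 m1 : egrow (fun z => pk k1 m1 (- bb z) (ba z)) by apply: egrow_pk egrow_ba; exact/egrowN/egrow_bb.
have gq k1 m1 : egrow (fun z => pk k1 m1 (- ba z) (bb z)) by apply: egrow_pk egrow_bb; exact/egrowN/egrow_ba.
have gpq k1 m1 k2 m2 := egrowM (gp k1 m1) (gq k2 m2).
elim: k m k' m' => [|k IH] m k' m'.
 have g0 j n i := egrowM (egrowX j egrow_ba) (gq n i).
 have L n i j : gL (fun z => ba z ^+ j * pk n i (- ba z) (bb z)) = ((n == 0) && (j == i))%N%:R * j`!%:R.
  elim: n i j => [|n IHn] i j; first by rewrite /= -/(mom j i) momE.
  rewrite (_ : (fun z => _) = (fun z => -1 * (ba z ^+ j.+1 * pk n i (- ba z) (bb z)) +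
    i%:R * (ba z ^+ j * pk n i.-1 (- ba z) (bb z)))); last first.
   by apply/funext => z; rewrite /= exprS; ring.
  rewrite gLD ?gLZ //; try by apply: egrowM (egrow_cst _) _.
  rewrite !IHn; case: n {IHn} => [|n] /=; last by rewrite !mul0r !mulr0 addr0.
  case: i => [|i] /=; first by rewrite eqn0Ngt /= !mul0r mulr0 addr0.
  have [<-|ji] := eqVneq j i; last by rewrite eqSS (negbTE ji) /= !mul0r !mulr0 addr0.
  by rewrite eqSS eqxx /= factS natrM; ring.
 by rewrite [LHS](L k' m' m) /= eq_sym mul1r.
have H : gL (fun z => pk k.+1 m (- bb z) (ba z) * pk k' m' (- ba z) (bb z)) =
  - gL (fun z => pk k m (- bb z) (ba z) * pk k' m'.+1 (- ba z) (bb z))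
  + k'%:R * gL (fun z => pk k m (- bb z) (ba z) * pk k'.-1 m' (- ba z) (bb z))
  + m%:R * gL (fun z => pk k m.-1 (- bb z) (ba z) * pk k' m' (- ba z) (bb z)).
 have g1 := egrowM (egrow_cst (-1)) (gpq k m k' m'.+1).
 have g2 := egrowM (egrow_cst k'%:R) (gpq k m k'.-1 m').
 have g3 := egrowM (egrow_cst m%:R) (gpq k m.-1 k' m').
 rewrite -mulN1r -(gLZ _ (gpq k m k' m'.+1)) -(gLZ _ (gpq k m k'.-1 m')) -(gLZ _ (gpq k m.-1 k' m')).
 rewrite -(gLD g1 g2) -(gLD (egrowD g1 g2) g3).
 by congr gL; apply/funext => z; rewrite pk_Sr /=; ring.
rewrite H !IH; case: k' {H} => [|k'] /=; case: m => [|m] /=;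
 rewrite ?mul0r ?addr0 ?andbF ?eqSS ?mulr0n ?mul0r ?oppr0 ?addr0 ?eqn0Ngt /= ?andbF ?mul0r ?mulr0 ?oppr0 ?add0r ?addr0 //.
- by rewrite factS natrM; ring.
- by rewrite factS natrM; have [<-|] := eqVneq k k' => /=; [ring|rewrite !mul0r mulr0].
rewrite !factS !natrM; have [<-|] := eqVneq k k' => /=; [ring|rewrite !mul0r mulr0 => _; ring].
Qed.
End Orthonormality.

(** * Orthonormality in several variables and rotation invariant cutoffs *)

Section Cutoffs.
Variable R : realType.
Local Notation C := R[i].
Local Notation Cd := (Cd R).
Local Notation leb := (@lebesgue_measure R).
Variable d : nat.
Local Notation NI := (NI d).
Implicit Types (h : Cd d -> C) (z : Cd d).

Lemma CI_prod_ex c (g : 'I_d -> C -> C) : 0 < c -> (forall j, exists M, domC M c (g j)) ->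
 (exists M, gdom M c (fun z => \prod_j g j (z j))) /\
 CI d (fun z => \prod_j g j (z j)) 0 = \prod_j pint (g j).
Proof.
move=> c0 /choice[M hM]; pose M' := \sum_j M j.
have M0 j := expbound_ge0 ((hM j).2 0).
have hM' j : domC M' c (g j).
 have [cg hg] := hM j; split=> // z; apply: le_trans (hg z) _; rewrite ler_wpM2r ?expR_ge0 //.
 by rewrite /M' (bigD1 j) //= lerDl; apply: sumr_ge0.
split; last by rewrite (CI_prod _ c0 hM' (leqnn d)); apply: eq_bigr => j _; rewrite ltn_ord.
exists (M' ^+ d); split=> [z l zl|z]; first by apply: ccvg_prod => j; apply: (hM j).1; exact: zl.
rewrite cabs_prod; apply: (@le_trans _ _ (\prod_(j < d) (M' * expR (- c * cabs2 (z j))))).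
 by apply: ler_prod => j _; rewrite cabs_ge0 (hM' j).2.
by rewrite big_split /= prodr_const card_ord -expR_sum -mulr_sumr.
Qed.

Lemma CI_sum I (r : seq I) (h : I -> Cd d -> C) c : 0 < c -> (forall i, exists M, gdom M c (h i)) ->
 (exists M, gdom M c (fun z => \sum_(i <- r) h i z)) /\
 CI d (fun z => \sum_(i <- r) h i z) 0 = \sum_(i <- r) CI d (h i) 0.
Proof.
move=> c0 hh; elim: r => [|i r [[M gM] IH]].
 have g0 : gdom 0 c (fun z => \sum_(i <- [::]) h i z : C).
  by split=> [z l zl|z]; rewrite big_nil ?cabs0 ?mul0r // ; under eq_fun do rewrite big_nil; exact: ccvg_cst.
 split; first by exists 0.
 rewrite big_nil -[RHS](mul0r (CI d (fun z => \sum_(i <- [::]) h i z : C) 0)) -(CI_Z _ _ c0 g0) //.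
 by congr CI; apply/funext => z; rewrite big_nil mulr0.
have [M' gM'] := hh i.
have E : (fun z => \sum_(j <- i :: r) h j z) = (fun z => h i z + \sum_(j <- r) h j z).
 by apply/funext => z; rewrite big_cons.
rewrite E big_cons -IH -(CI_D _ c0 gM' gM (leqnn d)); split=> //.
exists (M' + M); split=> [z l zl|z]; first by apply: ccvgD; [exact: gM'.1|exact: gM.1].
by apply: le_trans (cabsD _ _) _; rewrite mulrDl lerD ?gM.2 ?gM'.2.
Qed.

Lemma u_conj_u k m k' m' (z : C) : u k m z * conjc (u k' m' z) = gE 0 0 z * (((fs R k m)%:C * (fs R k' m')%:C)^-1 *
 (pk k m (- bb z) (ba z) * pk k' m' (- ba z) (bb z))) :> C.
Proof.
rewrite gE00 /u !conjM conjV !conjR pk_conj !rmorphN /= !conjM conjcK !conjR -/(ba z) -/(bb z).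
have -> : - pi * cabs2 z = - (pi / 2) * cabs2 z + - (pi / 2) * cabs2 z by field.
rewrite expRD realCM invfM.
by move: (_^-1) (_^-1) (pk _ _ _ _) (pk _ _ _ _) (expR _)%:C => *; ring.
Qed.

(** The rate [pi / 2] supplied by [domC_gauss] is lowered to 1, the fixed rate used together with
    the cutoffs. *)
Lemma pint_u k m k' m' : (exists M, domC M 1 (fun z : C => u k m z * conjc (u k' m' z))) /\
 pint (fun z : C => u k m z * conjc (u k' m' z)) = ((k == k') && (m == m'))%:R :> C.
Proof.
have g : egrow (fun z : C => pk k m (- bb z) (ba z) * pk k' m' (- ba z) (bb z)).
 have [gb ga] := (@egrow_bb R, @egrow_ba R).
 exact: (egrowM (egrow_pk k m (egrowN gb) ga) (egrow_pk k' m' (egrowN ga) gb)).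
have E := funext (u_conj_u k m k' m'); rewrite E; split.
 have [M [h1 h2]] := domC_gauss (egrowM (egrow_cst ((fs R k m)%:C * (fs R k' m')%:C)^-1) g).
 exists M; split=> // z; apply: le_trans (h2 z) _.
 have M0 := expbound_ge0 (h2 0).
 rewrite ler_wpM2l // ler_expR ler_wpM2r ?cabs2_ge0 // lerN2 ler_pdivlMr // mul1r; exact: pi_ge2.
rewrite -[LHS]/(gL _) gLZ // gL_pk; case: (boolP ((k == k') && (m == m'))) => [/andP[/eqP <- /eqP <-]|_].
 rewrite mul1r -realCM -expr2 /fs sqr_sqrtr ?mulr_ge0 // realCM !realCn mulVf //.
by rewrite mul0r mulr0.
Qed.

Lemma ortho (k m k' m' : NI) : (exists M, gdom M 1 (fun z => U k m z * conjc (U k' m' z))) /\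
 CI d (fun z => U k m z * conjc (U k' m' z)) 0 = ((k == k') && (m == m'))%:R :> C.
Proof.
have E : (fun z => U k m z * conjc (U k' m' z)) = (fun z => \prod_j (u (k j) (m j) (z j) * conjc (u (k' j) (m' j) (z j)))).
 by apply/funext => z; rewrite /U conj_prod -big_split.
rewrite E; have [] := CI_prod_ex (g := fun j w => u (k j) (m j) w * conjc (u (k' j) (m' j) w)) ltr01.
 by move=> j; have [] := pint_u (k j) (m j) (k' j) (m' j).
move=> h1 ->; split=> //.
have -> : \prod_j pint (fun w => u (k j) (m j) w * conjc (u (k' j) (m' j) w)) =
  \prod_j (((k j == k' j) && (m j == m' j))%:R : C).
 by apply: eq_bigr => j _; have [] := pint_u (k j) (m j) (k' j) (m' j).
case: (boolP ((k == k') && (m == m'))) => [/andP[/eqP <- /eqP <-]|ne].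
 by rewrite big1 // => j _; rewrite !eqxx.
have [j hj] : exists j, ~~ ((k j == k' j) && (m j == m' j)).
 apply/existsP; apply: contraR ne => /existsPn h.
 by apply/andP; split; apply/eqP/ffunP => j; have := h j; rewrite negbK => /andP[/eqP ? /eqP ?].
by rewrite (bigD1 j) //= (negbTE hj) mul0r.
Qed.

(** Continuous and piecewise linear: 1 up to [N], 0 from [N + 1] on, increasing with [N]. *)
Definition cut (N : nat) (t : R) : R := (`|N.+1%:R - t| - `|N%:R - t| + 1) / 2.
Lemma cut_cases N t : [/\ 0 <= cut N t <= 1, t <= N%:R -> cut N t = 1, N.+1%:R <= t -> cut N t = 0 & cut N t <= cut N.+1 t].
Proof.
rewrite /cut -[N.+2%:R]natr1 -![N.+1%:R]natr1.
by case: (ger0P (N%:R + 1 - t)); case: (ger0P (N%:R - t)); case: (ger0P (N%:R + 1 + 1 - t)) => *; split; try (move=> *; lra); apply/andP; split; lra.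
Qed.
Lemma cut_cont N (v : nat -> R) l : v @ \oo --> l -> (fun n => cut N (v n)) @ \oo --> cut N l.
Proof.
move=> vl; rewrite /cut; apply: cvgM; last exact: cvg_cst.
apply: cvgD; last exact: cvg_cst.
by apply: cvgB; apply: cvg_norm; apply: cvgB => //; exact: cvg_cst.
Qed.
Definition ccut N (w : C) : C := (cut N (cabs2 w))%:C.
Lemma ccont_ccut N : ccont (ccut N).
Proof.
move=> u l ul; apply: ccvg_real; apply: cut_cont; under eq_fun do rewrite -cabs_sqr.
rewrite -cabs_sqr; under eq_fun do rewrite expr2; rewrite expr2.
by apply: cvgM; exact: ccvg_cabs.
Qed.
(** It depends on the moduli of the coordinates only and so is invariant under the rotation of each;
    its compact support makes every continuous function integrable against it. *)
Definition chi N z : C := \prod_j ccut N (z j).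

Lemma chi_real N z : exists2 r, 0 <= r <= 1 & chi N z = r%:C.
Proof.
exists (\prod_j cut N (cabs2 (z j))); last by rewrite /chi rmorph_prod.
rewrite prodr_ge0 => [|j _]; last by have [/andP[]] := cut_cases N (cabs2 (z j)).
have : \prod_j cut N (cabs2 (z j)) <= \prod_(j < d) 1.
 by apply: ler_prod => j _; have [] := cut_cases N (cabs2 (z j)).
by rewrite big1_eq.
Qed.

Lemma chi_supp N z : chi N z != 0 -> forall j, cabs2 (z j) <= N.+1%:R.
Proof.
move=> /prodf_neq0 h j; have := h j isT; rewrite leNgt; apply: contra => lt.
by have [_ _ e _] := cut_cases N (cabs2 (z j)); rewrite /ccut e // ltW.
Qed.

Lemma chi_one z : exists N0, forall N, (N0 <= N)%N -> chi N z = 1.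
Proof.
have [r r0 hr] := Cd_bound z; exists (Num.bound (r ^+ 2)) => N hN.
rewrite /chi big1 // => j _; have [_ e _ _] := cut_cases N (cabs2 (z j)); rewrite /ccut e //.
rewrite -cabs_sqr; apply: le_trans (_ : r ^+ 2 <= _); first by rewrite lerXn2r ?nnegrE ?cabs_ge0.
apply: le_trans (ltW (archi_boundP (sqr_ge0 r))) _; by rewrite ler_nat.
Qed.

Lemma chi_mono N N' z : (N <= N')%N -> Re (chi N z) <= Re (chi N' z).
Proof.
have E n : Re (chi n z) = \prod_j cut n (cabs2 (z j)) by rewrite /chi -rmorph_prod.
move=> NN; rewrite !E; apply: ler_prod => j _.
have [/andP[-> _] _ _ _] := cut_cases N (cabs2 (z j)) => /=.
rewrite -(subnKC NN); elim: (N' - N)%N => [|n IH]; first by rewrite addn0.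
by apply: le_trans IH _; rewrite addnS; have [] := cut_cases (N + n) (cabs2 (z j)).
Qed.

Lemma gdom_chi N h B : dcont h -> 0 <= B -> (forall z, (forall j, cabs (z j) <= N.+1%:R) -> cabs (h z) <= B) ->
 gdom (B * expR (d%:R * N.+1%:R)) 1 (fun z => chi N z * h z).
Proof.
move=> ch B0 hB; split=> [z l zl|z].
 by apply: ccvgM; [apply: ccvg_prod => j; apply: ccont_ccut; exact: zl|exact: ch].
have [->|/chi_supp hs] := eqVneq (chi N z) 0; first by rewrite mul0r cabs0 !mulr_ge0 ?expR_ge0.
have [r /andP[r0 r1] ->] := chi_real N z; rewrite cabsM cabsR ger0_norm //.
apply: (@le_trans _ _ (1 * B)).
 apply: ler_pM; rewrite ?cabs_ge0 ?hB // => j; rewrite -(@ler_pXn2r _ 2) ?nnegrE ?cabs_ge0 // cabs_sqr.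
 by apply: le_trans (hs j) _; rewrite expr2 ler_peMr // ler1n.
rewrite mul1r -mulrA -expRD ler_peMr // -[leLHS]expR0 ler_expR mulN1r subr_ge0 /nrm2.
apply: le_trans (_ : \sum_(j < d) N.+1%:R <= _); first exact: ler_sum.
by rewrite sumr_const card_ord mulr_natl.
Qed.

Lemma gdom_chi_ex N h : dcont h -> exists M, gdom M 1 (fun z => chi N z * h z).
Proof.
move=> ch; have [B hB] := dcont_locbounded N.+1%:R ch.
exists (`|B| * expR (d%:R * N.+1%:R)); apply: gdom_chi => // z hz; apply: le_trans (hB z hz) (ler_norm _).
Qed.

Definition lc N h : C := CI d (fun z => chi N z * h z) 0.

(** Rotating one coordinate multiplies [U k m] by the character of weight [m j - k j], and the
    cutoff is invariant: different weights are orthogonal under every cutoff, not only on the whole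
    space. *)
Lemma lc_mode N (k m k' m' : NI) : (exists j, (m j + k' j)%N != (k j + m' j)%N) ->
 lc N (fun z => U k m z * conjc (U k' m' z)) = 0.
Proof.
move=> [j0 hj]; pose g (j : 'I_d) (w : C) := ccut N w * (u (k j) (m j) w * conjc (u (k' j) (m' j) w)).
have hg j : exists M, domC M 1 (g j).
 have [[M [h1 h2]] _] := pint_u (k j) (m j) (k' j) (m' j); exists M; split=> [v l vl|w].
  by apply: ccvgM; [exact: ccont_ccut|exact: h1].
 apply: le_trans (h2 w); rewrite [leLHS]cabsM cabsR ler_piMl ?cabs_ge0 //.
 by have [/andP[a b] _ _ _] := cut_cases N (cabs2 w); rewrite ger0_norm.
rewrite /lc (_ : (fun z => _) = (fun z => \prod_j g j (z j))); last first.
 by apply/funext => z; rewrite /chi /U conj_prod -!big_split.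
have [_ ->] := CI_prod_ex ltr01 hg; rewrite (bigD1 j0) //=; have [M hM] := hg j0.
rewrite (pint_mode ltr01 hM _ hj) ?mul0r // => w z w1; rewrite /g.
have pkw a b (x y : C) : pk a b (conjc w * x) (w * y) = conjc w ^+ a * w ^+ b * pk a b x y.
 have ww : w * conjc w = 1 by rewrite mul_conj -cabs_sqr w1 expr1n.
 elim: a b => [|a IH] b /=; first by rewrite exprMn mul1r.
 rewrite !IH; case: b => [|b] /=; first by rewrite exprS; ring.
 have -> : conjc w ^+ a * w ^+ b = conjc w ^+ a.+1 * w ^+ b.+1.
  by rewrite !exprSr mulrACA [conjc w * w]mulrC ww mulr1.
 by rewrite [conjc w ^+ a.+1]exprS; ring.
have uw a b : u a b (w * z) = conjc w ^+ a * w ^+ b * u a b z.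
 rewrite /u cabs2M -(cabs_sqr w) w1 expr1n mul1r [conjc (w * z)]conjM.
 have -> : - ((sq R)%:C * (conjc w * conjc z)) = conjc w * - ((sq R)%:C * conjc z) by rewrite mulrN mulrCA.
 rewrite [X in pk _ _ _ X]mulrCA pkw.
 by move: (_%:C) (pk _ _ _ _) (_^-1) => *; ring.
rewrite !uw [conjc (_ * u _ _ z)]conjM conjM !conjX conjcK /ccut cabs2M -(cabs_sqr w) w1 expr1n mul1r !exprD.
by move: (u _ _ z) (conjc (u _ _ z)) (_%:C) => *; ring.
Qed.

Lemma lcB N h h' : dcont h -> dcont h' -> lc N (fun z => h z - h' z) = lc N h - lc N h'.
Proof.
move=> /(gdom_chi_ex N)[M gM] ch'; have [M' gM'] := gdom_chi_ex N ch'.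
have gN : gdom M' 1 (fun z => -1 * (chi N z * h' z)).
 split=> [z l zl|z]; first by apply: ccvgZ; exact: gM'.1.
 by rewrite mulN1r cabsN gM'.2.
rewrite /lc -[- CI d _ _]mulN1r -(CI_Z _ _ ltr01 gM') // -(CI_D _ ltr01 gM gN) //.
by congr CI; apply/funext => z; ring.
Qed.

Lemma lc_sum N I (r : seq I) (h : I -> Cd d -> C) : (forall i, dcont (h i)) ->
 lc N (fun z => \sum_(i <- r) h i z) = \sum_(i <- r) lc N (h i).
Proof.
move=> ch; have [_ <-] := CI_sum r ltr01 (fun i => gdom_chi_ex N (ch i)).
by congr CI; apply/funext => z; rewrite mulr_sumr.
Qed.
Lemma lcZ N b h : dcont h -> lc N (fun z => b * h z) = b * lc N h.
Proof.
move=> /(gdom_chi_ex N)[M gM]; rewrite /lc -(CI_Z b _ ltr01 gM) //.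
by congr CI; apply/funext => z; ring.
Qed.

Definition locb (h : nat -> Cd d -> C) := forall r, exists B, forall n z, (forall j, cabs (z j) <= r) -> cabs (h n z) <= B.

Lemma lc_dct N (h : nat -> Cd d -> C) h' : (forall n, dcont (h n)) -> dcont h' -> locb h ->
 (forall z, ccvg (fun n => h n z) (h' z)) -> ccvg (fun n => lc N (h n)) (lc N h').
Proof.
move=> ch ch' hb cv; have [B hB] := hb N.+1%:R.
have B0 : 0 <= B by apply: le_trans (cabs_ge0 _) (hB 0%N 0 _) => j; rewrite ffunE cabs0.
apply: (@CI_dct _ _ (B * expR (d%:R * N.+1%:R)) 1 d (fun n z => chi N z * h n z) (fun z => chi N z * h' z) 0 ltr01) => // [n||z];
 try apply: gdom_chi => //.
- exact: hB.
- by move=> z hz; apply: ccvg_cabs_le (cv z) _ => n; exact: hB.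
- by apply: ccvgZ; exact: cv.
Qed.

Lemma lc_lim M h : gdom M 1 h -> ccvg (fun N => lc N h) (CI d h 0).
Proof.
move=> gM; apply: (@CI_dct _ _ M 1 d (fun N z => chi N z * h z) h 0 ltr01) => // [N|z].
 split=> [z l zl|z]; first by apply: ccvgM; [apply: ccvg_prod => j; apply: ccont_ccut; exact: zl|exact: gM.1].
 have [r /andP[r0 r1] ->] := chi_real N z; rewrite cabsM cabsR ger0_norm //.
 by apply: le_trans (gM.2 z); rewrite ler_piMl ?cabs_ge0.
have [N0 hN] := chi_one z => e e0; exists N0 => N /hN ->; by rewrite mul1r subrr cabs0.
Qed.

Lemma iint_ge0 (G : Cd d -> \bar R) k z : (forall z, 0 <= G z)%E -> (0 <= iint k G z)%E.
Proof.
move=> G0; elim: k z => [|k IH] z //=; case: insub => [j|] //.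
by do 2 (apply: integral_ge0 => ? _).
Qed.
(** For nonnegative functions the integral is a supremum over simple minorants, so monotonicity
    holds without any measurability of the inner integrals. *)
Lemma le_integral0 (f g : R -> \bar R) : (forall x, 0 <= f x)%E -> (forall x, f x <= g x)%E -> (\int[leb]_x f x <= \int[leb]_x g x)%E.
Proof.
move=> f0 fg; rewrite !ge0_integralTE // => [|x]; last exact: le_trans (fg x).
by apply: le_ereal_sup => _ [h hf <-]; exists h => // x; exact: le_trans (hf x) (fg x).
Qed.
Lemma le_iint (G H : Cd d -> \bar R) k z : (forall z, 0 <= G z)%E -> (forall z, G z <= H z)%E -> (iint k G z <= iint k H z)%E.
Proof.
move=> G0 GH; have H0 z' := le_trans (G0 z') (GH z').
elim: k z => [|k IH] z //=; case: insub => [j|] //.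
apply: le_integral0 => [x|x]; first by apply: integral_ge0 => y _; exact: iint_ge0.
by apply: le_integral0 => y; rewrite ?iint_ge0.
Qed.

(** Monotone convergence is applied to one real variable at a time; the approximants are measurable
    because they agree with [CI]. *)
Lemma iint_mct (h : nat -> Cd d -> C) (g : Cd d -> R) k z : (forall n, exists M, gdom M 1 (h n)) ->
 (forall n z, 0 <= Re (h n z)) -> (forall n n' z, (n <= n')%N -> Re (h n z) <= Re (h n' z)) ->
 (forall z, (fun n => Re (h n z)) @ \oo --> g z) -> (k <= d)%N ->
 (fun n => iint k (fun z => (Re (h n z))%:E) z) @ \oo --> iint k (fun z => (g z)%:E) z.
Proof.
move=> /choice[M gM] h0 hm hg; elim: k z => [|k IH] z kd; first by apply: cvg_EFin; [exact: nearW|exact: hg].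
pose j := Ordinal kd; pose f n z := iint k (fun z => (Re (h n z))%:E) z.
have fE n z' : f n z' = (Re (CI k (h n) z'))%:E by have [] := iint_CI z' ltr01 (gM n) (ltnW kd).
have f0 n z' : (0 <= f n z')%E by apply: iint_ge0 => ?; rewrite lee_fin.
have fm n n' z' : (n <= n')%N -> (f n z' <= f n' z')%E.
 by move=> nn; apply: le_iint => ?; rewrite lee_fin ?h0 ?hm.
have d2 n := CI_dom2 j z ltr01 (gM n).
have s1 n x : (\int[leb]_y f n (upd z j (x +i* y)) = (Re (lint setT (fun y => CI k (h n) (upd z j (x +i* y)))))%:E)%E.
 have [<- _] := fin_int ltr01 (dom2_slice x (d2 n)); by apply: eq_integral => y _; rewrite fE.
have E : iint k.+1 (fun z => (g z)%:E) z = (\int[leb]_x (limn (fun n => \int[leb]_y f n (upd z j (x +i* y)))))%E.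
 rewrite /= insubT; apply: eq_integral => x _.
 rewrite -monotone_convergence //.
 - by apply: eq_integral => y _; apply/esym/cvg_lim => //; exact: IH (ltnW kd).
 - move=> n; under eq_fun do rewrite fE; apply/measurable_EFinP.
  by have [] := rcont_meas (dom2_slice x (d2 n)).1.
 - by move=> y _ n n' nn; exact: fm.
rewrite E (_ : (fun n => _) = (fun n => \int[leb]_x \int[leb]_y f n (upd z j (x +i* y))))%E; last first.
 by apply/funext => n; rewrite /= insubT.
apply: cvg_monotone_convergence => //.
- move=> n; under eq_fun do rewrite s1; apply/measurable_EFinP.
 by have [] := rcont_meas (dom2_inner ltr01 (d2 n)).1.
- by move=> n x _; apply: integral_ge0.
- by move=> x _ n n' nn; apply: le_integral0 => y; rewrite ?f0 ?fm.
Qed.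
End Cutoffs.

(** * Parseval's identity for series of matrix coefficients *)

Section Parseval.
Variable R : realType.
Local Notation C := R[i].
Local Notation Cd := (Cd R).
Variables (d : nat) (K : finType) (kk : K -> NI d).
Hypothesis kk_inj : injective kk.
Local Notation NI := (NI d).
Local Notation I := (K * NI)%type.
Implicit Types (a : I -> C) (t : I) (z : Cd d).

Lemma rsum_finpair (J : choiceType) (g : K * J -> R) : (forall x, 0 <= g x) -> (forall k, rasum (fun m => g (k, m))) ->
 rasum g /\ rsum g = \sum_k rsum (fun m => g (k, m)).
Proof.
move=> g0 hg; have r0 k := rsum_ge0 (hg k).
have hr : rasum (fun k => rsum (fun m => g (k, m))).
 by apply: (rasum_fin (s := enum K)) => k; rewrite mem_enum.
have h := rasum_pair g0 hg hr; split=> //; rewrite (rsum_pair g0 h).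
apply: (@complexI R); rewrite -csum_real // (csum_fin (s := enum K)) ?enum_uniq //.
 by rewrite big_enum raddf_sum.
by move=> k; rewrite mem_enum.
Qed.

Lemma cvg_le (u : nat -> R) l M : u @ \oo --> l -> (forall n, u n <= M) -> l <= M.
Proof.
by move=> ul h; rewrite -(cvg_lim (@Rhausdorff R) ul); apply: limr_le; [exact: cvgP ul|exact: nearW].
Qed.
Lemma cvg_ge (u : nat -> R) l M : u @ \oo --> l -> (forall n, M <= u n) -> M <= l.
Proof.
by move=> ul h; rewrite -(cvg_lim (@Rhausdorff R) ul); apply: limr_ge; [exact: cvgP ul|exact: nearW].
Qed.

Definition uk t z : C := U (kk t.1) t.2 z.
Lemma uk_l2 z : l2 (fun t => uk t z) /\ n2 (fun t => uk t z) = #|K|%:R.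
Proof.
have [h e] := rsum_finpair (fun t => cabs2_ge0 (uk t z)) (fun k => (U_l2 (kk k) z).1).
split=> //; rewrite [LHS]e -sum1_card natr_sum; apply: eq_bigr => k _; exact: (U_l2 (kk k) z).2.
Qed.

Definition FS a z : C := kop (fun z t => uk t z) a z.
Lemma FS_bound a z : l2 a -> cabs2 (FS a z) <= n2 a * #|K|%:R.
Proof. by move=> la; have [l <-] := uk_l2 z; exact: cauchy_schwarz. Qed.
Lemma FS_fin a (s : seq I) z : uniq s -> (forall t, t \notin s -> a t = 0) -> FS a z = \sum_(t <- s) a t * uk t z.
Proof. by move=> us hs; apply: csum_fin => // t ts; rewrite hs // mul0r. Qed.

Lemma dcont_U (k m : NI) : dcont (@U R d k m).
Proof.
move=> z l zl; apply: ccvg_prod => j; rewrite /u; apply: ccvgM; last exact: ccvg_cst.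
apply: ccvgM; last exact: (egrow_pk (k j) (m j) (egrowN (@egrow_bb R)) (@egrow_ba R)).1.
under eq_fun do rewrite -cexp_real; rewrite -cexp_real; apply: cexp_cont; apply: ccvg_real.
apply: cvgM; first exact: cvg_cst.
under eq_fun do rewrite -cabs_sqr expr2; rewrite -cabs_sqr expr2.
by apply: cvgM; apply: ccvg_cabs; exact: zl.
Qed.
Lemma dcont_mul (f g : Cd d -> C) : dcont f -> dcont g -> dcont (fun z => f z * conjc (g z)).
Proof. by move=> cf cg z l zl; apply: ccvgM; [exact: cf|apply: ccvg_conj; exact: cg]. Qed.
Definition fin a := exists2 s, uniq s & forall t, t \notin s -> a t = 0.
Lemma dcont_FS a : fin a -> dcont (FS a).
Proof.
move=> [s us hs]; rewrite (_ : FS a = fun z => \sum_(t <- s) a t * uk t z); last by apply/funext => z; exact: FS_fin.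
by move=> z l zl; apply: ccvg_sum => t; apply: ccvgZ; exact: dcont_U.
Qed.
Lemma fin_l2 a : fin a -> l2 a.
Proof. by move=> [s us hs]; exact: l2_fin hs. Qed.

Lemma FS_prod a b (s s' : seq I) : uniq s -> uniq s' -> (forall t, t \notin s -> a t = 0) -> (forall t, t \notin s' -> b t = 0) ->
 (fun z => FS a z * conjc (FS b z)) =
 (fun z => \sum_(t <- s) \sum_(t' <- s') (a t * conjc (b t')) * (uk t z * conjc (uk t' z))).
Proof.
move=> us us' hs hs'; apply/funext => z; rewrite !(FS_fin _ us hs) (FS_fin _ us' hs') conj_sum mulr_suml.
apply: eq_bigr => t _; rewrite mulr_sumr; apply: eq_bigr => t' _; rewrite conjM.
by move: (uk t z) (conjc (uk t' z)) => *; ring.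
Qed.

Lemma FS_parseval a : fin a -> (exists M, gdom M 1 (fun z => FS a z * conjc (FS a z))) /\
 CI d (fun z => FS a z * conjc (FS a z)) 0 = (n2 a)%:C.
Proof.
move=> [s us hs]; rewrite (FS_prod us us hs hs).
have gZ b t t' : (exists M, gdom M 1 (fun z => b * (uk t z * conjc (uk t' z)))) /\
  CI d (fun z => b * (uk t z * conjc (uk t' z))) 0 = b * (t == t')%:R.
 have [[M gM] e] := ortho R (kk t.1) t.2 (kk t'.1) t'.2.
 rewrite (CI_Z b _ ltr01 gM) // e (inj_eq kk_inj) -xpair_eqE -!surjective_pairing; split=> //.
 exists (cabs b * M); split=> [z l zl|z]; first by apply: ccvgZ; exact: gM.1.
 by rewrite cabsM -mulrA ler_wpM2l ?cabs_ge0 ?gM.2.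
have in1 t := CI_sum s ltr01 (fun t' => (gZ (a t * conjc (a t')) t t').1).
have [h ->] := CI_sum s ltr01 (fun t => (in1 t).1); split=> //.
rewrite (n2_fin us hs) raddf_sum /= big_seq [RHS]big_seq; apply: eq_bigr => t ts.
rewrite (in1 t).2 (bigD1_seq t) //= big1 ?addr0 => [|t' tt']; last by rewrite (gZ _ _ _).2 eq_sym (negbTE tt') mulr0.
by rewrite (gZ _ _ _).2 eqxx mulr1 mul_conj.
Qed.

Lemma lc_cross N a b : fin a -> fin b -> (forall t t', a t != 0 -> b t' != 0 ->
 exists j, (t.2 j + kk t'.1 j)%N != (kk t.1 j + t'.2 j)%N) -> lc N (fun z => FS a z * conjc (FS b z)) = 0.
Proof.
move=> [s us hs] [s' us' hs'] h; rewrite (FS_prod us us' hs hs').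
have ck t t' b0 : dcont (fun z => b0 * (uk t z * conjc (uk t' z))).
 by move=> z l zl; apply: ccvgZ; apply: (dcont_mul (@dcont_U _ _) (@dcont_U _ _)) zl.
rewrite lc_sum => [|t z l zl]; last by apply: ccvg_sum => t'; exact: ck.
rewrite big1 // => t _; rewrite lc_sum => [|t']; last exact: ck.
rewrite big1 // => t' _; rewrite lcZ; last exact: dcont_mul (@dcont_U _ _) (@dcont_U _ _).
have [->|a0] := eqVneq (a t) 0; first by rewrite !mul0r.
have [->|b0] := eqVneq (b t') 0; first by rewrite conjc0 mulr0 mul0r.
by rewrite lc_mode ?mulr0 //; exact: h.
Qed.
Lemma Re_chi_mul N z (f : C) : Re (chi N z * (f * conjc f)) = Re (chi N z) * cabs2 f.
Proof. by have [r _ ->] := chi_real N z; rewrite mul_conj -realCM. Qed.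
Lemma Re_chi01 N z : 0 <= Re (chi N z) <= 1.
Proof. by have [r ? ->] := chi_real N z. Qed.

Lemma lc_iint N (f : Cd d -> C) : dcont f ->
 iint d (fun z => (Re (chi N z) * cabs2 (f z))%:E) 0 = (Re (lc N (fun z => f z * conjc (f z))))%:E.
Proof.
move=> cf; have [M gM] := gdom_chi_ex N (dcont_mul cf cf).
have [<- _] := iint_CI 0 ltr01 gM (leqnn d).
by congr (iint _ _ _); apply/funext => z; rewrite Re_chi_mul.
Qed.
Lemma lc_ge0 N (f : Cd d -> C) : dcont f -> 0 <= Re (lc N (fun z => f z * conjc (f z))).
Proof.
move=> cf; rewrite -lee_fin -lc_iint //; apply: iint_ge0 => z; rewrite lee_fin.
by have /andP[c0 _] := Re_chi01 N z; rewrite mulr_ge0 ?cabs2_ge0.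
Qed.
Lemma lc_le N M (f : Cd d -> C) : dcont f -> gdom M 1 (fun z => f z * conjc (f z)) ->
 Re (lc N (fun z => f z * conjc (f z))) <= Re (CI d (fun z => f z * conjc (f z)) 0).
Proof.
move=> cf gM; rewrite -lee_fin -lc_iint //; have [<- _] := iint_CI 0 ltr01 gM (leqnn d).
apply: le_iint => z; rewrite lee_fin; have /andP[c0 c1] := Re_chi01 N z.
 by rewrite mulr_ge0 ?cabs2_ge0.
by rewrite mul_conj ler_piMl ?cabs2_ge0.
Qed.

Definition wt z : C := (expR (- (pi / 2) * nrm2 z))%:C.
Lemma fnorm2E (F : Cd d -> C) : fnorm2 F = iint d (fun z => (cabs2 (F z * wt z))%:E) 0.
Proof.
rewrite /fnorm2 /cint (_ : [ffun => 0] = 0 :> Cd d); last by apply/ffunP => j; rewrite !ffunE.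
congr (iint _ _ _); apply/funext => z; rewrite cabs2M cabs2R /gauss -expRM_natl; congr (_ * expR _)%:E.
by rewrite /nrm2 /normsq; field.
Qed.

(** The norm may be infinite, so it is reached as the monotone limit of finite cutoff integrals. *)
Lemma fnorm2_lc (F : Cd d -> C) (f := fun z => F z * wt z) : dcont f ->
 (forall N, ((Re (lc N (fun z => f z * conjc (f z))))%:E <= fnorm2 F)%E) /\
 (fun N => (Re (lc N (fun z => f z * conjc (f z))))%:E) @ \oo --> fnorm2 F.
Proof.
move=> cf; rewrite fnorm2E; split=> [N|].
 rewrite -lc_iint //; apply: le_iint => z; rewrite lee_fin; have /andP[c0 c1] := Re_chi01 N z.
  by rewrite mulr_ge0 ?cabs2_ge0.
 by rewrite ler_piMl ?cabs2_ge0.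
rewrite (_ : (fun N => _) = (fun N => iint d (fun z => (Re (chi N z * (f z * conjc (f z))))%:E) 0)); last first.
 by apply/funext => N; rewrite -lc_iint //; congr (iint _ _ _); apply/funext => z; rewrite Re_chi_mul.
apply: iint_mct => // [N|N z|N N' z NN|z].
- by apply: gdom_chi_ex; exact: dcont_mul.
- by have /andP[c0 _] := Re_chi01 N z; rewrite Re_chi_mul mulr_ge0 ?cabs2_ge0.
- by rewrite !Re_chi_mul ler_wpM2r ?cabs2_ge0 ?chi_mono.
have [N0 hN] := chi_one z; apply: (ccvg_Re (u := fun N => chi N z * (f z * conjc (f z))) (a := (cabs2 (f z))%:C)) => e e0.
by exists N0 => N /hN ->; rewrite mul1r mul_conj subrr cabs0.
Qed.

(** Under a fixed cutoff the truncations of [a] converge inside the integral, each bounded by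
    Parseval; the cutoff is removed last. *)
Lemma fnorm2_le_n2 (F : Cd d -> C) a : l2 a -> dcont (fun z => F z * wt z) -> (forall z, F z * wt z = FS a z) ->
 (fnorm2 F <= (n2 a)%:E)%E.
Proof.
move=> la cf hf; have [_ cv] := fnorm2_lc cf.
have [x [xa fx hx]] := l2_truncate la.
have fnx n : fin (x n).
 by have [s hs] := fx n; exists (undup s); rewrite ?undup_uniq // => t; rewrite mem_undup; exact: hs.
have n2x n : n2 (x n) <= n2 a.
 by apply: ler_rsum la => t; case: (hx n t) => -> //; rewrite cabs2R expr0n cabs2_ge0.
rewrite -(cvg_lim (@ereal_hausdorff R) cv); apply: lime_le; first exact: cvgP cv.
apply: nearW => N; rewrite lee_fin.
apply: (@cvg_le (fun n => Re (lc N (fun z => FS (x n) z * conjc (FS (x n) z))))) => [|n].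
 apply: ccvg_Re; apply: lc_dct => [n||r|z].
 - exact: dcont_mul (dcont_FS (fnx n)) (dcont_FS (fnx n)).
 - exact: dcont_mul.
 - exists (n2 a * #|K|%:R) => n z _; rewrite mul_conj cabsR ger0_norm ?cabs2_ge0 //.
  apply: le_trans (FS_bound z (fin_l2 (fnx n))) _; rewrite ler_wpM2r //; exact: n2x.
 rewrite hf; have h := kop_ccvg (k := fun z t => uk t z) (fun z => (uk_l2 z).1) z xa.
 by apply: ccvgM => //; exact: ccvg_conj.
have [[M gM] e] := FS_parseval (fnx n).
by apply: le_trans (lc_le N (dcont_FS (fnx n)) gM) _; rewrite e; exact: n2x.
Qed.

(** Truncation by the angular weight [m j - k j] rather than by [m j]: a kept and a removed term
    then differ in some weight and are orthogonal under every cutoff. A change between monomials and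
    [pk] also preserves this weight. *)
Definition mlt (M : nat) t := [forall j, (t.2 j < M + kk t.1 j)%N].
Definition trunc M a t := if mlt M t then a t else 0.
Lemma trunc_fin M a : fin (trunc M a).
Proof.
pose B := (\sum_k \sum_j kk k j)%N.
have hB k j : (kk k j <= B)%N by rewrite /B (bigD1 k) // (bigD1 j) //= -addnA leq_addr.
pose g (m : {ffun 'I_d -> 'I_(M + B).+1}) : NI := [ffun j => val (m j)].
exists (undup [seq (k, g m) | k <- enum K, m <- enum {: {ffun 'I_d -> 'I_(M + B).+1}}]); first exact: undup_uniq.
move=> [k m]; rewrite mem_undup /trunc; case: ifP => // /forallP h /negP[].
apply/allpairsP; exists (k, [ffun j => inord (m j)]); rewrite !mem_enum; split=> //; congr pair.
apply/ffunP => j; rewrite /g !ffunE [RHS]inordK // ltnS; apply: leq_trans (ltnW (h j)) _.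
by rewrite leq_add2l.
Qed.
Lemma trunc_eventually a t : exists N0, forall M, (N0 <= M)%N -> trunc M a t = a t.
Proof.
exists (\sum_j t.2 j).+1 => M hM; rewrite /trunc (_ : mlt M t = true) //; apply/forallP => j.
have h : (t.2 j <= \sum_j t.2 j)%N by rewrite (bigD1 j) //= leq_addr.
by apply: leq_trans (leq_addr _ _); apply: leq_trans hM; rewrite ltnS.
Qed.
Lemma trunc_cvg a t : ccvg (fun M => trunc M a t) (a t).
Proof. by have [N0 h] := trunc_eventually a t => e e0; exists N0 => M /h ->; rewrite subrr cabs0. Qed.
Lemma FS_trunc a z : l2 a -> ccvg (fun M => FS (trunc M a) z) (FS a z).
Proof.
move=> la; apply: (csum_dct (g := fun t => cabs (a t * uk t z))) => [|M t|t].
- exact: casum_l2 la (uk_l2 z).1.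
- by rewrite /trunc; case: ifP => // _; rewrite mul0r cabs0 cabs_ge0.
- by apply: ccvgM (ccvg_cst _); exact: trunc_cvg.
Qed.

(** Under a cutoff the added terms are orthogonal to the old ones, so the norms of the truncated
    series increase with [M] towards that of [f]. Each truncation is thus bounded by the norm of
    [F], first under the cutoff and then without it; Fatou removes the truncation. *)
Lemma bessel (F : Cd d -> C) a (f := fun z => F z * wt z) : dcont f -> (fnorm2 F < +oo)%E ->
 locb (fun M => FS (trunc M a)) -> (forall z, ccvg (fun M => FS (trunc M a) z) (f z)) ->
 [/\ l2 a, ((n2 a)%:E <= fnorm2 F)%E & forall z, f z = FS a z].
Proof.
move=> cf Ffin hb cv; have [le _] := fnorm2_lc cf.
have cT M := dcont_FS (trunc_fin M a); pose q g N : R := Re (lc N (fun z => g z * conjc (g z))).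
have step1 M L N : (M <= L)%N -> q (FS (trunc M a)) N <= q (FS (trunc L a)) N.
 move=> ML; pose b t := trunc L a t - trunc M a t.
 have fb : fin b.
  have [s us hs] := trunc_fin L a; exists s => // t ts; rewrite /b hs // /trunc.
  have := hs t ts; rewrite /trunc; case: ifP => [_ ->|h _]; first by rewrite if_same subrr.
  case: ifP => [/forallP hM|_]; last by rewrite subrr.
  by move/negP: h => []; apply/forallP => j; apply: leq_trans (hM j) _; rewrite leq_add2r.
 have E z : FS (trunc L a) z = FS (trunc M a) z + FS b z.
  rewrite -[LHS](subrK (FS (trunc M a) z)) addrC; congr (_ + _); apply/esym.
  exact: (kopB (fun z => (uk_l2 z).1) z (fin_l2 (trunc_fin L a)) (fin_l2 (trunc_fin M a))).
 have nb t : b t != 0 -> mlt M t = false.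
  by apply: contra_neqF => hM; rewrite /b /trunc hM (_ : mlt L t) ?subrr //; apply/forallP => j;
   apply: leq_trans (forallP hM j) _; rewrite leq_add2r.
 have nM t : trunc M a t != 0 -> mlt M t by rewrite /trunc; case: ifP; rewrite ?eqxx.
 have sep t t' : mlt M t -> mlt M t' = false -> exists j, (t.2 j + kk t'.1 j)%N != (kk t.1 j + t'.2 j)%N.
  move=> /forallP h1 /negbT; rewrite negb_forall => /existsP[j h2]; exists j; have := h1 j; lia.
 have cM := cT M; have cb := dcont_FS fb.
 have x1 : lc N (fun z => FS (trunc M a) z * conjc (FS b z)) = 0.
  by apply: lc_cross fb _ => [|t t' /nM h /nb]; [exact: trunc_fin|exact: sep].
 have x2 : lc N (fun z => FS b z * conjc (FS (trunc M a) z)) = 0.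
  apply: lc_cross fb (trunc_fin M a) _ => t t' /nb h /nM h'; have [j hj] := sep _ _ h' h.
  by exists j; apply: contraNneq hj => e; rewrite addnC -e addnC.
 rewrite /q -subr_ge0 -ReN -ReD -lcB; try exact: dcont_mul.
 have -> : (fun z => FS (trunc L a) z * conjc (FS (trunc L a) z) - FS (trunc M a) z * conjc (FS (trunc M a) z)) =
   (fun z => FS b z * conjc (FS b z) - (-1 * (FS (trunc M a) z * conjc (FS b z)) - FS b z * conjc (FS (trunc M a) z))).
  by apply/funext => z; rewrite E conjD; move: (conjc (FS b z)) (conjc _) => *; ring.
 have cZ (h : Cd d -> C) : dcont h -> dcont (fun z => -1 * h z) by move=> ch z l zl; apply: ccvgZ; exact: ch.
 have cB (h h' : Cd d -> C) : dcont h -> dcont h' -> dcont (fun z => h z - h' z).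
  by move=> ch ch' z l zl; apply: ccvgB; [exact: ch|exact: ch'].
 have m1 := dcont_mul cb cb; have m2 := dcont_mul cM cb; have m3 := dcont_mul cb cM.
 by rewrite (lcB N m1 (cB _ _ (cZ _ m2) m3)) (lcB N (cZ _ m2) m3) (lcZ _ _ m2) x1 x2 mulr0 !subr0 lc_ge0.
have step2 M N : q (FS (trunc M a)) N <= q f N.
 apply: (cvg_ge (u := fun L => q (FS (trunc (M + L) a)) N)) => [|L]; last by apply: step1; exact: leq_addr.
 apply: ccvg_Re; apply: lc_dct => [L||r|z].
 - exact: dcont_mul.
 - exact: dcont_mul.
 - have [B hB] := hb r; exists (B * B) => L z hz; rewrite cabsM cabs_conj.
  by apply: ler_pM; rewrite ?cabs_ge0 ?hB.
 have cz : ccvg (fun L => FS (trunc (M + L) a) z) (f z).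
  by move=> e /(cv z)[N0 hN]; exists N0 => L hL; apply: hN; exact: leq_trans hL (leq_addl _ _).
 by apply: ccvgM => //; exact: ccvg_conj.
have F0 : fnorm2 F \is a fin_num.
 by rewrite fin_numElt Ffin andbT; apply: lt_le_trans (le 0%N); exact: ltNyr.
have nT M : ((n2 (trunc M a))%:E <= fnorm2 F)%E.
 have [[B gB] e] := FS_parseval (trunc_fin M a).
 have cvN := ccvg_Re (lc_lim gB); rewrite e in cvN.
 rewrite -(fineK F0) lee_fin; apply: (cvg_le cvN) => N; apply: le_trans (step2 M N) _.
 by rewrite -lee_fin fineK //; exact: le.
have [la na] : l2 a /\ n2 a <= constructive_ereal.fine (fnorm2 F).
 by apply: l2_fatou (fun M => fin_l2 (trunc_fin M a)) (trunc_cvg a) _ => M; rewrite -lee_fin fineK.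
split=> // [|z]; first by rewrite -(fineK F0) lee_fin.
exact: ccvg_uniq (cv z) (FS_trunc z la).
Qed.

Lemma fnorm2_FS (F : Cd d -> C) a : l2 a -> dcont (fun z => F z * wt z) -> (forall z, F z * wt z = FS a z) ->
 fnorm2 F = (n2 a)%:E.
Proof.
move=> la cf hf; have le := fnorm2_le_n2 la cf hf; apply/le_anti; rewrite le /=.
have lt : (fnorm2 F < +oo)%E by apply: le_lt_trans le _; rewrite ltry.
have hb : locb (fun M => FS (trunc M a)).
 move=> r; exists (Num.sqrt (n2 a * #|K|%:R)) => M z _; rewrite -[leLHS]ger0_norm ?cabs_ge0 // -sqrtr_sqr ler_wsqrtr // cabs_sqr.
 apply: le_trans (FS_bound z (fin_l2 (trunc_fin M a))) _; rewrite ler_wpM2r //.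
 by apply: ler_rsum la => t; rewrite /trunc; case: ifP => // _; rewrite cabs2R expr0n cabs2_ge0.
have cv z : ccvg (fun M => FS (trunc M a) z) (F z * wt z) by rewrite hf; exact: FS_trunc.
by have [] := bessel cf lt hb cv.
Qed.
End Parseval.

(** * Passing between monomials and the orthogonal polynomials *)

Section BasisChange.
Variable R : realType.
Local Notation C := R[i].
Local Notation Cd := (Cd R).

(* With s1 + s2 = 1 this expands pk in monomials, with s1 + s2 = -1 monomials in pk. *)
Lemma binomial_expansion (s1 s2 x : C) (f g : nat -> nat -> C) L : (forall m, f 0%N m = g 0%N m) ->
 (forall k m, f k.+1 m = x * f k m + s1 * m%:R * f k m.-1) ->
 (forall k m, x * g k m = g k.+1 m + s2 * m%:R * g k m.-1) ->
 forall k m, (k < L)%N -> f k m = \sum_(i < L) (s1 + s2) ^+ i * ('C(k, i) * m ^_ i)%:R * g (k - i)%N (m - i)%N.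
Proof.
move=> f0 fS gS k m; case: L => // L; elim: k m => [|k IH] m kL.
 rewrite big_ord_recl big1 => [|i _]; last by rewrite bin0n /= mul0n mulr0 mul0r.
 by rewrite addr0 bin0 ffactn0 !mul1r !subn0 f0.
rewrite fS !IH ?(ltnW kL) // [in LHS]mulr_sumr [X in _ + X]mulr_sumr -big_split /=.
rewrite (eq_bigr (fun i : 'I_L.+1 => (s1 + s2) ^+ i * ('C(k, i) * m ^_ i)%:R * g (k.+1 - i)%N (m - i)%N +
 (s1 + s2) ^+ i.+1 * ('C(k, i) * m ^_ i.+1)%:R * g (k - i)%N (m - i.+1)%N)); last first.
 move=> i _; have [ik|ki] := leqP i k; last by rewrite !bin_small // !mul0n !mulr0 !mul0r !mulr0 addr0.
 rewrite mulrCA gS subSn // -subnS (_ : (m.-1 - i)%N = (m - i.+1)%N); last by case: m.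
 have e1 : (m ^_ i.+1)%:R = m%:R * (m.-1 ^_ i)%:R :> C by rewrite -natrM; case: m => [|m]; rewrite ?ffactnS ?mul0n.
 have e2 : (m ^_ i.+1)%:R = (m ^_ i)%:R * (m - i)%:R :> C by rewrite -natrM ffactnSr.
 move: e2; rewrite !(natrM _ 'C(k, i)) e1 exprS => e2.
 transitivity ((s1 + s2) ^+ i * ('C(k, i))%:R * ((m ^_ i)%:R * g (k - i).+1 (m - i)%N + s2 * ((m ^_ i)%:R * (m - i)%:R) * g (k - i)%N (m - i.+1)%N
  + s1 * (m%:R * (m.-1 ^_ i)%:R) * g (k - i)%N (m - i.+1)%N)); first by ring.
 by rewrite -e2; ring.
rewrite big_split /= big_ord_recl [X in _ + X]big_ord_recr /= (bin_small (kL : (k < L)%N)) mul0n mulr0 mul0r addr0.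
rewrite [RHS]big_ord_recl /= !bin0 -addrA; congr (_ + _); rewrite -big_split; apply: eq_bigr => i _.
by rewrite /bump /= add1n binS mulnDl natrD subSS; ring.
Qed.

Variables (d : nat) (K : finType) (kk : K -> NI d).
Local Notation NI := (NI d).
Hypothesis kk_inj : injective kk.
Hypothesis kk_down : forall (e : K) (k : NI), (forall j, (k j <= kk e j)%N) -> exists e', kk e' = k.
Implicit Types (c f : NI * NI -> C) (z : Cd d).

Definition ranged c := forall t, (forall e, kk e != t.1) -> c t = 0.
Lemma casum_ranged f : ranged f -> (forall e, casum (fun m => f (kk e, m))) -> casum f.
Proof.
move=> rf hf; have f0 k : (forall e, kk e != k) -> (fun m => cabs (f (k, m))) = fun=> 0.
 by move=> h; apply/funext => m; rewrite rf ?cabs0.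
have hk k : rasum (fun m => cabs (f (k, m))).
 case: (pselect (exists e, kk e = k)) => [[e <-]|h]; first exact: hf.
 rewrite f0 => [|e]; [exact: rasum0|by apply/eqP => he; apply: h; exists e].
apply: rasum_pair => // [t|]; first exact: cabs_ge0.
apply: (rasum_fin (s := [seq kk e | e <- enum K])) => k hk'; rewrite f0 => [|e].
 by apply: rsum_le => A _; rewrite big1.
by apply: contraNneq hk' => <-; rewrite map_f // mem_enum.
Qed.
Lemma csum_ranged f : ranged f -> casum f -> csum f = csum (fun t : K * NI => f (kk t.1, t.2)).
Proof.
move=> rf hf; apply/esym/(csum_inj (h := fun t : K * NI => (kk t.1, t.2))) => //.
 by move=> [e m] [e' m'] [/kk_inj -> ->].
by move=> [k m] h; apply: rf => e; apply/eqP => /= he; apply: (h (e, m)); rewrite /= he.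
Qed.

Definition shup (k i : NI) : NI := [ffun j => (k j + i j)%N].
Definition shdn (k i : NI) : NI := [ffun j => (k j - i j)%N].
Definition gam (s : C) (t : NI * NI) (i : NI) : C := \prod_j (s ^+ i j * ('C(t.1 j, i j) * (t.2 j) ^_ (i j))%:R).
Definition LL := (\max_e \max_j kk e j).+1%N.
Definition emb (i : {ffun 'I_d -> 'I_LL}) : NI := [ffun j => val (i j)].
(** Coefficients after the change of basis: a term of index [(k, m)] feeds the indices
    [(k - i, m - i)], so the new coefficient at [t] collects [c] at [t + i]. Since [LL] exceeds all
    components of the [kk e], finitely many shifts suffice. *)
Definition shc s c (t : NI * NI) : C := \sum_i c (shup t.1 (emb i), shup t.2 (emb i)) * gam s (shup t.1 (emb i), shup t.2 (emb i)) (emb i).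

Lemma LL_gt e j : (kk e j < LL)%N.
Proof. by rewrite ltnS (leq_trans (leq_bigmax j)) // (leq_bigmax e). Qed.

(** The range of [kk] is closed downwards, so shifting up an index outside it never leads inside. *)
Lemma ranged_shc s c : ranged c -> ranged (shc s c).
Proof.
move=> rc t ht; apply: big1 => i _; rewrite rc ?mul0r // => e; apply/eqP => /= he.
have [e' he'] : exists e', kk e' = t.1 by apply: (kk_down (e := e)) => j; rewrite he ffunE leq_addr.
by have := ht e'; rewrite he' eqxx.
Qed.

(** Absolute convergence is asked for each shift [i] separately. A shift is an injection of the
    index set, and off its range the binomial or the falling factorial in [gam] vanishes. *)
Lemma csum_shift_basis s c (f g : 'I_d -> nat -> nat -> C) : ranged c ->
 (forall j k m, (k < LL)%N -> f j k m = \sum_(i < LL) s ^+ i * ('C(k, i) * m ^_ i)%:R * g j (k - i)%N (m - i)%N) ->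
 (forall i, casum (fun t => c t * (gam s t (emb i) * \prod_j g j (shdn t.1 (emb i) j) (shdn t.2 (emb i) j)))) ->
 casum (fun t => shc s c t * \prod_j g j (t.1 j) (t.2 j)) /\
 csum (fun t => c t * \prod_j f j (t.1 j) (t.2 j)) = csum (fun t => shc s c t * \prod_j g j (t.1 j) (t.2 j)).
Proof.
move=> rc hf hc; pose P i t := c t * (gam s t (emb i) * \prod_j g j (shdn t.1 (emb i) j) (shdn t.2 (emb i) j)).
pose h i t : NI * NI := (shup t.1 (emb i), shup t.2 (emb i)).
have dn (k i : NI) : shdn (shup k i) i = k by apply/ffunP => j; rewrite !ffunE addnK.
have hi i : injective (h i).
 by move=> [k m] [k' m'] [] /(congr1 (fun k => shdn k (emb i))) + /(congr1 (fun k => shdn k (emb i))); rewrite !dn => -> ->.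
have E1 t : c t * \prod_j f j (t.1 j) (t.2 j) = \sum_i P i t.
 have [[e he]|h0] := pselect (exists e, kk e = t.1); last first.
  have c0 : c t = 0 by apply: rc => e; apply/eqP => he; apply: h0; exists e.
  by rewrite c0 mul0r big1 // => i _; rewrite /P c0 mul0r.
 rewrite (eq_bigr _ (fun j _ => hf j _ _ _)); last by move=> j; rewrite -he LL_gt.
 rewrite (bigA_distr_bigA (fun (j : 'I_d) (i : 'I_LL) =>
  s ^+ i * ('C(t.1 j, i) * (t.2 j) ^_ i)%:R * g j (t.1 j - i)%N (t.2 j - i)%N : C)).
 rewrite mulr_sumr; apply: eq_bigr => i _; rewrite /P /gam -big_split; congr (_ * _).
 by apply: eq_bigr => j _; rewrite /= !ffunE.
have E2 t : shc s c t * \prod_j g j (t.1 j) (t.2 j) = \sum_i P i (h i t).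
 by rewrite /shc mulr_suml; apply: eq_bigr => i _; rewrite /P /= !dn mulrA.
have hP i : casum (fun t => P i (h i t)) := rasum_inj (hi i) (hc i).
rewrite (funext E1) (funext E2) !csum_sum //; split; first exact: casum_sum.
apply: eq_bigr => i _; apply/esym/(csum_inj (hi i) (hc i)) => t ht; rewrite /P /gam.
have [j hj] : exists j, (t.1 j < emb i j)%N || (t.2 j < emb i j)%N.
 apply: contrapT => hn; have up (k : NI) : (forall j, (emb i j <= k j)%N) -> shup (shdn k (emb i)) (emb i) = k.
  by move=> hk; apply/ffunP => j; rewrite !ffunE subnK // -[val _]/(val (i j)); have := hk j; rewrite ffunE.
 apply: (ht (shdn t.1 (emb i), shdn t.2 (emb i))); rewrite /h /= !up -?surjective_pairing // => j; rewrite leqNgt;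
  by apply/negP => hj; apply: hn; exists j; rewrite hj ?orbT.
rewrite (bigD1 j) //= (_ : ('C(t.1 j, emb i j) * _ = 0)%N) ?mulr0n ?mulr0 ?mul0r ?mulr0 //.
by case/orP: hj => hj; rewrite ?(bin_small hj) ?(ffact_small hj) ?mul0n ?muln0.
Qed.

Definition Mn (t : NI * NI) z : C := \prod_j ((- bb (z j)) ^+ t.1 j * ba (z j) ^+ t.2 j).
Definition Pk (t : NI * NI) z : C := \prod_j pk (t.1 j) (t.2 j) (- bb (z j)) (ba (z j)).
Lemma UPk (k m : NI) z : U k m z = Pk (k, m) z / (fsd R k m)%:C * wt z.
Proof.
rewrite /U /Pk /fsd /wt /nrm2 mulr_sumr expR_sum !rmorph_prod -prodfV -!big_split.
by apply: eq_bigr => j _; rewrite /u /= -mulrA mulrC.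
Qed.
Definition tau (t : NI * NI) : C := \prod_j ((- (sq R)%:C) ^+ t.1 j * (sq R)%:C ^+ t.2 j).
Lemma tau_neq0 t : tau t != 0.
Proof.
have s0 : (sq R)%:C != 0 :> C := real_neq0 (sq_gt0 R).
by apply/prodf_neq0 => j _; rewrite mulf_neq0 // expf_neq0 // oppr_eq0.
Qed.
Lemma MnE (t : NI * NI) z : Mn t z = tau t * (\prod_j conjc (z j) ^+ t.1 j * mon t.2 z).
Proof.
rewrite /Mn /tau /mon -!big_split; apply: eq_bigr => j _ /=.
by rewrite /bb /ba -mulNr !exprMn mulrACA.
Qed.

Lemma Pk_of_Mn (X Y : C) k m L : (k < L)%N ->
 pk k m X Y = \sum_(i < L) 1 ^+ i * ('C(k, i) * m ^_ i)%:R * (X ^+ (k - i) * Y ^+ (m - i)).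
Proof.
have := @binomial_expansion 1 0 X (fun k m => pk k m X Y) (fun k m => X ^+ k * Y ^+ m) L.
rewrite addr0; apply=> [n|k' n|k' n] /=; first by rewrite mul1r.
 by rewrite mul1r.
by rewrite !mul0r addr0 exprS mulrA.
Qed.
Lemma Mn_of_Pk (X Y : C) k m L : (k < L)%N ->
 X ^+ k * Y ^+ m = \sum_(i < L) (-1) ^+ i * ('C(k, i) * m ^_ i)%:R * pk (k - i) (m - i) X Y.
Proof.
have := @binomial_expansion 0 (-1) X (fun k m => X ^+ k * Y ^+ m) (fun k m => pk k m X Y) L.
rewrite add0r; apply=> [n|k' n|k' n] /=; first by rewrite mul1r.
 by rewrite !mul0r addr0 exprS mulrA.
by rewrite mulN1r mulNr addrK.
Qed.
End BasisChange.

(** * Coefficients of polyanalytic functions *)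

Section Polyanalytic.
Variable R : realType.
Local Notation C := R[i].
Local Notation Cd := (Cd R).
Variables (d : nat) (K : finType) (kk : K -> NI d).
Local Notation NI := (NI d).
Hypothesis kk_inj : injective kk.
Hypothesis kk_down : forall (e : K) (k : NI), (forall j, (k j <= kk e j)%N) -> exists e', kk e' = k.
Implicit Types (a : K * NI -> C) (b : K -> NI -> C) (z : Cd d).

Definition lft a (t : NI * NI) : C := \sum_(e | kk e == t.1) a (e, t.2).
Lemma lftE a e m : lft a (kk e, m) = a (e, m).
Proof. by rewrite /lft (big_pred1 e) // => e'; rewrite (inj_eq kk_inj). Qed.
Lemma ranged_lft a (f : NI * NI -> C) : ranged kk (fun t => lft a t * f t).
Proof. by move=> t ht; rewrite /lft big_pred0 ?mul0r // => e; exact/negbTE. Qed.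

Lemma csum_split (f : NI * NI -> C) : ranged kk f -> casum f -> csum f = \sum_e csum (fun m => f (kk e, m)).
Proof.
move=> rf hf; have hi : injective (fun t : K * NI => (kk t.1, t.2)) by move=> [e m] [e' m'] [/kk_inj -> ->].
rewrite (csum_ranged kk_inj rf hf) csum_pair; last exact: (rasum_inj hi hf).
by rewrite (csum_fin (s := enum K)) ?enum_uniq ?big_enum // => e; rewrite mem_enum.
Qed.

Definition polyser b z : C := \sum_e (\prod_j conjc (z j) ^+ kk e j) * powsum (b e) z.

Lemma dcont_wt : dcont (@wt R d).
Proof.
move=> z l zl; rewrite /wt; under eq_fun do rewrite -cexp_real; rewrite -cexp_real.
apply: cexp_cont; rewrite realCM; under eq_fun do rewrite realCM.
apply: ccvgZ; rewrite /nrm2 raddf_sum; under eq_fun do rewrite raddf_sum.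
apply: ccvg_sum => j /=; rewrite -mul_conj; under eq_fun do rewrite -mul_conj.
by apply: ccvgM; [|apply: ccvg_conj]; exact: zl.
Qed.
Lemma wt_le1 z : cabs (wt z) <= 1.
Proof.
rewrite cabsR ger0_norm ?expR_ge0 // -expR0 ler_expR mulNr oppr_le0 mulr_ge0 ?divr_ge0 ?pi_ge0 //.
by apply: sumr_ge0 => j _; exact: cabs2_ge0.
Qed.

Lemma dcont_polyser b : (forall e, summ (b e)) -> dcont (fun z => polyser b z * wt z).
Proof.
move=> hb z l zl; apply: ccvgM; last exact: dcont_wt.
apply: ccvg_sum => e; apply: ccvgM; last exact: dcont_powsum (hb e) _ _ zl.
by apply: ccvg_prod => j; apply: ccvgX; apply: ccvg_conj; exact: zl.
Qed.

(** The candidates for [a] come from rewriting the monomials in the orthogonal polynomials. The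
    rewriting is done on weight truncations, where every sum is finite, and [bessel] then supplies
    both square summability and convergence. *)
Theorem polyser_coef b : (forall e, summ (b e)) -> (fnorm2 (polyser b) < +oo)%E ->
 exists2 a, l2 a & forall z, polyser b z * wt z = FS kk a z.
Proof.
move=> hb Ffin; pose b' (t : K * NI) := b t.1 t.2.
pose c t := lft b' t * (tau R t)^-1.
pose md M (t : NI * NI) := [forall j, (t.2 j < M + t.1 j)%N].
pose cM M t := lft (fun s => if md M (kk s.1, s.2) then b' s else 0) t * (tau R t)^-1.
have rcM M : ranged kk (cM M) by exact: ranged_lft.
pose a (t : K * NI) := shc kk (-1) c (kk t.1, t.2) * (fsd R (kk t.1) t.2)%:C.
have cME M t : cM M t = if md M t then c t else 0.
 rewrite /cM /c /lft (eq_bigr (fun e => if md M t then b' (e, t.2) else 0)) => [|e /eqP he]; last first.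
  by rewrite /= he -surjective_pairing.
 by case: (md M t); rewrite // big1 ?mul0r.
(* The change of basis preserves weights, so truncating before or after it is the same. *)
have aM M t : trunc kk M a t = shc kk (-1) (cM M) (kk t.1, t.2) * (fsd R (kk t.1) t.2)%:C.
 rewrite /trunc /a /shc; have mdE (i : NI) : md M (shup (kk t.1) i, shup t.2 i) = mlt kk M t.
  by apply: eq_forallb => j; rewrite /= !ffunE addnA ltn_add2r.
 case: ifP => h; [congr (_ * _); apply: eq_bigr|rewrite big1 ?mul0r //] => i _; by rewrite cME mdE h // !mul0r.
have hc M (g : NI * NI -> C) : casum (fun t => cM M t * g t).
 apply: casum_ranged => [t ht|e]; first by rewrite rcM ?mul0r.
 have [s us hs] := trunc_fin kk M b'; apply: (casum_fin (s := [seq t.2 | t <- s])) => m hm.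
 rewrite /cM lftE /= (_ : (if _ then _ else _) = trunc kk M b' (e, m)) // hs ?mul0r //.
 by apply: contra hm => h; apply/mapP; exists (e, m).
pose fM M z := \sum_e (\prod_j conjc (z j) ^+ kk e j) * csum (fun m => (if md M (kk e, m) then b e m else 0) * mon m z).
have FSE M z : FS kk (trunc kk M a) z = fM M z * wt z.
 have [h1 h2] := @csum_shift_basis _ _ _ kk (-1) (cM M) (fun j k m => (- bb (z j)) ^+ k * ba (z j) ^+ m)
  (fun j k m => pk k m (- bb (z j)) (ba (z j))) (rcM M) (fun j k m => @Mn_of_Pk R (- bb (z j)) (ba (z j)) k m (LL kk))
  (fun i => hc M _).
 have -> : FS kk (trunc kk M a) z = csum (fun t => shc kk (-1) (cM M) t * Pk t z) * wt z.
  have rA : ranged kk (fun t => shc kk (-1) (cM M) t * Pk t z).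
   by move=> t ht; rewrite (ranged_shc kk_down (-1) (rcM M)) ?mul0r.
  rewrite (csum_ranged kk_inj rA h1) -csumZr; last first.
   by apply: (rasum_inj _ h1) => -[e m] [e' m'] [/kk_inj -> ->].
  apply: eq_csum => t; rewrite aM /uk UPk mulrA; congr (_ * _).
  by rewrite -!mulrA; congr (_ * _); rewrite mulrCA mulfV ?mulr1 // fsd_neq0.
 rewrite -h2; congr (_ * _); rewrite (_ : (fun t => _) = (fun t => cM M t * Mn t z)) //.
 rewrite csum_split; last exact: hc; last by move=> t ht; rewrite rcM ?mul0r.
 apply: eq_bigr => e _; rewrite -csumZ; last first.
  by apply: rasum_le (powsum_casum z (hb e)) => m; case: ifP => // _; rewrite mul0r cabs0 cabs_ge0.
 apply: eq_csum => m; rewrite /cM lftE MnE /= -mulrA mulKf ?tau_neq0 // mulrCA //.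
have hB : locb (fun M => FS kk (trunc kk M a)).
 move=> r; pose r1 := Num.max r 0; exists (\sum_e (\prod_j r1 ^+ kk e j) * rsum (fun m => cabs (b e m) * rpow m r1)) => M z hz.
 have hz1 j : cabs (z j) <= r1 by apply: le_trans (hz j) _; rewrite le_max lexx.
 have r10 : 0 <= r1 by rewrite le_max lexx orbT.
 rewrite FSE cabsM; apply: (@le_trans _ _ (cabs (fM M z) * 1)); first by rewrite ler_wpM2l ?cabs_ge0 ?wt_le1.
 rewrite mulr1; apply: le_trans (cabs_sum _ _ _) _; apply: ler_sum => e _; rewrite cabsM.
 apply: ler_pM; rewrite ?cabs_ge0 //.
  rewrite cabs_prod; apply: ler_prod => j _; rewrite cabs_ge0 cabsX cabs_conj.
  by rewrite lerXn2r ?nnegrE ?cabs_ge0.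
 have le m : cabs ((if md M (kk e, m) then b e m else 0) * mon m z) <= cabs (b e m) * rpow m r1.
  case: ifP => _; last by rewrite mul0r cabs0 mulr_ge0 ?cabs_ge0 ?prodr_ge0 // => j _; rewrite exprn_ge0.
  by rewrite cabsM ler_wpM2l ?cabs_ge0 ?cabs_mon.
 apply: le_trans (cabs_csum _) _; first exact: rasum_le le (hb e _ r10).
 exact: ler_rsum le (hb e _ r10).
have hC z : ccvg (fun M => FS kk (trunc kk M a) z) (polyser b z * wt z).
 under eq_fun do rewrite FSE; apply: ccvgM; last exact: ccvg_cst.
 apply: ccvg_sum => e; apply: ccvgZ; apply: (csum_dct (g := fun m => cabs (b e m * mon m z))) => [|M m|m].
 - exact: powsum_casum.
 - by case: ifP => // _; rewrite mul0r cabs0 cabs_ge0.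
 have [N0 h] := trunc_eventually kk b' (e, m); apply: ccvgM (ccvg_cst _) => e' e0; exists N0 => M /h.
 by rewrite /trunc /b' /= => ->; rewrite subrr cabs0.
by have [la _ fa] := bessel kk_inj (F := polyser b) (dcont_polyser hb) Ffin hB hC; exists a.
Qed.

(** At the moduli all terms of the expansion are nonnegative and add up to [pk], so each is at most
    the total. *)
Lemma pk_term (X Y : C) k m L (i : 'I_L) : (k < L)%N ->
 cabs (1 ^+ i * ('C(k, i) * m ^_ i)%:R * (X ^+ (k - i) * Y ^+ (m - i))) <= pk k m (cabs X) (cabs Y).
Proof.
move=> kL; pose T (i : 'I_L) : R := ('C(k, i) * m ^_ i)%:R * (cabs X ^+ (k - i) * cabs Y ^+ (m - i)).
have -> : pk k m (cabs X) (cabs Y) = \sum_i T i.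
 apply: (@complexI R); rewrite rmorph_pk (Pk_of_Mn _ _ m kL) raddf_sum; apply: eq_bigr => l _.
 by rewrite /= /T expr1n mul1r !realCM !realCX realCn.
rewrite (bigD1 i) //= expr1n mul1r !cabsM !cabsX cabs_nat lerDl; apply: sumr_ge0 => l _.
by rewrite !mulr_ge0 ?exprn_ge0 ?cabs_ge0.
Qed.

Lemma l2_pk (k : NI) (x y : 'I_d -> R) : (forall j, 0 <= x j) -> (forall j, 0 <= y j) ->
 l2 (fun m : NI => (\prod_j pk (k j) (m j) (x j) (y j) / fsd R k m)%:C : C).
Proof.
move=> x0 y0; pose f j n : C := pk (k j) n (x j)%:C (y j)%:C * pk (k j) n (x j)%:C (y j)%:C / n`!%:R.
have [h _] := csum_prod (f := f) (fun j => casum_pk2 _ _ _ _ _ _).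
have c0 : 0 <= \prod_j ((k j)`!%:R)^-1 :> R by apply: prodr_ge0 => j _; rewrite invr_ge0.
apply: rasum_le (rasumZ c0 h) => m; rewrite cabs2R cabs_prod /fsd -big_split -prodf_div -prodrXl.
apply/eq_ler/eq_bigr => j _; rewrite /= /f -!rmorph_pk cabsM cabsV cabs_nat.
by rewrite expr_div_n -realCM cabsR -expr2 ger0_norm ?sqr_ge0 // /fs sqr_sqrtr ?mulr_ge0 // invfM; ring.
Qed.

(** In this direction the rearrangement converges absolutely: the square summable [a] is paired with
    the square summable family of [l2_pk], evaluated at the moduli. *)
Theorem coef_polyser a : l2 a -> exists2 b, forall e, summ (b e) & forall z, polyser b z * wt z = FS kk a z.
Proof.
move=> la; pose c t := lft a t * (fsd R t.1 t.2)%:C^-1; pose A := shc kk 1 c.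
have rc : ranged kk c by exact: ranged_lft.
have rA : ranged kk A by exact: (ranged_shc kk_down 1 rc).
have bd (h : NI * NI -> C) z : (forall e m, cabs (h (kk e, m)) <= \prod_j pk (kk e j) (m j) (cabs (bb (z j))) (cabs (ba (z j)))) ->
  casum (fun t => c t * h t).
 move=> hh; apply: casum_ranged => [t ht|e]; first by rewrite rc ?mul0r.
 have le : l2 (fun m => a (e, m)) by apply: (rasum_inj _ la) => m m' [].
 have := casum_l2 le (l2_pk (kk e) (fun j => cabs_ge0 (bb (z j))) (fun j => cabs_ge0 (ba (z j)))).
 apply: rasum_le => m; rewrite /c lftE -mulrA !cabsM ler_wpM2l ?cabs_ge0 // cabsV !cabsR.
 have f0 : 0 < fsd R (kk e) m by apply: prodr_gt0 => j _; exact: fs_gt0.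
 rewrite (ger0_norm (ltW f0)) ger0_norm; last first.
  by rewrite divr_ge0 ?(ltW f0) // prodr_ge0 // => j _; rewrite pk_ge0 ?cabs_ge0.
 by rewrite mulrC ler_wpM2r ?invr_ge0 ?(ltW f0).
have key z : casum (fun t => A t * Mn t z) /\ csum (fun t => c t * Pk t z) = csum (fun t => A t * Mn t z).
 apply: (@csum_shift_basis _ _ _ kk 1 c (fun j k m => pk k m (- bb (z j)) (ba (z j)))
  (fun j k m => (- bb (z j)) ^+ k * ba (z j) ^+ m) rc) => [j k m|i]; first exact: Pk_of_Mn.
 apply: (bd _ z) => e m; rewrite /gam -big_split cabs_prod; apply: ler_prod => j _; rewrite cabs_ge0 /= !ffunE -[cabs (bb _)]cabsN.
 by apply: pk_term; exact: LL_gt.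
pose b e m := A (kk e, m) * tau R (kk e, m).
have AE e m z : A (kk e, m) * Mn (kk e, m) z = (\prod_j conjc (z j) ^+ kk e j) * (b e m * mon m z).
 by rewrite MnE /b /=; move: (A _) (tau _ _) (mon _ _) => *; ring.
have sl e z := rasum_inj (h := fun m : NI => (kk e, m)) (fun m m' => ltac:(by move=> [])) (key z).1.
have hb e : summ (b e).
 move=> r r0; apply: rasum_le (sl e [ffun=> (r + 1)%:C]) => m; have r1 : 0 <= r + 1 by rewrite addr_ge0.
 have p0 : 0 <= rpow m r by apply: prodr_ge0 => j _; exact: exprn_ge0.
 rewrite AE (cabsM (\prod_j _)) (cabsM (b e m)) !cabs_prod -[leLHS]mul1r; apply: ler_pM; [exact: ler01|by rewrite mulr_ge0 ?cabs_ge0| |].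
  apply: (@le_trans _ _ (\prod_(j < d) 1)); first by rewrite big1_eq.
  apply: ler_prod => j _; rewrite ler01 ffunE cabsX cabs_conj cabsR ger0_norm //.
  by rewrite exprn_ege1 // lerDr.
 rewrite ler_wpM2l ?cabs_ge0 //; apply: ler_prod => j _; rewrite exprn_ge0 // ffunE cabsX cabsR ger0_norm //.
 by rewrite lerXn2r ?nnegrE // lerDl.
exists b => // z; have hU : casum (fun t => c t * Pk t z).
 apply: (bd _ z) => e m; rewrite /Pk cabs_prod; apply: ler_prod => j _; rewrite cabs_ge0 -[cabs (bb _)]cabsN; exact: cabs_pk.
have -> : FS kk a z = csum (fun t => c t * Pk t z) * wt z.
 have rU : ranged kk (fun t => c t * Pk t z) by move=> t ht; rewrite rc ?mul0r.
 rewrite (csum_ranged kk_inj rU hU) -csumZr; last first.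
  by apply: (rasum_inj _ hU) => -[e m] [e' m'] [/kk_inj -> ->].
 by apply: eq_csum => -[e m]; rewrite /= /c lftE /uk UPk /=; move: (_^-1) => *; ring.
rewrite (key z).2 csum_split; [|by move=> t ht; rewrite rA ?mul0r|exact: (key z).1].
congr (_ * _); apply: eq_bigr => e _; under [RHS]eq_csum do rewrite AE.
by rewrite csumZ //; exact: powsum_casum.
Qed.
End Polyanalytic.

(** * Inner products with the translated basis functions *)

Section FockInnerProduct.
Variable R : realType.
Local Notation C := R[i].
Local Notation Cd := (Cd R).
Variable d : nat.
Local Notation NI := (NI d).
Implicit Types (k m : NI) (w z : Cd d) (b : NI -> C) (F : Cd d -> C).

Lemma gdom_mul M c (f h : Cd d -> C) B : 0 <= B -> dcont f -> (forall w, cabs (f w) <= B) -> gdom M c h ->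
 gdom (B * M) c (fun w => f w * h w).
Proof.
move=> B0 cf fB [ch hh]; split=> [z l zl|w]; first by apply: ccvgM; [exact: cf|exact: ch].
by rewrite cabsM -mulrA ler_pM ?cabs_ge0.
Qed.

(** Cauchy-Schwarz with [n2 (E^~ w) <= 1], uniform in [w], dominates all truncations of the series
    by a multiple of the Gaussian bound of [h]; this permits the limit under the integral. *)
Lemma CI_expand (E : NI -> Cd d -> C) b h M c (q := fun m => CI d (fun w => E m w * h w) 0) : 0 < c -> gdom M c h ->
 (forall m, dcont (E m)) -> (forall w, l2 (E^~ w)) -> (forall w, n2 (E^~ w) <= 1) -> l2 b -> l2 q ->
 dcont (kop (fun w m => E m w) b) ->
 CI d (fun w => kop (fun w m => E m w) b w * h w) 0 = csum (fun m => b m * q m).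
Proof.
move=> c0 gh cE lE E1 lb lq cb; have [x [xb fx hx]] := l2_truncate lb; have [lx _ _] := xb.
set T := kop _ in cb *.
have T1 f w : l2 f -> n2 f <= n2 b -> cabs (T f w) <= Num.sqrt (n2 b).
 move=> lf fb; rewrite -[leLHS]ger0_norm ?cabs_ge0 // -sqrtr_sqr ler_wsqrtr // cabs_sqr.
 by apply: le_trans (cauchy_schwarz lf (lE w)) _; apply: le_trans fb; rewrite ler_piMr ?n2_ge0.
have E2 m w : cabs (E m w) <= 1.
 rewrite -(@ler_pXn2r _ 2) ?nnegrE ?cabs_ge0 // cabs_sqr expr1n.
 exact: le_trans (cabs2_le_n2 m (lE w)) (E1 w).
have xn n : n2 (x n) <= n2 b.
 by apply: ler_rsum lb => t; case: (hx n t) => -> //; rewrite cabs2R expr0n cabs2_ge0.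
have fin n : exists s, uniq s /\ forall m, m \notin s -> x n m = 0 by have [s /fin_supp] := fx n.
have cT n : dcont (T (x n)).
 have [s [us hs]] := fin n; rewrite (_ : T (x n) = fun w => \sum_(m <- s) x n m * E m w); last first.
  by apply/funext => w; exact: kop_fin.
 by move=> z l zl; apply: ccvg_sum => m; apply: ccvgZ; exact: cE.
have s0 := sqrtr_ge0 (n2 b).
apply: ccvg_uniq (@CI_dct _ _ (Num.sqrt (n2 b) * M) c d (fun n w => T (x n) w * h w) _ 0 c0 _ _ _ (leqnn d)) _.
- by move=> n; apply: gdom_mul => // w; exact: T1.
- by apply: gdom_mul => // w; exact: T1.
- by move=> w; apply: ccvgM (ccvg_cst _); exact: (kop_ccvg lE w xb).
have -> : (fun n => CI d (fun w => T (x n) w * h w) 0) = (fun n => kop (fun _ : unit => q) (x n) tt).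
 apply/funext => n; have [s [us hs]] := fin n; rewrite (kop_fin _ _ us hs).
 have g m : exists M', gdom M' c (fun w => x n m * E m w * h w).
  exists (cabs (x n m) * M); apply: gdom_mul => // [|z l zl|w]; [exact: cabs_ge0| |]; first by apply: ccvgZ; exact: cE.
  by rewrite cabsM ler_piMr ?cabs_ge0.
 have [_] := CI_sum s c0 g.
 rewrite (_ : (fun w => \sum_(m <- s) _) = (fun w => T (x n) w * h w)) => [->|]; last first.
  by apply/funext => w; rewrite /T (kop_fin _ _ us hs) mulr_suml.
 apply: eq_bigr => m _; rewrite /q -(@CI_Z _ _ (1 * M) c d _ _ 0 c0 (gdom_mul ler01 (cE m) (E2 m) gh)) //.
 by congr CI; apply/funext => w; rewrite mulrA.
exact: (kop_ccvg (fun _ => lq) tt xb).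
Qed.

(** Read off the decay of [|U|^2] in [ortho]: the inequality [|w - z|^2 >= |w|^2 / 2 - |z|^2],
    followed by a square root, turns rate 1 into [1/4]. *)
Lemma gdom_U k m z : exists M, gdom M 4^-1 (fun w => U k m (w - z)).
Proof.
have [[M [_ hM]] _] := ortho R k m k m; exists (Num.sqrt (M * expR (nrm2 z))); split=> [w l wl|w].
 by apply: dcont_U => j; rewrite !ffunE; under eq_fun do rewrite !ffunE; apply: ccvgB => //; exact: ccvg_cst.
have M0 := expbound_ge0 (hM 0).
rewrite -(@ler_pXn2r _ 2) ?nnegrE ?cabs_ge0 ?mulr_ge0 ?sqrtr_ge0 ?expR_ge0 // exprMn cabs_sqr sqr_sqrtr ?mulr_ge0 ?expR_ge0 //.
have := hM (w - z); rewrite mul_conj cabsR ger0_norm ?cabs2_ge0 // => h; apply: le_trans h _.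
rewrite -mulrA ler_wpM2l // -expRM_natl -expRD ler_expR /nrm2 mulN1r !mulr_sumr -big_split -sumrN.
apply: ler_sum => j _; rewrite !ffunE /= /cabs2 !raddfB /=.
have : 0 <= (Re (w j) - 2 * Re (z j)) ^+ 2 + (Im (w j) - 2 * Im (z j)) ^+ 2 by rewrite addr_ge0 ?sqr_ge0.
by move: (Re (w j)) (Re (z j)) (Im (w j)) (Im (z j)) => x y x' y'; nra.
Qed.

(** The exponential of [beta] and the weight complete the square as in [gauss_phase], and [e_k]
    times the weight is the entry [U 0 k] of the row of index 0. *)
Lemma beta_ek z k w : beta z (ek (fun j => k j)) w * wt w = phase w z * U (e0 d) k (w - z) :> C.
Proof.
have key : cexp (pi%:C * (\sum_j conjc (z j) * w j) - (pi / 2 * normsq z)%:C) * wt w = phase w z * wt (w - z).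
 rewrite phaseE /wt /nrm2 cexpD !mulr_sumr cexp_sum -rmorphN -sumrN /= cexp_real !expR_sum !rmorph_prod -!big_split.
 apply: eq_bigr => j _ /=; have -> : (w - z) j = w j - z j by rewrite !ffunE.
 apply: (etrans _ (gauss_phase (w j) (z j))).
 have -> : (sq R)%:C * w j * ((sq R)%:C * conjc (z j)) = pi%:C * (conjc (z j) * w j).
  by rewrite -sq_sqr realCX; ring.
 by rewrite -mulNr [RHS]mulrC -mulrA; congr (_ * _); rewrite mulrC.
have ekE v : ek (fun j => k j) v = Pk (e0 d, k) v / (fsd R (e0 d) k)%:C :> C.
 rewrite /ek.
 have -> : Num.sqrt (pi ^+ mabs k / (mfact k)%:R) = \prod_j (sq R ^+ k j / fs R 0 (k j)).
  rewrite -[RHS]ger0_norm; last by apply: prodr_ge0 => j _; rewrite divr_ge0 ?exprn_ge0 ?sqrtr_ge0.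
  rewrite -sqrtr_sqr -prodrXl /mabs /mfact natr_prod -prodrXr -prodf_div; congr Num.sqrt.
  by apply: eq_bigr => j _; rewrite expr_div_n -exprM mulnC exprM sq_sqr /fs sqr_sqrtr ?mulr_ge0 // fact0 mul1r.
 rewrite /Pk /fsd !rmorph_prod -prodfV -!big_split; apply: eq_bigr => j _.
 by rewrite /= !ffunE /= /ba exprMn realCM realCV realCX mulrAC.
rewrite UPk -ekE /beta mulrAC key -mulrA [wt _ * ek _ _]mulrC; congr (_ * (ek _ _ * _)).
by apply/ffunP => j; rewrite !ffunE.
Qed.

(** The conjugate of the weighted [beta_z e_k] is expanded, by [U_add], in conjugates of the
    orthonormal functions [U 0 m], and [F] in these functions themselves. Each expansion is an
    infinite series, hence two passes through [CI_expand]. *)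
Theorem finner_coef F b k z : l2 b -> dcont (fun w => F w * wt w) -> (forall w, F w * wt w = V w b (e0 d)) ->
 finner F (beta z (ek (fun j => k j))) = V z b k.
Proof.
move=> lb cF hF; pose g w : C := phase w z * U (e0 d) k (w - z).
have cph : dcont (fun w => phase w z).
 move=> w l wl; apply: cexp_cont; apply: ccvg_ReIm; first exact: cvg_cst.
 apply: cvgM; first exact: cvg_cst.
 have := ccvg_sum (index_enum 'I_d) (fun j => ccvgM (wl j) (ccvg_cst (conjc (z j)))).
 by move=> /ccvg_Im; under eq_fun do rewrite Im_sum; rewrite Im_sum.
have q4 : 0 < 4^-1 :> R by rewrite invr_gt0.
have [M gU] := gdom_U (e0 d) k z.
have gg : gdom (1 * M) 4^-1 g by apply: gdom_mul => // w; rewrite cabs_phase.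
have gconj N (h : Cd d -> C) : gdom N 4^-1 h -> gdom N 4^-1 (fun w => conjc (h w)).
 by move=> [ch hh]; split=> [w l wl|w]; rewrite ?cabs_conj //; apply: ccvg_conj; exact: ch.
have lU w := U_l2 (e0 d) w.
have fE : (fun w => F w * wt w) = kop (fun w m => U (e0 d) m w) b by apply/funext => w; rewrite hF.
have coef m : CI d (fun w => U (e0 d) m w * conjc (g w)) 0 = U k m z.
 have [N gN] := gdom_U (e0 d) m 0.
 have gN' : gdom N 4^-1 (fun w => U (e0 d) m w) by move: gN; under eq_fun do rewrite subr0.
 have E w : conjc (g w) = kop (fun w m => conjc (U (e0 d) m w)) (fun m => U k m z) w.
  rewrite /g -(U_add _ _ _ _).2 -csum_conj; last exact: (U_add _ _ _ _).1.
  by apply: eq_csum => n; rewrite conjM conjcK mulrC.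
 have ort n : CI d (fun w => conjc (U (e0 d) n w) * U (e0 d) m w) 0 = (m == n)%:R.
  have [_] := ortho R (e0 d) m (e0 d) n; rewrite eqxx => <-.
  by congr CI; apply/funext => w; rewrite mulrC.
 have := @CI_expand (fun m w => conjc (U (e0 d) m w)) (fun m => U k m z) _ N 4^-1 q4 gN'.
 rewrite (funext ort) => h; rewrite (_ : (fun w => _) = (fun w => kop (fun w m => conjc (U (e0 d) m w)) (fun m => U k m z) w * U (e0 d) m w)).
  rewrite h => [|n w l wl|w|w|||].
  - under eq_csum do rewrite ort; rewrite (csum1 (i := m)) ?eqxx ?mulr1 // => n /negbTE nm.
   by rewrite eq_sym nm mulr0.
  - by apply: ccvg_conj; exact: dcont_U.
  - exact: l2_conj (lU w).1.
  - by rewrite n2_conj (lU w).2.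
  - exact: (U_l2 k z).1.
  - by apply: (l2_fin (s := [:: m])) => n; rewrite inE eq_sym => /negbTE ->.
  - by rewrite -(funext E); have [] := gconj _ _ gg.
 by apply/funext => w; rewrite -E mulrC.
have [gf e] : (exists N, gdom N 4^-1 (fun w => (F w * wt w) * conjc (g w))) /\ CI d (fun w => (F w * wt w) * conjc (g w)) 0 = V z b k.
 split.
  exists (Num.sqrt (n2 b) * (1 * M)); apply: (gdom_mul _ cF _ (gconj _ _ gg)) => [|w]; first exact: sqrtr_ge0.
  rewrite -[leLHS]ger0_norm ?cabs_ge0 // -sqrtr_sqr ler_wsqrtr // cabs_sqr hF.
  by have [l1 l2'] := V_l2 w lb; apply: le_trans (cabs2_le_n2 (e0 d) l1) _.
 rewrite fE in cF *; have := @CI_expand (fun m w => U (e0 d) m w) b _ _ _ q4 (gconj _ _ gg).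
 rewrite (funext coef) => h.
 rewrite (_ : (fun w => F w * wt w * conjc (g w)) = (fun w => kop (fun w m => U (e0 d) m w) b w * conjc (g w))); last by rewrite -fE.
 rewrite h // => [|m|w|w|]; [by apply: eq_csum => m; rewrite coef|exact: dcont_U|exact: (lU w).1|by rewrite (lU w).2|exact: (U_l2 k z).1].
have [N gN] := gf; have [r1 r2] := iint_CI 0 q4 gN (leqnn d).
rewrite /finner /cint (_ : [ffun => 0] = 0 :> Cd d); last by apply/ffunP => j; rewrite !ffunE.
have hE w : F w * conjc (beta z (ek (fun j => k j)) w) * (gauss w)%:C = (F w * wt w) * conjc (g w).
 rewrite /g -beta_ek (conjM _ (wt w)) [conjc (wt w)]conjR; have -> : (gauss w)%:C = wt w * wt w :> C.
  by rewrite /wt -realCM -expRD /gauss /normsq /nrm2; congr ((expR _)%:C); field.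
 by move: (conjc _) => *; ring.
rewrite (_ : (fun w => (Re _)%:E) = (fun w => (Re (F w * wt w * conjc (g w)))%:E)); last first.
 by apply/funext => w; rewrite -hE.
rewrite (_ : (fun w => (Im _)%:E) = (fun w => (Im (F w * wt w * conjc (g w)))%:E)); last first.
 by apply/funext => w; rewrite -hE.
by rewrite r1 r2 /= e -cE.
Qed.
End FockInnerProduct.

(** * A lattice, its adjoint, and the data of the duality *)

Section LatticePair.
Variable R : realType.
Local Notation C := R[i].
Local Notation Cd := (Cd R).
Variable d : nat.
Local Notation p := (d + d)%N.
Local Notation Z := {ffun 'I_p -> int}.
Implicit Types (x y : 'I_p -> R) (n m : Z) (A B : 'M[R]_p).

Definition zof x : Cd d := [ffun j => x (lshift d j) +i* x (rshift d j)].
(** This is [i] times [zof x]. The symplectic form between the two becomes the dot product, so the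
    adjoint lattice is [i] times the dual lattice. *)
Definition iz x : Cd d := [ffun j => - x (rshift d j) +i* x (lshift d j)].
Definition sym (w z : Cd d) : R := \sum_j Im (w j * conjc (z j)).

Lemma sym_iz x y : sym (iz y) (zof x) = \sum_i x i * y i /\ sym (zof x) (iz y) = - \sum_i x i * y i.
Proof.
rewrite /sym big_split_ord /= -big_split -sumrN /=.
by split; apply: eq_bigr => j _; rewrite !ffunE /=; ring.
Qed.
Lemma nrm_zof x : [/\ nrm2 (zof x) = \sum_i x i ^+ 2, nrm1 (zof x) <= \sum_i `|x i|,
 nrm2 (iz x) = \sum_i x i ^+ 2 & nrm1 (iz x) <= \sum_i `|x i|].
Proof.
rewrite /nrm2 /nrm1 !big_split_ord /= -!big_split /=; split; try (apply: ler_sum => j _; rewrite ffunE).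
- by apply: eq_bigr => j _; rewrite ffunE.
- exact: cabs_ReIm.
- by apply: eq_bigr => j _; rewrite ffunE /cabs2 /= sqrrN addrC.
- by apply: le_trans (cabs_ReIm _) _; rewrite /= normrN addrC.
Qed.
Lemma gsumc_lat A B (f : ('I_p -> R) -> Cd d) : B *m A = 1%:M ->
 (forall x, nrm2 (f x) = \sum_i x i ^+ 2 /\ nrm1 (f x) <= \sum_i `|x i|) -> gsumc (fun n : Z => f (lat A n)).
Proof.
move=> BA hf c r c0; apply: rasum_le (lat_gauss BA `|r| c0) => n; have [-> h] := hf (lat A n).
rewrite ler_expR lerD2l; apply: le_trans (ler_wpM2l (normr_ge0 r) h).
by rewrite ler_wpM2r ?ler_norm // sumr_ge0 // => j _; exact: cabs_ge0.
Qed.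
Lemma phase_sqr (w z : Cd d) : phase w z ^+ 2 = ez 1 (sym w z)%:C.
Proof. by rewrite /phase -cexp_natM /ez; congr cexp; rewrite -realCn; apply: ceq; rewrite /= /sym; ring. Qed.
Lemma ez1_int (k : int) : ez 1 (k%:~R)%:C = 1 :> C.
Proof. by rewrite -(ez_1 R k) /ez; congr cexp; apply: ceq; rewrite /=; ring. Qed.
Lemma phase_swap (w z : Cd d) (k : int) : sym w z = k%:~R -> phase w z = phase z w.
Proof.
move=> e; have := phase_sqr w z; rewrite e ez1_int -(phaseV w z) expr2 => /mulfI -> //.
exact: cexp_neq0.
Qed.

Lemma dot_lat A B n y : B *m A = 1%:M -> \sum_i lat A n i * (\sum_j B j i * y j) = \sum_j (n j)%:~R * y j.
Proof.
move=> BA; under eq_bigr do rewrite mulr_sumr; rewrite exchange_big; apply: eq_bigr => j _ /=.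
by rewrite (lat_inv n j BA) mulr_suml; apply: eq_bigr => i _; ring.
Qed.

Definition divp N n := [forall j, (N.+1 %| n j)%Z].
Lemma divpN N n : divp N (- n) = divp N n.
Proof. by apply: eq_forallb => j; rewrite !ffunE dvdzE abszN. Qed.
Lemma divp0 N : divp N 0.
Proof. by apply/forallP => j; rewrite ffunE dvdz0. Qed.
Lemma divp_neq0 n : n != 0 -> exists N0, forall N, (N0 <= N)%N -> divp N n = false.
Proof.
move=> n0; have [j nj] : exists j, n j != 0.
 apply/existsP; apply: contraR n0 => /existsPn h; apply/eqP/ffunP => j.
 by have := h j; rewrite negbK ffunE => /eqP.
exists `|n j|%N => N hN; apply/negbTE/forallPn; exists j; rewrite dvdzE gtnNdvd ?absz_gt0 //=.
Qed.

(** The sum factors over the coordinates into geometric sums of [(N + 1)]-th roots of unity, each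
    equal to [N + 1] or 0. *)
Lemma average N n : \sum_(r : {ffun 'I_p -> 'I_N.+1}) ez 1 (\sum_j (n j)%:~R * ((r j)%:R / N.+1%:R))%:C =
 (#|{ffun 'I_p -> 'I_N.+1}|%:R : R)%:C * (divp N n)%:R :> C.
Proof.
pose om j : C := ez 1 ((n j)%:~R / N.+1%:R)%:C; have N0 : N.+1%:R != 0 :> R by rewrite pnatr_eq0.
rewrite (eq_bigr (fun r : {ffun 'I_p -> 'I_N.+1} => \prod_j om j ^+ r j)) => [|r _]; last first.
 rewrite raddf_sum /ez mulr_sumr cexp_sum; apply: eq_bigr => j _; rewrite -cexp_natM; congr cexp.
 by rewrite -realCn; apply: ceq; rewrite /=; ring.
rewrite -(bigA_distr_bigA (fun j (i : 'I_N.+1) => om j ^+ i)).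
have e1 j : om j ^+ N.+1 = 1.
 rewrite -[RHS](ez1_int (n j)) /om /ez -cexp_natM; congr cexp; rewrite -realCn.
 by apply: ceq; rewrite /=; field.
case: (boolP (divp N n)) => [/forallP h|/forallPn[j hj]].
 rewrite mulr1 card_ffun !card_ord natrX realCX realCn -[X in _ ^+ X]card_ord -prodr_const.
 apply: eq_bigr => j _; have /dvdzP[q hq] := h j.
 have -> : om j = 1 by rewrite /om hq intrM mulfK //; exact: ez1_int.
 by under eq_bigr do rewrite expr1n; rewrite sumr_const card_ord.
rewrite mulr0 (bigD1 j) //= (_ : \sum_(i < N.+1) _ = 0) ?mul0r //.
have /eqP : (om j - 1) * (\sum_(i < N.+1) om j ^+ i) = 0 by rewrite -subrX1 e1 subrr.
rewrite mulf_eq0 subr_eq0 => /orP[/eqP/ez1_eq1[q hq]|/eqP //]; case/negP: hj; apply/dvdzP; exists q.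
by apply/(mulIf N0)/(mulIf (invr_neq0 N0)) || (apply: (@intr_inj R); rewrite intrM -hq divfK).
Qed.

Section Data.
Variables A B : 'M[R]_p.
Hypothesis BA : B *m A = 1%:M.
Definition la n := zof (lat A n).
Definition mu m := iz (lat B^T m).
Let DB : A^T *m B^T = 1%:M. Proof. by rewrite -trmx_mul BA trmx1. Qed.
Lemma la_add : {morph la : x y / x + y}.
Proof. by move=> n m; apply/ffunP => j; rewrite !ffunE !latD; apply: ceq. Qed.
Lemma mu_add : {morph mu : x y / x + y}.
Proof. by move=> n m; apply/ffunP => j; rewrite !ffunE !latD opprD; apply: ceq. Qed.
Lemma hla : gsumc la.
Proof. by apply: gsumc_lat BA _ => x; have [] := nrm_zof x. Qed.
Lemma hmu : gsumc mu.
Proof. by apply: gsumc_lat DB _ => x; have [] := nrm_zof x. Qed.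
Lemma sym_la_iz n y : sym (la n) (iz (fun i => \sum_j B^T i j * y j)) = - \sum_j (n j)%:~R * y j.
Proof. by rewrite (sym_iz _ _).2; under eq_bigr do under eq_bigr do rewrite mxE; rewrite dot_lat. Qed.
Lemma comm n m : phase (la n) (mu m) = phase (mu m) (la n).
Proof.
apply: (@phase_swap _ _ (- \sum_j n j * m j)).
rewrite [LHS]sym_la_iz mulrNz mulrz_sumr; congr (- _); apply: eq_bigr => j _; by rewrite intrM.
Qed.

Definition frac N (r : {ffun 'I_p -> 'I_N.+1}) j : R := (r j)%:R / N.+1%:R.
Let T N : finType := {ffun 'I_p -> 'I_N.+1}.
Let T0 N : (0 < #|T N|)%N. Proof. by apply/card_gt0P; exists [ffun=> ord0]. Qed.
Lemma averaging_la : averaging (fun N (r : T N) => iz (fun i => \sum_j B^T i j * frac r j)) divp la.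
Proof.
split; [|exact: divp0|exact: divp_neq0|exact: T0] => N n.
rewrite -divpN -average; apply: eq_bigr => r _; rewrite phase_sqr sym_la_iz -sumrN.
by congr (ez 1 (_%:C)); apply: eq_bigr => j _; rewrite ffunE mulrNz mulNr.
Qed.
Lemma averaging_mu : averaging (fun N (r : T N) => zof (fun i => \sum_j A i j * frac r j)) divp mu.
Proof.
split; [|exact: divp0|exact: divp_neq0|exact: T0] => N m.
rewrite -average; apply: eq_bigr => r _; rewrite phase_sqr (sym_iz _ _).1; congr (ez 1 (_%:C)).
by rewrite -(dot_lat _ _ DB); apply: eq_bigr => i _; rewrite mulrC; under [in RHS]eq_bigr do rewrite mxE.
Qed.

(** Poisson summation at a complex argument [v]: the exponent of [T4] is quadratic in the real
    coordinates of a lattice point, and [v] completes the square. The completion leaves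
    [exp (w . w')], the factor that [intertwining] asks for; the dual sum stands on the other side
    of [theta_identity], hence the inverse constant. *)
Lemma twist : exists2 c : R, 0 < c & forall w w',
 T4 mu w w' = c%:C * cexp (\sum_j w j * w' j) * T4 la (- w) w'.
Proof.
have [c c0 hc] := theta_identity BA; exists c^-1; rewrite ?invr_gt0 // => w w'.
have c1 : c%:C != 0 :> C := real_neq0 c0.
have s0 : (sq R)%:C != 0 :> C := real_neq0 (sq_gt0 R).
have ii : (0 +i* 1) * (0 +i* 1) = -1 :> C by apply: ceq; rewrite /=; ring.
have pE : pi%:C = (sq R)%:C * (sq R)%:C :> C by rewrite -realCM -expr2 sq_sqr.
(* [v] solves [- 2 pi (x . v) = sqrt pi (conj(z) . w' - z . w)] for [z = zof x], where no conjugate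
   is implied by the dots; its sum of squares is [- w . w' / pi]. *)
pose v (i : 'I_p) : C := match fintype.split i with
 inl j => (w j - w' j) / (2 * (sq R)%:C) | inr j => (0 +i* 1) * (w j + w' j) / (2 * (sq R)%:C) end.
have vl j : v (lshift d j) = (w j - w' j) / (2 * (sq R)%:C) by rewrite /v (unsplitK (inl j)).
have vr j : v (rshift d j) = (0 +i* 1) * (w j + w' j) / (2 * (sq R)%:C) by rewrite /v (unsplitK (inr j)).
have two : 2 != 0 :> C by rewrite pnatr_eq0.
have iE (a b : R) : a +i* b = a%:C + (0 +i* 1) * b%:C :> C by apply: ceq; rewrite /=; ring.
have iB (a b : R) : conjc (a +i* b) = a%:C - (0 +i* 1) * b%:C :> C by apply: ceq; rewrite /=; ring.
have lhs n : cexp (- (pi%:C * \sum_i ((lat A n i)%:C + v i) ^+ 2)) = cexp (\sum_j w j * w' j) *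
  cexp ((- pi * nrm2 (la n))%:C + (sq R)%:C * \sum_j (la n j * (- w) j + conjc (la n j) * w' j)).
 have [-> _ _ _] := nrm_zof (lat A n); rewrite -cexpD; congr cexp.
 rewrite realCM !big_split_ord /= -!big_split raddf_sum /= !mulr_sumr -sumrN -!big_split; apply: eq_bigr => j _.
 rewrite vl vr /la /zof !ffunE (iB (lat A n _)) (iE (lat A n _)) /=.
 have -> (x y : R) : (x ^+ 2 + y ^+ 2)%:C = x%:C ^+ 2 + y%:C ^+ 2 :> C by rewrite realCD !realCX.
 rewrite rmorphN /= pE; apply: subr0_eq.
 move: ii; move: (0 +i* 1) => i ii; transitivity (- (i * i + 1) * ((w j + w' j) ^+ 2 / 4)); last by rewrite ii addNr oppr0 mul0r.
 by field; rewrite s0.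
have rhs m : (expR (- pi * \sum_i lat B^T m i ^+ 2))%:C * cexp ((0 +i* (2 * pi)) * \sum_i (lat B^T m i)%:C * v i) =
  cexp ((- pi * nrm2 (mu m))%:C + (sq R)%:C * \sum_j (mu m j * w j + conjc (mu m j) * w' j)).
 have [_ _ -> _] := nrm_zof (lat B^T m); rewrite -cexp_real -cexpD; congr (cexp (_ + _)).
 rewrite (_ : 0 +i* (2 * pi) = (0 +i* 1) * (2 * ((sq R)%:C * (sq R)%:C))); last first.
  by rewrite -pE -[X in X * pi%:C](realCn R 2) -realCM; apply: ceq; rewrite /=; ring.
 rewrite big_split_ord /= -big_split !mulr_sumr; apply: eq_bigr => j _ /=.
 rewrite vl vr /mu /iz !ffunE (iB (- lat _ _ _)) (iE (- lat _ _ _)) rmorphN /=; apply: subr0_eq.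
 move: ii; move: (0 +i* 1) => i ii; transitivity ((i * i + 1) * ((sq R)%:C * (lat B^T m (rshift d j))%:C * (w j + w' j))); last by rewrite ii addNr mul0r.
 by field; rewrite s0.
have := hc v; rewrite (funext lhs) (funext rhs) csumZ; last by apply: T4_casum; apply: gsumc_gsum; exact: hla.
by rewrite -/(T4 _ _ _) -/(T4 _ _ _) -mulrA => ->; rewrite realCV mulKf.
Qed.
End Data.
End LatticePair.

(** * Coefficients of Fock functions *)

Section FockCoefficients.
Variables (R : realType) (d : nat).
Local Notation C := R[i].
Local Notation Cd := (Cd R).
Local Notation NI := (NI d).

(** The Fock space is the polyanalytic space whose only antiholomorphic exponent is 0, so the
    general coefficient theorems apply to it. *)
Definition k0 (e : unit) : NI := e0 d.
Let k0_inj : injective k0. Proof. by case; case. Qed.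
Let k0_down (e : unit) (k : NI) : (forall j, (k j <= k0 e j)%N) -> exists e', k0 e' = k.
Proof. by move=> h; exists tt; apply/ffunP => j; have := h j; rewrite !ffunE leqn0 => /eqP. Qed.
Let hv (b : NI -> C) : l2 b -> l2 (fun t : unit * NI => b t.2) /\ n2 (fun t : unit * NI => b t.2) = n2 b.
Proof.
move=> lb; have bij : bijective (@snd unit NI) by exists (pair tt) => -[] // [].
by split; [exact: (rasum_inj (bij_inj bij) lb)|exact: (rsum_bij bij lb (fun _ => cabs2_ge0 _))].
Qed.
Let FSV (b : NI -> C) (w : Cd d) : l2 b -> FS k0 (fun t => b t.2) w = V w b (e0 d).
Proof.
move=> lb; have bij : bijective (@snd unit NI) by exists (pair tt) => -[] // [].
exact: (csum_bij (f := fun m => b m * U (e0 d) m w) bij (casum_l2 lb (U_l2 (e0 d) w).1)).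
Qed.

Definition fock_coef (F : Cd d -> C) (b : NI -> C) := [/\ l2 b, fnorm2 F = (n2 b)%:E,
 dcont (fun w => F w * wt w) & forall w, F w * wt w = V w b (e0 d)].

Lemma fock_to_coef (F : Cd d -> C) : fock F -> exists b, fock_coef F b.
Proof.
move=> [/entire_sephol/power_series[b [hb Fb]] Ff].
have E : F = polyser k0 (fun=> b).
 apply/funext => z; rewrite Fb /polyser (big_pred1 tt) //.
 by rewrite big1 ?mul1r // => j _; rewrite ffunE expr0.
rewrite E in Ff *; have [a la ha] := polyser_coef k0_inj k0_down (fun=> hb) Ff; have cF := dcont_polyser k0 (fun=> hb).
have lb : l2 (fun m => a (tt, m)) by apply: (rasum_inj _ la) => m m' [].
have aE : a = (fun t => a (tt, t.2)) by apply/funext => -[[] m].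
exists (fun m => a (tt, m)); split=> // [|w]; last by rewrite ha -FSV // -aE.
by rewrite (fnorm2_FS k0_inj la cF ha) aE (hv lb).2.
Qed.

Lemma coef_to_fock (b : NI -> C) : l2 b -> exists2 F, fock F & fock_coef F b.
Proof.
move=> lb; have [la na] := hv lb; have [b' hb' hF] := coef_polyser k0_inj k0_down la.
have cF := dcont_polyser k0 hb'; have nF := fnorm2_FS k0_inj la cF hF; rewrite na in nF.
exists (polyser k0 b'); last by split=> // w; rewrite hF FSV.
split; last by rewrite nF ltry.
rewrite (_ : polyser k0 b' = powsum (b' tt)); first by apply/entire_sephol; exact: sephol_powsum.
apply/funext => z; rewrite /polyser (big_pred1 tt) //.
by rewrite big1 ?mul1r // => j _; rewrite ffunE expr0.
Qed.
End FockCoefficients.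

(** * Interpolation and sampling as statements on sequences *)

Section Interpolation.
Variables (R : realType) (d : nat).
Local Notation C := R[i].
Local Notation Cd := (Cd R).
Local Notation NI := (NI d).
Local Notation p := (d + d)%N.
Local Notation Z := {ffun 'I_p -> int}.

Lemma esum_range (pt : Z -> Cd d) (g : Cd d -> R) : injective pt -> (forall z, 0 <= g z) ->
 ((\esum_(z in range pt) (g z)%:E < +oo)%E -> rasum (fun n => g (pt n))) /\
 (rasum (fun n => g (pt n)) -> \esum_(z in range pt) (g z)%:E = (rsum (fun n => g (pt n)))%:E)%E.
Proof.
move=> inj g0; rewrite esum_image; last by move=> x y _ _; exact: inj.
set E := (\esum_(i in _) _)%E; have E0 : (0 <= E)%E by apply: esum_ge0 => i _; rewrite lee_fin.
have le s : uniq s -> ((\sum_(n <- s) g (pt n))%:E <= E)%E.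
 move=> us; apply: esum_ge; exists [set` s]; first by split=> //; exact: finite_seq.
 by rewrite -fsbig_seq // sumEFin.
have ub (M : R) : (E <= M%:E)%E -> E \is a fin_num by move=> h; rewrite ge0_fin_numE // (le_lt_trans h) ?ltry.
split=> [lt|h].
 have Ef : E \is a fin_num by rewrite ge0_fin_numE.
 by exists (constructive_ereal.fine E) => s us; rewrite -lee_fin fineK // le.
have h1 : (E <= (rsum (fun n => g (pt n)))%:E)%E.
 apply: ge_ereal_sup => _ [X [fX _] <-]; rewrite fsbig_finite // sumEFin lee_fin.
 by apply: rsum_ub => //; exact: fset_uniq.
apply/le_anti; rewrite h1 -(fineK (ub _ h1)) lee_fin; apply: rsum_le => s us.
by rewrite -lee_fin (fineK (ub _ h1)) le.
Qed.

Variables (n : 'I_d -> nat) (A : 'M[R]_p).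
Local Notation K := {dffun forall j : 'I_d, 'I_(n j)}.
Hypothesis An : A \in unitmx.
Let B := invmx A.
Let BA : B *m A = 1%:M. Proof. exact: mulVmx. Qed.
Let AB : A *m B = 1%:M. Proof. exact: mulmxV. Qed.
Local Notation la := (la A).
Local Notation mu := (mu B).

Definition kk (k : K) : NI := [ffun j => nat_of_ord (k j)].
Lemma kk_inj : injective kk.
Proof. by move=> k k' /ffunP h; apply/ffunP => j; apply: val_inj; have := h j; rewrite !ffunE. Qed.
Lemma kk_down (e : K) (k : NI) : (forall j, (k j <= kk e j)%N) -> exists e', kk e' = k.
Proof.
move=> h; have h' j : (k j < n j)%N by apply: leq_ltn_trans (h j) _; rewrite ffunE ltn_ord.
by exists [ffun j => Ordinal (h' j)]; apply/ffunP => j; rewrite !ffunE.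
Qed.

Definition zc (v : 'cV[R]_p) : Cd d := [ffun j => tf_x v j +i* tf_w v j].
Lemma zcE v : zc v = zof (fun i => v i 0).
Proof. by apply/ffunP => j; rewrite !ffunE /tf_x /tf_w !mxE. Qed.

Lemma zof_inj x y : zof x = zof y :> Cd d -> forall i, x i = y i.
Proof.
move=> /ffunP h i; rewrite -(splitK i); case: (fintype.split i) => j /=; have := h j; rewrite !ffunE => -[] //.
Qed.
Lemma lat_inj (M N : 'M[R]_p) : N *m M = 1%:M -> injective (lat M).
Proof.
move=> NM m m' h; apply/ffunP => j; apply: (@intr_inj R); rewrite !(lat_inv _ _ NM).
by rewrite h.
Qed.
Lemma la_inj : injective la.
Proof. by move=> m m' /zof_inj h; apply: (lat_inj BA); apply/funext. Qed.
Lemma iz_inj x y : iz x = iz y :> Cd d -> forall i, x i = y i.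
Proof.
move=> /ffunP h i; rewrite -(splitK i); case: (fintype.split i) => j /=; have := h j; rewrite !ffunE => -[h1 h2] //; exact: oppr_inj.
Qed.
Lemma mu_inj : injective mu.
Proof.
move=> m m' /iz_inj h; apply: (@lat_inj B^T A^T); last exact/funext.
by rewrite -trmx_mul BA trmx1.
Qed.

Lemma Gamma_la : GammaOf (lattice A) = range la.
Proof.
apply/seteqP; split=> z /= [].
 move=> v [[m ->] ->]; exists [ffun j => m j 0] => //; rewrite -/(zc _) zcE; congr zof; apply/funext => i.
 by rewrite mxE; apply: eq_bigr => j _; rewrite mxE ffunE.
move=> m _ <-; exists (A *m map_mx (fun k : int => k%:~R) (\col_j m j)); split; first by exists (\col_j m j).
rewrite -/(zc _) zcE; congr zof; apply/funext => i.
by rewrite mxE; apply: eq_bigr => j _; rewrite !mxE.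
Qed.

Lemma tfshiftE (v : 'cV[R]_p) f t : tfshift v f t = ez 1 (\sum_j tf_w v j * t j)%:C * f (fun j => t j - tf_x v j) :> C.
Proof.
rewrite /tfshift /ez; congr (_ * _); rewrite (_ : _ * _%:C = 0 +i* (2 * pi * \sum_j tf_w v j * t j)).
 by rewrite /cexp /= expR0; apply: ceq; rewrite /= ?mul0r ?mul1r ?subr0 ?addr0.
by apply: ceq; rewrite /=; ring.
Qed.

(** The two orders of composition differ by the scalar [exp (2 pi i sym)]; the constant function 1
    evaluated at the origin detects it. *)
Lemma tfshift_comm (u v : 'cV[R]_p) : (forall f t, tfshift u (tfshift v f) t = tfshift v (tfshift u f) t) <->
 ez 1 (sym (zc u) (zc v))%:C = 1 :> C.
Proof.
have ezB (x y : R) : ez 1 (x - y)%:C = ez 1 x%:C / ez 1 y%:C :> C.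
 by rewrite /ez realCB mulrBr cexpB.
have ez_n0 (x : R) : ez 1 x%:C != 0 :> C by exact: cexp_neq0.
pose s (u v : 'cV[R]_p) := \sum_j tf_w v j * tf_x u j.
have symE : sym (zc u) (zc v) = s v u - s u v.
 by rewrite /sym /s -sumrB; apply: eq_bigr => j _; rewrite !ffunE /=; ring.
have E (a b : 'cV[R]_p) f t : tfshift a (tfshift b f) t =
  ez 1 (\sum_j tf_w a j * t j)%:C * (ez 1 (\sum_j tf_w b j * t j)%:C / ez 1 (s a b)%:C) * f (fun j => t j - tf_x a j - tf_x b j).
 rewrite !tfshiftE mulrA -ezB; congr (_ * ez 1 _%:C * _).
 by rewrite /s -sumrB; apply: eq_bigr => j _; rewrite mulrBr.
rewrite symE ezB; split=> [/(_ (fun=> 1) (fun=> 0))|/divr1_eq e f t].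
 rewrite !E !big1 => [|j _|j _]; rewrite ?mulr0 // ez_0 !mul1r !mulr1 => /invr_inj ->.
 by rewrite divff.
rewrite !E e mulrCA; congr (_ * _); congr f; apply/funext => j; ring.
Qed.

Lemma Gamma_mu : GammaOf (adjoint_lattice (lattice A)) = range mu.
Proof.
have DA : B^T *m A^T = 1%:M by rewrite -trmx_mul AB trmx1.
have adjE v : adjoint_lattice (lattice A) v <-> forall m, ez 1 (sym (la m) (zc v))%:C = 1 :> C.
 split=> [h m|h u [m ->]].
  have : GammaOf (lattice A) (la m) by rewrite Gamma_la; exists m.
  by move=> [u [/h hu ->]]; apply/tfshift_comm.
 apply/tfshift_comm; have : GammaOf (lattice A) (zc (A *m map_mx (fun k : int => k%:~R) m)) by eexists; split; [exists m|].
 by rewrite Gamma_la => -[m' _ <-].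
apply/seteqP; split=> z /= [].
 move=> v [/adjE h ->]; rewrite -/(zc v); pose X : 'cV[R]_p := col_mx (dsubmx v) (- usubmx v).
 have vX : zc v = iz (fun i => X i 0).
  by apply/ffunP => j; rewrite !ffunE /tf_x /tf_w /X col_mxEu col_mxEd !mxE opprK.
 (* Commutation with the [j]-th column of [A] says that the [j]-th entry of [A^T X] is an integer,
    so [X] lies in the lattice generated by the inverse transpose. *)
 have /choice[m hm] j : exists k : int, (A^T *m X) j 0 = k%:~R.
  have := h (unitv j); rewrite vX (sym_iz _ _).2 => /ez1_eq1[k hk]; exists (- k).
  rewrite mulrNz -hk opprK mxE; apply: eq_bigr => i _; by rewrite lat_unitv mxE.
 exists [ffun j => m j] => //; rewrite vX; congr iz; apply/funext => i.
 rewrite -[X in RHS](mul1mx X) -DA -mulmxA [RHS]mxE; apply: eq_bigr => j _; by rewrite hm ffunE.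
move=> m _ <-; pose v : 'cV[R]_p := col_mx (\col_j Re (mu m j)) (\col_j Im (mu m j)).
have vE : zc v = mu m by apply/ffunP => j; rewrite ffunE /tf_x /tf_w /v col_mxKu col_mxKd !mxE -cE.
exists v; split; last by rewrite -vE.
apply/adjE => m'; rewrite vE [sym _ _](sym_la_iz BA) -sumrN.
rewrite (_ : \sum_j _ = (\sum_j - (m' j * m j))%:~R) ?ez1_int // mulrz_sumr.
by apply: eq_bigr => j _; rewrite mulrNz intrM.
Qed.

Let K' (s : Z) (t : K * NI) := uk kk t (la s).
(** The interpolation problem prescribes exactly the weighted values [F z * wt z], which are the
    pairings of the coefficients of [F] with the rows [K']. *)
Lemma interpolating_surjective : interpolating n (GammaOf (lattice A)) <-> surjective_l2 K'.
Proof.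
rewrite Gamma_la; split=> h al.
 (* Data indexed by the lattice become data on points. Off the lattice [al'] takes the junk value
    [al 0], which neither the sum over the range nor the interpolation condition sees. *)
 move=> lal; pose al' z := al (xget 0 [set s | la s = z]).
 have alE s : al' (la s) = al s by rewrite /al'; congr al; apply: la_inj; exact: (@xgetI _ 0 [set s' | la s' = la s] s).
 have [_ e] := esum_range la_inj (fun z => cabs2_ge0 (al' z)).
 have lal' : rasum (fun s => cabs2 (al' (la s))) by under eq_fun do rewrite alE.
 have [|F [[[phi [ephi Fphi]] Ff] hF]] := h al'; first by rewrite e // ltry.
 have /choice[b hb] k : exists b, summ b /\ forall z, phi k z = powsum b z.
  by apply: power_series; exact/entire_sephol.
 have FE : F = polyser kk b.
  apply/funext => z; rewrite Fphi; apply: eq_bigr => k _; rewrite (hb k).2; congr (_ * _).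
  by apply: eq_bigr => j _; rewrite ffunE.
 rewrite FE in Ff hF; have [a la_ ha] := polyser_coef kk_inj kk_down (fun k => (hb k).1) Ff.
 exists a; split=> // s; rewrite -alE -hF; last by exists s.
 by rewrite -[LHS]ha mulrC /wt mulNr.
have [e _] := esum_range la_inj (fun z => cabs2_ge0 (al z)).
move=> /e lal; have [a [la_ ha]] := h (fun s => al (la s)) lal.
have [b hb hF] := coef_polyser kk_inj kk_down la_; exists (polyser kk b); split.
 split; last by rewrite (fnorm2_FS kk_inj la_ (dcont_polyser kk hb) hF) ltry.
 exists (fun k => powsum (b k)); split=> [k|z]; first by apply/entire_sephol; exact: sephol_powsum.
 by apply: eq_bigr => k _; congr (_ * _); apply: eq_bigr => j _; rewrite ffunE.
by move=> z [s _ <-]; rewrite -ha -[RHS]hF mulrC /wt mulNr.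
Qed.

Lemma riesz_rieszL : riesz K' <-> rieszL la kk.
Proof.
have E (ss : seq Z) (x : Z -> C) : n2 (fun t => \sum_(s <- ss) x s * K' s t) =
  \sum_k n2 (fun m => \sum_(s <- ss) x s * U (kk k) m (la s)).
 apply: (rsum_finpair (fun t => cabs2_ge0 (\sum_(s <- ss) x s * K' s t)) _).2 => k.
 by apply: l2_sum => s; exact: (U_l2 (kk k) (la s)).1.
by split=> -[c c0 h]; exists c => // ss x us; [rewrite -E|rewrite E]; exact: h.
Qed.

Lemma sampling_multiple c : 0 < c -> (forall k m k' m', S4 mu k m k' m' = c%:C * S4 la k k' m m') ->
 sampling mu kk <-> multiple_sampling n (GammaOf (adjoint_lattice (lattice A))).
Proof.
move=> c0 tw; pose Wl k f := W_l2 c0 (hmu BA) (hla BA) tw (kk k) (f := f).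
(* The upper sampling bound always holds, by the Bessel bound [W_l2]; the added 1 keeps the constant
   positive. *)
pose D := 1 + \sum_k c * rsum (fun s => cabs (U (kk k) (kk k) (la s))).
have cas k : 0 <= rsum (fun s => cabs (U (kk k) (kk k) (la s))) by apply: rsum_ge0; exact: la_casum (hla BA) _ _.
have D0 : 0 < D by apply: ltr_pwDl => //; apply: sumr_ge0 => k _; rewrite mulr_ge0 // ltW.
have S (F : Cd d -> C) b : fock_coef F b -> (\esum_(z in GammaOf (adjoint_lattice (lattice A)))
  (\sum_(k : Kn n) cabs2 (finner F (beta z (ek (fun j => k j)))))%:E = (\sum_k n2 (W mu (kk k) b))%:E)%E.
 move=> [lb _ cF hF]; pose g z := \sum_(k : K) cabs2 (V z b (kk k)).
 have gE z : \sum_(k : Kn n) cabs2 (finner F (beta z (ek (fun j => k j)))) = g z.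
  apply: eq_bigr => k _; rewrite -(finner_coef _ _ lb cF hF); congr (cabs2 (finner F (beta z (ek _)))).
  by apply/funext => j; rewrite ffunE.
 under eq_esum do rewrite gE; rewrite Gamma_mu.
 have g0 z : 0 <= g z by apply: sumr_ge0 => k _; exact: cabs2_ge0.
 pose f k s : C := (cabs2 (W mu (kk k) b s))%:C.
 have fE s : \sum_k f k s = (g (mu s))%:C.
  by rewrite /g raddf_sum; apply: eq_bigr => k _; rewrite /f WE.
 have cf k : casum (f k) by apply: casum_real (Wl k b lb).1 _ => s; exact: cabs2_ge0.
 have ra : rasum (fun s => g (mu s)).
  by apply: rasum_le (casum_sum (index_enum K) cf) => s; rewrite fE cabsR ler_norm.
 rewrite (esum_range mu_inj g0).2 //; congr EFin; apply: (@complexI R); rewrite -csum_real // -(funext fE) csum_sum //.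
 by rewrite raddf_sum; apply: eq_bigr => k _; apply: csum_real (Wl k b lb).1 _ => s; exact: cabs2_ge0.
split=> [[a a0 h]|[a [b' [a0 [_ h]]]]].
 exists a, D; do 2!split=> //; move=> F /fock_to_coef[b hb]; have [lb nF _ _] := hb.
 rewrite (S F b hb) nF -!EFinM !lee_fin h //= mulrDl mul1r mulr_suml ler_wpDl ?n2_ge0 //.
 by apply: ler_sum => k _; exact: (Wl k b lb).2.
exists a => // b /coef_to_fock[F fF hb]; have := h F fF; have [_ nF _ _] := hb.
by rewrite (S F b hb) nF -!EFinM !lee_fin => /andP[].
Qed.

Lemma interpolating_sampling : interpolating n (GammaOf (lattice A)) <-> multiple_sampling n (GammaOf (adjoint_lattice (lattice A))).
Proof.
have [c c0 hT] := twist BA.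
have [gl gm] := (gsumc_gsum (hla BA), gsumc_gsum (hmu BA)).
have tw := intertwining gm gl hT.
have c1 : c%:C != 0 :> C := real_neq0 c0.
(* The same identity read backwards with the inverse constant: the two lattices play symmetric
   parts, and each direction of the duality uses Janssen's representation on one or both of them. *)
have hT' w w' : T4 la w w' = (c^-1)%:C * cexp (\sum_j w j * w' j) * T4 mu (- w) w'.
 have e : \sum_j (- w) j * w' j = - \sum_j w j * w' j by rewrite -sumrN; apply: eq_bigr => j _; rewrite ffunE mulNr.
 have := cexp_neq0 (\sum_j w j * w' j); rewrite hT opprK e cexpN realCV; move: c1.
 by move: (cexp _) c%:C (T4 la _ _) => x y t y0 x0; field; rewrite x0 y0.
have tw' := intertwining gl gm hT'.
have lK s : l2 (K' s) := (uk_l2 kk (la s)).1.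
rewrite -(sampling_multiple c0 tw) interpolating_surjective; split.
 move=> /(surjective_riesz lK)/riesz_rieszL.
 exact: (riesz_sampling c0 (hmu BA) (hla BA) tw tw' (@la_add _ _ A) (@mu_add _ _ B) (averaging_mu BA)).
move=> h; apply: (riesz_surjective lK); apply/riesz_rieszL.
exact: (sampling_riesz c0 (hmu BA) (hla BA) tw (@la_add _ _ A) (@mu_add _ _ B) (comm BA) (averaging_la BA)).
Qed.
End Interpolation.

Theorem theorem5 (R : realType) (d : nat) (n : 'I_d -> nat)
  (A : 'M[R]_(d + d)) :
  (0 < d)%N -> (forall j, (0 < n j)%N) -> A \in unitmx ->
  (interpolating n (GammaOf (lattice A)) <->
   multiple_sampling n (GammaOf (adjoint_lattice (lattice A)))).
Proof. by move=> _ _ An; exact: interpolating_sampling. Qed.
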